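(* Let $f=(f_1,f_2):\mathbb{C}^2\to\mathbb{C}^2$ be a generically non-proper polynomial map, and let $\mathcal{E}_f$ denote the set of isolated points of $\mathbb{C}^2\setminus f(\mathbb{C}^2)$. Then $|\mathcal{E}_f|$ exceeds neither of the two values $$6\deg f \qquad\text{and}\qquad \frac{\deg f_1\deg f_2}{\mu_f(\mu_f-1)}+2(\deg f_1+\deg f_2).$$
   Context: For a polynomial $P\in\mathbb{C}[x_1,x_2]$, $\deg P$ is its total degree, and for a polynomial map $f=(f_1,f_2):\mathbb{C}^2\to\mathbb{C}^2$ we set $\deg f:=\max(\deg f_1,\deg f_2)$. The map $f$ is dominant if $f(\mathbb{C}^2)$ is dense in $\mathbb{C}^2$; in that case $\mu_f$ denotes the number of preimages under $f$ of a generic point of $\mathbb{C}^2$. The support $\operatorname{supp}P\subset\mathbb{N}^2$ of $P=\sum_w c_wx^w$ is $\{w: c_w\neq 0\}$, and the support of $f$ is the pair $A=(A_1,A_2)=(\operatorname{supp}f_1,\operatorname{supp}f_2)$. For finite sets $B_1,B_2\subset\mathbb{Z}^2$ with convex hulls $\Delta_1,\Delta_2$, $V(B_1,B_2):=\mathrm{Vol}(\Delta_1+\Delta_2)-\mathrm{Vol}(\Delta_1)-\mathrm{Vol}(\Delta_2)$ (mixed volume; $+$ is Minkowski sum and $\mathrm{Vol}$ is Lebesgue measure on $\mathbb{R}^2$); write $V(A)=V(A_1,A_2)$. The map $f$ is non-proper at $y\in\mathbb{C}^2$ if there is a sequence $x_k\in\mathbb{C}^2$ with $\|x_k\|\to\infty$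 and $f(x_k)\to y$; $f$ is non-proper if it is non-proper at some point. Let $|\mathrm{Jac} f|$ be the determinant of the Jacobian matrix of $f$ and $\Sigma$ its support. The map $f$ is called generically non-proper if it is dominant, non-proper, $f(0,0)\in(\mathbb{C}^* )^2$, and the systems $f_1=f_2=0$, $f_1=|\mathrm{Jac} f|=0$, $f_2=|\mathrm{Jac} f|=0$ have respectively $V(A_1,A_2)$, $V(A_1,\Sigma)$ and $V(A_2,\Sigma)$ isolated solutions in $(\mathbb{C}^* )^2$ (counted with multiplicity). *)

(* Defs.v *)
From HB Require Import structures.
From mathcomp Require Import all_boot all_order all_algebra.
From mathcomp Require Import all_classical all_reals all_analysis.
From mathcomp.real_closed Require Import complex.
Import Order.TTheory GRing.Theory Num.Theory.

Set Implicit Arguments.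
Unset Strict Implicit.
Unset Printing Implicit Defensive.

Local Open Scope ring_scope.
Local Open Scope classical_set_scope.

(* The complex numbers are R[i] for an arbitrary realType R (i.e. a model of
   the real numbers).  A polynomial in C[x1,x2] is represented as an element
   of {poly {poly C}}: the outer variable is x1, the inner one is x2, so the
   coefficient of x1^i x2^j in P is (P`_i)`_j. *)

Section Defs.
Context (R : realType).
Local Notation C := (R[i]).

Local Notation cpoly2 := {poly {poly C}}.

Definition coef2 (P : cpoly2) (w : nat * nat) : C := nth 0%R (polyseq (nth 0%R (polyseq P) w.1)) w.2.

Definition supp (P : cpoly2) : set (nat * nat) := [set w | coef2 P w != 0].

(* total degree (0 for the zero polynomial) *)
Definition tdeg (P : cpoly2) : nat :=
  \max_(i < size P) \max_(j < size (nth 0%R (polyseq P) i) | coef2 P (i : nat, j : nat) != 0%R)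
    (i + j)%N.

Definition peval (P : cpoly2) (z : C * C) : C :=
  (map_poly (fun q : {poly C} => q.[z.2]) P).[z.1].

Definition pd1 (P : cpoly2) : cpoly2 := deriv P.
Definition pd2 (P : cpoly2) : cpoly2 := map_poly (fun q : {poly C} => deriv q) P.

Definition pmap2 := ({poly {poly C}} * {poly {poly C}})%type.
Definition fmap (f : pmap2) (z : C * C) : C * C := (peval f.1 z, peval f.2 z).
Definition pdeg (f : pmap2) : nat := maxn (tdeg f.1) (tdeg f.2).

Definition jacdet (f : pmap2) : cpoly2 :=
  pd1 f.1 * pd2 f.2 - pd2 f.1 * pd1 f.2.

Definition cnorm2 (z : C * C) : R :=
  Num.sqrt (complex.Re z.1 ^+ 2 + complex.Im z.1 ^+ 2
             + complex.Re z.2 ^+ 2 + complex.Im z.2 ^+ 2).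
Definition cdist (z w : C * C) : R := cnorm2 (z.1 - w.1, z.2 - w.2).

Definition torus (z : C * C) : Prop := z.1 != 0 /\ z.2 != 0.

Definition dominant (f : pmap2) : Prop :=
  forall (y : C * C) (eps : R), 0 < eps -> exists x, cdist (fmap f x) y < eps.

Definition npreimages (f : pmap2) (y : C * C) (m : nat) : Prop :=
  exists s : seq (C * C), [/\ uniq s, (forall x, x \in s <-> fmap f x = y)
                            & size s = m].

Definition generic_preimages (f : pmap2) (m : nat) : Prop :=
  exists h : cpoly2, h != 0 /\ forall y, peval h y != 0 -> npreimages f y m.

Definition non_proper_at (f : pmap2) (y : C * C) : Prop :=
  exists x : nat -> C * C,
    (forall M : R, exists N, forall k, (N <= k)%N -> M < cnorm2 (x k)) /\
    (forall eps : R, 0 < eps ->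
       exists N, forall k, (N <= k)%N -> cdist (fmap f (x k)) y < eps).
Definition non_proper (f : pmap2) : Prop := exists y, non_proper_at f y.

Definition conv (B : set (nat * nat)) : set (R * R) :=
  [set p | exists n (a : 'I_n -> nat * nat) (w : 'I_n -> R),
     [/\ (forall i, B (a i)), (forall i, 0 <= w i), \sum_i w i = 1 &
         p = (\sum_i w i * ((a i).1)%:R, \sum_i w i * ((a i).2)%:R)]].

Definition msum (X Y : set (R * R)) : set (R * R) :=
  [set p | exists a b, [/\ X a, Y b & p = (a.1 + b.1, a.2 + b.2)]].

Definition vol2 (X : set (R * R)) : \bar R :=
  ((@lebesgue_measure R) \x (@lebesgue_measure R))%E X.

Definition mixed_volume (B1 B2 : set (nat * nat)) : \bar R :=
  (vol2 (msum (conv B1) (conv B2)) - vol2 (conv B1) - vol2 (conv B2))%E.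

Definition isolated_sol (P Q : cpoly2) (z : C * C) : Prop :=
  [/\ peval P z = 0, peval Q z = 0 &
      exists2 eps : R, 0 < eps & forall w, peval P w = 0 -> peval Q w = 0 ->
                                  cdist w z < eps -> w = z].

(* h belongs to the ideal (P,Q) of the local ring O_z (localisation of
   C[x1,x2] at the maximal ideal of z) *)
Definition in_loc_ideal (P Q : cpoly2) (z : C * C) (h : cpoly2) : Prop :=
  exists s a b : cpoly2, peval s z != 0 /\ s * h = a * P + b * Q.

Definition loc_indep (P Q : cpoly2) (z : C * C) (n : nat) (q : 'I_n -> cpoly2)
  : Prop :=
  forall c : 'I_n -> C,
    in_loc_ideal P Q z (\sum_i (c i)%:P%:P * q i) -> forall i, c i = 0.

(* intersection multiplicity: dim_C O_z/(P,Q)O_z = m *)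
Definition int_mult (P Q : cpoly2) (z : C * C) (m : nat) : Prop :=
  (exists q : 'I_m -> cpoly2, loc_indep P Q z q) /\
  ~ (exists q : 'I_m.+1 -> cpoly2, loc_indep P Q z q).

Definition isolated_count (P Q : cpoly2) (V : \bar R) : Prop :=
  exists (s : seq (C * C)) (m : C * C -> nat),
    [/\ uniq s, (forall z, z \in s <-> (torus z /\ isolated_sol P Q z)),
        (forall z, z \in s -> int_mult P Q z (m z)) &
        (((\sum_(z <- s) m z)%N)%:R)%:E = V].

Definition generically_non_proper (f : pmap2) : Prop :=
  [/\ dominant f, non_proper f & torus (fmap f (0, 0))] /\
  [/\ isolated_count f.1 f.2 (mixed_volume (supp f.1) (supp f.2)),
      isolated_count f.1 (jacdet f) (mixed_volume (supp f.1) (supp (jacdet f)))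
    & isolated_count f.2 (jacdet f) (mixed_volume (supp f.2) (supp (jacdet f)))].

Definition in_Ef (f : pmap2) (y : C * C) : Prop :=
  (forall x, fmap f x <> y) /\
  exists2 eps : R, 0 < eps &
    forall y', cdist y' y < eps -> y' <> y -> exists x, fmap f x = y'.

End Defs.

(* Main.v *)
(* One has |E_f| <= 2 (deg f1 + deg f2), which gives both bounds.
   Monomials at infinity: if V(P, Q) solutions of P = Q = 0 exist in the torus, then along no sequence leaving the
   compacts of the torus can P and Q both be negligible with respect to their largest monomials; otherwise, in large
   dilates of the Newton polygons, some monomial would be independent modulo (P, Q) of all the multiplicities
   already counted.  Applied to the three systems, this shows that the monomials of f1 and f2 stay bounded when
   f -> y, provided y_i <> f_i(0).
   Toric chart: the extremal rays of the cone spanned by the supports define a finite cover of the torus in which f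
   becomes a polynomial map G, proper over such y, and a point y of E_f is then taken by G only on the axes.
   Multiplicities: near a point of an axis where the Jacobian of G vanishes to its generic order k along the axis,
   |G - y| >= c |t|^(k+1) (a Lojasiewicz inequality obtained by Newton steps), so that comparing the orders of the
   resultant of G1 - y1 and G2 - y2 at finite points with its growth at infinity bounds the total multiplicity of
   the axes over y from below.  On the other side y is a singular point of the image of the axes, whose equation K
   has vanishing gradient at y; hence the sum over y of these multiplicities is at most the degree of dK restricted
   to the axes.  The remaining points of E_f are values of G at zeros of the leading part of its Jacobian on the
   axes, or lie on a line y_i = f_i(0), where they are asymptotic values of f along the curve f_i = y_i. *)
Require Import Defs.
From HB Require Import structures.
From mathcomp Require Import all_boot all_order all_algebra.
From mathcomp Require Import all_classical all_reals all_analysis.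
From mathcomp.real_closed Require Import complex.
From mathcomp Require Import polyXY measurable_realfun.
From mathcomp Require Import ring lra zify.
Import Order.TTheory GRing.Theory Num.Theory.
Set Implicit Arguments.
Unset Strict Implicit.
Unset Printing Implicit Defensive.
Local Open Scope ring_scope.
Local Open Scope classical_set_scope.

(** The factor 2 rests on a saving on each axis of the chart. If the ray of an axis is a coordinate
    ray, [G] takes there values of [f], so no point of E_f is involved; any other primitive ray has
    coordinate sum at least 2, and the part of [f] on it has at most half the degree. The
    multiplicities k + 1 and l + 1 of the Jacobian along the axes, lost in the count of regular
    points, come back from the count of zeros of its leading part. Either [f1] and [f2] both have
    nonconstant terms on both rays, and the pair (f1, f2) alone gives properness over all of E_f; or
    at most one axis matters, which leaves deg f1 + deg f2 for the lines y_i = f_i(0). Mixed volumes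
    are used only as areas: V + 1 independent classes modulo (P, Q) at each step of an n by n grid
    of dilates would produce (V + 1) n^2 extra lattice points, hence a mixed volume above V. This
    takes the place of Bernstein's theorem. Ultrafilters take the place of Puiseux series: growth
    rates are always comparable, bounded functions converge, and roots are followed without
    continuous branches. *)

Section Modulus.
Variable R : realType.
Implicit Types z w : R[i].

(** The norm of [R[i]] has values in [R[i]]; the estimates below compare moduli in [R]. *)
Definition nC z : R := Normc.normc z.

Lemma nC_ge0 z : 0 <= nC z.
Proof. by case: z => a b; rewrite /nC /= sqrtr_ge0. Qed.
Lemma nC0 : nC 0 = 0. Proof. exact: Normc.normc0. Qed.
Lemma nC1 : nC 1 = 1. Proof. exact: Normc.normc1. Qed.
Lemma nCM z w : nC (z * w) = nC z * nC w. Proof. exact: Normc.normcM. Qed.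
Lemma nCV z : nC z^-1 = (nC z)^-1. Proof. exact: Normc.normcV. Qed.
Lemma nCN z : nC (- z) = nC z. Proof. exact: normcN. Qed.
Lemma nCD z w : nC (z + w) <= nC z + nC w. Proof. exact: le_normcD. Qed.
Lemma nCB z w : nC (z - w) <= nC z + nC w.
Proof. by rewrite -(nCN w) nCD. Qed.
Lemma nCBC z w : nC (z - w) = nC (w - z).
Proof. by rewrite -nCN opprB. Qed.
Lemma nCBB z w : nC z - nC w <= nC (z - w).
Proof. by have := nCD (z - w) w; rewrite subrK; lra. Qed.
Lemma nC_eq0 z : (nC z == 0) = (z == 0).
Proof.
by apply/eqP/eqP => [/Normc.eq0_normc//|->]; rewrite nC0.
Qed.
Lemma nC_gt0 z : (0 < nC z) = (z != 0).
Proof. by rewrite lt_def nC_ge0 andbT nC_eq0. Qed.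
Lemma nCX z n : nC (z ^+ n) = nC z ^+ n.
Proof. by elim: n => [|n IH]; rewrite ?expr0 ?nC1// !exprS nCM IH. Qed.
Lemma nC_sum (I : Type) (r : seq I) (P : pred I) (f : I -> R[i]) :
  nC (\sum_(i <- r | P i) f i) <= \sum_(i <- r | P i) nC (f i).
Proof.
elim/big_rec2: _ => [|i y1 y2 _ IH]; first by rewrite nC0.
by apply: le_trans (nCD _ _) _; rewrite lerD2l.
Qed.
Lemma nC_prod (I : Type) (r : seq I) (P : pred I) (f : I -> R[i]) :
  nC (\prod_(i <- r | P i) f i) = \prod_(i <- r | P i) nC (f i).
Proof. by elim/big_rec2: _ => [|i y1 y2 _ <-]; rewrite ?nC1 ?nCM. Qed.
Lemma nC_real (r : R) : nC (r%:C)%C = `|r|.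
Proof. by rewrite /nC /= expr0n /= addr0 sqrtr_sqr. Qed.
Lemma nC_natr n : nC n%:R = n%:R.
Proof.
elim: n => [|n IH]; first by rewrite nC0.
have -> : (n.+1%:R : R[i]) = ((n.+1%:R : R)%:C)%C by rewrite rmorph_nat.
by rewrite nC_real ger0_norm.
Qed.
Lemma Re_le_nC z : `|complex.Re z| <= nC z.
Proof.
case: z => a b; rewrite /nC /= -sqrtr_sqr ler_sqrt; last by rewrite addr_ge0 ?sqr_ge0.
by rewrite lerDl sqr_ge0.
Qed.
Lemma Im_le_nC z : `|complex.Im z| <= nC z.
Proof.
case: z => a b; rewrite /nC /= -sqrtr_sqr ler_sqrt; last by rewrite addr_ge0 ?sqr_ge0.
by rewrite lerDr sqr_ge0.
Qed.
Lemma nC_le_ReIm z : nC z <= `|complex.Re z| + `|complex.Im z|.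
Proof.
case: z => a b; rewrite /nC /=.
rewrite -(@ler_pXn2r _ 2) ?nnegrE ?addr_ge0 ?sqrtr_ge0 ?normr_ge0//.
rewrite sqr_sqrtr ?addr_ge0 ?sqr_ge0// sqrrD !real_normK ?num_real//.
have : 0 <= `|a| * `|b| by rewrite mulr_ge0.
lra.
Qed.
Lemma nC1_le_cnorm2 (z : R[i] * R[i]) : nC z.1 <= cnorm2 z.
Proof.
case: z => [[a b] [c d]]; rewrite /nC /cnorm2 /=.
by rewrite ler_sqrt ?addr_ge0 ?sqr_ge0// -addrA lerDl addr_ge0 ?sqr_ge0.
Qed.
Lemma nC2_le_cnorm2 (z : R[i] * R[i]) : nC z.2 <= cnorm2 z.
Proof.
case: z => [[a b] [c d]]; rewrite /nC /cnorm2 /=.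
by rewrite ler_sqrt ?addr_ge0 ?sqr_ge0// -(addrA (a ^+ 2 + b ^+ 2)) lerDr addr_ge0 ?sqr_ge0.
Qed.
Lemma cnorm2_le (z : R[i] * R[i]) : cnorm2 z <= nC z.1 + nC z.2.
Proof.
case: z => [[a b] [c d]]; rewrite /nC /cnorm2 /=.
rewrite -(@ler_pXn2r _ 2) ?nnegrE ?addr_ge0 ?sqrtr_ge0//.
rewrite sqr_sqrtr ?addr_ge0 ?sqr_ge0// sqrrD !sqr_sqrtr ?addr_ge0 ?sqr_ge0//.
have : 0 <= Num.sqrt (a ^+ 2 + b ^+ 2) * Num.sqrt (c ^+ 2 + d ^+ 2).
  by rewrite mulr_ge0 ?sqrtr_ge0.
lra.
Qed.
End Modulus.
#[global] Hint Extern 0 (is_true (0 <= nC _)) => exact: nC_ge0 : core.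

(** * Asymptotics along an ultrafilter *)

Section Asymptotics.
Variables (R : realType) (T : Type) (F : set_system T).
Context {FU : UltraFilter F}.
Implicit Types (u v w : T -> R) (f g : T -> R[i]).

(* u = O(v) and u = o(v) along F; as F is an ultrafilter, u = o(v) or v = O(u), and
   lo (fun=> 1) u says that u tends to infinity *)
Definition lO u v := exists2 K : R, 0 < K & F (fun x => u x <= K * v x).
Definition lo u v := forall e : R, 0 < e -> F (fun x => u x <= e * v x).
Definition ulim f (l : R[i]) := lo (fun x => nC (f x - l)) (fun=> 1).

Lemma ufT (A : set T) : (forall x, A x) -> F A.
Proof. by move=> h; apply: (@filterS _ F _ setT) => [x _|]; [exact: h|exact: filterT]. Qed.

Lemma uf_not (A : set T) : ~ F A -> F (fun x => ~ A x).
Proof. by case: (in_ultra_setVsetC A FU). Qed.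

Lemma uf_absurd : F (fun=> False) -> False.
Proof. by move=> h; have [x] := filter_ex h. Qed.

Lemma uf_or (A B : set T) : F (fun x => A x \/ B x) -> F A \/ F B.
Proof.
move=> h; have [?|nA] := pselect (F A); first by left.
right; apply: filterS2 h (uf_not nA) => x [] //.
Qed.

Lemma uf_has (I : eqType) (s : seq I) (A : I -> set T) :
  F (fun x => exists2 i, i \in s & A i x) -> exists2 i, i \in s & F (A i).
Proof.
elim: s => [|i s IH] h.
  by case: uf_absurd; apply: filterS h => x [].
have : F (fun x => A i x \/ (exists2 i, i \in s & A i x)).
  apply: filterS h => x [j]; rewrite inE => /orP[/eqP->|js] Aj; [by left|right].
  by exists j.
case/uf_or => [Ai|/IH[j js Aj]]; first by exists i; rewrite ?mem_head.
by exists j; rewrite // inE js orbT.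
Qed.

Lemma uf_all (I : eqType) (s : seq I) (A : I -> set T) :
  (forall i, i \in s -> F (A i)) -> F (fun x => forall i, i \in s -> A i x).
Proof.
elim: s => [|i s IH] h; first exact: ufT.
have h1 := h i (mem_head _ _).
have h2 : F (fun x => forall i, i \in s -> A i x).
  by apply: IH => j js; apply: h; rewrite inE js orbT.
by apply: filterS2 h1 h2 => x a b j; rewrite inE => /orP[/eqP->|/b].
Qed.

Lemma lO_le u v : (forall x, u x <= v x) -> lO u v.
Proof. by move=> h; exists 1 => //; apply: ufT => x; rewrite mul1r. Qed.

Lemma lO_lev u v : F (fun x => u x <= v x) -> lO u v.
Proof. by move=> h; exists 1 => //; apply: filterS h => x; rewrite mul1r. Qed.

Lemma lO_refl u : lO u u. Proof. exact: lO_le. Qed.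

Lemma lO_trans v u w : lO u v -> lO v w -> lO u w.
Proof.
move=> [K K0 h] [L L0 k]; exists (K * L); first by rewrite mulr_gt0.
apply: filterS2 h k => x h k; apply: le_trans h _.
by rewrite -mulrA ler_pM2l.
Qed.

Lemma lo_lO u v : lo u v -> lO u v. Proof. by move=> /(_ 1 ltr01); exists 1. Qed.

Lemma lo_lO_trans v u w : lo u v -> lO v w -> lo u w.
Proof.
move=> h [L L0 k] e e0; have := h (e / L); rewrite divr_gt0// => /(_ isT) {}h.
apply: filterS2 h k => x h k; apply: le_trans h _.
by rewrite -mulrA ler_pM2l// mulrC ler_pdivrMr// mulrC.
Qed.

Lemma lO_lo_trans v u w : lO u v -> lo v w -> lo u w.
Proof.
move=> [K K0 h] k e e0; have := k (e / K); rewrite divr_gt0// => /(_ isT) {}k.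
apply: filterS2 h k => x h k; apply: le_trans h _.
apply: le_trans (_ : K * (e / K * w x) <= _); first by rewrite ler_pM2l.
by rewrite mulrA mulrCA divff ?mulr1// gt_eqF.
Qed.

Lemma lo_or u v : lo u v \/ lO v u.
Proof.
have [h|nh] := pselect (lo u v); [by left|right].
have [e e0 /uf_not he] : exists2 e : R, 0 < e & ~ F (fun x => u x <= e * v x).
  apply: contrapT => h; apply: nh => e e0; apply: contrapT => h2.
  by apply: h; exists e.
exists e^-1; first by rewrite invr_gt0.
apply: filterS he => x /negP; rewrite -ltNge => /ltW h.
by rewrite mulrC ler_pdivlMr// mulrC.
Qed.

Lemma lO_add u v w : lO u w -> lO v w -> lO (fun x => u x + v x) w.
Proof.
move=> [K K0 h] [L L0 k]; exists (K + L); first by rewrite addr_gt0.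
by apply: filterS2 h k => x h k; rewrite mulrDl lerD.
Qed.

Lemma lo_add u v w : lo u w -> lo v w -> lo (fun x => u x + v x) w.
Proof.
move=> h k e e0; have e20 : 0 < e / 2 by rewrite divr_gt0.
apply: filterS2 (h _ e20) (k _ e20) => x {}h {}k.
by rewrite [e]splitr mulrDl lerD.
Qed.

Lemma lO_mul u v u' v' : (forall x, 0 <= u x) -> (forall x, 0 <= u' x) ->
  lO u v -> lO u' v' -> lO (fun x => u x * u' x) (fun x => v x * v' x).
Proof.
move=> u0 u'0 [K K0 h] [L L0 k]; exists (K * L); first by rewrite mulr_gt0.
by apply: filterS2 h k => x h k; rewrite mulrACA ler_pM.
Qed.

Lemma lo_mulr u v u' v' : (forall x, 0 <= u x) -> (forall x, 0 <= u' x) ->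
  lo u v -> lO u' v' -> lo (fun x => u x * u' x) (fun x => v x * v' x).
Proof.
move=> u0 u'0 h [L L0 k] e e0; have := h (e / L); rewrite divr_gt0// => /(_ isT) {}h.
apply: filterS2 h k => x h k.
have -> : e * (v x * v' x) = (e / L * v x) * (L * v' x).
  by rewrite mulrACA mulfVK ?gt_eqF.
by rewrite ler_pM.
Qed.

Lemma lo_mull u v u' v' : (forall x, 0 <= u x) -> (forall x, 0 <= u' x) ->
  lO u v -> lo u' v' -> lo (fun x => u x * u' x) (fun x => v x * v' x).
Proof.
move=> u0 u'0 h k; have := @lo_mulr u' v' u v u'0 u0 k h.
by congr lo; apply/funext => x; rewrite mulrC.
Qed.

Lemma lO_sum (I : eqType) (s : seq I) (u : I -> T -> R) w :
  (forall x, 0 <= w x) ->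
  (forall i, i \in s -> lO (u i) w) -> lO (fun x => \sum_(i <- s) u i x) w.
Proof.
move=> w0; elim: s => [|i s IH] h.
  by apply: lO_le => x; rewrite big_nil.
have -> : (fun x => \sum_(j <- i :: s) u j x) = fun x => u i x + \sum_(j <- s) u j x.
  by apply/funext => x; rewrite big_cons.
apply: lO_add; first by apply: h; rewrite mem_head.
by apply: IH => j js; apply: h; rewrite inE js orbT.
Qed.

Lemma lo_sum (I : eqType) (s : seq I) (u : I -> T -> R) w :
  (forall x, 0 <= w x) ->
  (forall i, i \in s -> lo (u i) w) -> lo (fun x => \sum_(i <- s) u i x) w.
Proof.
move=> w0; elim: s => [|i s IH] h.
  by move=> e e0; apply: ufT => x; rewrite big_nil mulr_ge0// ltW.
have -> : (fun x => \sum_(j <- i :: s) u j x) = fun x => u i x + \sum_(j <- s) u j x.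
  by apply/funext => x; rewrite big_cons.
apply: lo_add; first by apply: h; rewrite mem_head.
by apply: IH => j js; apply: h; rewrite inE js orbT.
Qed.

Lemma lO_exp u v n : (forall x, 0 <= u x) -> lO u v ->
  lO (fun x => u x ^+ n) (fun x => v x ^+ n).
Proof.
move=> u0 h; elim: n => [|n IH]; first by apply: lO_le => x; rewrite !expr0.
have -> : (fun x => u x ^+ n.+1) = fun x => u x * u x ^+ n.
  by apply/funext => x; rewrite exprS.
have -> : (fun x => v x ^+ n.+1) = fun x => v x * v x ^+ n.
  by apply/funext => x; rewrite exprS.
by apply: lO_mul => // x; rewrite exprn_ge0.
Qed.

Lemma lo_exp u v n : (0 < n)%N -> (forall x, 0 <= u x) -> lo u v ->
  lo (fun x => u x ^+ n) (fun x => v x ^+ n).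
Proof.
case: n => // n _ u0 h.
have -> : (fun x => u x ^+ n.+1) = fun x => u x * u x ^+ n.
  by apply/funext => x; rewrite exprS.
have -> : (fun x => v x ^+ n.+1) = fun x => v x * v x ^+ n.
  by apply/funext => x; rewrite exprS.
apply: lo_mulr => //; first by move=> x; rewrite exprn_ge0.
by apply: lO_exp => //; exact: lo_lO.
Qed.

Lemma lo_irr u v : lo u v -> lO v u -> F (fun x => 0 < u x) -> False.
Proof.
move=> h k p; have {h k} := lo_lO_trans h k => /(_ (1/2)).
rewrite divr_gt0// => /(_ isT) h.
by apply: uf_absurd; apply: filterS2 h p => x; lra.
Qed.

Lemma lO_root u v n : (0 < n)%N -> (forall x, 0 <= u x) -> (forall x, 0 <= v x) ->
  lO (fun x => u x ^+ n) (fun x => v x ^+ n) -> lO u v.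
Proof.
move=> n0 u0 v0 [K K0 h]; exists (K + 1); first by rewrite addr_gt0.
apply: filterS h => x h.
have K1 : 0 <= K + 1 by rewrite addr_ge0// ltW.
rewrite -(@ler_pXn2r _ n)// ?nnegrE ?mulr_ge0//.
apply: le_trans h _; rewrite exprMn ler_wpM2r ?exprn_ge0//.
apply: le_trans (_ : K + 1 <= _); first by rewrite lerDl.
by case: n n0 => // n _; rewrite exprS ler_peMr ?exprn_ege1 ?lerDr// ltW.
Qed.

Lemma ulim_ext f g l : F (fun x => f x = g x) -> ulim f l -> ulim g l.
Proof. by move=> h k e e0; apply: filterS2 h (k e e0) => x ->. Qed.

Lemma ulim_cst l : ulim (fun=> l) l.
Proof. by move=> e e0; apply: ufT => x; rewrite subrr nC0 mulr1 ltW. Qed.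

Lemma ulim_lO f l : ulim f l -> lO (fun x => nC (f x)) (fun=> 1).
Proof.
move=> /(_ 1 ltr01) h; exists (1 + nC l); first by rewrite ltr_pwDl.
apply: filterS h => x; rewrite !mulr1 => h.
by have := nCBB (f x) l; lra.
Qed.

Lemma ulimD f g l m : ulim f l -> ulim g m -> ulim (fun x => f x + g x) (l + m).
Proof.
move=> h k; have := lo_add h k.
by apply: lO_lo_trans; apply: lO_le => x; rewrite opprD addrACA nCD.
Qed.

Lemma ulimM f g l m : ulim f l -> ulim g m -> ulim (fun x => f x * g x) (l * m).
Proof.
move=> h k.
have h1 : lo (fun x => nC (f x - l) * nC (g x)) (fun=> 1).
  have -> : (fun=> 1) = (fun x : T => 1 * 1 : R) by apply/funext => ?; rewrite mulr1.
  by apply: lo_mulr => //; exact: ulim_lO k.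
have h2 : lo (fun x => nC l * nC (g x - m)) (fun=> 1).
  have -> : (fun=> 1) = (fun x : T => 1 * 1 : R) by apply/funext => ?; rewrite mulr1.
  by apply: lo_mull => //; exact: ulim_lO (ulim_cst l).
have := lo_add h1 h2; apply: lO_lo_trans; apply: lO_le => x.
have -> : f x * g x - l * m = (f x - l) * g x + l * (g x - m) by ring.
by rewrite -!nCM nCD.
Qed.

Lemma ulimN f l : ulim f l -> ulim (fun x => - f x) (- l).
Proof.
by move=> h e e0; apply: filterS (h e e0) => x; rewrite -opprD nCN.
Qed.

Lemma ulimB f g l m : ulim f l -> ulim g m -> ulim (fun x => f x - g x) (l - m).
Proof. by move=> h k; exact: ulimD h (ulimN k). Qed.

Lemma ulimX f l n : ulim f l -> ulim (fun x => f x ^+ n) (l ^+ n).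
Proof.
move=> h; elim: n => [|n IH]; first by rewrite expr0; apply: ulim_ext (ulim_cst _); apply: ufT.
rewrite exprS; apply: ulim_ext (ulimM h IH); apply: ufT => x; by rewrite exprS.
Qed.

Lemma ulim_sum (I : Type) (s : seq I) (f : I -> T -> R[i]) l :
  (forall i, ulim (f i) (l i)) ->
  ulim (fun x => \sum_(i <- s) f i x) (\sum_(i <- s) l i).
Proof.
move=> h; elim: s => [|i s IH].
  by rewrite big_nil; apply: ulim_ext (ulim_cst _); apply: ufT => x; rewrite big_nil.
by rewrite big_cons; apply: ulim_ext (ulimD (h i) IH); apply: ufT => x; rewrite big_cons.
Qed.

Lemma ulim_prod (I : eqType) (s : seq I) (f : I -> T -> R[i]) l :
  (forall i, i \in s -> ulim (f i) (l i)) ->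
  ulim (fun x => \prod_(i <- s) f i x) (\prod_(i <- s) l i).
Proof.
elim: s => [|i s IH] h.
  by rewrite big_nil; apply: ulim_ext (ulim_cst _); apply: ufT => x; rewrite big_nil.
rewrite big_cons; apply: ulim_ext (ulimM (h i (mem_head _ _)) (IH _)).
  by apply: ufT => x; rewrite big_cons.
by move=> j js; apply: h; rewrite inE js orbT.
Qed.

Lemma ulim0P f : ulim f 0 <-> lo (fun x => nC (f x)) (fun=> 1).
Proof. by split=> h e e0; apply: filterS (h e e0) => x; rewrite subr0. Qed.

Lemma ulim_uniq f l m : ulim f l -> ulim f m -> l = m.
Proof.
move=> h k; apply/eqP; rewrite -subr_eq0 -nC_eq0; apply/eqP.
apply/le_anti; rewrite nC_ge0 andbT leNgt; apply/negP => p.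
have := ulimB h k => /(_ (nC (l - m) / 2)); rewrite divr_gt0// => /(_ isT) q.
apply: uf_absurd; apply: filterS q => x.
by rewrite subrr sub0r nCN mulr1; lra.
Qed.

Lemma ulim_neq0 f l : ulim f l -> l != 0 -> lO (fun=> 1) (fun x => nC (f x)).
Proof.
move=> h l0; have l1 : 0 < nC l by rewrite nC_gt0.
have := h (nC l / 2); rewrite divr_gt0// => /(_ isT) k.
exists (2 / nC l); first by rewrite divr_gt0.
apply: filterS k => x; rewrite mulr1 nCBC mulrAC => k.
by rewrite ler_pdivlMr// mul1r; have := nCBB l (f x); lra.
Qed.

Lemma ulim_ev_neq f l m : ulim f l -> l != m -> F (fun x => f x <> m).
Proof.
move=> h lm; have := ulim_neq0 (ulimB h (ulim_cst m)).
rewrite subr_eq0 lm => /(_ isT)[K K0 k]; apply: filterS k => x /[swap] ->.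
by rewrite subrr nC0 mulr0 ler10.
Qed.

(** The limit is the supremum of the r with r <= u on a member of [F]; beyond it the ultrafilter
    contains the opposite inequality. *)
Lemma ulim_real (u : T -> R) : lO (fun x => `|u x|) (fun=> 1) ->
  exists l : R, forall e : R, 0 < e -> F (fun x => `|u x - l| <= e).
Proof.
move=> [K K0 h]; pose S : set R := fun r => F (fun x => r <= u x).
have S0 : S !=set0.
  by exists (- K); apply: filterS h => x; rewrite mulr1 ler_norml => /andP[].
have SK : ubound S K.
  move=> r Sr; rewrite leNgt; apply/negP => Kr; apply: uf_absurd.
  apply: filterS2 h Sr => x; rewrite mulr1 ler_norml => /andP[_] a b.
  by have := lt_le_trans Kr (le_trans b a); rewrite ltxx.
have hs : has_sup S by split => //; exists K.
exists (sup S) => e e0.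
have h1 : F (fun x => sup S - e <= u x).
  have [r Sr /ltW lt_r] := sup_adherent e0 hs.
  by apply: filterS Sr => x; apply: le_trans.
have h2 : ~ S (sup S + e).
  by move=> /(sup_upper_bound hs); rewrite gerDl leNgt e0.
apply: filterS2 h1 (uf_not h2) => x a /negP; rewrite -ltNge => /ltW b.
by rewrite ler_norml; apply/andP; split; lra.
Qed.

Lemma ulim_ex f : lO (fun x => nC (f x)) (fun=> 1) -> exists l, ulim f l.
Proof.
move=> h.
have [a ha] : exists l : R, forall e : R, 0 < e -> F (fun x => `|complex.Re (f x) - l| <= e).
  by apply: ulim_real; apply: lO_trans h; apply: lO_le => x; exact: Re_le_nC.
have [b hb] : exists l : R, forall e : R, 0 < e -> F (fun x => `|complex.Im (f x) - l| <= e).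
  by apply: ulim_real; apply: lO_trans h; apply: lO_le => x; exact: Im_le_nC.
exists (a +i* b)%C => e e0; have e20 : 0 < e / 2 by rewrite divr_gt0.
apply: filterS2 (ha _ e20) (hb _ e20) => x {}ha {}hb; rewrite mulr1.
apply: le_trans (nC_le_ReIm _) _; rewrite [e]splitr.
by apply: lerD; [move: ha|move: hb]; case: (f x).
Qed.

Lemma ulim_poly (p : {poly R[i]}) f l : ulim f l -> ulim (fun x => p.[f x]) p.[l].
Proof.
move=> h; rewrite horner_coef.
apply: ulim_ext (_ : ulim (fun x => \sum_(i < size p) p`_i * f x ^+ i) _).
  by apply: ufT => x; rewrite horner_coef.
by apply: ulim_sum => i; apply: ulimM (ulim_cst _) _; exact: ulimX.
Qed.

Lemma ulim_le f l u (m : R) : ulim f l -> F (fun x => nC (f x) <= u x) ->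
  (forall e : R, 0 < e -> F (fun x => u x <= m + e)) -> nC l <= m.
Proof.
move=> h k q; rewrite leNgt; apply/negP => lt.
pose e := (nC l - m) / 3; have e0 : 0 < e by rewrite divr_gt0 ?subr_gt0.
apply: uf_absurd; apply: filterS3 k (q e e0) (h e e0) => x a b; rewrite mulr1 => c.
have := nCBB l (f x); rewrite nCBC /e in a b c *; lra.
Qed.

End Asymptotics.

(** The source of all ultrafilters below: sequences tending to a point, to infinity or to an infimum
    enter as decreasing nonempty conditions. *)
Lemma uf_exists (T : Type) (S : nat -> set T) :
  (forall n, exists x, S n x) -> (forall n x, S n.+1 x -> S n x) ->
  exists F : set_system T, UltraFilter F /\ forall n, F (S n).
Proof.
move=> S0 Sd.
have Sm m n : (m <= n)%N -> S n `<=` S m.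
  move=> /subnK <-; elim: (n - m)%N => [|k IH] //= x.
  by rewrite addSn => /Sd /IH.
pose G : set_system T := filter_from setT S.
have GF : ProperFilter G.
  apply: filter_from_proper; last by move=> n _; exact: S0.
  apply: filter_from_filter; first by exists 0%N.
  move=> m n _ _; exists (maxn m n) => // x Sx; split.
    exact: (Sm _ _ (leq_maxl m n)).
  exact: (Sm _ _ (leq_maxr m n)).
have [F [FU FG]] := ultraFilterLemma GF.
by exists F; split => // n; apply: FG; exists n.
Qed.

Lemma natSinv_small (R : realType) (e : R) : 0 < e -> exists n : nat, (n.+1%:R)^-1 <= e.
Proof.
move=> e0; pose n := Num.truncn e^-1; exists n.
rewrite -(invrK e) lef_pV2 ?posrE ?ltr0n ?invr_gt0//.
by apply/ltW; rewrite truncnS_gt.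
Qed.

(** * Exponents, monomials and evaluation of polynomials in two variables *)

Section Bivariate.
Variable R : realType.
Local Notation C := (R[i]).
Implicit Types (P Q : {poly {poly C}}) (z : C * C) (w v : nat * nat).

Definition mon w z : C := z.1 ^+ w.1 * z.2 ^+ w.2.
Definition wadd w v : nat * nat := ((w.1 + v.1)%N, (w.2 + v.2)%N).

Lemma wadd_inj v w w' : wadd v w = wadd v w' -> w = w'.
Proof. by case: w w' => a b [a' b'] [] /addnI-> /addnI->. Qed.

Lemma waddC v w : wadd v w = wadd w v.
Proof. by rewrite /wadd addnC [X in (_, X)]addnC. Qed.

Lemma waddA u v w : wadd u (wadd v w) = wadd (wadd u v) w.
Proof. by rewrite /wadd /= !addnA. Qed.

Lemma monD w v z : mon (wadd w v) z = mon w z * mon v z.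
Proof. by rewrite /mon !exprD mulrACA. Qed.

Lemma mon0 z : mon (0%N, 0%N) z = 1.
Proof. by rewrite /mon !expr0 mulr1. Qed.

Lemma mon_neq0 w z : torus z -> mon w z != 0.
Proof. by move=> [z1 z2]; rewrite mulf_neq0 ?expf_neq0. Qed.

Lemma nC_mon_gt0 w z : torus z -> 0 < nC (mon w z).
Proof. by move=> tz; rewrite nC_gt0 mon_neq0. Qed.

Lemma pevalE P z : peval P z = P.[z.1%:P].[z.2].
Proof.
rewrite /peval -[RHS]/(horner_eval z.2 P.[z.1%:P]) -horner_map /=.
by rewrite /horner_eval hornerC.
Qed.

Lemma pevalD P Q z : peval (P + Q) z = peval P z + peval Q z.
Proof. by rewrite !pevalE !hornerD. Qed.
Lemma pevalN P z : peval (- P) z = - peval P z.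
Proof. by rewrite !pevalE !hornerN. Qed.
Lemma pevalB P Q z : peval (P - Q) z = peval P z - peval Q z.
Proof. by rewrite pevalD pevalN. Qed.
Lemma pevalM P Q z : peval (P * Q) z = peval P z * peval Q z.
Proof. by rewrite !pevalE !hornerM. Qed.
Lemma peval0 z : peval 0 z = 0 :> C.
Proof. by rewrite pevalE !horner0. Qed.
Lemma peval1 z : peval 1 z = 1 :> C.
Proof. by rewrite pevalE !hornerC. Qed.
Lemma pevalC (c : C) z : peval c%:P%:P z = c.
Proof. by rewrite pevalE !hornerC. Qed.
Lemma pevalX P n z : peval (P ^+ n) z = peval P z ^+ n.
Proof. by elim: n => [|n IH]; rewrite ?expr0 ?peval1// !exprS pevalM IH. Qed.
Lemma peval_sum (I : Type) (r : seq I) (p : pred I) (f : I -> {poly {poly C}}) z :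
  peval (\sum_(i <- r | p i) f i) z = \sum_(i <- r | p i) peval (f i) z.
Proof. by elim/big_rec2: _ => [|i y1 y2 _ <-]; rewrite ?peval0 ?pevalD. Qed.
Lemma peval_prod (I : Type) (r : seq I) (p : pred I) (f : I -> {poly {poly C}}) z :
  peval (\prod_(i <- r | p i) f i) z = \prod_(i <- r | p i) peval (f i) z.
Proof. by elim/big_rec2: _ => [|i y1 y2 _ <-]; rewrite ?peval1 ?pevalM. Qed.

Lemma coef2E P w : coef2 P w = (P`_w.1)`_w.2. Proof. by []. Qed.
Lemma coef2D P Q w : coef2 (P + Q) w = coef2 P w + coef2 Q w.
Proof. by rewrite !coef2E !coefD. Qed.
Lemma coef2N P w : coef2 (- P) w = - coef2 P w.
Proof. by rewrite !coef2E !coefN. Qed.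
Lemma coef20 w : coef2 (0 : {poly {poly C}}) w = 0.
Proof. by rewrite !coef2E !coef0. Qed.
Lemma coef2Cmul (c : C) P w : coef2 (c%:P%:P * P) w = c * coef2 P w.
Proof. by rewrite !coef2E !coefCM. Qed.
Lemma coef2_sum (I : Type) (r : seq I) (p : pred I) (f : I -> {poly {poly C}}) w :
  coef2 (\sum_(i <- r | p i) f i) w = \sum_(i <- r | p i) coef2 (f i) w.
Proof. by elim/big_rec2: _ => [|i y1 y2 _ <-]; rewrite ?coef20 ?coef2D. Qed.
Lemma eq_coef2 P Q : (forall w, coef2 P w = coef2 Q w) -> P = Q.
Proof. by move=> h; apply/polyP => i; apply/polyP => j; exact: (h (i, j)). Qed.

Definition Xm w : {poly {poly C}} := ('X^(w.2))%:P * 'X^(w.1).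

Lemma coef2_Xm w v : coef2 (Xm w) v = (v == w)%:R.
Proof.
rewrite coef2E /Xm coefCM coefXn; case: v w => [a b] [c d] /=.
rewrite xpair_eqE; case: (a == c); rewrite /= ?mulr1 ?coefXn//.
by rewrite mulr0 coef0.
Qed.

Lemma coef2_XmM w P v : coef2 (Xm w * P) v =
  if (w.1 <= v.1)%N && (w.2 <= v.2)%N then coef2 P ((v.1 - w.1)%N, (v.2 - w.2)%N) else 0.
Proof.
rewrite coef2E /Xm -mulrA coefCM coefXnM coefXnM ltnNge [(v.1 < w.1)%N]ltnNge.
by case: (w.1 <= v.1)%N; case: (w.2 <= v.2)%N; rewrite //= coef0.
Qed.

Lemma coef2_XmMD w P v : coef2 (Xm w * P) (wadd w v) = coef2 P v.
Proof.
by rewrite coef2_XmM /= !leq_addr /= !addKn -surjective_pairing.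
Qed.

Lemma peval_Xm w z : peval (Xm w) z = mon w z.
Proof.
by rewrite pevalE /Xm hornerM hornerC hornerXn hornerM -rmorphXn hornerC hornerXn mulrC.
Qed.

Lemma XmD w v : Xm (wadd w v) = Xm w * Xm v.
Proof. by rewrite /Xm !exprD rmorphM /=; ring. Qed.

Definition suppl P : seq (nat * nat) :=
  [seq w <- [seq (i, j) | i <- iota 0 (size P), j <- iota 0 (sizeY P)] | coef2 P w != 0].

Lemma mem_suppl P w : (w \in suppl P) = (coef2 P w != 0).
Proof.
rewrite mem_filter -/(coef2 P w); case: (boolP (coef2 P w != 0)) => // cw; rewrite andTb.
have h1 : (w.1 < size P)%N.
  by rewrite ltnNge; apply: contra_neqN cw => h; rewrite coef2E [P`__]nth_default ?coef0.
have h2 : (w.2 < sizeY P)%N.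
  rewrite ltnNge; apply: contra_neqN cw => h; rewrite coef2E [X in X = _]nth_default//.
  exact: leq_trans (max_size_coefXY _ _) h.
rewrite /=; case: w cw h1 h2 => i j _ /= h1 h2.
by apply/allpairsP; exists (i, j); rewrite !mem_iota.
Qed.

Lemma suppl_uniq P : uniq (suppl P).
Proof.
apply: filter_uniq; apply: allpairs_uniq; rewrite ?iota_uniq// => -[a b] [c d] _ _ /=.
by case=> -> ->.
Qed.

Lemma suppP P w : supp P w <-> w \in suppl P.
Proof. by rewrite mem_suppl. Qed.

Lemma poly_suppl P : P = \sum_(w <- suppl P) (coef2 P w)%:P%:P * Xm w.
Proof.
apply: eq_coef2 => v; rewrite coef2_sum.
under eq_bigr do rewrite coef2Cmul coef2_Xm.
have [vP|vP] := boolP (v \in suppl P).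
  rewrite (bigD1_seq v)//= ?suppl_uniq// eqxx mulr1 big1 ?addr0// => w wv.
  by rewrite eq_sym (negbTE wv) mulr0.
rewrite big_seq big1; first by apply/eqP; rewrite mem_suppl negbK in vP.
by move=> w wP; case: eqP => [e|_]; rewrite ?mulr0//; rewrite -e (negbTE vP) in wP.
Qed.

Lemma peval_suppl P z : peval P z = \sum_(w <- suppl P) coef2 P w * mon w z.
Proof.
rewrite {1}(poly_suppl P) peval_sum; apply: eq_bigr => w _.
by rewrite pevalM pevalC peval_Xm.
Qed.

Lemma suppl_neq0 P : P != 0 -> exists w, w \in suppl P.
Proof.
move=> P0; case e : (suppl P) => [|w s]; last by exists w; rewrite mem_head.
by move: P0; rewrite (poly_suppl P) e big_nil eqxx.
Qed.

(** Up to a constant factor this is the modulus of the largest monomial of [P] at [z]; the sum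
    avoids a choice of the largest one. *)
Definition Mx P z : R := \sum_(w <- suppl P) nC (mon w z).

Lemma Mx_ge P w z : w \in suppl P -> nC (mon w z) <= Mx P z.
Proof.
move=> wP; rewrite /Mx (bigD1_seq w) ?suppl_uniq//= lerDl; exact: sumr_ge0.
Qed.

Lemma tdegP P w : w \in suppl P -> (w.1 + w.2 <= tdeg P)%N.
Proof.
rewrite mem_suppl => cw.
have h1 : (w.1 < size P)%N.
  by rewrite ltnNge; apply: contra_neqN cw => h; rewrite coef2E [P`__]nth_default ?coef0.
have h2 : (w.2 < size (P`_w.1)%R)%N.
  by rewrite ltnNge; apply: contra_neqN cw => h; rewrite coef2E [X in X = _]nth_default.
apply: leq_trans (leq_bigmax (Ordinal h1)) => /=.
have -> : (w.1 + w.2 = w.1 + Ordinal h2)%N by [].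
by apply: leq_bigmax_cond; rewrite /= -surjective_pairing.
Qed.

Lemma coef2M P Q w : coef2 (P * Q) w =
  \sum_(v <- suppl P) \sum_(v' <- suppl Q) coef2 P v * coef2 Q v' * (wadd v v' == w)%:R.
Proof.
rewrite {1}(poly_suppl P) {1}(poly_suppl Q) mulr_suml coef2_sum.
apply: eq_bigr => v _; rewrite mulr_sumr coef2_sum; apply: eq_bigr => v' _.
have -> : (coef2 P v)%:P%:P * Xm v * ((coef2 Q v')%:P%:P * Xm v') =
  (coef2 P v)%:P%:P * ((coef2 Q v')%:P%:P * Xm (wadd v v')) by rewrite XmD; ring.
by rewrite !coef2Cmul coef2_Xm mulrA [w == _]eq_sym.
Qed.

Lemma suppl_mul P Q w : w \in suppl (P * Q) ->
  exists v v', [/\ v \in suppl P, v' \in suppl Q & w = wadd v v'].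
Proof.
rewrite mem_suppl => h; apply: contrapT => nh; move/negP: h; apply.
rewrite coef2M big_seq big1// => v vP; rewrite big_seq big1// => v' v'Q.
by case: eqP => [e|]; rewrite ?mulr0//; case: nh; exists v, v'.
Qed.

Lemma suppl_Xm w : suppl (Xm w) = [:: w].
Proof.
apply: perm_small_eq => //; apply: uniq_perm; rewrite ?suppl_uniq// => v.
by rewrite mem_suppl coef2_Xm inE; case: (v == w); rewrite ?oner_eq0 ?eqxx.
Qed.

Lemma ulim_peval (T : Type) (F : set_system T) {FU : UltraFilter F} P (f g : T -> C) l m :
  ulim F f l -> ulim F g m -> ulim F (fun x => peval P (f x, g x)) (peval P (l, m)).
Proof.
move=> fl gm; rewrite peval_suppl.
apply: ulim_ext (_ : ulim F (fun x => \sum_(w <- suppl P) coef2 P w * mon w (f x, g x)) _).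
  by apply: ufT => x; rewrite peval_suppl.
apply: ulim_sum => w; apply: ulimM (ulim_cst _) _.
by apply: ulimM; exact: ulimX.
Qed.

Lemma nC_peval_le (P : {poly {poly C}}) : exists2 K : R, 0 < K &
  forall z, nC (peval P z) <= K * Mx P z.
Proof.
exists (1 + \sum_(w <- suppl P) nC (coef2 P w)).
  by rewrite ltr_pwDl//; exact: sumr_ge0.
move=> z; rewrite peval_suppl; apply: le_trans (nC_sum _ _ _) _.
rewrite mulr_sumr big_seq [leRHS]big_seq; apply: ler_sum => w wP; rewrite nCM ler_wpM2r//.
rewrite (bigD1_seq w) ?suppl_uniq//= addrCA lerDl addr_ge0//; exact: sumr_ge0.
Qed.

Lemma coef2_swapXY P w : coef2 (swapXY P) w = coef2 P (w.2, w.1).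
Proof. by rewrite !coef2E coef_swapXY. Qed.

Lemma peval_swapXY P z : peval (swapXY P) z = peval P (z.2, z.1).
Proof. by rewrite !pevalE horner2_swapXY. Qed.

End Bivariate.

(** * Roots and multiplicities of complex polynomials in one variable *)

Section Univariate.
Variable R : realType.
Local Notation C := (R[i]).
Implicit Types (p q : {poly C}).

Lemma polyC_split p : exists s : seq C, p = lead_coef p *: \prod_(x <- s) ('X - x%:P).
Proof. by have [s hs] := closed_field_poly_normal p; exists s. Qed.

Definition rootsC p : seq C := sval (cid (polyC_split p)).
Lemma rootsCE p : p = lead_coef p *: \prod_(x <- rootsC p) ('X - x%:P).
Proof. by rewrite /rootsC; case: cid. Qed.

Lemma size_rootsC p : p != 0 -> size p = (size (rootsC p)).+1.
Proof.
by move=> p0; rewrite {1}(rootsCE p) size_scale ?lead_coef_eq0// size_prod_XsubC.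
Qed.

Lemma mem_rootsC p x : p != 0 -> (x \in rootsC p) = (p.[x] == 0).
Proof.
move=> p0; rewrite -[RHS]/(root p x) {2}(rootsCE p) rootZ ?lead_coef_eq0//.
by rewrite root_prod_XsubC.
Qed.

Lemma horner_rootsC p x : p.[x] = lead_coef p * \prod_(y <- rootsC p) (x - y).
Proof.
rewrite {1}(rootsCE p) hornerZ horner_prod; congr (_ * _).
by apply: eq_bigr => y _; rewrite !hornerE.
Qed.

Lemma mup_rootsC p x : p != 0 -> mup x p = count_mem x (rootsC p).
Proof.
move=> p0; rewrite {1}(rootsCE p) -mul_polyC mupMr ?mu_prod_XsubC//.
by rewrite rootC lead_coef_eq0.
Qed.

Lemma sum_mup p (s : seq C) : p != 0 -> uniq s -> (\sum_(x <- s) mup x p <= (size p).-1)%N.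
Proof.
move=> p0 us; rewrite size_rootsC//=.
under eq_bigr do rewrite mup_rootsC//.
elim: (rootsC p) => [|a r IH]; first by rewrite big1.
rewrite /= big_split /=; rewrite -[(size r).+1]add1n; apply: leq_add IH.
have [as_|as_] := boolP (a \in s).
  rewrite (bigD1_seq a)//= eqxx big1 ?addn0// => i ia; by rewrite eq_sym (negbTE ia).
rewrite big_seq big1// => i is_; case: eqP => // e; by rewrite e is_ in as_.
Qed.

Lemma sum_mup_all p (s : seq C) : p != 0 -> uniq s -> {subset rootsC p <= s} ->
  (\sum_(x <- s) mup x p)%N = (size p).-1.
Proof.
move=> p0 us hs; rewrite size_rootsC//=.
under eq_bigr do rewrite mup_rootsC//.
elim: (rootsC p) hs => [|a r IH] hs; first by rewrite big1.
rewrite /= big_split /= IH; last by move=> x xr; apply: hs; rewrite inE xr orbT.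
rewrite (bigD1_seq a)//=; last by apply: hs; rewrite mem_head.
rewrite eqxx big1 => [|i ia]; last by rewrite eq_sym (negbTE ia).
by rewrite addn0 add1n.
Qed.

Lemma size_undup_roots p (s : seq C) : p != 0 -> uniq s -> (forall x, x \in s -> p.[x] = 0) ->
  (size s <= (size p).-1)%N.
Proof.
move=> p0 us hs; rewrite size_rootsC//=; apply: uniq_leq_size => // x xs.
by rewrite mem_rootsC// hs.
Qed.

Lemma exists_nonroot p (s : seq C) : p != 0 -> exists x, p.[x] != 0 /\ x \notin s.
Proof.
move=> p0; apply: contrapT => h.
pose r := [seq (i%:R : C) | i <- iota 0 (size p + size s).+1].
have ur : uniq r.
  rewrite map_inj_uniq ?iota_uniq// => i j /eqP; rewrite eqr_nat; by move/eqP.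
have : (size r <= size (rootsC p ++ s))%N.
  apply: uniq_leq_size => // x xr; rewrite mem_cat mem_rootsC//.
  have [//|px] := eqVneq p.[x] 0; apply: contrapT => xs; apply: h; exists x.
  by split => //; apply/negP.
rewrite size_map size_iota size_cat => h2.
have := size_rootsC p0; lia.
Qed.

Lemma poly_infinite0 p : (forall x, p.[x] = 0) -> p = 0.
Proof.
move=> h; apply/eqP; apply: contrapT => /negP p0.
by have [x [+ _]] := exists_nonroot [::] p0; rewrite h eqxx.
Qed.

Lemma poly_cofinite0 p (s : seq C) : (forall x, x \notin s -> p.[x] = 0) -> p = 0.
Proof.
move=> h; apply/eqP; apply: contrapT => /negP p0.
by have [x [+ xs]] := exists_nonroot s p0; rewrite h// eqxx.
Qed.

Lemma peval_torus0 (P : {poly {poly C}}) : (forall z, torus z -> peval P z = 0) -> P = 0.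
Proof.
move=> h; apply/eqP; apply: contrapT => /negP P0.
have : forall x, x \notin [:: 0] -> (P.[x%:P]) = 0.
  move=> x x0; apply: (@poly_cofinite0 _ [:: 0]) => y y0.
  have := h (x, y); rewrite pevalE; apply; split => /=.
    by rewrite inE in x0.
  by rewrite inE in y0.
move=> h2; have : swapXY P = 0.
  apply/polyP => j; rewrite coef0; apply: (@poly_cofinite0 _ [:: 0]) => x x0.
  have := h2 x x0 => /(congr1 (fun p : {poly C} => p`_j)).
  rewrite coef0 => <-; rewrite -{2}(swapXYK P) horner_swapXY coef_map /=.
  by [].
by move/eqP; rewrite swapXY_eq0 (negbTE P0).
Qed.

End Univariate.

Lemma size_factor_le1 (d g : nat) : ((d + g).-1 <= g -> 0 < g -> d <= 1)%N.
Proof. lia. Qed.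

(** * Counting monomials and lattice points *)

Section Syzygies.
Variable R : realType.
Local Notation C := (R[i]).
Implicit Types (P Q g q u r : {poly {poly C}}) (c e : {poly C}).

(** Coprimality, in the form of exactness of the Koszul complex of [P] and [Q] that the dimension
    count uses. *)
Definition syz P Q := forall u r, u * P = r * Q -> exists d : {poly {poly C}}, u = d * Q /\ r = d * P.

(** Primitivity over an algebraically closed field: the coefficients of [g] have no common root. *)
Definition primitivep g := forall x : C, map_poly (horner_eval x) g != 0.

Lemma divides_XsubC x g : map_poly (horner_eval x) g = 0 ->
  exists g', g = ('X - x%:P)%:P * g'.
Proof.
move=> h; exists (map_poly (fun c => c %/ ('X - x%:P)) g).
apply/polyP => i; rewrite coefCM coef_map_id0 ?div0p//.
have : root g`_i x.
  by have := congr1 (fun p : {poly C} => p`_i) h; rewrite coef_map coef0 /= => /eqP.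
by rewrite root_factor_theorem => /divpK; rewrite mulrC => ->.
Qed.

(** Gauss's lemma, one root x of [c] at a time: specialising the inner variable at x gives 0 = g q
    with g nonzero, so the linear factor divides [q]. *)
Lemma gauss_cancel c g P q : c != 0 ->
  (forall x, c.[x] = 0 -> map_poly (horner_eval x) g != 0) ->
  c%:P * P = g * q -> exists q', q = c%:P * q'.
Proof.
have [n] := ubnP (size c); elim: n c P q => // n IH c P q sc c0 hg e.
have [s1|s1] := leqP (size c) 1.
  have := size1_polyC s1; set a := c`_0 => ac; rewrite {}ac in c0 e *.
  have a0 : a != 0 by move: c0; rewrite polyC_eq0.
  exists ((a^-1)%:P%:P * q); rewrite mulrA -!polyCM divff//.
  by rewrite mul1r.
have [x /rootP cx] : exists x, root c x.
  by apply/closed_rootP; rewrite gtn_eqF.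
have /eqP := congr1 (map_poly (horner_eval x)) e.
rewrite !rmorphM /= map_polyC /= /horner_eval cx mul0r eq_sym mulf_eq0.
rewrite (negbTE (hg _ cx)) /= => /eqP /divides_XsubC[q1 q1E].
have /factor_theorem[c1 c1E] : root c x by apply/rootP.
have X0 : ('X - x%:P)%:P != 0 :> {poly {poly C}} by rewrite polyC_eq0 polyXsubC_eq0.
have c10 : c1 != 0 by apply: contra_neq c0 => h; rewrite c1E h mul0r.
have [|y yc||q' q'E] := IH c1 P q1 _ c10.
- by move: sc; rewrite c1E size_mul ?polyXsubC_eq0// size_XsubC addn2.
- by apply: hg; rewrite c1E hornerM yc mul0r.
- apply: (mulfI X0); transitivity (c%:P * P); first by rewrite c1E rmorphM /=; ring.
  by rewrite e q1E; ring.
exists q'; rewrite q1E q'E c1E rmorphM /=; ring.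
Qed.

Lemma primitive_part g : g != 0 ->
  exists e g0, [/\ e != 0, primitivep g0 & g = e%:P * g0].
Proof.
have [n] := ubnP (size (lead_coef g)); elim: n g => // n IH g sg g0.
have [pg|/existsNP[x /negP]] := pselect (primitivep g).
  by exists 1, g; rewrite oner_eq0 mul1r.
rewrite negbK => /eqP /divides_XsubC[g' gE].
have g'0 : g' != 0 by apply: contra_neq g0 => h; rewrite gE h mulr0.
have [|e [g1 [e0 pg1 g1E]]] := IH g' _ g'0.
  by move: sg; rewrite gE lead_coefM lead_coefC mulrC size_mul ?lead_coef_eq0 ?polyXsubC_eq0// size_XsubC addn2.
exists (('X - x%:P) * e), g1; split => //.
  by rewrite mulf_neq0 ?polyXsubC_eq0.
by rewrite gE g1E rmorphM mulrA.
Qed.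

(** The common factor is assembled from the gcd of the contents and the primitive part of a gcd over
    the field of fractions of the coefficients. *)
Lemma gcd_syz P Q : P != 0 -> Q != 0 ->
  exists h P' Q', [/\ P = h * P', Q = h * Q' & syz P' Q'].
Proof.
move=> P0 Q0.
have [e1 [P1 [e10 pP1 P1E]]] := primitive_part P0.
have [e2 [Q1 [e20 pQ1 Q1E]]] := primitive_part Q0.
have P10 : P1 != 0 by apply: contra_neq P0 => h; rewrite P1E h mulr0.
have Q10 : Q1 != 0 by apply: contra_neq Q0 => h; rewrite Q1E h mulr0.
pose g := gcdp P1 Q1.
have g0 : g != 0 by rewrite gcdp_eq0 negb_and P10.
have [e [g1 [e0 pg1 g1E]]] := primitive_part g0.
have g10 : g1 != 0 by apply: contra_neq g0 => h; rewrite g1E h mulr0.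
have divg T : T != 0 -> g %| T -> exists T', T = g1 * T'.
  move=> T0 /Pdiv.Idomain.dvdpP[[c q] /= c0 cq].
  have [x _||q' q'E] := @gauss_cancel c g1 T (e%:P * q) c0; first exact: pg1.
    by rewrite mul_polyC cq g1E; ring.
  exists q'; apply: (@mulfI _ c%:P); first by rewrite polyC_eq0.
  by rewrite mul_polyC cq g1E mulrC -mulrA [g1 * q]mulrC mulrA q'E; ring.
have [P2 P2E] := divg _ P10 (dvdp_gcdl _ _).
have [Q2 Q2E] := divg _ Q10 (dvdp_gcdr _ _).
have P20 : P2 != 0 by apply: contra_neq P10 => h; rewrite P2E h mulr0.
have pQ2 : primitivep Q2.
  by move=> x; have := pQ1 x; rewrite Q2E rmorphM /=; apply: contra_neq => ->; rewrite mulr0.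
have pP2 : primitivep P2.
  by move=> x; have := pP1 x; rewrite P2E rmorphM /=; apply: contra_neq => ->; rewrite mulr0.
(* Over the fraction field [P2] and [Q2] are coprime; clearing denominators in a Bezout identity
   leaves a nonzero [rho] in the inner variable. *)
have [U [V [rho [rho0 UV]]]] : exists U V (rho : {poly C}), rho != 0 /\ U * P2 + V * Q2 = rho%:P.
  pose d := gcdp P2 Q2.
  have d0 : d != 0 by rewrite gcdp_eq0 negb_and P20.
  have sd : (size d <= 1)%N.
    have : d * g1 %| g.
      rewrite dvdp_gcd P2E Q2E ![g1 * _]mulrC !Pdiv.Idomain.dvdp_mul2r// dvdp_gcdl.
      by rewrite dvdp_gcdr.
    move=> /(dvdp_leq g0); rewrite g1E size_mul// size_Cmul// => h.
    by apply: size_factor_le1 h _; rewrite size_poly_gt0.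
  have := size1_polyC sd; set a := d`_0 => ad.
  have [uv] := Bezoutp P2 Q2; rewrite -/d ad => /eqpP[[c1 c2]] /= /andP[c10 c20] h.
  exists (c1%:P * uv.1), (c1%:P * uv.2), (c2 * a); split.
    by rewrite mulf_neq0//; apply: contra_neq d0 => h0; rewrite ad h0.
  by rewrite -!mulrA -mulrDr mul_polyC h -mul_polyC rmorphM.
pose gm := gcdp e1 e2.
have gm0 : gm != 0 by rewrite gcdp_eq0 negb_and e10.
have e1E : e1 = gm * (e1 %/ gm) by rewrite mulrC divpK ?dvdp_gcdl.
have e2E : e2 = gm * (e2 %/ gm) by rewrite mulrC divpK ?dvdp_gcdr.
set e1' := e1 %/ gm in e1E; set e2' := e2 %/ gm in e2E.
have e1'0 : e1' != 0 by apply: contra_neq e10 => h; rewrite e1E h mulr0.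
have e2'0 : e2' != 0 by apply: contra_neq e20 => h; rewrite e2E h mulr0.
have cop x : e2'.[x] = 0 -> e1'.[x] != 0.
  move=> h; have : coprimep e1' e2' by apply: coprimep_div_gcd; rewrite e10.
  apply: contraTneq => h2; apply/negP => /coprimep_root /(_ _) - /(_ x).
  by rewrite rootE h2 eqxx => /(_ isT); rewrite h eqxx.
exists (gm%:P * g1), (e1'%:P * P2), (e2'%:P * Q2); split.
- by rewrite P1E P2E e1E rmorphM /=; ring.
- by rewrite Q1E Q2E e2E rmorphM /=; ring.
move=> u r ur.
(* Multiplied by e1' rho = e1' (U P2 + V Q2), the factor [u] becomes a multiple of [Q2], and
   primitivity of [Q2] removes e1' rho again. *)
have [|x _||u1 u1E] := @gauss_cancel (e1' * rho) Q2 u (U * r * e2'%:P + e1'%:P * u * V).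
- by rewrite mulf_neq0.
- exact: pQ2.
- rewrite rmorphM /= -UV.
  have -> : e1'%:P * (U * P2 + V * Q2) * u = U * (u * (e1'%:P * P2)) + e1'%:P * u * V * Q2 by ring.
  by rewrite ur; ring.
have {}u1E : u = Q2 * u1.
  apply: (@mulfI _ (e1' * rho)%:P); first by rewrite polyC_eq0 mulf_neq0.
  rewrite mulrCA -u1E rmorphM /= -UV.
  have -> : e1'%:P * (U * P2 + V * Q2) * u = U * (u * (e1'%:P * P2)) + e1'%:P * u * V * Q2 by ring.
  by rewrite ur; ring.
have Q20 : Q2 != 0 by apply: contra_neq Q10 => h; rewrite Q2E h mulr0.
have h3 : e2'%:P * r = (e1'%:P * P2) * u1.
  apply: (mulfI Q20); transitivity (r * (e2'%:P * Q2)); first by ring.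
  by rewrite -ur u1E; ring.
have [x ex2|u2 u2E] := gauss_cancel e2'0 _ h3.
  rewrite rmorphM /= map_polyC /=; apply: mulf_neq0; last exact: pP2.
  by rewrite polyC_eq0; exact: cop ex2.
exists u2; split; first by rewrite u1E u2E; ring.
apply: (@mulfI _ e2'%:P); first by rewrite polyC_eq0.
by rewrite h3 u2E; ring.
Qed.

End Syzygies.

Lemma seq_argmax (T : eqType) (f : T -> int) (s : seq T) x0 : x0 \in s ->
  exists2 x, x \in s & forall y, y \in s -> f y <= f x.
Proof.
elim: s x0 => // a s IH x0 _; case: s IH => [|b s] IH.
  by exists a; rewrite ?mem_head// => y; rewrite inE => /eqP->.
have [x xs hx] := IH b (mem_head _ _).
have [h|h] := leP (f a) (f x).
  exists x; first by rewrite inE xs orbT.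
  by move=> y; rewrite inE => /orP[/eqP->//|/hx].
exists a; first exact: mem_head.
move=> y; rewrite inE => /orP[/eqP->//|/hx hy]; exact: le_trans hy (ltW h).
Qed.

(** * Dimension count in spaces of polynomials with exponents in a polygon *)

Section Dimension.
Variable R : realType.
Local Notation C := (R[i]).
Implicit Types (P Q u r e : {poly {poly C}}) (w v : nat * nat) (l : int * int).

Definition lf l w : int := l.1 * (w.1)%:Z + l.2 * (w.2)%:Z.

Lemma lfD l w v : lf l (wadd w v) = lf l w + lf l v.
Proof. by rewrite /lf /wadd /= !PoszD; ring. Qed.

(** Leading terms multiply: for the order given first by [l] and then lexicographically, the sum of
    the greatest exponents of [e] and [P] occurs in [e * P] without cancellation, so the [l]-degree
    is additive. *)
Lemma degree_cancel l (d a : int) e P w0 :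
  w0 \in suppl P -> lf l w0 = a -> (forall w, w \in suppl P -> lf l w <= a) ->
  (forall w, w \in suppl (e * P) -> lf l w <= d + a) ->
  forall w, w \in suppl e -> lf l w <= d.
Proof.
move=> w0P w0a Pa hd w we.
(* All coordinates involved are below [B], so [key] codes this order by one integer written in base
   [B]. *)
pose B : nat := (size e + sizeY e + size P + sizeY P).+1.
pose key v : int := lf l v * (B * B)%:Z + (v.1)%:Z * B%:Z + (v.2)%:Z.
have small T v : v \in suppl T -> (v.1 < size T)%N /\ (v.2 < sizeY T)%N.
  by rewrite mem_filter => /andP[_ /allpairsP[[i j] /= []]]; rewrite !mem_iota => ? ? ->.
have [ve vee he] := seq_argmax key we.
have [vp vpp hp] := seq_argmax key w0P.
have lexi v v' : (v.1 < B)%N -> (v.2 < B)%N -> (v'.1 < B)%N -> (v'.2 < B)%N ->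
  key v <= key v' -> lf l v <= lf l v' /\ (key v = key v' -> v = v').
  case: v v' => [x y] [x' y']; rewrite /key; move: (lf l _) (lf l _) => m m' /=.
  move=> xB yB x'B y'B h; split.
    by nia.
  move=> e1; have mm : m = m' by nia.
  rewrite mm in e1; have xx : x = x' by nia.
  by rewrite xx in e1 *; congr (_, _); lia.
have sb v : v \in suppl e -> (v.1 < B)%N /\ (v.2 < B)%N by move=> /small[]; rewrite /B; lia.
have sb' v : v \in suppl P -> (v.1 < B)%N /\ (v.2 < B)%N by move=> /small[]; rewrite /B; lia.
have keyD v v' : key (wadd v v') = key v + key v'.
  by rewrite /key lfD /wadd /= !PoszD; ring.
have top : wadd ve vp \in suppl (e * P).
  rewrite mem_suppl coef2M (bigD1_seq ve) ?suppl_uniq//= (bigD1_seq vp) ?suppl_uniq//=.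
  rewrite eqxx mulr1 big1_seq ?addr0.
    rewrite big1_seq ?addr0; first by rewrite mulf_neq0 -?mem_suppl.
    move=> v /andP[vve vs]; rewrite big1_seq// => v' /andP[_ v's].
    case: eqP => [E|]; rewrite ?mulr0//.
    have := congr1 key E; rewrite !keyD => E2.
    have k1 := he _ vs; have k2 := hp _ v's.
    have [v1 v2] := sb _ vs; have [ve1 ve2] := sb _ vee.
    have [_ vve'] := lexi _ _ v1 v2 ve1 ve2 k1.
    by move/eqP: vve; case; apply: vve'; lia.
  move=> v' /andP[v'vp v's]; case: eqP => [/wadd_inj/eqP|]; rewrite ?mulr0//.
  by rewrite (negbTE v'vp).
have [w1 w2] := sb _ we; have [ve1 ve2] := sb _ vee.
have [h1 _] := lexi _ _ w1 w2 ve1 ve2 (he _ we).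
have [x1 x2] := sb' _ w0P; have [y1 y2] := sb' _ vpp.
have [h2 _] := lexi _ _ x1 x2 y1 y2 (hp _ w0P).
have := hd _ top; rewrite lfD; have := Pa _ vpp; lia.
Qed.

Variable LL : seq (int * int).
Implicit Types (d a b : int * int -> int).

(** A polygon is recorded by its upper bounds in finitely many directions, so that multiplying
    polynomials amounts to adding bounds ([dadd]). *)
Definition regb d w : bool := all (fun l => lf l w <= d l) LL.
Definition inD d P : Prop := forall w, w \in suppl P -> regb d w.
Definition box (N : nat) : seq (nat * nat) := [seq (i, j) | i <- iota 0 N, j <- iota 0 N].
Definition Reg N d : seq (nat * nat) := [seq w <- box N | regb d w].
Definition cnt N d : nat := size (Reg N d).
Definition dadd d a : int * int -> int := fun l => d l + a l.

Lemma mem_box N w : (w \in box N) = (w.1 < N)%N && (w.2 < N)%N.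
Proof.
case: w => i j; apply/allpairsP/idP => [[[x y] /= []]|/andP[h1 h2]].
  by rewrite !mem_iota !add0n => /andP[_ h1] /andP[_ h2] [-> ->]; rewrite h1 h2.
by exists (i, j); rewrite !mem_iota.
Qed.

Lemma mem_Reg N d w : (w \in Reg N d) = [&& regb d w, (w.1 < N)%N & (w.2 < N)%N].
Proof. by rewrite mem_filter mem_box. Qed.

Lemma Reg_uniq N d : uniq (Reg N d).
Proof.
apply: filter_uniq; apply: allpairs_uniq; rewrite ?iota_uniq// => -[x y] [z t] _ _ /=.
by case=> -> ->.
Qed.

Lemma regbP d w : reflect (forall l, l \in LL -> lf l w <= d l) (regb d w).
Proof. exact: allP. Qed.

Lemma regb_add d a w v : regb d w -> regb a v -> regb (dadd d a) (wadd w v).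
Proof.
move=> /regbP h1 /regbP h2; apply/regbP => l lL.
by rewrite lfD lerD ?h1 ?h2.
Qed.

Lemma inD_mul d a P Q : inD d P -> inD a Q -> inD (dadd d a) (P * Q).
Proof.
move=> hP hQ w /suppl_mul[v [v' [vP v'Q ->]]].
by apply: regb_add; [exact: hP|exact: hQ].
Qed.

Lemma inD_sum d (I : eqType) (s : seq I) (f : I -> {poly {poly C}}) :
  (forall i, i \in s -> inD d (f i)) -> inD d (\sum_(i <- s) f i).
Proof.
move=> h w; rewrite mem_suppl coef2_sum => hw; apply: contrapT => nw.
move/negP: hw; apply; apply/eqP; rewrite big_seq big1// => i is_.
apply: contrapT => /eqP; rewrite -mem_suppl => /(h _ is_); exact: nw.
Qed.

Lemma inD_Cmul d (c : C) P : inD d P -> inD d (c%:P%:P * P).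
Proof.
move=> h w; rewrite mem_suppl coef2Cmul mulf_eq0 negb_or => /andP[_].
by rewrite -mem_suppl; exact: h.
Qed.

Lemma inD_Xm d w : regb d w -> inD d (Xm _ w : {poly {poly C}}).
Proof. by move=> h v; rewrite suppl_Xm inE => /eqP->. Qed.

Definition exact_deg a P := inD a P /\ forall l, l \in LL -> exists2 w, w \in suppl P & lf l w = a l.

Lemma inD_cancel d a e P : exact_deg a P -> inD (dadd d a) (e * P) -> inD d e.
Proof.
move=> [Pa ex] h w we; apply/regbP => l lL.
have [w0 w0P w0a] := ex l lL.
apply: (@degree_cancel l (d l) (a l) e P w0) => //.
- by move=> v vP; exact: (regbP _ _ (Pa v vP)).
- by move=> v vP; exact: (regbP _ _ (h v vP)).
Qed.

Section Count.
Variables (N : nat) (d a b : int * int -> int) (P Q : {poly {poly C}}) (K : nat).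
Variable g : 'I_K -> {poly {poly C}}.
Let D4 := dadd (dadd d a) b.
Hypothesis boxN : forall w, regb D4 w -> (w.1 < N)%N && (w.2 < N)%N.
Hypothesis boxN1 : forall w, regb (dadd d b) w -> (w.1 < N)%N && (w.2 < N)%N.
Hypothesis boxN2 : forall w, regb (dadd d a) w -> (w.1 < N)%N && (w.2 < N)%N.
Hypothesis boxN0 : forall w, regb d w -> (w.1 < N)%N && (w.2 < N)%N.
Hypothesis Pa : exact_deg a P.
Hypothesis Qb : inD b Q.
Hypothesis P0 : P != 0.
Hypothesis sPQ : syz P Q.
Hypothesis gD : forall k, inD D4 (g k).
Hypothesis indep : forall (c : 'I_K -> C) u r, inD (dadd d b) u -> inD (dadd d a) r ->
  \sum_k (c k)%:P%:P * g k = u * P + r * Q -> forall k, c k = 0.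

Let n4 := cnt N D4.
Let n1 := cnt N (dadd d b).
Let n2 := cnt N (dadd d a).
Let n0 := cnt N d.
Let vec n (D : seq (nat * nat)) T : 'rV[C]_n := \row_k coef2 T (nth (0%N, 0%N) D k).
Let pol n (D : seq (nat * nat)) (x : 'rV[C]_n) : {poly {poly C}} :=
  \sum_(k < n) (x 0 k)%:P%:P * Xm _ (nth (0%N, 0%N) D k).

Let vec_pol d' (x : 'rV[C]_(cnt N d')) : vec _ (Reg N d') (pol (Reg N d') x) = x.
Proof.
apply/rowP => k; rewrite mxE coef2_sum (bigD1 k)//= coef2Cmul coef2_Xm eqxx mulr1.
rewrite big1 ?addr0// => i ik; rewrite coef2Cmul coef2_Xm nth_uniq ?Reg_uniq//.
by rewrite eq_sym (inj_eq val_inj) (negbTE ik) mulr0.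
Qed.

Let pol_vec d' T : inD d' T -> (forall w, regb d' w -> (w.1 < N)%N && (w.2 < N)%N) ->
  pol (Reg N d') (vec (cnt N d') (Reg N d') T) = T.
Proof.
move=> hT hN; apply: eq_coef2 => w; rewrite coef2_sum.
have [wD|wD] := boolP (w \in Reg N d').
  have iw : (index w (Reg N d') < cnt N d')%N by rewrite index_mem.
  rewrite (bigD1 (Ordinal iw))//= coef2Cmul coef2_Xm mxE nth_index// eqxx mulr1.
  rewrite big1 ?addr0// => i ik; rewrite coef2Cmul coef2_Xm.
  case: eqP => [e|]; rewrite ?mulr0//; move/eqP: ik; case; apply: val_inj => /=.
  by rewrite e index_uniq ?Reg_uniq.
rewrite big1 => [|i _].
  apply/esym/eqP; rewrite -[_ == _]negbK -mem_suppl; apply: contra wD => /hT h.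
  by rewrite mem_Reg h hN.
rewrite coef2Cmul coef2_Xm; case: eqP => [e|]; rewrite ?mulr0//.
by move: wD; rewrite e mem_nth.
Qed.

Let pol_inD d' (x : 'rV[C]_(cnt N d')) : inD d' (pol (Reg N d') x).
Proof.
apply: inD_sum => k _; apply: inD_Cmul; apply: inD_Xm.
have := mem_nth (0%N, 0%N) (ltn_ord k); rewrite mem_Reg => /and3P[] //.
Qed.

Let vecD n D T T' : vec n D (T + T') = vec n D T + vec n D T'.
Proof. by apply/rowP => k; rewrite !mxE coef2D. Qed.

Let vec_comb n D m (x : 'rV[C]_m) (h : 'I_m -> {poly {poly C}}) :
  vec n D (\sum_k (x 0 k)%:P%:P * h k) = x *m \matrix_k vec n D (h k).
Proof.
apply/rowP => j; rewrite !mxE coef2_sum; apply: eq_bigr => k _.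
by rewrite coef2Cmul !mxE.
Qed.

(** A relation among the rows of [Psi] involves no [g k] by [indep], and by [syz] it comes from a
    multiple e (Q, -P), where [degree_cancel] confines [e] to the region of [d]. So the kernel lies
    in the row space of [E], of rank at most [n0], and rank plus nullity is the number of rows. *)
Lemma rank_count : (K + (n1 + n2) <= n4 + n0)%N.
Proof.
pose D := Reg N D4; pose G : 'M[C]_(K, n4) := \matrix_k vec n4 D (g k).
pose M1 : 'M[C]_(n1, n4) :=
  \matrix_k vec n4 D (Xm _ (nth (0%N, 0%N) (Reg N (dadd d b)) k) * P).
pose M2 : 'M[C]_(n2, n4) :=
  \matrix_k vec n4 D (Xm _ (nth (0%N, 0%N) (Reg N (dadd d a)) k) * Q).
pose Psi := col_mx G (col_mx M1 M2).
pose E1 : 'M[C]_(n0, n1) :=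
  \matrix_k vec n1 (Reg N (dadd d b)) (Xm _ (nth (0%N, 0%N) (Reg N d) k) * Q).
pose E2 : 'M[C]_(n0, n2) :=
  \matrix_k vec n2 (Reg N (dadd d a)) (Xm _ (nth (0%N, 0%N) (Reg N d) k) * P).
pose E : 'M[C]_(n0, K + (n1 + n2)) := row_mx 0 (row_mx E1 (- E2)).
have D4E : D4 = dadd (dadd d b) a.
  by apply/funext => l; rewrite /D4 /dadd addrAC.
have kerE : (kermx Psi <= E)%MS.
  apply/row_subP => i.
  have : row i (kermx Psi) *m Psi = 0 by apply/eqP; rewrite -sub_kermx row_sub.
  move: (row i (kermx Psi)) => v; rewrite -[v]hsubmxK -[rsubmx v]hsubmxK.
  set c := lsubmx v; set x := lsubmx (rsubmx v); set y := rsubmx (rsubmx v).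
  rewrite !mul_row_col => h.
  pose u := pol (Reg N (dadd d b)) x; pose r := pol (Reg N (dadd d a)) y.
  have uD : inD (dadd d b) u by exact: pol_inD.
  have rD : inD (dadd d a) r by exact: pol_inD.
  have E0 : vec n4 D (\sum_k (c 0 k)%:P%:P * g k + (u * P + r * Q)) = 0.
    rewrite -h !vecD -vec_comb; congr (_ + (_ + _)).
      rewrite /u /pol mulr_suml -vec_comb; congr vec; apply: eq_bigr => k _.
      by rewrite -mulrA.
    rewrite /r /pol mulr_suml -vec_comb; congr vec; apply: eq_bigr => k _.
    by rewrite -mulrA.
  have T0 : \sum_k (c 0 k)%:P%:P * g k + (u * P + r * Q) = 0.
    rewrite -(@pol_vec D4 (_ + _)) ?E0//; last first.
      move=> w; rewrite mem_suppl coef2D => hw.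
      have : w \in suppl (\sum_k (c 0 k)%:P%:P * g k) \/ w \in suppl (u * P + r * Q).
        rewrite !mem_suppl; have [h1|] := eqVneq (coef2 (\sum_k (c 0 k)%:P%:P * g k) w) 0; last by left.
        by right; rewrite h1 add0r in hw.
      case=> hw1.
        by apply: (@inD_sum D4 _ _ _ _ w hw1) => k _; apply: inD_Cmul; exact: gD.
      have : w \in suppl (u * P) \/ w \in suppl (r * Q).
        move: hw1; rewrite !mem_suppl coef2D.
        by have [->|] := eqVneq (coef2 (u * P) w) 0; [rewrite add0r; right|left].
      case=> [hw2|hw2].
        by rewrite D4E; exact: (inD_mul uD Pa.1 hw2).
      exact: (inD_mul rD Qb hw2).
    rewrite /pol big1// => k _; by rewrite mxE mul0r.
  have c0 : c = 0.
    apply/rowP => k; rewrite [RHS]mxE.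
    have uN : inD (dadd d b) (- u) by move=> w; rewrite mem_suppl coef2N oppr_eq0 -mem_suppl; exact: uD.
    have rN : inD (dadd d a) (- r) by move=> w; rewrite mem_suppl coef2N oppr_eq0 -mem_suppl; exact: rD.
    apply: (@indep (fun k => c 0 k) _ _ uN rN) => //.
    by apply/eqP; rewrite -subr_eq0 -[X in _ == X]T0; apply/eqP; ring.
  have [|e [ue re]] := @sPQ u (- r).
    move: T0; rewrite c0 big1 ?add0r => [h0|k _]; last by rewrite mxE !polyC0 mul0r.
    by apply/eqP; rewrite -subr_eq0 -[X in _ == X]h0; apply/eqP; ring.
  have eD : inD d e.
    apply: (@inD_cancel d a e P Pa); rewrite -re => w.
    by rewrite mem_suppl coef2N oppr_eq0 -mem_suppl; exact: rD.
  have eV := pol_vec eD boxN0; set z := vec _ _ e in eV.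
  apply/submxP; exists z; rewrite /E mul_mx_row mulmx0 mul_mx_row c0 mulmxN; congr (row_mx _ (row_mx _ _)).
    rewrite -vec_comb -[x]vec_pol -/u ue; congr vec.
    by rewrite -eV mulr_suml; apply: eq_bigr => k _; rewrite -mulrA.
  apply: oppr_inj; rewrite opprK -vec_comb -[y]vec_pol -/r.
  have -> : r = - (e * P) by rewrite -re opprK.
  have -> : vec n2 (Reg N (dadd d a)) (- (e * P)) = - vec n2 (Reg N (dadd d a)) (e * P).
    by apply/rowP => k; rewrite !mxE coef2N.
  rewrite opprK; congr vec.
  by rewrite -eV mulr_suml; apply: eq_bigr => k _; rewrite -mulrA.
have := mxrankS kerE; rewrite mxrank_ker.
have := rank_leq_row E; have := rank_leq_col Psi; lia.
Qed.
End Count.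

Lemma rank_count_fin (I : finType) (N : nat) (d a b : int * int -> int) P Q
    (g : I -> {poly {poly C}}) (D4 := dadd (dadd d a) b) :
  (forall w, regb D4 w -> (w.1 < N)%N && (w.2 < N)%N) ->
  (forall w, regb d w -> (w.1 < N)%N && (w.2 < N)%N) ->
  exact_deg a P -> inD b Q -> syz P Q -> (forall i, inD D4 (g i)) ->
  (forall (c : I -> C) u r, inD (dadd d b) u -> inD (dadd d a) r ->
    \sum_i (c i)%:P%:P * g i = u * P + r * Q -> forall i, c i = 0) ->
  (#|I| + (cnt N (dadd d b) + cnt N (dadd d a)) <= cnt N D4 + cnt N d)%N.
Proof.
move=> hN hN0 Pa Qb sPQ gD indep.
have P0 : P != 0.
  have [l lL] : exists l, l \in LL.
    apply: contrapT => n; have rN : regb D4 (N, N) by apply/regbP => l lL; case: n; exists l.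
    by have := hN _ rN; rewrite ltnn.
  by apply/eqP => P0; have [w + _] := Pa.2 l lL; rewrite P0 mem_suppl coef20 eqxx.
apply: (@rank_count N d a b P Q #|I| (fun k => g (enum_val k))) => //.
move=> c u r ud rd e k.
rewrite -[X in c X](enum_valK k); apply: (indep (fun i => c (enum_rank i)) u r ud rd).
rewrite -e (big_enum_val (A := I)) /=; apply: eq_bigr => j _; by rewrite enum_valK.
Qed.
End Dimension.

(** * Gordan's alternative in the plane and separation by integer functionals *)

Section PlaneGordan.
Variable R : realType.
Implicit Types (s : seq (R * R)) (v p l : R * R).

Definition dotp l v : R := l.1 * v.1 + l.2 * v.2.

Definition comb s (t : R) p := exists w : nat -> R,
  [/\ (forall i, 0 <= w i), \sum_(i < size s) w i = t,
      \sum_(i < size s) w i * (nth (0, 0) s i).1 = p.1 &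
      \sum_(i < size s) w i * (nth (0, 0) s i).2 = p.2].

Lemma comb_add s t p t' p' : comb s t p -> comb s t' p' ->
  comb s (t + t') (p.1 + p'.1, p.2 + p'.2).
Proof.
move=> [w [w0 w1 wx wy]] [w' [w'0 w'1 w'x w'y]]; exists (fun i => w i + w' i).
split=> [i|||]; first by rewrite addr_ge0.
- by rewrite big_split /= w1 w'1.
- by under eq_bigr do rewrite mulrDl; rewrite big_split /= wx w'x.
- by under eq_bigr do rewrite mulrDl; rewrite big_split /= wy w'y.
Qed.

Lemma comb_scale s t p c : 0 <= c -> comb s t p -> comb s (c * t) (c * p.1, c * p.2).
Proof.
move=> c0 [w [w0 w1 wx wy]]; exists (fun i => c * w i).
split=> [i|||]; first by rewrite mulr_ge0.
- by rewrite -mulr_sumr w1.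
- by under eq_bigr do rewrite -mulrA; rewrite -mulr_sumr wx.
- by under eq_bigr do rewrite -mulrA; rewrite -mulr_sumr wy.
Qed.

Lemma comb_mem s v : v \in s -> comb s 1 v.
Proof.
move=> vs; have iv : (index v s < size s)%N by rewrite index_mem.
exists (fun i => (i == index v s)%:R); split=> [i|||]; first by rewrite ler0n.
all: rewrite (bigD1 (Ordinal iv))//= eqxx ?mul1r ?nth_index// big1 ?addr0// => i ii.
all: have /negbTE-> : (i : nat) != index v s by apply: contra_neq ii => h; apply: val_inj.
all: by rewrite ?mul0r.
Qed.

Lemma comb_cons v s t p : comb s t p -> comb (v :: s) t p.
Proof.
move=> [w [w0 w1 wx wy]]; exists (fun i => if i is j.+1 then w j else 0).
by split=> [[|i]|||] //; rewrite big_ord_recl /= ?mul0r add0r.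
Qed.

(** Induction on the list. A functional negative on [s] but not at [v] can be replaced by one near
    the normal of [v] if [s] lies strictly on one side of the line of [v]; otherwise [v] and two
    vectors of [s] have 0 in their convex hull. *)
Lemma gordan s : (exists l, forall v, v \in s -> dotp l v < 0) \/ comb s 1 (0, 0).
Proof.
elim: s => [|v s [[l hl]|h]]; [by left; exists (0,0)| |by right; exact: comb_cons].
have [lv|lv] := ltP (dotp l v) 0.
  by left; exists l => u; rewrite inE => /orP[/eqP->|/hl].
have [v0|v0] := eqVneq v (0, 0).
  by right; rewrite -v0; apply: comb_mem; rewrite mem_head.
have nv : 0 < dotp v v.
  rewrite /dotp -!expr2 lt_def addr_ge0 ?sqr_ge0// andbT paddr_eq0 ?sqr_ge0// !sqrf_eq0.
  by apply: contra v0 => /andP[/eqP a /eqP b]; case: v a b {lv} => x y /= -> ->.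
pose m u := v.1 * u.2 - v.2 * u.1.
(* The normal of [v] with the right sign is negative on [s] and 0 at [v]; subtracting a small
   multiple of [v] makes it negative at [v] too. *)
have rot (g : R) : (forall u, u \in s -> 0 < g * m u) ->
    exists l, forall u, u \in v :: s -> dotp l u < 0.
  move=> hm.
  have [e e0 he] : exists2 e : R, 0 < e & forall u, u \in s -> - (g * m u) + e * `|dotp v u| < 0.
    elim: (s) hm => [|a r IH] hm; first by exists 1.
    have [u ur|e e0 he] := IH; first by apply: hm; rewrite inE ur orbT.
    have ma := hm a (mem_head _ _).
    have [e' e'0 he'] : exists2 e' : R, 0 < e' & e' * `|dotp v a| < g * m a.
      exists (g * m a / (1 + `|dotp v a|)); first by rewrite divr_gt0 ?ltr_pwDl.
      have a1 : 0 < 1 + `|dotp v a| by rewrite ltr_pwDl.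
      by rewrite mulrAC ltr_pdivrMr// ltr_pM2l// ltrDr.
    exists (Num.min e e'); first by rewrite lt_min e0.
    move=> u; rewrite inE => /orP[/eqP->|/he hu].
      rewrite addrC subr_lt0; apply: le_lt_trans he'.
      by rewrite ler_wpM2r// ge_min lexx orbT.
    apply: le_lt_trans hu; rewrite lerD2l ler_wpM2r// ge_min lexx //.
  exists (g * v.2 - e * v.1, - (g * v.1) - e * v.2) => u.
  have -> : dotp (g * v.2 - e * v.1, - (g * v.1) - e * v.2) u = - (g * m u) - e * dotp v u.
    by rewrite /dotp /m /=; ring.
  rewrite inE => /orP[/eqP->|/he hu].
    have -> : m v = 0 by rewrite /m; ring.
    by rewrite mulr0 oppr0 sub0r oppr_lt0 mulr_gt0.
  apply: le_lt_trans hu; rewrite lerD2l -mulrN; apply: ler_wpM2l; first exact: ltW.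
  by rewrite -normrN ler_norm.
have [/allP hp|/allPn[u1 u1s h1]] := boolP (all (fun u => 0 < m u) s).
  by left; apply: (rot 1) => u us; rewrite mul1r hp.
have [/allP hp|/allPn[u2 u2s h2]] := boolP (all (fun u => m u < 0) s).
  by left; apply: (rot (-1)) => u us; rewrite mulN1r oppr_gt0 hp.
right; rewrite -leNgt in h1; rewrite -leNgt in h2.
(* This combination [p] of [u1] and [u2] lies on the line of [v]. As [l] is negative at [p] but not
   at [v], p = - c v with c >= 0, and p + c v = 0 is normalised. *)
have [a [b [a0 b0 ab mab]]] : exists a b : R, [/\ 0 <= a, 0 <= b, 0 < a + b & a * m u1 + b * m u2 = 0].
  have [e1|n1] := eqVneq (m u1) 0; first by exists 1, 0; split; rewrite ?addr0 ?e1 ?mulr0 ?mul0r ?addr0.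
  exists (m u2), (- m u1); split; rewrite ?oppr_ge0//; last by ring.
  rewrite ltr_wpDl// oppr_gt0 lt_def h1 andbT eq_sym//.
pose p := (a * u1.1 + b * u2.1, a * u1.2 + b * u2.2).
have cp : comb (v :: s) (a + b) p.
  have := comb_add (comb_scale a0 (comb_mem u1s)) (comb_scale b0 (comb_mem u2s)).
  by rewrite !mulr1 /= => /comb_cons-/(_ v).
have mp : v.1 * p.2 = v.2 * p.1.
  apply/eqP; rewrite -subr_eq0 -[X in _ == X]mab; apply/eqP; rewrite /p /m /=; ring.
have lp : dotp l p < 0.
  have -> : dotp l p = a * dotp l u1 + b * dotp l u2 by rewrite /dotp /p /=; ring.
  have := hl _ u1s; have := hl _ u2s => l2 l1.
  have [a1|a1] := eqVneq a 0.
    have bp : 0 < b by move: ab; rewrite a1 add0r.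
    by rewrite a1 mul0r add0r pmulr_rlt0.
  have ap : 0 < a by rewrite lt_def a1.
  have ha : a * dotp l u1 < 0 by rewrite pmulr_rlt0.
  have hb : b * dotp l u2 <= 0 by rewrite mulr_ge0_le0// ltW.
  by rewrite -[ltRHS]addr0; exact: ltr_leD.
pose c := - (dotp v p / dotp v v).
have pc1 : p.1 = - c * v.1.
  rewrite /c opprK mulrAC; apply/eqP; rewrite eq_sym; rewrite -(inj_eq (mulIf (lt0r_neq0 nv))).
  rewrite mulfVK ?lt0r_neq0// /dotp; apply/eqP.
  have -> : (v.1 * p.1 + v.2 * p.2) * v.1 = v.1 * p.1 * v.1 + v.2 * (v.1 * p.2) by ring.
  by rewrite mp; ring.
have pc2 : p.2 = - c * v.2.
  rewrite /c opprK mulrAC; apply/eqP; rewrite eq_sym; rewrite -(inj_eq (mulIf (lt0r_neq0 nv))).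
  rewrite mulfVK ?lt0r_neq0// /dotp; apply/eqP.
  have -> : (v.1 * p.1 + v.2 * p.2) * v.2 = v.1 * (v.2 * p.1) + v.2 * p.2 * v.2 by ring.
  by rewrite -mp; ring.
have c0 : 0 <= c.
  rewrite leNgt; apply/negP => c0; move: lp.
  have -> : dotp l p = - c * dotp l v by rewrite /dotp pc1 pc2; ring.
  by rewrite ltNge mulr_ge0// oppr_ge0 ltW.
have cv := comb_scale c0 (comb_mem (mem_head v s)).
have := comb_add cp cv; rewrite mulr1 pc1 pc2 => cc.
have abc : 0 < a + b + c by rewrite ltr_wpDr.
have := comb_scale (ltW (_ : 0 < (a + b + c)^-1)) cc; rewrite invr_gt0 abc => /(_ isT) /=.
rewrite mulVf ?lt0r_neq0//.
have -> : - c * v.1 + c * v.1 = 0 by ring.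
have -> : - c * v.2 + c * v.2 = 0 by ring.
by rewrite !mulr0.
Qed.

Definition lr (l : int * int) (y : R * R) : R := (l.1)%:~R * y.1 + (l.2)%:~R * y.2.
Definition ptR (w : nat * nat) : R * R := ((w.1)%:R, (w.2)%:R).

Lemma lr_ptR (l : int * int) (w : nat * nat) : lr l (ptR w) = (lf l w)%:~R.
Proof. by rewrite /lr /ptR /lf rmorphD !rmorphM /=. Qed.

(** Integer functionals suffice: a real functional that separates strictly is multiplied by a large
    [N] and rounded down, which changes its value at [v] by at most |v.1| + |v.2|, less than the
    gap. *)
Lemma conv_sep (s : seq (nat * nat)) (y : R * R) :
  (forall l : int * int, exists2 w, w \in s & lr l y <= lr l (ptR w)) ->
  @Defs.conv R [set w | w \in s] y.
Proof.
move=> h; pose sv := [seq ((w.1)%:R - y.1, (w.2)%:R - y.2) : R * R | w <- s].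
have [[l hl]|[w [w0 w1 wx wy]]] := gordan sv.
  have [N hN] : exists N : nat, forall v, v \in sv -> `|v.1| + `|v.2| < N%:R * - dotp l v.
    elim: sv hl => [|v r IH] hl; first by exists 0%N.
    have [u ur|N hN] := IH; first by apply: hl; rewrite inE ur orbT.
    have lv := hl v (mem_head _ _).
    pose n := Num.truncn ((`|v.1| + `|v.2|) / - dotp l v).
    exists (maxn N n.+1) => u; rewrite inE => /orP[/eqP->|ur].
      have h1 : `|v.1| + `|v.2| < n.+1%:R * - dotp l v.
        by rewrite -ltr_pdivrMr ?oppr_gt0// truncnS_gt.
      by apply: lt_le_trans h1 _; rewrite ler_pM2r ?oppr_gt0// ler_nat leq_maxr.
    apply: lt_le_trans (hN _ ur) _; rewrite ler_pM2r ?oppr_gt0 ?hl ?inE ?ur ?orbT//.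
    by rewrite ler_nat leq_maxl.
  pose l' : int * int := (Num.floor (N%:R * l.1), Num.floor (N%:R * l.2)).
  have [u us hu] := h l'.
  pose v : R * R := ((u.1)%:R - y.1, (u.2)%:R - y.2).
  have vs : v \in sv by apply/mapP; exists u.
  have := hN _ vs.
  have f1 := floor_le_tmp (N%:R * l.1).
  have : lr l' v >= 0.
    by move: hu; rewrite /lr /v /ptR /=; lra.
  have b1 : `|(l'.1)%:~R - N%:R * l.1| <= 1.
    rewrite /l' /= distrC ger0_norm ?subr_ge0 ?floor_le_tmp//.
    by have := floorD1_gt (N%:R * l.1); rewrite intrD; lra.
  have b2 : `|(l'.2)%:~R - N%:R * l.2| <= 1.
    rewrite /l' /= distrC ger0_norm ?subr_ge0 ?floor_le_tmp//.
    by have := floorD1_gt (N%:R * l.2); rewrite intrD; lra.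
  have -> : lr l' v = N%:R * dotp l v + ((l'.1)%:~R - N%:R * l.1) * v.1 + ((l'.2)%:~R - N%:R * l.2) * v.2.
    by rewrite /lr /dotp; ring.
  have c1 : ((l'.1)%:~R - N%:R * l.1) * v.1 <= `|v.1|.
    by apply: le_trans (ler_norm _) _; rewrite normrM ler_piMl.
  have c2 : ((l'.2)%:~R - N%:R * l.2) * v.2 <= `|v.2|.
    by apply: le_trans (ler_norm _) _; rewrite normrM ler_piMl.
  by rewrite mulrN; lra.
exists (size s), (fun i => nth (0%N, 0%N) s i), (fun i => w i); split => //.
- by move=> i /=; rewrite mem_nth.
- by move: w1; rewrite size_map.
- rewrite size_map in w1.
  have E (f : nat * nat -> R) (c : R) : \sum_(i < size s) w i * (f (nth (0%N, 0%N) s i) - c) = 0 ->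
      \sum_(i < size s) w i * f (nth (0%N, 0%N) s i) = c.
    under eq_bigr do rewrite mulrBr.
    by rewrite sumrB -mulr_suml w1 mul1r => /eqP; rewrite subr_eq0 => /eqP.
  have e1 : \sum_(i < size s) w i * ((nth (0%N, 0%N) s i).1)%:R = y.1.
    apply: (E (fun v : nat * nat => (v.1)%:R : R) y.1); rewrite -[RHS]wx size_map; apply: eq_bigr => i _.
    by rewrite (nth_map (0%N, 0%N)).
  have e2 : \sum_(i < size s) w i * ((nth (0%N, 0%N) s i).2)%:R = y.2.
    apply: (E (fun v : nat * nat => (v.2)%:R : R) y.2); rewrite -[RHS]wy size_map; apply: eq_bigr => i _.
    by rewrite (nth_map (0%N, 0%N)).
  by rewrite e1 e2 -surjective_pairing.
Qed.

Lemma conv_le (s : set (nat * nat)) (l : int * int) (c : R) :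
  (forall w, s w -> lr l (ptR w) <= c) -> @Defs.conv R s `<=` [set y | lr l y <= c].
Proof.
move=> h _ [n [a [w [ha w0 w1 ->]]]] /=.
have -> : lr l (\sum_i w i * ((a i).1)%:R, \sum_i w i * ((a i).2)%:R) =
  \sum_i w i * lr l (ptR (a i)).
  rewrite /lr /= !mulr_sumr -big_split /=; apply: eq_bigr => i _; rewrite /ptR /=; ring.
rewrite -[c]mul1r -w1 mulr_suml; apply: ler_sum => i _.
by rewrite ler_wpM2l// h.
Qed.
End PlaneGordan.

(** * Areas of lattice polygons as limits of lattice point counts *)

Section LatticeVolume.
Variable R : realType.
Local Notation mu := (@vol2 R).
Implicit Types (s sA sB : seq (nat * nat)) (X Y : set (R * R)).

Lemma vol2_ge0 X : (0 <= mu X)%E.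
Proof. exact: measure_ge0. Qed.

Lemma vol2_le X Y : measurable X -> measurable Y -> X `<=` Y -> (mu X <= mu Y)%E.
Proof. by move=> mX mY XY; apply: le_measure; rewrite ?inE. Qed.

Lemma lr_measurable (l : int * int) (c : R) : measurable [set y : R * R | lr l y <= c].
Proof.
have h : measurable_fun setT (fun y : R * R => lr l y).
  apply: measurable_funD; apply: measurable_funM; try exact: measurable_cst.
    exact: measurable_fst.
  exact: measurable_snd.
have := h measurableT _ (measurable_itv (Interval -oo%O (BRight c))).
rewrite setTI; congr measurable; exact/seteqP.
Qed.

Lemma halfplanes_measurable (LL : seq (int * int)) (c : int * int -> R) :
  measurable [set y : R * R | forall l, l \in LL -> lr l y <= c l].
Proof.
elim: LL => [|l LL IH].
  rewrite (_ : mkset _ = setT); first exact: measurableT.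
  by apply/seteqP; split.
rewrite (_ : mkset _ = [set y | lr l y <= c l] `&` [set y | forall l, l \in LL -> lr l y <= c l]).
  by apply: measurableI => //; exact: lr_measurable.
apply/seteqP; split => [y /= h|y /= [h1 h2] l']; last by rewrite inE => /orP[/eqP->//|/h2].
split; first by apply: h; rewrite mem_head.
by move=> l' l'L; apply: h; rewrite inE l'L orbT.
Qed.

Definition LLm (m : nat) : seq (int * int) :=
  [seq (i%:Z - m%:Z, j%:Z - m%:Z) | i <- iota 0 (2 * m).+1, j <- iota 0 (2 * m).+1].

Lemma mem_LLm m (l : int * int) : (l \in LLm m) = (`|l.1|%N <= m)%N && (`|l.2|%N <= m)%N.
Proof.
apply/allpairsP/idP => [[[i j] []]|/andP[h1 h2]].
  by rewrite !mem_iota => /andP[_ h1] /andP[_ h2] ->; apply/andP; split; move: h1 h2 => /=; lia.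
exists (`|(l.1 + m%:Z)%R|%N, `|(l.2 + m%:Z)%R|%N); rewrite !mem_iota; split.
- by apply/andP => /=; split; lia.
- by apply/andP => /=; split; lia.
by case: l h1 h2 => x y /= h1 h2; congr (_, _); lia.
Qed.

Definition l1n (l : int * int) : nat := (`|l.1|%N + `|l.2|%N)%N.

Definition supfun s (h : int * int -> int) :=
  forall l, (forall w, w \in s -> lf l w <= h l) /\ exists2 w, w \in s & lf l w = h l.

Lemma conv_halfplanes s h : supfun s h ->
  @Defs.conv R [set w | w \in s] = [set y | forall l, lr l y <= (h l)%:~R].
Proof.
move=> hs; apply/seteqP; split => [y cy l|y hy].
  apply: (@conv_le R [set w | w \in s] l) cy => w ws.
  by rewrite lr_ptR ler_int; apply: (hs l).1.
apply: conv_sep => l; have [_ [w ws wl]] := hs l; exists w => //.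
by rewrite lr_ptR wl; exact: hy.
Qed.

Lemma lrD l (y z : R * R) : lr l (y.1 + z.1, y.2 + z.2) = lr l y + lr l z.
Proof. by rewrite /lr /=; ring. Qed.

Lemma msum_halfplanes sA sB hA hB : supfun sA hA -> supfun sB hB ->
  Defs.msum (@Defs.conv R [set w | w \in sA]) (@Defs.conv R [set w | w \in sB]) =
  [set y | forall l, lr l y <= (hA l + hB l)%:~R].
Proof.
move=> sA_ sB_; apply/seteqP; split => [y [a [b [ha hb ->]]] l|y hy].
  rewrite lrD rmorphD /= lerD//.
    by move: ha; rewrite (conv_halfplanes sA_); apply.
  by move: hb; rewrite (conv_halfplanes sB_); apply.
pose sAB := [seq wadd a b | a <- sA, b <- sB].
have : @Defs.conv R [set w | w \in sAB] y.
  apply: conv_sep => l; have [_ [a aA al]] := sA_ l; have [_ [b bB bl]] := sB_ l.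
  exists (wadd a b); first by apply/allpairsP; exists (a, b).
  by rewrite lr_ptR lfD al bl; exact: hy.
move=> [n [f [w [fAB w0 w1 ->]]]].
have /choice[g hg] : forall i, exists p : (nat * nat) * (nat * nat),
    [/\ p.1 \in sA, p.2 \in sB & f i = wadd p.1 p.2].
  by move=> i; have /allpairsP[p [? ? ?]] := fAB i; exists p.
exists (\sum_i w i * ((g i).1.1)%:R, \sum_i w i * ((g i).1.2)%:R),
  (\sum_i w i * ((g i).2.1)%:R, \sum_i w i * ((g i).2.2)%:R); split.
- by exists n, (fun i => (g i).1), w; split => // i; have [] := hg i.
- by exists n, (fun i => (g i).2), w; split => // i; have [] := hg i.
- congr (_, _); rewrite /= -big_split /=; apply: eq_bigr => i _; have [_ _ ->] := hg i.
    by rewrite /wadd /= natrD mulrDr.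
  by rewrite /wadd /= natrD mulrDr.
Qed.

(** A countable intersection of finite families gives measurability of the hulls. *)
Lemma all_halfplanesE (c : int * int -> R) :
  [set y : R * R | forall l, lr l y <= c l] =
  \bigcap_m [set y | forall l, l \in LLm m -> lr l y <= c l].
Proof.
apply/seteqP; split => [y hy m _ l _|y hy l]; first exact: hy.
apply: (hy (maxn `|l.1|%N `|l.2|%N)) => //.
by rewrite mem_LLm leq_maxl leq_maxr.
Qed.

Lemma conv_measurable s h : supfun s h -> measurable (@Defs.conv R [set w | w \in s]).
Proof.
move=> /conv_halfplanes->; rewrite all_halfplanesE.
by apply: bigcapT_measurable => m; exact: halfplanes_measurable.
Qed.

(* the square of side 1/n indexed by w, after translating by (M, M) *)
Definition square (n M : nat) (w : nat * nat) : set (R * R) :=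
  [set y | (w.1)%:R - M%:R <= n%:R * y.1 < (w.1)%:R - M%:R + 1 /\
           (w.2)%:R - M%:R <= n%:R * y.2 < (w.2)%:R - M%:R + 1].

Lemma squareE n M w : (0 < n)%N -> square n M w =
  `[((w.1)%:R - M%:R) / n%:R, ((w.1)%:R - M%:R + 1) / n%:R[ `*`
  `[((w.2)%:R - M%:R) / n%:R, ((w.2)%:R - M%:R + 1) / n%:R[.
Proof.
move=> n0; have n0' : 0 < n%:R :> R by rewrite ltr0n.
apply/seteqP; split => y [] /=; rewrite /= !in_itv /= !ler_pdivrMr// !ltr_pdivlMr//.
  by move=> h1 h2; split; rewrite [_ * n%:R]mulrC.
by rewrite ![_ * n%:R]mulrC.
Qed.

Lemma square_measurable n M w : (0 < n)%N -> measurable (square n M w).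
Proof.
by move=> n0; rewrite squareE//; apply: measurableX; exact: (@measurable_itv R (Interval _ _)).
Qed.

Lemma vol_square n M w : (0 < n)%N -> mu (square n M w) = ((n%:R ^- 2)%:E)%E.
Proof.
move=> n0; have n0' : 0 < n%:R :> R by rewrite ltr0n.
have side (k : R) : @lebesgue_measure R `[k / n%:R, (k + 1) / n%:R[ = ((n%:R^-1)%:E)%E.
  rewrite (@lebesgue_measure_itv R (Interval _ _)) /= lte_fin ltr_pM2r ?invr_gt0// ltrDl ltr01.
  by rewrite -EFinD; congr EFin; rewrite -mulrBl addrAC subrr add0r mul1r.
rewrite squareE// /vol2 product_measure1E; try exact: (@measurable_itv R (Interval _ _)).
transitivity ((n%:R^-1)%:E * (n%:R^-1)%:E : \bar R)%E; first by congr (_ * _)%E; exact: side.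
by rewrite -EFinM; congr EFin; rewrite -exprVn expr2.
Qed.

Lemma square_disjoint n M w v : (0 < n)%N -> w != v -> square n M w `&` square n M v = set0.
Proof.
move=> n0 wv.
have eqn (a b : nat) (t : R) : a%:R - M%:R <= t < a%:R - M%:R + 1 ->
    b%:R - M%:R <= t < b%:R - M%:R + 1 -> a = b.
  move=> /andP[a1 a2] /andP[b1 b2].
  have h1 : (a%:R < b.+1%:R :> R) by rewrite -[b.+1]addn1 natrD; lra.
  have h2 : (b%:R < a.+1%:R :> R) by rewrite -[a.+1]addn1 natrD; lra.
  by move: h1 h2; rewrite !ltr_nat !ltnS => h1 h2; apply/eqP; rewrite eqn_leq h1.
apply/seteqP; split => // y [[w1 w2] [v1 v2]]; move/eqP: wv; apply.
by case: w v w1 w2 v1 v2 => a b [c d] /= a1 b1 c1 d1; rewrite (eqn _ _ _ a1 c1) (eqn _ _ _ b1 d1).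
Qed.

Lemma vol_squares n M (s : seq (nat * nat)) : (0 < n)%N -> uniq s ->
  measurable [set y | exists2 w, w \in s & square n M w y] /\
  mu [set y | exists2 w, w \in s & square n M w y] = (((size s)%:R / n%:R ^+ 2)%:E)%E.
Proof.
move=> n0; elim: s => [_|w s IH /= /andP[ws us]].
  rewrite (_ : mkset _ = set0).
    by split; [exact: measurable0|rewrite /vol2 measure0 mul0r].
  by apply/seteqP; split => // y [].
have [mS vS] := IH us.
have E : [set y | exists2 w0, w0 \in w :: s & square n M w0 y] =
    square n M w `|` [set y | exists2 w0, w0 \in s & square n M w0 y].
  apply/seteqP; split => [y [v]|y [h|[v vs h]]].
  - by rewrite inE => /orP[/eqP->|vs] h; [left|right; exists v].
  - by exists w; rewrite ?mem_head.
  - by exists v; rewrite // inE vs orbT.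
rewrite E; have mq := square_measurable M w n0; split; first exact: measurableU.
rewrite /vol2 measureU//; last first.
  apply/seteqP; split => // y [h [v vs h2]].
  have wv : w != v by apply: contraNneq ws => ->.
  by have := square_disjoint M n0 wv => /seteqP[/(_ y) + _]; apply; split.
rewrite [X in (_ + X)%E](vS) [X in (X + _)%E](vol_square M w n0) -EFinD; congr EFin.
by rewrite -natr1 mulrDl mul1r addrC.
Qed.

(** Together with [dscale n h] this is the n-th dilate of a polygon, translated by (M, M) and
    thickened by [Cst] in the l1 norm. The translation provides exponents with positive coordinates,
    the thickening a margin around them. *)
Definition dshift (M Cst : nat) (l : int * int) : int := lf l (M, M) + (Cst * l1n l)%:Z.
Definition dscale (n : nat) (h : int * int -> int) (l : int * int) : int := n%:Z * h l.

(** A point [y] of the hull lies in the square indexed by the integer part of n y, translated by (M,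
    M); in direction [l] the rounding costs at most the l1 norm of [l], which the thickening by
    [Cst >= 1] covers. *)
Lemma conv_lower s h LL M Cst n N : supfun s h -> (0 < n)%N -> (0 < Cst)%N ->
  (forall w, regb LL (dadd (dshift M Cst) (dscale n h)) w -> (w.1 < N)%N && (w.2 < N)%N) ->
  (mu (@Defs.conv R [set w | w \in s]) <=
   ((cnt LL N (dadd (dshift M Cst) (dscale n h)))%:R / n%:R ^+ 2)%:E)%E.
Proof.
move=> hs n0 C0 hN; have n0' : 0 < n%:R :> R by rewrite ltr0n.
have [mS <-] := vol_squares M n0 (Reg_uniq LL N (dadd (dshift M Cst) (dscale n h))).
apply: vol2_le => //; first exact: conv_measurable hs.
move=> y; rewrite (conv_halfplanes hs) => /= hy.
have y1 : 0 <= y.1.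
  have := hy (-1, 0); have [_ [w _ <-]] := hs (-1, 0).
  rewrite /lr /lf /= mul0r addr0 mulN1r mul0r addr0 mulN1r.
  by rewrite mulrNz lerN2; apply: le_trans.
have y2 : 0 <= y.2.
  have := hy (0, -1); have [_ [w _ <-]] := hs (0, -1).
  rewrite /lr /lf /= mul0r add0r mulN1r mul0r add0r mulN1r.
  by rewrite mulrNz lerN2; apply: le_trans.
pose w : nat * nat := ((Num.truncn (n%:R * y.1) + M)%N, (Num.truncn (n%:R * y.2) + M)%N).
have t1 : (w.1)%:R - M%:R <= n%:R * y.1 < (w.1)%:R - M%:R + 1.
  by rewrite /w /= natrD addrK [_ + 1]natr1 truncn_itv// mulr_ge0// ltW.
have t2 : (w.2)%:R - M%:R <= n%:R * y.2 < (w.2)%:R - M%:R + 1.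
  by rewrite /w /= natrD addrK [_ + 1]natr1 truncn_itv// mulr_ge0// ltW.
exists w; last by split.
have wr : regb LL (dadd (dshift M Cst) (dscale n h)) w.
  apply/regbP => l _; rewrite /dadd /dshift /dscale -(ler_int R).
  have := hy l; rewrite -(ler_pM2l n0') => hl.
  have b (k : int) (t : R) : 0 <= t <= 1 -> - (k%:~R * t) <= `|k|%N%:R :> R.
    move=> /andP[t0 t1']; apply: le_trans (ler_norm _) _.
    by rewrite normrN normrM (ger0_norm t0) -intr_norm natr_absz ler_piMr// ler0z.
  have := b l.1 (n%:R * y.1 - ((w.1)%:R - M%:R)); have := b l.2 (n%:R * y.2 - ((w.2)%:R - M%:R)).
  move: t1 t2 => /andP[a1 a2] /andP[a3 a4].
  have -> : 0 <= n%:R * y.1 - ((w.1)%:R - M%:R) <= 1 by apply/andP; split; lra.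
  have -> : 0 <= n%:R * y.2 - ((w.2)%:R - M%:R) <= 1 by apply/andP; split; lra.
  move=> /(_ isT) b2 /(_ isT) b1.
  have cc : ((`|l.1|%N%:R + `|l.2|%N%:R : R) <= (Cst * l1n l)%:R).
    by rewrite -natrD ler_nat /l1n leq_pmull.
  rewrite /lf /= !rmorphD !rmorphM /= -!pmulrn.
  move: hl b1 b2 cc; rewrite /lr /=.
  set X1 := (w.1)%:R; set X2 := (w.2)%:R; set L1 := (l.1)%:~R; set L2 := (l.2)%:~R.
  rewrite !mulrBr !mulrDr; move=> hl b1 b2 cc.
  have := hl; have := b1; have := b2; nra.
by rewrite mem_Reg wr hN.
Qed.

Definition outer (m : nat) (h : int * int -> int) : set (R * R) :=
  [set y | forall l, l \in LLm m -> lr l y <= (h l)%:~R + (m.+1%:R)^-1].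

(** In the directions of [LLm m] thickening and rounding cost together at most (Cst + 1) 2m, that
    is, at most n / (m + 1); so the squares stay in the outer polygon. *)
Lemma conv_upper h m M Cst n N : (0 < n)%N -> (Cst.+1 * (2 * m) * m.+1 <= n)%N ->
  (((cnt (LLm m) N (dadd (dshift M Cst) (dscale n h)))%:R / n%:R ^+ 2)%:E <= mu (outer m h))%E.
Proof.
move=> n0 hn; have n0' : 0 < n%:R :> R by rewrite ltr0n.
have [mS <-] := vol_squares M n0 (Reg_uniq (LLm m) N (dadd (dshift M Cst) (dscale n h))).
apply: vol2_le => //; first exact: halfplanes_measurable.
move=> y [w]; rewrite mem_Reg => /and3P[/regbP wr _ _] [/andP[a1 a2] /andP[a3 a4]] l lm.
have := wr l lm; rewrite /dadd /dshift /dscale -(ler_int R).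
rewrite mem_LLm in lm.
have lm' : (l1n l <= 2 * m)%N by rewrite /l1n mul2n -addnn; move: lm => /andP[? ?]; exact: leq_add.
have b (k : int) (t : R) : 0 <= t <= 1 -> k%:~R * t <= `|k|%N%:R :> R.
  move=> /andP[t0 t1']; apply: le_trans (ler_norm _) _.
  by rewrite normrM (ger0_norm t0) -intr_norm natr_absz ler_piMr// ler0z.
have := b l.1 (n%:R * y.1 - ((w.1)%:R - M%:R)); have := b l.2 (n%:R * y.2 - ((w.2)%:R - M%:R)).
have -> : 0 <= n%:R * y.1 - ((w.1)%:R - M%:R) <= 1 by apply/andP; split; lra.
have -> : 0 <= n%:R * y.2 - ((w.2)%:R - M%:R) <= 1 by apply/andP; split; lra.
move=> /(_ isT) b2 /(_ isT) b1 hw.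
rewrite -(ler_pM2l n0') mulrDr; move: hw.
rewrite /lf /= !rmorphD !rmorphM /= -!pmulrn.
have key : (Cst * l1n l)%:R + (`|l.1|%N%:R + `|l.2|%N%:R) <= n%:R / m.+1%:R :> R.
  rewrite -!natrD ler_pdivlMr ?ltr0n// -natrM ler_nat; apply: leq_trans hn.
  rewrite leq_mul2r; apply/orP; right; rewrite mulSn addnC.
  by rewrite leq_add// leq_mul2l lm' orbT.
move: b1 b2 key; rewrite natrM /lr /=.
set X1 := (w.1)%:R; set X2 := (w.2)%:R; set L1 := (l.1)%:~R; set L2 := (l.2)%:~R.
move: (m.+1%:R^-1) (n%:R : R) => im nn b1 b2 key hl; lra.
Qed.

Lemma outer_measurable m h : measurable (outer m h).
Proof. exact: halfplanes_measurable. Qed.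

(** The outer polygons decrease to the hull and the first one lies in a rectangle, so the areas
    converge by continuity from above. *)
Lemma outer_cvg h (a : R) (e : R) : mu [set y | forall l, lr l y <= (h l)%:~R] = a%:E%E -> 0 < e ->
  exists2 m, (0 < m)%N & (mu (outer m h) <= (a + e)%:E)%E.
Proof.
move=> ha e0; pose F k := outer k.+1 h.
have Fm k : measurable (F k) by exact: outer_measurable.
have capE : [set y | forall l, lr l y <= (h l)%:~R] = \bigcap_k F k.
  apply/seteqP; split => [y hy k _ l _|y hy l].
    by apply: le_trans (hy l) _; rewrite lerDl invr_ge0 ler0n.
  rewrite leNgt; apply/negP => lt.
  have [k hk] := @natSinv_small R ((lr l y - (h l)%:~R) / 2) ltac:(by rewrite divr_gt0// subr_gt0).
  pose k' := maxn k (maxn `|l.1|%N `|l.2|%N).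
  have := hy k' I l; rewrite mem_LLm /k' !leqW ?leq_max ?leqnn ?orbT// => /(_ isT).
  have : (k'.+2%:R)^-1 <= (k.+1%:R)^-1 :> R.
    by rewrite lef_pV2 ?posrE ?ltr0n// ler_nat ltnS leqW// leq_maxl.
  rewrite -/k'; move: hk lt; move: (lr l y) ((h l)%:~R : R) (k'.+2%:R^-1 : R) (k.+1%:R^-1 : R).
  by clear; move=> p q r t; lra.
have Fd : {homo F : n p / (n <= p)%N >-> (p <= n)%O}.
  move=> i j ij; apply/subsetPset => y hy l.
  rewrite mem_LLm => /andP[l1 l2]; apply: le_trans (hy l _) _.
    by rewrite mem_LLm (leq_trans l1)// (leq_trans l2).
  by rewrite lerD2l lef_pV2 ?posrE ?ltr0n// ler_nat ltnS.
have F0 : (mu (F 0%N) < +oo)%E.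
  pose b := `[ - (h (-1, 0))%:~R - 1, (h (1, 0))%:~R + 1] `*`
            `[ - (h (0, -1))%:~R - 1, (h (0, 1))%:~R + 1] : set (R * R).
  have bm : measurable b by apply: measurableX; exact: (@measurable_itv R (Interval _ _)).
  apply: le_lt_trans (_ : mu b < +oo)%E.
    apply: (vol2_le (Fm 0%N) bm).
    move=> y hy; have half : (2%:R : R)^-1 <= 1 by rewrite invf_le1 ?ler1n ?ltr0n.
    have h1 := hy (1, 0) isT; have h2 := hy (-1, 0) isT.
    have h3 := hy (0, 1) isT; have h4 := hy (0, -1) isT.
    move: h1 h2 h3 h4; rewrite /lr /= !mul1r !mul0r !addr0 !add0r !mulN1r.
    by split; rewrite /= in_itv /=; apply/andP; split; lra.
  rewrite /b /vol2 product_measure1E; try exact: (@measurable_itv R (Interval _ _)).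
  have fin (x y : R) : (@lebesgue_measure R `[x, y] \is a fin_num)%E.
    by rewrite (@lebesgue_measure_itv R (Interval _ _)) /=; case: ifP.
  have := fin (- (h (-1, 0))%:~R - 1) ((h (1, 0))%:~R + 1).
  have := fin (- (h (0, -1))%:~R - 1) ((h (0, 1))%:~R + 1).
  by move=> f1 f2; have := fin_numM f2 f1; rewrite fin_numElt => /andP[].
have cv := nonincreasing_cvg_mu F0 Fm (bigcapT_measurable Fm) Fd.
rewrite -capE [X in _ --> X]ha in cv.
have /fine_cvgP[_ /cvgr_lt] := cv => /(_ (a + e)); rewrite ltrDl => /(_ e0)[k _ /(_ k (leqnn k)) /= hk].
exists k.+1 => //; have Fk : (mu (F k) < +oo)%E.
  by apply: le_lt_trans F0; apply: vol2_le; rewrite ?Fm//; apply/subsetPset; exact: Fd.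
have fk : (mu (F k) \is a fin_num)%E by move: (vol2_ge0 (F k)) Fk; case: (mu (F k)).
by rewrite -[mu _](fineK fk) lee_fin ltW.
Qed.

Lemma ereal_sub2 (a b c : \bar R) (V : R) : (0 <= a)%E -> (0 <= b)%E -> (0 <= c)%E ->
  (a - b - c = V%:E)%E ->
  exists a' b' c' : R, [/\ a = a'%:E%E, b = b'%:E%E, c = c'%:E%E & a' = V + b' + c'].
Proof.
case: a b c => [a||] [b||] [c||] //= _ _ _ [<-]; exists a, b, c; split => //; ring.
Qed.

(** Divided by n^2 the counts become areas, and the hypothesis says that [K] plus the areas of both
    hulls is at most the area of their sum. The three areas are finite because they are nonnegative
    and their combination is [V]. *)
Lemma mixed_volume_lower sA sB hA hB (V K : nat) : supfun sA hA -> supfun sB hB ->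
  @mixed_volume R [set w | w \in sA] [set w | w \in sB] = (V%:R%:E)%E ->
  (forall m, (0 < m)%N -> exists M Cst, (0 < Cst)%N /\ forall n, exists N,
    [/\ forall w, regb (LLm m) (dadd (dshift M Cst) (dscale n hA)) w -> (w.1 < N)%N && (w.2 < N)%N,
        forall w, regb (LLm m) (dadd (dshift M Cst) (dscale n hB)) w -> (w.1 < N)%N && (w.2 < N)%N &
        (K * n ^ 2 + cnt (LLm m) N (dadd (dshift M Cst) (dscale n hA)) +
           cnt (LLm m) N (dadd (dshift M Cst) (dscale n hB)) <=
         cnt (LLm m) N (dadd (dshift M Cst) (dscale n (fun l => (hA l + hB l)%R))) +
           cnt (LLm m) N (dshift M Cst))%N]) ->
  (K <= V)%N.
Proof.
move=> hsA hsB; rewrite /mixed_volume.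
have mA := conv_measurable hsA; have mB := conv_measurable hsB.
have gA := vol2_ge0 (@Defs.conv R [set w | w \in sA]).
have gB := vol2_ge0 (@Defs.conv R [set w | w \in sB]).
have gM := vol2_ge0 (Defs.msum (@Defs.conv R [set w | w \in sA]) (@Defs.conv R [set w | w \in sB])).
have lowA := @conv_lower sA hA; have lowB := @conv_lower sB hB.
have outM := @outer_cvg (fun l => hA l + hB l); rewrite -(msum_halfplanes hsA hsB) in outM.
move=> /(ereal_sub2 gM gA gB)[a [b [c [aE bE cE abc]]]] hK.
rewrite bE in lowA; rewrite cE in lowB; have {}outM := outM a _ aE.
(* One error of 1/3 from the outer polygon and another from the constant [D] over n^2 leave K < V +
   1, enough for integers. *)
have [m m0 om] := outM (1/3) ltac:(by rewrite divr_gt0).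
have [M [Cst [C0 hn]]] := hK m m0.
(* [D] bounds the number of exponents in the fixed region [dshift M Cst]. In [n], the first summand
   is what [conv_upper] asks for and the second makes 3 D at most n^2. *)
pose D := ((M + Cst).+1 ^ 2)%N.
pose n := (Cst.+1 * (2 * m) * m.+1 + 3 * D + 1)%N.
have n0 : (0 < n)%N by rewrite /n addn1.
have n0' : 0 < n%:R :> R by rewrite ltr0n.
have [N [NA NB hN]] := hn n.
have lA := lowA _ M Cst n N hsA n0 C0 NA; have lB := lowB _ M Cst n N hsB n0 C0 NB.
have up := @conv_upper (fun l => hA l + hB l) m M Cst n N n0 _.
rewrite {1}/n in up.
have {}up := le_trans (up ltac:(by rewrite -addnA leq_addr)) om.
rewrite !lee_fin in lA lB up.
have cD : (cnt (LLm m) N (dshift M Cst) <= D)%N.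
  have -> : D = size (box (M + Cst).+1) by rewrite /box size_allpairs !size_iota /D expnS expn1.
  apply: uniq_leq_size; first exact: Reg_uniq.
  move=> w; rewrite mem_Reg mem_box => /and3P[/regbP wr _ _].
  have := wr (1, 0); have := wr (0, 1); rewrite !mem_LLm /= m0 => /(_ isT) w2 /(_ isT) w1.
  by move: w1 w2; rewrite /dshift /lf /l1n /=; lia.
have n2 : 0 < n%:R ^+ 2 :> R by rewrite exprn_gt0.
rewrite !ler_pdivlMr// in lA lB; rewrite ler_pdivrMr// in up.
have Dn : D%:R * 3 <= n%:R ^+ 2 :> R.
  rewrite -natrM -natrX ler_nat; apply: leq_trans (_ : n <= _)%N; first by rewrite /n; lia.
  by rewrite expnS expn1 leq_pmulr.
have {}hN : (K%:R * n%:R ^+ 2 + b * n%:R ^+ 2 + c * n%:R ^+ 2 <= (a + 1/3) * n%:R ^+ 2 + D%:R :> R).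
  apply: le_trans (lerD (lerD (lexx _) lA) lB) _; apply: le_trans (lerD up (lexx _)).
  by rewrite -natrX -natrM -!natrD ler_nat; apply: leq_trans hN _; rewrite leq_add2l.
have : (K%:R < V%:R + 1 :> R).
  rewrite -(ltr_pM2r n2); rewrite abc in hN; set T := n%:R ^+ 2 in hN n2 Dn *.
  have : K%:R * T <= (V%:R + 1/3) * T + D%:R by nra.
  nra.
by rewrite natr1 ltr_nat ltnS.
Qed.
End LatticeVolume.

(** * Multiplicities and nondegeneracy at infinity *)

Section LocalIdeals.
Variable R : realType.
Local Notation C := (R[i]).
Implicit Types (P Q h t g : {poly {poly C}}) (z : C * C).

Lemma loc_add P Q z h h' : in_loc_ideal P Q z h -> in_loc_ideal P Q z h' ->
  in_loc_ideal P Q z (h + h').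
Proof.
move=> [s [a [b [s0 e]]]] [s' [a' [b' [s'0 e']]]].
exists (s * s'), (a * s' + a' * s), (b * s' + b' * s); split.
  by rewrite pevalM mulf_neq0.
transitivity (s * h * s' + s' * h' * s); first by ring.
by rewrite e e'; ring.
Qed.

Lemma loc_mull P Q z h g : in_loc_ideal P Q z h -> in_loc_ideal P Q z (g * h).
Proof.
move=> [s [a [b [s0 e]]]]; exists s, (g * a), (g * b); split => //.
transitivity (g * (s * h)); first by ring.
by rewrite e; ring.
Qed.

Lemma loc_unit P Q z h t : peval t z != 0 -> in_loc_ideal P Q z (t * h) -> in_loc_ideal P Q z h.
Proof.
move=> t0 [s [a [b [s0 e]]]]; exists (s * t), a, b; split.
  by rewrite pevalM mulf_neq0.
by rewrite -e mulrA.
Qed.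

Lemma loc_comb P Q z u v : in_loc_ideal P Q z (u * P + v * Q).
Proof. by exists 1, u, v; rewrite mul1r peval1 oner_neq0. Qed.

Lemma loc_sum P Q z (I : Type) (r : seq I) (p : pred I) (f : I -> {poly {poly C}}) :
  (forall i, p i -> in_loc_ideal P Q z (f i)) -> in_loc_ideal P Q z (\sum_(i <- r | p i) f i).
Proof.
move=> hf; apply: (big_ind (in_loc_ideal P Q z)) => //.
  by have := loc_comb P Q z 0 0; rewrite !mul0r addr0.
exact: loc_add.
Qed.

(* used in a finite-dimensional local algebra: the powers 1, t, ..., t^m of a nonunit are dependent,
   and the lowest term of a relation is t^j times a unit *)
Lemma poly_lowest (F : fieldType) (p : {poly F}) : p != 0 ->
  exists j q, [/\ q.[0] != 0, p = q * 'X^j & (j < size p)%N].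
Proof.
have [n] := ubnP (size p); elim: n p => // n IH p sp p0.
have [p00|p00] := eqVneq p.[0] 0; last first.
  by exists 0%N, p; rewrite expr0 mulr1 size_poly_gt0.
have /factor_theorem[q qE] : root p 0 by apply/rootP.
rewrite subr0 in qE.
have q0 : q != 0 by apply: contra_neq p0 => h; rewrite qE h mul0r.
have sq : size p = (size q).+1 by rewrite qE size_mulX.
have [|j [q' [q'0 q'E js]]] := IH q _ q0; first by move: sp; rewrite sq.
exists j.+1, q'; split => //; last by rewrite sq.
by rewrite {1}qE q'E exprSr mulrA.
Qed.

Lemma loc_pow P Q z m t : int_mult P Q z m -> peval t z = 0 -> in_loc_ideal P Q z (t ^+ m).
Proof.
move=> [_ nq] tz; have : ~ loc_indep P Q z (fun i : 'I_m.+1 => t ^+ i).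
  by move=> h; apply: nq; exists (fun i => t ^+ i).
move=> /existsNP[c /not_implyP[hc /existsNP[i0 /eqP ci0]]].
pose p : {poly C} := \poly_(i < m.+1) c (inord i).
have sp : (size p <= m.+1)%N by exact: size_poly.
have pE : \sum_i (c i)%:P%:P * t ^+ i = (map_poly (polyC \o polyC) p).[t].
  rewrite (@horner_coef_wide _ m.+1); last exact: leq_trans (size_poly _ _) sp.
  apply: eq_bigr => i _; rewrite coef_map coef_poly ltn_ord /=.
  by rewrite inord_val.
have p0 : p != 0.
  apply: contraNneq ci0 => h; have := congr1 (fun q : {poly C} => q`_i0) h.
  by rewrite coef_poly ltn_ord inord_val coef0 => ->.
have [j [q [q0 pq js]]] := poly_lowest p0.
have jm : (j <= m)%N by rewrite -ltnS; exact: leq_trans js sp.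
move: hc; rewrite pE pq rmorphM /= map_polyXn hornerM hornerXn => /loc_unit h.
have -> : t ^+ m = t ^+ (m - j) * t ^+ j by rewrite -exprD subnK.
apply: loc_mull; apply: h.
suff -> : peval (map_poly (polyC \o polyC) q).[t] z = q.[0] by [].
rewrite horner_coef size_map_poly_id0; last by rewrite /= !polyC_eq0 lead_coef_eq0; apply: contraNneq q0 => ->; rewrite horner0.
rewrite peval_sum horner_coef; apply: eq_bigr => i _.
by rewrite coef_map pevalM pevalC pevalX tz.
Qed.
End LocalIdeals.

Section Comparison.
Variable R : realType.
Local Notation C := (R[i]).

(* logarithmic size of a point of the torus; it is unbounded exactly when the point leaves compacts *)
Definition lsize (z : C * C) : R := `|ln (nC z.1)| + `|ln (nC z.2)|.
Definition leaves (F : set_system (C * C)) := forall B : R, F (fun z => B <= lsize z).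

Variable F : set_system (C * C).
Context {FU : UltraFilter F}.
Hypothesis Ft : F (fun z => torus z).

Definition comparable_mon (w v : nat * nat) :=
  lO F (fun z => nC (mon w z)) (fun z => nC (mon v z)).

Lemma ln_mon w (z : C * C) : torus z -> ln (nC (mon w z)) = (w.1)%:R * ln (nC z.1) + (w.2)%:R * ln (nC z.2).
Proof.
move=> [z1 z2]; rewrite /mon nCM !nCX lnM ?posrE ?exprn_gt0 ?nC_gt0//.
by rewrite !lnXn ?nC_gt0// !mulr_natl.
Qed.

Lemma lO_ln w v : comparable_mon w v ->
  exists K : R, F (fun z => ln (nC (mon w z)) - ln (nC (mon v z)) <= K).
Proof.
move=> [K K0 h]; exists (ln K); apply: filterS2 h Ft => z h tz.
have := ler_ln (x := nC (mon w z)) (y := K * nC (mon v z)).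
rewrite !posrE nC_mon_gt0// mulr_gt0 ?nC_mon_gt0// => /(_ isT isT).
by rewrite h lnM ?posrE ?nC_mon_gt0// => ?; lra.
Qed.

(** Comparable monomials have a bounded logarithmic quotient, a linear form in (ln |z1|, ln |z2|).
    Two such forms that are not proportional would bound both logarithms by Cramer's rule. *)
Lemma nonparallel_bounded w1 w2 v1 v2 : leaves F ->
  comparable_mon w1 w2 -> comparable_mon w2 w1 -> comparable_mon v1 v2 -> comparable_mon v2 v1 ->
  ((w1.1)%:Z - (w2.1)%:Z) * ((v1.2)%:Z - (v2.2)%:Z) = ((w1.2)%:Z - (w2.2)%:Z) * ((v1.1)%:Z - (v2.1)%:Z).
Proof.
move=> Fl /lO_ln[K1 h1] /lO_ln[K2 h2] /lO_ln[K3 h3] /lO_ln[K4 h4].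
apply: contrapT => /eqP; rewrite -subr_eq0 => ne.
pose a1 : R := (w1.1)%:R - (w2.1)%:R; pose a2 : R := (w1.2)%:R - (w2.2)%:R.
pose b1 : R := (v1.1)%:R - (v2.1)%:R; pose b2 : R := (v1.2)%:R - (v2.2)%:R.
pose D := a1 * b2 - a2 * b1.
have D0 : D != 0.
  have -> : D = (((w1.1)%:Z - (w2.1)%:Z) * ((v1.2)%:Z - (v2.2)%:Z) - ((w1.2)%:Z - (w2.2)%:Z) * ((v1.1)%:Z - (v2.1)%:Z))%:~R.
    by rewrite /D /a1 /a2 /b1 /b2 !(rmorphD, rmorphN, rmorphM).
  by rewrite intr_eq0.
have D1 : 0 < `|D| by rewrite normr_gt0.
pose K := `|K1| + `|K2| + (`|K3| + `|K4|).
have := Fl ((K * (`|b2| + `|a2| + `|a1| + `|b1|)) / `|D| + 1) => Fl'.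
apply: uf_absurd; apply: filterS3 (filterI (filterI h1 h2) (filterI h3 h4)) Ft Fl' => z [[g1 g2] [g3 g4]] tz.
rewrite !(ln_mon _ tz) in g1 g2 g3 g4; rewrite /lsize.
set L1 := ln (nC z.1) in g1 g2 g3 g4 *; set L2 := ln (nC z.2) in g1 g2 g3 g4 *.
have Kle x : x \in [:: K1; K2; K3; K4] -> x <= K.
  rewrite !inE /K => /or4P[] /eqP->; apply: le_trans (ler_norm _) _.
  by rewrite -addrA lerDl !addr_ge0.
  by rewrite [X in X + _]addrC -addrA lerDl !addr_ge0.
  by rewrite addrC -addrA lerDl !addr_ge0.
  by rewrite addrC [X in X + _]addrC -addrA lerDl !addr_ge0.
have g12 : `|a1 * L1 + a2 * L2| <= K.
  rewrite ler_norml; apply/andP; rewrite /a1 /a2; split.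
    by have := Kle K2 ltac:(by rewrite !inE eqxx ?orbT); lra.
  by have := Kle K1 ltac:(by rewrite !inE eqxx ?orbT); lra.
have g34 : `|b1 * L1 + b2 * L2| <= K.
  rewrite ler_norml; apply/andP; rewrite /b1 /b2; split.
    by have := Kle K4 ltac:(by rewrite !inE eqxx ?orbT); lra.
  by have := Kle K3 ltac:(by rewrite !inE eqxx ?orbT); lra.
have e1 : `|D| * `|L1| <= K * (`|b2| + `|a2|).
  rewrite -normrM; have -> : D * L1 = b2 * (a1 * L1 + a2 * L2) - a2 * (b1 * L1 + b2 * L2).
    by rewrite /D; ring.
  apply: le_trans (ler_normB _ _) _; rewrite !normrM mulrDr.
  by rewrite lerD// mulrC ler_wpM2r.
have e2 : `|D| * `|L2| <= K * (`|a1| + `|b1|).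
  rewrite -normrM; have -> : D * L2 = a1 * (b1 * L1 + b2 * L2) - b1 * (a1 * L1 + a2 * L2).
    by rewrite /D; ring.
  apply: le_trans (ler_normB _ _) _; rewrite !normrM mulrDr.
  by rewrite lerD// mulrC ler_wpM2r.
rewrite leNgt => /negP; apply; rewrite ltr_pwDr// ler_pdivlMr//.
by move: e1 e2; rewrite !mulrDr !mulrDl ![_ * `|D|]mulrC; lra.
Qed.

Lemma mon_argmax (s : seq (nat * nat)) w0 : w0 \in s ->
  exists2 w, w \in s & forall v, v \in s -> F (fun z => nC (mon v z) <= nC (mon w z)).
Proof.
move=> w0s.
have : F (fun z => exists2 w, w \in s & forall v, v \in s -> nC (mon v z) <= nC (mon w z)).
  apply: ufT => z; elim: s w0 w0s => // a s IH w0 _.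
  case: s IH => [|b s] IH; first by exists a; rewrite ?mem_head// => v; rewrite inE => /eqP->.
  have [w ws hw] := IH b (mem_head _ _).
  have [h|h] := leP (nC (mon a z)) (nC (mon w z)).
    by exists w; [rewrite inE ws orbT|move=> v; rewrite inE => /orP[/eqP->//|/hw]].
  exists a; first exact: mem_head.
  move=> v; rewrite inE => /orP[/eqP->//|/hw hv]; exact: le_trans hv (ltW h).
move=> /(@uf_has _ F FU _ s)[w ws hw]; exists w => // v vs.
by apply: filterS hw => z /(_ v vs).
Qed.

(** If none of the four tends to infinity, all four are bounded, and so is [lsize]. *)
Lemma leaves_coord : leaves F ->
  [\/ lo F (fun=> 1) (fun z => nC z.1), lo F (fun=> 1) (fun z => (nC z.1)^-1),
      lo F (fun=> 1) (fun z => nC z.2) | lo F (fun=> 1) (fun z => (nC z.2)^-1)].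
Proof.
move=> Fl.
have [?|[K1 K10 h1]] := lo_or (F := F) (fun=> 1) (fun z : C * C => nC z.1); first exact: Or41.
have [?|[K2 K20 h2]] := lo_or (F := F) (fun=> 1) (fun z : C * C => (nC z.1)^-1); first exact: Or42.
have [?|[K3 K30 h3]] := lo_or (F := F) (fun=> 1) (fun z : C * C => nC z.2); first exact: Or43.
have [?|[K4 K40 h4]] := lo_or (F := F) (fun=> 1) (fun z : C * C => (nC z.2)^-1); first exact: Or44.
have bd (x K L : R) : 0 < x -> 0 < K -> 0 < L -> x <= K -> x^-1 <= L -> `|ln x| <= `|ln K| + `|ln L|.
  move=> x0 K0 L0 xK xL; rewrite ler_norml; apply/andP; split.
    have : ln x^-1 <= ln L by rewrite ler_ln ?posrE ?invr_gt0.
    by rewrite lnV ?posrE// => ?; have := ler_norm (ln L); have := normr_ge0 (ln K); lra.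
  have : ln x <= ln K by rewrite ler_ln ?posrE.
  by move=> ?; have := ler_norm (ln K); have := normr_ge0 (ln L); lra.
have := Fl (`|ln K1| + `|ln K2| + (`|ln K3| + `|ln K4|) + 1) => Fl'.
exfalso; apply: uf_absurd.
apply: filterS3 (filterI (filterI h1 h2) (filterI h3 h4)) Ft Fl' => z [[g1 g2] [g3 g4]] [z1 z2].
rewrite !mulr1 in g1 g2 g3 g4; rewrite /lsize.
have := bd (nC z.1) K1 K2; have := bd (nC z.2) K3 K4; rewrite !nC_gt0 z1 z2.
by move=> /(_ isT K30 K40 g3 g4) b2 /(_ isT K10 K20 g1 g2) b1; lra.
Qed.
End Comparison.

Section Multiplicity.
Variable R : realType.
Local Notation C := (R[i]).
Implicit Types (P Q h t g : {poly {poly C}}) (z : C * C).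

Lemma XsubC_power_cancel (c h s : {poly {poly C}}) (a : {poly C}) m :
  h.[a] != 0 -> s * ('X - a%:P) ^+ m = c * h -> exists c', s = c' * h.
Proof.
move=> ha; elim: m s c => [|m IH] s c; first by rewrite expr0 mulr1 => ->; exists c.
move=> e; have : (c * h).[a] = 0 by rewrite -e exprS !hornerM hornerXsubC subrr mul0r mulr0.
rewrite hornerM => /eqP; rewrite mulf_eq0 (negbTE ha) orbF => /factor_theorem[c' c'E].
apply: (IH s c'); apply: (mulIf (negbT (polyXsubC_eq0 a))).
by rewrite -mulrA -exprSr e c'E mulrAC.
Qed.

(** If [h] vanished at [z], [loc_pow] would make a unit at [z] times a power of x1 - z1, and another
    times a power of x2 - z2, multiples of [h]. Unless [h] vanishes on the line x1 = z1, the first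
    relation makes the unit a multiple of [h]; otherwise restricting the second to this line makes
    its unit vanish there. *)
Lemma int_mult_common P Q z m h P' Q' : int_mult P Q z m -> P = h * P' -> Q = h * Q' ->
  peval h z != 0.
Proof.
move=> hm eP eQ; apply/eqP => hz.
have key t : peval t z = 0 -> exists s c, peval s z != 0 /\ s * t ^+ m = c * h.
  move=> /(loc_pow hm)[s [a [b [s0 e]]]]; exists s, (a * P' + b * Q'); split => //.
  by rewrite e eP eQ; ring.
pose tx : {poly {poly C}} := 'X - z.1%:P%:P; pose ty : {poly {poly C}} := ('X - z.2%:P)%:P.
have [hz1|hz1] := eqVneq h.[z.1%:P] 0; last first.
  have [|s [c [s0 e]]] := key tx; first by rewrite pevalE hornerXsubC subrr horner0.
  have [c' c'E] := XsubC_power_cancel hz1 e.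
  by move: s0; rewrite c'E pevalM hz mulr0 eqxx.
have [|s [c [s0 e]]] := key ty; first by rewrite pevalE /ty !hornerE subrr.
have := congr1 (fun p : {poly {poly C}} => p.[z.1%:P]) e.
rewrite !hornerM hz1 mulr0 horner_exp hornerC => /eqP.
rewrite mulf_eq0 expf_eq0 polyXsubC_eq0 andbF orbF => /eqP s1.
by move: s0; rewrite pevalE s1 horner0 eqxx.
Qed.

Lemma int_mult_factor P Q z m h P' Q' : int_mult P Q z m -> P = h * P' -> Q = h * Q' ->
  int_mult P' Q' z m.
Proof.
move=> hm eP eQ; have hz := int_mult_common hm eP eQ.
have up g : in_loc_ideal P' Q' z g -> in_loc_ideal P Q z g.
  move=> [s [a [b [s0 e]]]]; exists (s * h), a, b; split; first by rewrite pevalM mulf_neq0.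
  transitivity (h * (s * g)); first by ring.
  by rewrite e eP eQ; ring.
have dn g : in_loc_ideal P Q z g -> in_loc_ideal P' Q' z g.
  move=> [s [a [b [s0 e]]]]; exists s, (a * h), (b * h); split => //.
  by rewrite e eP eQ; ring.
case: hm => [[q hq] nq]; split; first by exists q => c /up; exact: hq.
by move=> [r hr]; apply: nq; exists r => c /dn; exact: hr.
Qed.

(* a linear form through z' that does not vanish at z <> z' *)
Definition lin (z z' : C * C) : {poly {poly C}} :=
  if z.1 != z'.1 then 'X - z'.1%:P%:P else ('X - z'.2%:P)%:P.

Lemma lin0 z z' : peval (lin z z') z' = 0.
Proof. by rewrite pevalE /lin; case: ifP => _; rewrite !hornerE subrr ?horner0. Qed.

Lemma lin_neq0 z z' : z != z' -> peval (lin z z') z != 0.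
Proof.
rewrite pevalE /lin; case: (eqVneq z.1 z'.1) => /= h zz'; rewrite !hornerE subr_eq0//.
by apply: contra zz' => /eqP h2; apply/eqP; case: z z' h h2 => a b [c d] /= -> ->.
Qed.

Definition degle (n : nat) P := forall w, w \in suppl P -> (w.1 + w.2 <= n)%N.

Lemma degle_sum n (I : finType) (f : I -> {poly {poly C}}) :
  (forall i, degle n (f i)) -> degle n (\sum_i f i).
Proof.
move=> h w; rewrite mem_suppl coef2_sum => hw; apply: contrapT => nw.
move/negP: hw; apply; apply/eqP; rewrite big1// => i _.
by apply: contrapT => /eqP; rewrite -mem_suppl => /h.
Qed.

Lemma degle_C n (c : C) P : degle n P -> degle n (c%:P%:P * P).
Proof.
move=> h w; rewrite mem_suppl coef2Cmul mulf_eq0 negb_or => /andP[_].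
by rewrite -mem_suppl; exact: h.
Qed.

Lemma inD_Xm_degle LL d w0 n p :
  (forall l, l \in LL -> lf l w0 + (n * l1n l)%:Z <= d l) -> degle n p ->
  inD LL d (Xm _ w0 * p).
Proof.
move=> hd hp w /suppl_mul[v [v' [+ v'p ->]]]; rewrite suppl_Xm inE => /eqP->.
apply/regbP => l lL; rewrite lfD; apply: le_trans (hd l lL); rewrite lerD2l.
have := hp _ v'p; case: v' v'p => i j _ /= ij; rewrite /lf /l1n /=.
apply: le_trans (_ : (`|l.1|%N * i + `|l.2|%N * j)%N%:Z <= _).
  by rewrite PoszD !PoszM; apply: lerD; apply: ler_wpM2r => //; lia.
by rewrite lez_nat mulnDr leq_add// mulnC leq_mul//; lia.
Qed.

(** The powers of [lin] lie in the local ideals of the other points by [loc_pow] and are units at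
    [z i], so a relation among the [g0] splits into one relation at each point. The monomial
    [Xm w0], a unit on the torus, moves them deep into the region; the [x k] are further classes,
    which [xi] eliminates first. *)
Lemma local_count LL N d a b P Q n (z : 'I_n -> C * C) (m : 'I_n -> nat)
    (q : forall i, 'I_(m i) -> {poly {poly C}}) e (x : 'I_e -> {poly {poly C}}) w0 C0
    (D4 := dadd (dadd d a) b)
    (g0 := fun i (k : 'I_(m i)) => q i k * \prod_(j | j != i) lin (z i) (z j) ^+ m j) :
  (forall w, regb LL D4 w -> (w.1 < N)%N && (w.2 < N)%N) ->
  (forall w, regb LL d w -> (w.1 < N)%N && (w.2 < N)%N) ->
  exact_deg LL a P -> inD LL b Q -> syz P Q ->
  injective z -> (forall i, torus (z i)) -> (forall i, int_mult P Q (z i) (m i)) ->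
  (forall i, loc_indep P Q (z i) (q i)) ->
  (forall i k, degle C0 (g0 i k)) ->
  (forall p, degle C0 p -> inD LL D4 (Xm _ w0 * p)) ->
  (forall k, inD LL D4 (x k)) ->
  (forall c p u r, degle C0 p -> inD LL (dadd d b) u -> inD LL (dadd d a) r ->
     \sum_k (c k)%:P%:P * x k + Xm _ w0 * p = u * P + r * Q -> forall k, c k = 0) ->
  (\sum_i m i + e + (cnt LL N (dadd d b) + cnt LL N (dadd d a)) <= cnt LL N D4 + cnt LL N d)%N.
Proof.
move=> hN hN0 Pa Qb sPQ zi zt zm qi gC wC xD xi.
pose I : finType := ({i : 'I_n & 'I_(m i)} + 'I_e)%type.
pose g (k : I) := match k with inl t => Xm _ w0 * g0 (tag t) (tagged t) | inr k => x k end.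
have cI : #|I| = (\sum_i m i + e)%N.
  rewrite card_sum card_tagged card_ord sumnE big_map big_enum /=; congr (_ + _)%N.
  by apply: eq_bigr => i _; rewrite card_ord.
rewrite -cI; apply: (@rank_count_fin _ LL I N d a b P Q g) => //.
  by case=> [t|k] /=; [exact/wC/gC|exact: xD].
move=> c u r ud rd; rewrite big_sumType /=.
pose p := \sum_(t : {i : 'I_n & 'I_(m i)}) (c (inl t))%:P%:P * g0 (tag t) (tagged t).
have -> : \sum_(t : {i : 'I_n & 'I_(m i)}) (c (inl t))%:P%:P * (Xm _ w0 * g0 (tag t) (tagged t)) =
    Xm _ w0 * p.
  by rewrite /p mulr_sumr; apply: eq_bigr => t _; rewrite mulrCA.
move=> e0; have pC : degle C0 p by apply: degle_sum => t; apply/degle_C/gC.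
have cr k : c (inr k) = 0.
  by apply: (xi (fun k => c (inr k)) p u r pC ud rd); rewrite addrC.
rewrite [X in _ + X]big1 ?addr0 in e0; last by move=> k _; rewrite cr !polyC0 mul0r.
case=> [[i k]|k]; last exact: cr.
have pl : in_loc_ideal P Q (z i) p.
  apply: (@loc_unit _ _ _ _ _ (Xm _ w0)); first by rewrite peval_Xm mon_neq0.
  by rewrite e0; exact: loc_comb.
pose ci j (k : 'I_(m j)) : C := c (inl (existT (fun j => 'I_(m j)) j k)).
pose pr (i : 'I_n) : {poly {poly C}} := \prod_(j | j != i) lin (z i) (z j) ^+ m j.
pose G j : {poly {poly C}} := \sum_(k : 'I_(m j)) (ci j k)%:P%:P * q j k.
have pE : p = \sum_j pr j * G j.
  have -> : p = \sum_j \sum_(k : 'I_(m j)) (ci j k)%:P%:P * g0 j k.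
    by rewrite sig_big_dep; apply: eq_bigr => -[].
  apply: eq_bigr => j _; rewrite /G mulr_sumr; apply: eq_bigr => k' _.
  by rewrite /g0 mulrA mulrC.
have pD : p = pr i * G i + \sum_(j | j != i) pr j * G j.
  by rewrite pE; exact: (@bigD1 _ _ _ _ i xpredT (fun j => pr j * G j)).
have restl : in_loc_ideal P Q (z i) (\sum_(j | j != i) pr j * G j).
  apply: loc_sum => j ji; rewrite mulrC; apply: loc_mull.
  have -> : pr j = (\prod_(l | (l != j) && (l != i)) lin (z j) (z l) ^+ m l) * lin (z j) (z i) ^+ m i.
    by rewrite mulrC; apply: (@bigD1 _ _ _ _ i); rewrite eq_sym.
  by apply: loc_mull; apply: loc_pow => //; exact: lin0.
have : in_loc_ideal P Q (z i) (pr i * G i).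
  have -> : pr i * G i = p + (-1) * (\sum_(j | j != i) pr j * G j).
    by rewrite pD mulN1r addrK.
  by apply: loc_add => //; exact: loc_mull.
move=> /loc_unit h; apply: (qi i (ci i)); apply: h.
rewrite peval_prod; apply/prodf_neq0 => j ji; rewrite pevalX expf_neq0// lin_neq0//.
by apply: contra ji => /eqP/zi->.
Qed.
End Multiplicity.

(** * Independence of a dominant monomial at infinity *)

Section AtInfinity.
Variable R : realType.
Local Notation C := (R[i]).
Implicit Types (P Q h u r p : {poly {poly C}}) (w v : nat * nat).

Lemma lo_peval_mul (F : set_system (C * C)) {FU : UltraFilter F} u P (sP : seq (nat * nat)) wm :
  lo F (fun z => nC (peval P z)) (fun z => \sum_(v <- sP) nC (mon v z)) ->
  (forall w v, w \in suppl u -> v \in sP -> F (fun z => nC (mon (wadd w v) z) <= nC (mon wm z))) ->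
  lo F (fun z => nC (peval (u * P) z)) (fun z => nC (mon wm z)).
Proof.
move=> hP huv; have [K K0 hK] := nC_peval_le u.
have h1 : lO F (fun z => nC (peval u z)) (Mx u) by exists K => //; apply: ufT.
have h2 := @lo_mull _ _ F FU _ _ _ _ (fun z => nC_ge0 (peval u z)) (fun z => nC_ge0 (peval P z)) h1 hP.
have h3 : lO F (fun z => Mx u z * \sum_(v <- sP) nC (mon v z)) (fun z => nC (mon wm z)).
  apply: (@lO_trans _ _ _ _ (fun z => \sum_(w <- suppl u) \sum_(v <- sP) nC (mon (wadd w v) z))).
    apply: lO_le => z; rewrite /Mx mulr_suml le_eqVlt; apply/orP; left; apply/eqP.
    apply: eq_bigr => w _; rewrite mulr_sumr; apply: eq_bigr => v _.
    by rewrite monD nCM.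
  apply: lO_sum => [z|w wu]; first exact: nC_ge0.
  apply: lO_sum => [z|v vP]; first exact: nC_ge0.
  by apply: lO_lev; exact: huv.
apply: (lO_lo_trans _ (lo_lO_trans h2 h3)).
by apply: lO_le => z; rewrite pevalM nCM.
Qed.

Section InfIndep.
Variable F : set_system (C * C).
Context {FU : UltraFilter F}.
Hypothesis Ft : F (fun z => torus z).
Hypothesis Fl : leaves F.
Variables (LL : seq (int * int)) (N : nat) (d a b : int * int -> int).
Let D4 := dadd (dadd d a) b.
Variables (P Q : {poly {poly C}}) (sP sQ : seq (nat * nat)).
Hypothesis sPa : forall v, v \in sP -> regb LL a v.
Hypothesis sQb : forall v, v \in sQ -> regb LL b v.
Hypothesis hP : lo F (fun z => nC (peval P z)) (fun z => \sum_(v <- sP) nC (mon v z)).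
Hypothesis hQ : lo F (fun z => nC (peval Q z)) (fun z => \sum_(v <- sQ) nC (mon v z)).
Hypothesis boxN : forall w, regb LL D4 w -> (w.1 < N)%N && (w.2 < N)%N.

(** By [leaves_coord] a coordinate or its inverse tends to infinity, so one of the four neighbours
    of [w] is infinitely larger than [w], while still bounded by [wm]. *)
Lemma lo_mon_step w wm : (1 <= w.1)%N -> (1 <= w.2)%N ->
  (forall v, v \in [:: (w.1.+1, w.2); (w.1.-1, w.2); (w.1, w.2.+1); (w.1, w.2.-1)] ->
     F (fun z => nC (mon v z) <= nC (mon wm z))) ->
  lo F (fun z => nC (mon w z)) (fun z => nC (mon wm z)).
Proof.
case: w => -[|i] [|j] //= _ _ h.
have key (g : C * C -> R) v : lo F (fun=> 1) g -> (forall z, torus z -> nC (mon (i.+1, j.+1) z) * g z = nC (mon v z)) ->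
    v \in [:: (i.+2, j.+1); (i, j.+1); (i.+1, j.+2); (i.+1, j)] ->
    lo F (fun z => nC (mon (i.+1, j.+1) z)) (fun z => nC (mon wm z)).
  move=> hg e /h hv k k0; apply: filterS3 (hg k k0) hv Ft => z {}hg {}hv tz.
  apply: le_trans (_ : k * nC (mon v z) <= _); last by rewrite ler_wpM2l// ltW.
  rewrite -e// mulrCA -[leLHS]mulr1 ler_wpM2l//; exact: nC_ge0.
have [] := leaves_coord Ft Fl => hg.
- apply: (key _ (i.+2, j.+1) hg) => [z tz|]; last by rewrite !inE eqxx.
  by rewrite -nCM /mon /=; congr nC; rewrite [z.1 ^+ i.+2]exprSr; ring.
- apply: (key _ (i, j.+1) hg) => [z [z1 _]|]; last by rewrite !inE eqxx orbT.
  rewrite -nCV -nCM /mon /=; congr nC; rewrite exprSr mulrAC -!mulrA; congr (_ * _).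
  by rewrite mulrA mulfV ?mul1r.
- apply: (key _ (i.+1, j.+2) hg) => [z tz|]; last by rewrite !inE eqxx !orbT.
  by rewrite -nCM /mon /=; congr nC; rewrite [z.2 ^+ j.+2]exprSr; ring.
- apply: (key _ (i.+1, j) hg) => [z [_ z2]|]; last by rewrite !inE eqxx !orbT.
  by rewrite -nCV -nCM /mon /=; congr nC; rewrite [z.2 ^+ j.+1]exprSr -!mulrA mulfV ?mulr1.
Qed.

(** The largest monomial [wm] of the region dominates [u * P] and [r * Q], since [P] and [Q] are
    negligible against their monomials, and [Xm w0 * p], since its exponents are interior to the
    region. With c nonzero, [wm] would be negligible against itself. *)
Lemma inf_indep w0 C0 wm c p u r :
  (forall l, l \in LL -> lf l w0 + (C0.+1 * l1n l)%:Z <= D4 l) ->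
  (1 <= w0.1)%N -> (1 <= w0.2)%N ->
  (forall v, v \in Reg LL N D4 -> F (fun z => nC (mon v z) <= nC (mon wm z))) ->
  degle C0 p -> inD LL (dadd d b) u -> inD LL (dadd d a) r ->
  c%:P%:P * Xm _ wm + Xm _ w0 * p = u * P + r * Q -> c = 0.
Proof.
move=> hw0 w01 w02 hm pC ud rd e0; apply/eqP/negPn/negP => c0.
have inR v : regb LL D4 v -> F (fun z => nC (mon v z) <= nC (mon wm z)).
  by move=> h; apply: hm; rewrite mem_Reg h; exact: boxN.
have h1 : lo F (fun z => nC (peval (u * P) z)) (fun z => nC (mon wm z)).
  apply: (lo_peval_mul hP) => w v wu vP; apply: inR.
  have -> : D4 = dadd (dadd d b) a by apply/funext => l; rewrite /D4 /dadd addrAC.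
  by apply: regb_add; [exact: ud|exact: sPa].
have h2 : lo F (fun z => nC (peval (r * Q) z)) (fun z => nC (mon wm z)).
  apply: (lo_peval_mul hQ) => w v wu vP; apply: inR.
  by apply: regb_add; [exact: rd|exact: sQb].
have h3 : lo F (fun z => nC (peval (Xm _ w0 * p) z)) (fun z => nC (mon wm z)).
  apply: (@lO_lo_trans _ _ _ _ (fun z => \sum_(v <- suppl p) nC (coef2 p v) * nC (mon (wadd w0 v) z))).
    apply: lO_le => z; rewrite pevalM peval_Xm peval_suppl mulr_sumr.
    apply: le_trans (nC_sum _ _ _) _; apply: ler_sum => v _.
    by rewrite mulrCA nCM monD.
  apply: lo_sum => [z|v vp]; first exact: nC_ge0.
  have [i ij] : exists k, (v.1 + v.2 + k = C0)%N by exists (C0 - (v.1 + v.2))%N; rewrite subnKC// pC.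
  have hv : lo F (fun z => nC (mon (wadd w0 v) z)) (fun z => nC (mon wm z)).
    apply: lo_mon_step => [||v' hv']; [by rewrite (leq_trans w01)//= leq_addr|by rewrite (leq_trans w02)//= leq_addr|].
    apply: inR; apply/regbP => l lL; apply: le_trans (hw0 l lL).
    have dv : (`|(v'.1%:Z - (w0.1)%:Z)%R|%N + `|(v'.2%:Z - (w0.2)%:Z)%R|%N <= C0.+1)%N.
      clear -ij hv' w01 w02; case: w0 v v' ij hv' w01 w02 => [x1 x2] [y1 y2] v' /= ij.
      by rewrite !inE /wadd /= => /or4P[] /eqP-> /=; lia.
    rewrite -lerBlDl /lf /l1n.
    have -> : l.1 * (v'.1)%:Z + l.2 * (v'.2)%:Z - (l.1 * (w0.1)%:Z + l.2 * (w0.2)%:Z) =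
      l.1 * ((v'.1)%:Z - (w0.1)%:Z) + l.2 * ((v'.2)%:Z - (w0.2)%:Z) by ring.
    move: dv; set x := ((v'.1)%:Z - _); set y := ((v'.2)%:Z - _) => dv.
    apply: le_trans (_ : (`|l.1|%N * `|x|%N + `|l.2|%N * `|y|%N)%N%:Z <= _).
      rewrite PoszD !PoszM !abszE -!normrM; apply: lerD; exact: ler_norm.
    by rewrite lez_nat mulnDr leq_add// mulnC leq_mul//; lia.
  move=> k k0; have k1 : 0 < k / (1 + nC (coef2 p v)) by rewrite divr_gt0// ltr_pwDl// nC_ge0.
  apply: filterS (hv _ k1) => z {}hv; apply: le_trans (ler_wpM2l (nC_ge0 _) hv) _.
  rewrite mulrA ler_wpM2r ?nC_ge0// mulrA ler_pdivrMr ?ltr_pwDl ?nC_ge0//.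
  by rewrite mulrC ler_wpM2l ?(ltW k0)//; have := ltr01 (R := R); lra.
have : lo F (fun z => nC (peval (c%:P%:P * Xm _ wm) z)) (fun z => nC (mon wm z)).
  apply: lO_lo_trans (lo_add (lo_add h1 h2) h3); apply: lO_le => z.
  have -> : c%:P%:P * Xm _ wm = u * P + r * Q - Xm _ w0 * p by rewrite -e0 addrK.
  by rewrite pevalB pevalD; apply: le_trans (nCB _ _) _; rewrite lerD// nCD.
move=> h; apply: (lo_irr h); last by apply: filterS Ft => z tz; rewrite pevalM pevalC peval_Xm nC_gt0 mulf_neq0// mon_neq0.
exists (nC c)^-1; first by rewrite invr_gt0 nC_gt0.
by apply: ufT => z; rewrite pevalM pevalC peval_Xm nCM mulKf// nC_eq0.
Qed.
End InfIndep.
End AtInfinity.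

(** * One step of the lattice count, with one class from infinity *)

Section StepCounts.
Variable R : realType.
Local Notation C := (R[i]).
Implicit Types (P Q h u r p : {poly {poly C}}) (w v : nat * nat) (d a b : int * int -> int).

Definition nonparallel P Q := exists w1 w2 v1 v2,
  [/\ (w1 \in suppl P /\ w2 \in suppl P) \/ (w1 \in suppl Q /\ w2 \in suppl Q),
      (v1 \in suppl P /\ v2 \in suppl P) \/ (v1 \in suppl Q /\ v2 \in suppl Q) &
      ((w1.1)%:Z - (w2.1)%:Z) * ((v1.2)%:Z - (v2.2)%:Z) !=
      ((w1.2)%:Z - (w2.2)%:Z) * ((v1.1)%:Z - (v2.1)%:Z)].

Lemma supfun_ex P : P != 0 -> exists a, supfun (suppl P) a.
Proof.
move=> /suppl_neq0[w wP].
have h l : exists e, (forall w, w \in suppl P -> lf l w <= e) /\ exists2 w, w \in suppl P & lf l w = e.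
  by have [x xP hx] := seq_argmax (lf l) wP; exists (lf l x); split => //; exists x.
by exists (fun l => sval (cid (h l))) => l; case: cid.
Qed.

Lemma supfun_exact LL P a : supfun (suppl P) a -> exact_deg LL a P.
Proof.
move=> h; split=> [w wP|l _]; last by have [] := h l.
by apply/regbP => l _; have [-> //] := h l.
Qed.

(** Newton polygons add under products: if the value a l + b l were not attained, [degree_cancel]
    would improve the bound a l for [P] by 1. *)
Lemma supfun_mul P Q a b : supfun (suppl P) a -> supfun (suppl Q) b ->
  supfun (suppl (P * Q)) (fun l => a l + b l).
Proof.
move=> hP hQ l; have [Pa [x xP xa]] := hP l; have [Qb [y yQ yb]] := hQ l; split.
  by move=> w /suppl_mul[v [v' [/Pa h1 /Qb h2 ->]]]; rewrite lfD lerD.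
apply: contrapT => nh.
have := @degree_cancel _ l (a l - 1) (b l) P Q y yQ yb Qb.
have h : forall w, w \in suppl (P * Q) -> lf l w <= a l - 1 + b l.
  move=> w wPQ; have : lf l w <= a l + b l.
    by have [v [v' [/Pa h1 /Qb h2 ->]]] := suppl_mul wPQ; rewrite lfD lerD.
  rewrite le_eqVlt => /orP[/eqP e|]; first by case: nh; exists w.
  by lia.
by move=> /(_ h x xP); rewrite xa; lia.
Qed.

Lemma supfun_uniq s a b : supfun s a -> supfun s b -> a = b.
Proof.
move=> ha hb; apply/funext => l; have [A1 [x xs xa]] := ha l; have [B1 [y ys yb]] := hb l.
by apply/eqP; rewrite eq_le -{1}xa B1//= -yb A1.
Qed.

Lemma supfun_ge0 s a : supfun s a -> 0 <= a (1, 0) /\ 0 <= a (0, 1).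
Proof. by move=> h; have [_ [w _ <-]] := h (1, 0); have [_ [v _ <-]] := h (0, 1); rewrite /lf /=; split; lia. Qed.

(* the region of d contains all exponents at l1-distance at most n of w *)
Definition bigat (LL : seq (int * int)) d w n :=
  [/\ forall l, l \in LL -> lf l w + (n * l1n l)%:Z <= d l, (1 <= w.1)%N & (1 <= w.2)%N].

Lemma bigat_add LL d w n s a : supfun s a -> bigat LL d w n -> exists w', bigat LL (dadd d a) w' n.
Proof.
move=> hs [h w1 w2]; have [_ [v vs _]] := hs (0, 0).
exists (wadd w v); split; [|by rewrite (leq_trans w1)//= leq_addr|by rewrite (leq_trans w2)//= leq_addr].
move=> l lL; rewrite lfD /dadd; have [/(_ v vs) h1 _] := hs l; have := h l lL; lia.
Qed.

Definition boxed (N : nat) d := d (1, 0) < N%:Z /\ d (0, 1) < N%:Z.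

Lemma boxedP LL N d : (1, 0) \in LL -> (0, 1) \in LL -> boxed N d ->
  forall w, regb LL d w -> (w.1 < N)%N && (w.2 < N)%N.
Proof.
move=> h1 h2 [b1 b2] w /regbP hw; have := le_lt_trans (hw _ h1) b1; have := le_lt_trans (hw _ h2) b2.
by rewrite /lf /=; lia.
Qed.

Lemma boxed_add N d s a : supfun s a -> boxed N (dadd d a) -> boxed N d.
Proof. by move=> /supfun_ge0; rewrite /boxed /dadd; lia. Qed.

Lemma ex_degle n (m : 'I_n -> nat) (g : forall i, 'I_(m i) -> {poly {poly C}}) :
  exists C0, forall i k, degle C0 (g i k).
Proof.
exists (\max_i \max_k tdeg (g i k)) => i k w /tdegP; move/leq_trans; apply.
by apply: leq_trans (leq_bigmax i); exact: (leq_bigmax k).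
Qed.

Section Step.
Variables (P Q : {poly {poly C}}) (a b : int * int -> int).
Hypothesis Pa : supfun (suppl P) a.
Hypothesis Qb : supfun (suppl Q) b.
Variables (n : nat) (z : 'I_n -> C * C) (m : 'I_n -> nat).
Hypothesis zi : injective z.
Hypothesis zt : forall i, torus (z i).
Hypothesis zm : forall i, int_mult P Q (z i) (m i).

(* one more monomial at infinity than the local multiplicities account for *)
Lemma step_coprime (F : set_system (C * C)) : UltraFilter F ->
  syz P Q -> F (fun z => torus z) -> leaves F ->
  lo F (fun z => nC (peval P z)) (Mx P) -> lo F (fun z => nC (peval Q z)) (Mx Q) ->
  exists C0, forall LL N d w0, (1, 0) \in LL -> (0, 1) \in LL -> bigat LL d w0 C0 ->
    boxed N (dadd (dadd d a) b) ->
    ((\sum_i m i).+1 + (cnt LL N (dadd d b) + cnt LL N (dadd d a)) <=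
     cnt LL N (dadd (dadd d a) b) + cnt LL N d)%N.
Proof.
move=> FU sPQ Ft Fl FP FQ.
pose q i := sval (cid (zm i).1).
have qi i : loc_indep P Q (z i) (q i) by rewrite /q; case: cid.
have [C0 hC0] := ex_degle (fun i (k : 'I_(m i)) => q i k * \prod_(j | j != i) lin (z i) (z j) ^+ m j).
exists C0.+1 => LL N d w0 l10 l01 bw bN.
have [w1 bw1] := bigat_add Pa bw; have [w2 [bw2 w21 w22]] := bigat_add Qb bw1.
have bN0 : boxed N d by exact: boxed_add Pa (boxed_add Qb bN).
have wR : w2 \in Reg LL N (dadd (dadd d a) b).
  rewrite mem_Reg; have h : regb LL (dadd (dadd d a) b) w2.
    by apply/regbP => l lL; have := bw2 l lL; lia.
  by rewrite h; exact: boxedP bN _ h.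
have [wm wmR hwm] := @mon_argmax R F FU (Reg LL N (dadd (dadd d a) b)) w2 wR.
rewrite -[(\sum_i m i).+1]addn1.
apply: (@local_count _ LL N d a b P Q n z m q 1 (fun=> Xm _ wm) w2 C0) => //.
- exact: boxedP.
- exact: boxedP.
- exact: supfun_exact.
- by have [] := supfun_exact LL Qb.
- move=> p pC; apply: (@inD_Xm_degle _ _ _ _ C0) => // l lL.
  by apply: le_trans (bw2 l lL); rewrite lerD2l lez_nat leq_mul2r leqnSn orbT.
- by move=> _; apply: inD_Xm; move: wmR; rewrite mem_Reg => /andP[].
move=> c p u r pC ud rd; rewrite big_ord1 => e0 k.
have -> : k = ord0 by apply: val_inj; case: k => -[].
apply: (@inf_indep R F FU Ft Fl LL N d a b P Q (suppl P) (suppl Q) _ _ FP FQ _ w2 C0 wm _ p u r) => //.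
- by have [] := supfun_exact LL Pa.
- by have [] := supfun_exact LL Qb.
- exact: boxedP.
Qed.
End Step.

(** With a nonzero constant term [h] has degree 0 in the directions (-1, 0) and (0, -1), so
    [degree_cancel] passes divisibility by the monomial from [u * h] to [u]. *)
Lemma syz_Xm h w : coef2 h (0%N, 0%N) != 0 -> syz h (Xm _ w).
Proof.
move=> h0 u r e.
have h0s : (0%N, 0%N) \in suppl h by rewrite mem_suppl.
have key (l : int * int) : (forall v, lf l v <= 0) -> (forall v, v \in suppl (r * Xm _ w) -> lf l v <= lf l w) ->
    forall v, v \in suppl u -> lf l v <= lf l w.
  move=> l0 hl; apply: (@degree_cancel _ l (lf l w) 0 u h _ h0s); rewrite ?/lf/= ?mulr0 ?addr0//.
    by move=> v _; exact: l0.
  by rewrite e; exact: hl.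
have uw v : v \in suppl u -> (w.1 <= v.1)%N /\ (w.2 <= v.2)%N.
  move=> vu; have := key (-1, 0) _ _ v vu; have := key (0, -1) _ _ v vu; rewrite /lf /=.
  have K v' : v' \in suppl (r * Xm _ w) -> (w.1 <= v'.1)%N /\ (w.2 <= v'.2)%N.
    by move=> /suppl_mul[x [y [_ + ->]]]; rewrite suppl_Xm inE => /eqP->; rewrite /= !leq_addl.
  have T1 : forall v : nat * nat, -1 * (v.1)%:Z + 0 * (v.2)%:Z <= 0 :> int by move=> ?; lia.
  have T2 : forall v : nat * nat, 0 * (v.1)%:Z + -1 * (v.2)%:Z <= 0 :> int by move=> ?; lia.
  move=> /(_ T2) h2 /(_ T1) h1.
  have {}h1 := h1 ltac:(by move=> v' /K; lia); have {}h2 := h2 ltac:(by move=> v' /K; lia).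
  by lia.
pose d := \sum_(v <- suppl u) (coef2 u v)%:P%:P * Xm R ((v.1 - w.1)%N, (v.2 - w.2)%N).
have ud : u = d * Xm _ w.
  rewrite {1}(poly_suppl u) /d mulr_suml big_seq [RHS]big_seq; apply: eq_bigr => v /uw[h1 h2].
  rewrite -mulrA -XmD /wadd /= !subnK//; congr (_ * Xm _ _); exact: surjective_pairing.
exists d; split => //.
have X0 : Xm R w != 0.
  by apply/eqP => /(congr1 (fun p => coef2 p w)); rewrite coef2_Xm eqxx coef20; apply/eqP; rewrite oner_eq0.
by apply: (mulIf X0); rewrite -e ud mulrAC.
Qed.

Lemma exists_nonroot_large (p : {poly C}) K : p != 0 -> exists2 y, p.[y] != 0 & K%:R <= nC y.
Proof.
move=> p0; apply: contrapT => nh.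
pose s := [seq ((K + i)%:R : C) | i <- iota 0 (size p)].
have us : uniq s.
  by rewrite map_inj_uniq ?iota_uniq// => i j /eqP; rewrite eqr_nat => /eqP /addnI.
have := size_undup_roots p0 us; rewrite size_map size_iota.
have hs x : x \in s -> p.[x] = 0.
  move=> /mapP[i _ ->]; apply: contrapT => /eqP px; apply: nh; exists (K + i)%:R => //.
  by rewrite nC_natr ler_nat leq_addr.
by move=> /(_ hs); rewrite -(size_poly_gt0 p) in p0; move: p0; case: (size p) => // k _; rewrite ltnn.
Qed.

(** The zero curve of [h] contains points of the torus with a large coordinate: x2 is taken large
    and x1 is solved for, or, if x1 does not occur in [h], x2 is a root and x1 is large. *)
Lemma curve_leaves h : coef2 h (0%N, 0%N) != 0 -> (exists2 w, w \in suppl h & w != (0%N, 0%N)) ->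
  exists F : set_system (C * C), [/\ UltraFilter F, F (fun z => torus z), leaves F &
    F (fun z => peval h z = 0)].
Proof.
move=> h0 [w wh w0].
suff S (n : nat) : exists z, [/\ torus z, n%:R <= lsize z & peval h z = 0].
  have [F [FU FS]] := @uf_exists _ (fun n z => [/\ torus z, n%:R <= lsize z & peval h z = 0]) S
    ltac:(by move=> n z [? h1 ?]; split => //; apply: le_trans h1; rewrite ler_nat).
  exists F; split => //; first by apply: filterS (FS 0%N) => z [].
    move=> B; have := FS (Num.truncn `|B|).+1; apply: filterS => z [_ hz _].
    apply: le_trans (ler_norm _) _; apply: le_trans hz.
    by apply: ltW; have /andP[] := truncn_itv (normr_ge0 B).
  by apply: filterS (FS 0%N) => z [].
have lnbig (x : C) : (n%:R + 1 <= `|ln (nC x)| -> n%:R <= lsize (x, x) ) by rewrite /lsize /=; have := normr_ge0 (ln (nC x)); lra.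
pose E : R := expR n%:R.
have [K EK] : exists K : nat, E <= K%:R.
  by exists (Num.truncn E).+1; apply: ltW; have /andP[] := truncn_itv (expR_ge0 n%:R : 0 <= E).
have bigln (y : C) : K%:R <= nC y -> n%:R <= `|ln (nC y)|.
  move=> Ky; apply: le_trans (ler_norm _); rewrite -[n%:R]expRK ler_ln ?posrE ?expR_gt0//; last first.
    by apply: lt_le_trans (expR_gt0 n%:R) _; exact: le_trans EK Ky.
  exact: le_trans EK Ky.
have hh0 : h`_0 != 0 by apply: contra h0 => /eqP e; rewrite coef2E e coef0.
have [sh|sh] := leqP (size h) 1.
  have hE : h = (h`_0)%:P by apply: size1_polyC.
  have s0 : (1 < size (h`_0)%R)%N.
    rewrite ltnNge; apply/negP => /size1_polyC e; move: wh; rewrite mem_suppl hE e.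
    case: w w0 => -[|i] [|j] //= _; rewrite coef2E /= ?coefC /= ?coef0 ?coefC /= ?eqxx//.
  have [y ry] : exists y, root h`_0 y by apply/closed_rootP; rewrite neq_ltn s0 orbT.
  exists (K.+1%:R, y); split.
  - split => /=; first by rewrite pnatr_eq0.
    by apply: contraNneq h0 => y0; move: ry; rewrite y0 /root horner_coef0.
  - apply: le_trans (_ : `|ln (nC K.+1%:R)| <= _); last by rewrite /lsize /= lerDl.
    by apply: bigln; rewrite nC_natr ler_nat.
  - by rewrite pevalE hE hornerC; apply/rootP.
have lc0 : lead_coef h != 0 by rewrite lead_coef_eq0; apply: contraTneq sh => ->; rewrite size_poly0.
(* The first factor keeps the root x1 away from 0, the second keeps the degree in x1. *)
have [y hy yK] := exists_nonroot_large K (mulf_neq0 hh0 lc0).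
rewrite hornerM mulf_eq0 negb_or in hy; case/andP: hy => hy0 hyl.
pose g : {poly C} := map_poly (horner_eval y) h.
have sg : size g = size h by apply: size_map_poly_id0.
have [x rx] : exists x, root g x by apply/closed_rootP; rewrite sg neq_ltn sh orbT.
exists (x, y); split.
- split => /=; last first.
    rewrite -nC_gt0; apply: lt_le_trans yK; apply: lt_le_trans EK; exact: expR_gt0.
  by apply: contraNneq hy0 => x0; move: rx; rewrite x0 /root horner_coef0 coef_map.
- by apply: le_trans (bigln _ yK) _; rewrite /lsize /= lerDr.
- rewrite pevalE /=; move/rootP: rx => <-.
  by rewrite -[LHS]/(horner_eval y h.[x%:P]) -horner_map /= /horner_eval hornerC.
Qed.

End StepCounts.

Section Nondegenerate.
Variable R : realType.
Local Notation C := (R[i]).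
Implicit Types (P Q h u r p : {poly {poly C}}) (w v : nat * nat) (d a b : int * int -> int).

Lemma coef2_00 P : coef2 P (0%N, 0%N) = peval P (0, 0).
Proof. by rewrite pevalE coef2E /= -horner_coef0 polyC0 -horner_coef0. Qed.

Lemma bigat_regb (LL : seq (int * int)) d w n : bigat LL d w n -> regb LL d w.
Proof. by move=> [h _ _]; apply/regbP => l lL; have := h l lL; lia. Qed.

Lemma poly2_constant h : (forall w, w \in suppl h -> w = (0%N, 0%N)) -> h = (coef2 h (0%N, 0%N))%:P%:P.
Proof.
move=> hw; apply: eq_coef2 => w; rewrite [RHS]coef2E coefC.
have [->|w0] := eqVneq w (0%N, 0%N); first by rewrite /= coefC.
have -> : coef2 h w = 0 by apply/eqP; apply: contraNT w0; rewrite -mem_suppl => /hw->.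
by case: w w0 => -[|i] [|j] //= _; rewrite ?coefC ?coef0.
Qed.

Lemma polyCC_mulVf (c : C) : c != 0 -> c^-1%:P%:P * c%:P%:P = 1 :> {poly {poly C}}.
Proof. by move=> c0; rewrite -(polyCM (c^-1)%:P) -(polyCM c^-1) mulVf. Qed.

(** Two counts are added. The coprime pair (P, Q), in the region enlarged by the polygon of [h],
    sees all local multiplicities; the coprime pair (h, x^w) gains one class at infinity along the
    curve h = 0, where x^w is negligible against another monomial. Their sum is the count for (h P,
    h Q). *)
Lemma step_common h P Q a b n (z : 'I_n -> C * C) (m : 'I_n -> nat) :
  P != 0 -> Q != 0 -> h != 0 ->
  supfun (suppl (h * P)) a -> supfun (suppl (h * Q)) b ->
  injective z -> (forall i, torus (z i)) -> (forall i, int_mult P Q (z i) (m i)) ->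
  syz P Q -> coef2 h (0%N, 0%N) != 0 -> (exists2 w, w \in suppl h & w != (0%N, 0%N)) ->
  nonparallel (h * P) (h * Q) ->
  exists C0, forall LL N d w0, (1, 0) \in LL -> (0, 1) \in LL -> bigat LL d w0 C0 ->
    boxed N (dadd (dadd d a) b) ->
    ((\sum_i m i).+1 + (cnt LL N (dadd d b) + cnt LL N (dadd d a)) <=
     cnt LL N (dadd (dadd d a) b) + cnt LL N d)%N.
Proof.
move=> P0 Q0 hn0 Pa Qb zi zt zm sPQ h0 hw npar.
have [e he] := supfun_ex hn0; have [a' Pa'] := supfun_ex P0; have [b' Qb'] := supfun_ex Q0.
have aE := supfun_uniq Pa (supfun_mul he Pa'); have bE := supfun_uniq Qb (supfun_mul he Qb').
pose th l := e l + a' l + b' l.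
have [G [GU Gt Gl Gh]] := curve_leaves h0 hw.
pose Th w := exists x y t, [/\ x \in suppl h, y \in suppl P, t \in suppl Q & w = wadd (wadd x y) t].
have [x0 x0h] := suppl_neq0 hn0; have [y0 y0P] := suppl_neq0 P0; have [t0 t0Q] := suppl_neq0 Q0.
have shift w1 w2 : (w1 \in suppl (h * P) /\ w2 \in suppl (h * P)) \/
    (w1 \in suppl (h * Q) /\ w2 \in suppl (h * Q)) -> exists s, Th (wadd w1 s) /\ Th (wadd w2 s).
  case=> -[/suppl_mul[x [y [xh yP ->]]] /suppl_mul[x' [y' [x'h y'P ->]]]].
    by exists t0; split; [exists x, y, t0|exists x', y', t0].
  exists y0; rewrite -!waddA ![wadd _ y0]waddC !waddA; split; first by exists x, y0, y.
  by exists x', y0, y'.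
(* If all exponents in [Th] gave comparable monomials, [nonparallel_bounded] would make their
   differences parallel, and [shift] carries this to the supports of h P and h Q. *)
have [w [w1 [Tw Tw1 ww1]]] : exists w w1, [/\ Th w, Th w1 & lo G (fun z => nC (mon w z)) (fun z => nC (mon w1 z))].
  apply: contrapT => nh.
  have cmp w w1 : Th w -> Th w1 -> comparable_mon G w1 w.
    move=> Tw Tw1; have [h1|//] := @lo_or R _ G GU (fun z => nC (mon w z)) (fun z => nC (mon w1 z)).
    by case: nh; exists w, w1.
  have [w1 [w2 [v1 [v2 [/shift[s [Tw1 Tw2]] /shift[s' [Tv1 Tv2]] /eqP ne]]]]] := npar.
  apply: ne; have := @nonparallel_bounded R G GU Gt _ _ _ _ Gl (cmp _ _ Tw2 Tw1) (cmp _ _ Tw1 Tw2)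
    (cmp _ _ Tv2 Tv1) (cmp _ _ Tv1 Tv2).
  by rewrite /wadd /= !PoszD => E; have := E; lia.
have Thb LL w' : Th w' -> regb LL th w'.
  move=> [x [y [t [xh yP tQ ->]]]]; apply/regbP => l _; rewrite !lfD /th.
  by have [A1 _] := he l; have [A2 _] := Pa' l; have [A3 _] := Qb' l; rewrite !lerD ?A1 ?A2 ?A3.
pose q i := sval (cid (zm i).1).
have qi i : loc_indep P Q (z i) (q i) by rewrite /q; case: cid.
have [C0 hC0] := ex_degle (fun i (k : 'I_(m i)) => q i k * \prod_(j | j != i) lin (z i) (z j) ^+ m j).
exists C0.+1 => LL N d wd l10 l01 bw bN.
have [u1 bu1] := bigat_add he bw; have [u2 bu2] := bigat_add Pa' bu1.
have [u3 [bu3 u31 u32]] := bigat_add Qb' bu2.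
have [r1 [br1 r11 r12]] : exists w', bigat LL (dadd (dadd d e) th) w' C0.+1.
  have [r1 b1] := bigat_add he (And3 bu3 u31 u32).
  exists r1; suff -> : dadd (dadd d e) th = dadd (dadd (dadd (dadd d e) a') b') e by [].
  by apply/funext => l; rewrite /dadd /th; ring.
have E1 : dadd (dadd (dadd d e) a') b' = dadd d th by apply/funext => l; rewrite /dadd /th; ring.
have E2 : dadd (dadd d a) b = dadd (dadd d e) th by apply/funext => l; rewrite aE bE /dadd /th; ring.
have E3 : dadd d a = dadd (dadd d e) a' by apply/funext => l; rewrite aE /dadd; ring.
have E4 : dadd d b = dadd (dadd d e) b' by apply/funext => l; rewrite bE /dadd; ring.
rewrite E2 in bN; rewrite E2 E3 E4.
have bN1 : boxed N (dadd (dadd (dadd d e) a') b').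
  apply: (boxed_add he); suff -> : dadd (dadd (dadd (dadd d e) a') b') e = dadd (dadd d e) th by [].
  by apply/funext => l; rewrite /dadd /th; ring.
have bN2 : boxed N (dadd d e) by apply: (boxed_add Pa'); exact: (boxed_add Qb' bN1).
have bN3 : boxed N d by exact: boxed_add he bN2.
have c1 : (\sum_i m i + 0 + (cnt LL N (dadd (dadd d e) b') + cnt LL N (dadd (dadd d e) a')) <=
    cnt LL N (dadd (dadd (dadd d e) a') b') + cnt LL N (dadd d e))%N.
  apply: (@local_count _ LL N (dadd d e) a' b' P Q n z m q 0 (fun=> 0) u3 C0) => //.
  - exact: boxedP.
  - exact: boxedP.
  - exact: supfun_exact.
  - by have [] := supfun_exact LL Qb'.
  - move=> p pC; apply: (@inD_Xm_degle _ _ _ _ C0) => // l lL.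
    by apply: le_trans (bu3 l lL); rewrite lerD2l lez_nat leq_mul2r leqnSn orbT.
  - by case.
  - by move=> ? ? ? ? ? ? ? ? [].
have rR : r1 \in Reg LL N (dadd (dadd d e) th).
  rewrite mem_Reg; have hr : regb LL (dadd (dadd d e) th) r1 by exact: bigat_regb (And3 br1 r11 r12).
  by rewrite hr; exact: boxedP bN _ hr.
have [wm wmR hwm] := @mon_argmax R G GU (Reg LL N (dadd (dadd d e) th)) r1 rR.
pose z0 (i : 'I_0) : C * C := (0, 0); pose m0 (i : 'I_0) := 0%N.
pose q0 (i : 'I_0) (k : 'I_(m0 i)) : {poly {poly C}} := 0.
have c2 : (\sum_(i < 0) m0 i + 1 + (cnt LL N (dadd d th) + cnt LL N (dadd d e)) <=
    cnt LL N (dadd (dadd d e) th) + cnt LL N d)%N.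
  apply: (@local_count _ LL N d e th h (Xm _ w) 0 z0 m0 q0 1 (fun=> Xm _ wm) r1 C0) => //;
    try by [case|case=> // x; case].
  - exact: boxedP.
  - exact: boxedP.
  - exact: supfun_exact.
  - by apply: inD_Xm; exact: Thb.
  - exact: syz_Xm.
  - move=> p pC; apply: (@inD_Xm_degle _ _ _ _ C0) => // l lL.
    by apply: le_trans (br1 l lL); rewrite lerD2l lez_nat leq_mul2r leqnSn orbT.
  - by move=> _; apply: inD_Xm; move: wmR; rewrite mem_Reg => /andP[].
  move=> c p u r pC ud rd; rewrite big_ord1 => e0 k.
  have -> : k = ord0 by apply: val_inj; case: k => -[].
  apply: (@inf_indep R G GU Gt Gl LL N d e th h (Xm _ w) (suppl h) [:: w1] _ _ _ _ _ r1 C0 wm _ p u r) => //.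
  - by have [] := supfun_exact LL he.
  - by move=> v; rewrite inE => /eqP->; exact: Thb.
  - move=> k0 k00; apply: filterS Gh => x ->; rewrite nC0 mulr_ge0 ?(ltW k00)//.
    by rewrite sumr_ge0// => ? _; exact: nC_ge0.
  - move=> k0 k00; apply: filterS (ww1 k0 k00) => x; by rewrite peval_Xm big_seq1.
  - exact: boxedP.
rewrite E1 addn0 in c1; rewrite big_ord0 add0n in c2.
by move: c1 c2; clear; lia.
Qed.

(** The hypothesis bounds mixed second differences below by [K], and these telescope over an n by n
    grid. *)
Lemma telescope2 (c : nat -> nat -> nat) K n :
  (forall i j, (i < n)%N -> (j < n)%N -> (K + (c i j.+1 + c i.+1 j) <= c i.+1 j.+1 + c i j)%N) ->
  (K * n ^ 2 + c n 0%N + c 0%N n <= c n n + c 0%N 0%N)%N.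
Proof.
move=> h; have row i j : (i < n)%N -> (j <= n)%N -> (K * j + c i j + c i.+1 0%N <= c i.+1 j + c i 0%N)%N.
  move=> i_n; elim: j => [|j IH] jn; first by rewrite muln0 add0n addnC.
  by have := IH (ltnW jn); have := h i j i_n jn; rewrite mulnS; lia.
suff H i : (i <= n)%N -> (K * (i * n) + c i 0%N + c 0%N n <= c i n + c 0%N 0%N)%N by have := H n (leqnn n); rewrite mulnn.
elim: i => [|i IH] i_n; first by rewrite mul0n muln0 add0n addnC.
have := IH (ltnW i_n); have := row i n i_n (leqnn n); rewrite mulSn mulnDr; lia.
Qed.

(** Summed over the grid d + i a + j b, the step counts yield (V + 1) n^2 lattice points, so the
    mixed volume would be at least V + 1. A gcd that is not constant is treated by [step_common], as
    the Koszul count needs coprime polynomials. *)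
Theorem nondegenerate P Q (F : set_system (C * C)) : UltraFilter F ->
  P != 0 -> Q != 0 -> coef2 P (0%N, 0%N) != 0 -> nonparallel P Q ->
  isolated_count P Q (mixed_volume R (supp P) (supp Q)) ->
  F (fun z => torus z) -> leaves F ->
  lo F (fun z => nC (peval P z)) (Mx P) -> lo F (fun z => nC (peval Q z)) (Mx Q) -> False.
Proof.
move=> FU P0 Q0 P00 npar [s [m [us hs hm MV]]] Ft Fl FP FQ.
pose z (i : 'I_(size s)) := nth (0, 0) s i.
have zi : injective z by move=> i j /eqP; rewrite nth_uniq// => /eqP/val_inj.
have zs i : z i \in s by exact: mem_nth.
have zt i : torus (z i) by have /hs[] := zs i.
have zm i : int_mult P Q (z i) (m (z i)) by apply: hm.
pose V := (\sum_i m (z i))%N.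
have VE : (\sum_(z <- s) m z)%N = V by rewrite (big_nth (0, 0)) big_mkord.
rewrite VE in MV.
have [a Pa] := supfun_ex P0; have [b Qb] := supfun_ex Q0.
have [C0 step] : exists C0, forall LL N d w0, (1, 0) \in LL -> (0, 1) \in LL -> bigat LL d w0 C0 ->
    boxed N (dadd (dadd d a) b) ->
    (V.+1 + (cnt LL N (dadd d b) + cnt LL N (dadd d a)) <=
     cnt LL N (dadd (dadd d a) b) + cnt LL N d)%N.
  have [h [P' [Q' [eP eQ sPQ]]]] := gcd_syz P0 Q0.
  have h0 : coef2 h (0%N, 0%N) != 0.
    by move: P00; rewrite eP !coef2_00 pevalM mulf_eq0 negb_or => /andP[].
  have hn0 : h != 0 by apply: contraNneq h0 => ->; rewrite coef20.
  have P'0 : P' != 0 by apply: contraNneq P0 => e; rewrite eP e mulr0.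
  have Q'0 : Q' != 0 by apply: contraNneq Q0 => e; rewrite eQ e mulr0.
  have [hw|hc] := pselect (exists2 w, w \in suppl h & w != (0%N, 0%N)).
    apply: (@step_common h P' Q' a b _ z) => //; rewrite -?eP -?eQ//.
    by move=> i; exact: int_mult_factor (zm i) eP eQ.
  apply: (@step_coprime _ P Q a b Pa Qb _ z _ zi zt zm F) => //.
  pose c := coef2 h (0%N, 0%N).
  have hE : h = c%:P%:P.
    by apply: poly2_constant => w wh; apply: contrapT => /eqP nw; apply: hc; exists w.
  have cc := polyCC_mulVf h0; rewrite -/c in cc.
  move=> u r e; have [|d [ud rd]] := sPQ u r.
    by apply: (mulfI hn0); rewrite mulrCA -eP e eQ mulrCA.
  exists (c^-1%:P%:P * d).
  have key T : c^-1%:P%:P * d * (h * T) = d * T.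
    by rewrite hE (mulrACA c^-1%:P%:P) cc mul1r.
  by rewrite eP eQ !key.
have := @mixed_volume_lower R (suppl P) (suppl Q) a b V V.+1 Pa Qb.
have -> : [set w | w \in suppl P] = supp P by apply/seteqP; split=> w; rewrite /= suppP.
have -> : [set w | w \in suppl Q] = supp Q by apply/seteqP; split=> w; rewrite /= suppP.
suff H : forall k, (0 < k)%N -> exists M Cst, (0 < Cst)%N /\ forall n, exists N,
    [/\ forall w, regb (LLm k) (dadd (dshift M Cst) (dscale n a)) w -> (w.1 < N)%N && (w.2 < N)%N,
        forall w, regb (LLm k) (dadd (dshift M Cst) (dscale n b)) w -> (w.1 < N)%N && (w.2 < N)%N &
        (V.+1 * n ^ 2 + cnt (LLm k) N (dadd (dshift M Cst) (dscale n a)) +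
           cnt (LLm k) N (dadd (dshift M Cst) (dscale n b)) <=
         cnt (LLm k) N (dadd (dshift M Cst) (dscale n (fun l => (a l + b l)%R))) +
           cnt (LLm k) N (dshift M Cst))%N].
  by move=> /(_ (esym MV) H); rewrite ltnn.
(* The exponent (1, 1) then has the margin [C0] required by the step counts; the successor makes the
   thickening positive. *)
move=> k k0; exists 1%N, C0.+1; split => // n.
have l10 : (1, 0) \in LLm k by rewrite mem_LLm /= k0.
have l01 : (0, 1) \in LLm k by rewrite mem_LLm /= k0.
pose D i j := dadd (dadd (dshift 1 C0.+1) (dscale i a)) (dscale j b).
have D0 i : D i 0%N = dadd (dshift 1 C0.+1) (dscale i a).
  by apply/funext => l; rewrite /D /dadd /dscale mul0r addr0.
have D0' j : D 0%N j = dadd (dshift 1 C0.+1) (dscale j b).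
  by apply/funext => l; rewrite /D /dadd /dscale mul0r addr0.
have D00 : D 0%N 0%N = dshift 1 C0.+1.
  by apply/funext => l; rewrite /D /dadd /dscale !mul0r !addr0.
have Dnn : D n n = dadd (dshift 1 C0.+1) (dscale n (fun l => (a l + b l)%R)).
  by apply/funext => l; rewrite /D /dadd /dscale mulrDr addrA.
have Da i j : D i.+1 j = dadd (D i j) a.
  by apply/funext => l; rewrite /D /dadd /dscale -(addn1 i) PoszD mulrDl mul1r; ring.
have Db i j : D i j.+1 = dadd (D i j) b.
  by apply/funext => l; rewrite /D /dadd /dscale -(addn1 j) PoszD mulrDl mul1r addrA.
have big i j : exists w, bigat (LLm k) (D i j) w C0.
  elim: j => [|j [w hw]]; last by rewrite Db; exact: bigat_add Qb hw.
  elim: i => [|i [w hw]]; last by rewrite Da; exact: bigat_add Pa hw.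
  exists (1%N, 1%N); rewrite D00; split => // l _; rewrite /dshift lerD2l lez_nat.
  by rewrite leq_mul2r leqnSn orbT.
pose N := (`|(D n n (1, 0))%R|%N + `|(D n n (0, 1))%R|%N).+1.
have bx i j : (i <= n)%N -> (j <= n)%N -> boxed N (D i j).
  move=> hi hj; have [a1 a2] := supfun_ge0 Pa; have [b1 b2] := supfun_ge0 Qb.
  have m1 : D i j (1, 0) <= D n n (1, 0).
    by rewrite /D /dadd /dscale !lerD// ler_wpM2r// lez_nat.
  have m2 : D i j (0, 1) <= D n n (0, 1).
    by rewrite /D /dadd /dscale !lerD// ler_wpM2r// lez_nat.
  split; [apply: le_lt_trans m1 _|apply: le_lt_trans m2 _]; rewrite /N; lia.
exists N; rewrite -Dnn -D0 -D0' -D00; split.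
- by apply: boxedP => //; exact: bx.
- by apply: boxedP => //; exact: bx.
apply: (@telescope2 (fun i j => cnt (LLm k) N (D i j))) => i j i_n j_n.
have [w hw] := big i j.
have := step (LLm k) N (D i j) w l10 l01 hw; rewrite -Da -Db -Db; apply.
exact: bx.
Qed.

End Nondegenerate.

(** * The logarithmic Jacobian along a face at infinity *)

Section LogJacobian.
Variable R : realType.
Local Notation C := (R[i]).
Implicit Types (P Q J : {poly {poly C}}) (w v u : nat * nat).

Definition detw w v : int := (w.1)%:Z * (v.2)%:Z - (w.2)%:Z * (v.1)%:Z.

Lemma detw_cramer w1 w0 w2 : detw w1 w0 != 0 -> detw w1 w2 = detw w1 w0 -> detw w0 w2 = 0 -> w2 = w0.
Proof.
case: w1 w0 w2 => a b [c d] [e f]; rewrite /detw /= => D e1 e2.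
have h1 : (a%:Z * d%:Z - b%:Z * c%:Z) * (e%:Z - c%:Z) = 0.
  rewrite mulrBr -{2}e1; transitivity (- a%:Z * (c%:Z * f%:Z - d%:Z * e%:Z)); first by ring.
  by rewrite e2 mulr0.
have h2 : (a%:Z * d%:Z - b%:Z * c%:Z) * (f%:Z - d%:Z) = 0.
  rewrite mulrBr -{2}e1; transitivity (- b%:Z * (c%:Z * f%:Z - d%:Z * e%:Z)); first by ring.
  by rewrite e2 mulr0.
move/eqP: h1; move/eqP: h2; rewrite !mulf_eq0 (negbTE D) /= !subr_eq0 !eqz_nat.
by move=> /eqP-> /eqP->.
Qed.

(** This is x1 x2 times the Jacobian ([logjac_jacdet]); in this form each pair of terms carries the
    determinant of its exponents. *)
Definition logjac P Q : {poly {poly C}} := \sum_(w <- suppl P) \sum_(v <- suppl Q)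
  ((detw w v)%:~R * coef2 P w * coef2 Q v)%:P%:P * Xm _ (wadd w v).

Lemma coef2_comb (s : seq (nat * nat)) (e : nat * nat -> C) u : uniq s ->
  coef2 (\sum_(w <- s) (e w)%:P%:P * Xm _ w) u = (u \in s)%:R * e u.
Proof.
move=> us; rewrite coef2_sum; under eq_bigr do rewrite coef2Cmul coef2_Xm.
have [us'|us'] := boolP (u \in s); last first.
  rewrite mul0r big_seq big1// => w ws; case: eqP => [e0|]; rewrite ?mulr0//.
  by rewrite -e0 (negbTE us') in ws.
rewrite (bigD1_seq u)//= eqxx mulr1 mul1r big1 ?addr0// => w wu.
by rewrite eq_sym (negbTE wu) mulr0.
Qed.

Lemma coef2_comb_mul (s t : seq (nat * nat)) (e g : nat * nat -> C) u :
  coef2 ((\sum_(w <- s) (e w)%:P%:P * Xm _ w) * (\sum_(v <- t) (g v)%:P%:P * Xm _ v)) u =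
  \sum_(w <- s) \sum_(v <- t) e w * g v * (wadd w v == u)%:R.
Proof.
rewrite mulr_suml coef2_sum; apply: eq_bigr => w _; rewrite mulr_sumr coef2_sum.
apply: eq_bigr => v _; rewrite mulrACA -XmD -!polyCM coef2Cmul coef2_Xm eq_sym.
by [].
Qed.

Lemma logjacE P Q (x1 : {poly {poly C}} := 'X) (x2 : {poly {poly C}} := 'X%:P) :
  logjac P Q = (x1 * pd1 P) * (x2 * pd2 Q) - (x2 * pd2 P) * (x1 * pd1 Q).
Proof.
have e1 T : x1 * pd1 T = \sum_(w <- suppl T) ((w.1)%:R * coef2 T w)%:P%:P * Xm _ w.
  apply: eq_coef2 => u; rewrite coef2_comb ?suppl_uniq// mem_suppl coef2E /x1 coefXM.
  case: u => -[|i] j /=; first by rewrite coef0 mul0r mulr0.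
  rewrite /pd1 coef_deriv coefMn /coef2 /=.
  by case: eqP => [->|_]; rewrite ?mul0rn ?mulr0 ?mul1r ?mulr_natl.
have e2 T : x2 * pd2 T = \sum_(w <- suppl T) ((w.2)%:R * coef2 T w)%:P%:P * Xm _ w.
  apply: eq_coef2 => u; rewrite coef2_comb ?suppl_uniq// mem_suppl coef2E /x2 coefCM coefXM.
  case: u => i [|j] /=; first by rewrite mul0r mulr0.
  rewrite /pd2 coef_map_id0 ?raddf0// coef_deriv -[LHS]mulr_natl /coef2 /=.
  by case: eqP => [->|_]; rewrite ?mulr0 ?mul0r ?mul1r.
apply: eq_coef2 => u; rewrite coef2D coef2N !e1 !e2 !coef2_comb_mul.
rewrite coef2_sum -sumrB; apply: eq_bigr => w _; rewrite coef2_sum -sumrB.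
apply: eq_bigr => v _; rewrite coef2Cmul coef2_Xm eq_sym /detw rmorphB !rmorphM /=.
by rewrite -!pmulrn; ring.
Qed.

Lemma logjac_jacdet (f : pmap2 R) : Xm _ (1%N, 1%N) * jacdet f = logjac f.1 f.2.
Proof.
rewrite logjacE /jacdet /Xm !expr1 mulrBr.
set x := 'X%:P; set a := pd1 _; set b := pd2 _; set c := pd2 _; set d := pd1 _.
ring.
Qed.

Lemma logjacC P Q : logjac Q P = - logjac P Q.
Proof. by rewrite !logjacE opprB mulrC [X in _ - X]mulrC. Qed.

Section Face.
Variable F : set_system (C * C).
Context {FU : UltraFilter F}.
Hypothesis Ft : F (fun z => torus z).
Variables (P Q J : {poly {poly C}}) (eps y : C).
Hypothesis P0 : coef2 P (0%N, 0%N) != 0.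
Hypothesis Q0 : coef2 Q (0%N, 0%N) != 0.
Hypothesis eps0 : eps != 0.
Hypothesis JE : Xm _ (1%N, 1%N) * J = eps%:P%:P * logjac P Q.
Hypothesis Py : ulim F (peval P) y.
Hypothesis yP : y != coef2 P (0%N, 0%N).
Hypothesis Qb : lO F (fun z => nC (peval Q z)) (fun=> 1).
Hypothesis MP : lO F (Mx P) (fun=> 1).
Hypothesis MQ : lo F (fun=> 1) (Mx Q).

Let mn w z : R := nC (mon w z).
Let mn_ge0 w z : 0 <= mn w z. Proof. exact: nC_ge0. Qed.
Let mn_gt0 w : F (fun z => 0 < mn w z).
Proof. by apply: filterS Ft => z; exact: nC_mon_gt0. Qed.

Lemma unbounded_leaves w0 : lo F (fun=> 1) (mn w0) -> leaves F.
Proof.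
move=> h B; apply: contrapT => /uf_not nB.
pose K := expR ((w0.1 + w0.2)%:R * `|B|).
have K1 : 0 < (2 * K)^-1 by rewrite invr_gt0 mulr_gt0 ?expR_gt0.
apply: (@uf_absurd _ F FU); apply: filterS3 nB (h _ K1) Ft => z /negP; rewrite -ltNge => zB.
rewrite mulrC ler_pdivlMr ?mulr_gt0 ?expR_gt0// mul1r => hK tz.
have : mn w0 z <= K.
  rewrite /K -[leLHS]lnK ?posrE ?nC_mon_gt0// ler_expR ln_mon// natrD mulrDl.
  have nB2 : lsize z <= `|B| by apply: le_trans (ltW zB) (ler_norm _).
  apply: lerD; rewrite ler_wpM2l// (le_trans (ler_norm _))// (le_trans _ nB2)// /lsize.
    by rewrite lerDl.
  by rewrite lerDr.
have := expR_gt0 ((w0.1 + w0.2)%:R * `|B|); rewrite -/K; lra.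
Qed.

(** The monomials of [P] tend to [lam], those of [Q] over the largest one [w0] tend to [mu], and
    boundedness of [Q] gives sum c_v mu_v = 0. By [nonparallel_bounded], detw w v does not depend on
    v among the v with mu v nonzero; so the log-Jacobian over mon w0 tends to a product containing
    this sum, that is to 0, although it has a monomial at least of the size of mon w0. *)
Lemma face_degenerate : [/\ leaves F, nonparallel Q J, J != 0 & lo F (fun z => nC (peval J z)) (Mx J)].
Proof.
have Q0s : (0%N, 0%N) \in suppl Q by rewrite mem_suppl.
have P0s : (0%N, 0%N) \in suppl P by rewrite mem_suppl.
have [w0 w0Q hw0] := @mon_argmax R F FU (suppl Q) _ Q0s.
have Qw0 : lO F (Mx Q) (mn w0).
  by apply: lO_sum => // v vQ; apply: lO_lev; exact: hw0.
have w0big : lo F (fun=> 1) (mn w0) by exact: lo_lO_trans MQ Qw0.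
have Fl := unbounded_leaves w0big.
have [lam hlam] : exists lam : nat * nat -> C, forall w, w \in suppl P -> ulim F (mon w) (lam w).
  suff h w : exists l, w \in suppl P -> ulim F (mon w) l.
    by exists (fun w => sval (cid (h w))) => w; case: cid.
  have [wP|] := boolP (w \in suppl P); last by exists 0.
  have [|l hl] := @ulim_ex R _ F FU (mon w); last by exists l.
  by apply: lO_trans MP; apply: lO_le => z; exact: Mx_ge.
have [mu hmu] : exists mu : nat * nat -> C, forall v, v \in suppl Q -> ulim F (fun z => mon v z / mon w0 z) (mu v).
  suff h v : exists l, v \in suppl Q -> ulim F (fun z => mon v z / mon w0 z) l.
    by exists (fun w => sval (cid (h w))) => w; case: cid.
  have [vQ|] := boolP (v \in suppl Q); last by exists 0.
  have [|l hl] := @ulim_ex R _ F FU (fun z => mon v z / mon w0 z); last by exists l.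
  apply: lO_lev; apply: filterS2 (hw0 v vQ) Ft => z h tz.
  by rewrite nCM nCV ler_pdivrMr ?mul1r ?nC_mon_gt0.
have smu : \sum_(v <- suppl Q) coef2 Q v * mu v = 0.
  apply: (@ulim_uniq R _ F FU (fun z => peval Q z / mon w0 z)).
    apply: (@ulim_ext R _ F FU (fun z => \sum_(v <- suppl Q) (if v \in suppl Q then coef2 Q v * (mon v z / mon w0 z) else 0))).
      apply: ufT => z; rewrite peval_suppl mulr_suml big_seq [RHS]big_seq; apply: eq_bigr => v ->.
      by rewrite mulrA.
    rewrite big_seq -[X in ulim F _ X]/(_); rewrite big_mkcond /=.
    apply: ulim_sum => v; case: ifP => [vQ|_]; last exact: ulim_cst.
    by apply: ulimM (hmu v vQ); exact: ulim_cst.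
  apply/ulim0P; apply: (@lO_lo_trans _ _ F FU (fun z => 1 * (mn w0 z)^-1)).
    have [K K0 hK] := Qb; exists K => //; apply: filterS2 hK Ft => z h tz.
    by rewrite nCM nCV mul1r mulr1 in h *; rewrite ler_wpM2r// invr_ge0.
  move=> k k0; apply: filterS2 (w0big k k0) (mn_gt0 w0) => z h p.
  by rewrite mul1r mulr1 -[leLHS]mul1r ler_pdivrMr.
have cP w : w \in suppl P -> lam w != 0 -> comparable_mon F w (0%N, 0%N) /\ comparable_mon F (0%N, 0%N) w.
  move=> wP lw; split; rewrite /comparable_mon.
    by apply: lO_trans (ulim_lO (hlam w wP)) _; apply: lO_le => z; rewrite mon0 nC1.
  by apply: lO_trans _ (ulim_neq0 (hlam w wP) lw); apply: lO_le => z; rewrite mon0 nC1.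
have cQ v : v \in suppl Q -> mu v != 0 -> comparable_mon F v w0 /\ comparable_mon F w0 v.
  move=> vQ mv; split; first by apply: lO_lev; exact: hw0.
  have [K K0 h] := ulim_neq0 (hmu v vQ) mv; exists K => //.
  apply: filterS2 h Ft => z h tz; move: h; rewrite nCM nCV mulrA ler_pdivlMr ?mul1r//.
  exact: nC_mon_gt0.
have detE w v : w \in suppl P -> lam w != 0 -> v \in suppl Q -> mu v != 0 -> detw w v = detw w w0.
  move=> wP lw vQ mv; have [a1 a2] := cP w wP lw; have [b1 b2] := cQ v vQ mv.
  have := @nonparallel_bounded R F FU Ft _ _ _ _ Fl a1 a2 b1 b2; rewrite /= /detw; clear; lia.
(* If only the constant term survived, [P] would tend to it, against [yP]. *)
have [w1 [w1P lw1 w10]] : exists w, [/\ w \in suppl P, lam w != 0 & w != (0%N, 0%N)].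
  apply: contrapT => nh; move/negP: yP; apply; apply/eqP.
  apply: (@ulim_uniq R _ F FU (peval P)) => //.
  apply: (@ulim_ext R _ F FU (fun z => \sum_(w <- suppl P) (if w \in suppl P then coef2 P w * mon w z else 0))).
    by apply: ufT => z; rewrite peval_suppl big_seq [RHS]big_seq; apply: eq_bigr => v ->.
  have -> : coef2 P (0%N, 0%N) = \sum_(w <- suppl P) (if w \in suppl P then coef2 P w * lam w else 0).
    rewrite (bigD1_seq _ P0s (suppl_uniq _)) /= P0s big_seq_cond big1 ?addr0 => [|w /andP[wP wn]].
      have -> : lam (0%N, 0%N) = 1; last by rewrite mulr1.
      apply: (@ulim_uniq R _ F FU (mon (0%N, 0%N))); first exact: hlam.
      by apply: ulim_ext (ulim_cst 1); apply: ufT => z; rewrite mon0.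
    have [lw|lw] := eqVneq (lam w) 0; first by rewrite lw mulr0 if_same.
    by case: nh; exists w.
  apply: ulim_sum => w; case: ifP => [wP|_]; last exact: ulim_cst.
  by apply: ulimM (hlam w wP); exact: ulim_cst.
(* If [w0] were parallel to [w1], a positive power of the unbounded mon w0 would be a power of the
   bounded mon w1. *)
have det1 : detw w1 w0 != 0.
  apply/eqP => d0; have [a1 a2] := cP w1 w1P lw1.
  have dN : (w1.1 * w0.2 = w1.2 * w0.1)%N.
    by apply/eqP; move/eqP: d0; rewrite /detw subr_eq0 -!PoszM eqz_nat.
  have E (z : C * C) : mon w1 z ^+ w0.1 = mon w0 z ^+ w1.1.
    rewrite /mon !exprMn -!exprM [(w0.1 * w1.1)%N]mulnC; congr (_ * z.2 ^+ _).
    by rewrite -dN mulnC.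
  have E' (z : C * C) : mon w1 z ^+ w0.2 = mon w0 z ^+ w1.2.
    rewrite /mon !exprMn -!exprM [(w0.2 * w1.2)%N]mulnC; congr (z.1 ^+ _ * _).
    by rewrite dN mulnC.
  have bd n : (0 < n)%N -> lO F (fun z => mn w0 z ^+ n) (fun=> 1) -> False.
    move=> n0 h; apply: (lo_irr w0big); last by apply: ufT.
    by apply: (lO_root n0) => //; apply: lO_trans h _; apply: lO_le => z; rewrite expr1n.
  have b1 k : lO F (fun z => mn w1 z ^+ k) (fun=> 1).
    apply: lO_trans (lO_exp k (mn_ge0 w1) a1) _; apply: lO_le => z.
    by rewrite mon0 nC1 expr1n.
  have [h1|h1] := posnP w1.1; last first.
    by apply: (bd _ h1); apply: lO_trans (b1 w0.1); apply: lO_le => z; rewrite /mn -!nCX E.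
  have h2 : (0 < w1.2)%N.
    by rewrite lt0n; apply: contra w10 => /eqP h2; apply/eqP; case: (w1) h1 h2 => a b /= -> ->.
  by apply: (bd _ h2); apply: lO_trans (b1 w0.2); apply: lO_le => z; rewrite /mn -!nCX E'.
have mw0 : mu w0 != 0.
  suff -> : mu w0 = 1 by exact: oner_neq0.
  apply: (@ulim_uniq R _ F FU (fun z => mon w0 z / mon w0 z)); first exact: hmu.
  by apply: ulim_ext (ulim_cst 1); apply: filterS Ft => z tz; rewrite divff ?mon_neq0.
(* [Df] and [Qf] collect the terms that survive in the limit. Any exponent [u] of their nonzero
   product has the same coefficient in [logjac P Q], because pairs with a vanishing limit give
   monomials smaller than mon w0. *)
pose Df := \sum_(w <- suppl P) ((lam w != 0)%:R * (detw w w0)%:~R * coef2 P w)%:P%:P * Xm R w.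
pose Qf := \sum_(v <- suppl Q) ((mu v != 0)%:R * coef2 Q v)%:P%:P * Xm R v.
have Df0 : Df != 0.
  apply/eqP => /(congr1 (fun p => coef2 p w1)); rewrite coef2_comb ?suppl_uniq// w1P lw1 coef20.
  by rewrite !mul1r => /eqP; rewrite mulf_eq0 intr_eq0 (negbTE det1) -[_ == 0]negbK -mem_suppl w1P.
have Qf0 : Qf != 0.
  apply/eqP => /(congr1 (fun p => coef2 p w0)); rewrite coef2_comb ?suppl_uniq// w0Q mw0 coef20.
  by rewrite !mul1r => /eqP; rewrite -[_ == 0]negbK -mem_suppl w0Q.
have [u uD] := suppl_neq0 (mulf_neq0 Df0 Qf0).
have uw0 : lO F (mn w0) (mn u).
  have [w [v [wP vQ uE lw mv]]] : exists w v, [/\ w \in suppl P, v \in suppl Q, u = wadd w v, lam w != 0 & mu v != 0].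
    apply: contrapT => nh; move: uD; rewrite mem_suppl coef2_comb_mul big_seq big1 ?eqxx// => w wP.
    rewrite big_seq big1// => v vQ.
    have [lw|lw] := eqVneq (lam w) 0; first by rewrite !mul0r.
    have [mv|mv] := eqVneq (mu v) 0; first by rewrite mul0r mulr0 mul0r.
    case: eqP => [e|_]; last by rewrite mulr0.
    by case: nh; exists w, v; split.
  have [a1 a2] := cP w wP lw; have [b1 b2] := cQ v vQ mv.
  apply: (@lO_trans _ _ F FU (fun z => mn (0%N, 0%N) z * mn w0 z)).
    by apply: lO_le => z; rewrite /mn mon0 nC1 mul1r.
  apply: lO_trans (lO_mul (mn_ge0 _) (mn_ge0 _) a2 b2) _; apply: lO_le => z.
  by rewrite uE /mn monD nCM.
have cu : coef2 (logjac P Q) u != 0.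
  suff -> : coef2 (logjac P Q) u = coef2 (Df * Qf) u by rewrite -mem_suppl.
  rewrite coef2_comb_mul coef2_sum big_seq [RHS]big_seq; apply: eq_bigr => w wP.
  rewrite coef2_sum big_seq [RHS]big_seq; apply: eq_bigr => v vQ.
  rewrite coef2Cmul coef2_Xm eq_sym; case: eqP => [uE|_]; last by rewrite !mulr0.
  have lw : lam w != 0.
    apply/eqP => l0; apply: (@lo_irr _ _ F FU (mn u) (mn w0)) => //.
    apply: (@lO_lo_trans _ _ F FU (fun z => mn w z * mn v z)).
      by apply: lO_le => z; rewrite -uE /mn monD nCM.
    apply: (@lo_lO_trans _ _ F FU (fun z => 1 * mn w0 z)); last by apply: lO_le => z; rewrite mul1r.
    apply: lo_mulr => //; first by apply/ulim0P; rewrite -l0; exact: hlam.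
    by apply: lO_lev; exact: hw0.
  have mv : mu v != 0.
    apply/eqP => l0; apply: (@lo_irr _ _ F FU (mn u) (mn w0)) => //.
    apply: (@lO_lo_trans _ _ F FU (fun z => mn w z * mn v z)).
      by apply: lO_le => z; rewrite -uE /mn monD nCM.
    apply: (@lo_lO_trans _ _ F FU (fun z => 1 * mn w0 z)); last by apply: lO_le => z; rewrite mul1r.
    apply: lo_mull => //; first exact: ulim_lO (hlam w wP).
    move=> k k0; have /ulim0P hm : ulim F (fun z => mon v z / mon w0 z) 0 by rewrite -l0; exact: hmu.
    apply: filterS2 (hm k k0) Ft => z h tz; move: h; rewrite mulr1 nCM nCV ler_pdivrMr//.
    exact: nC_mon_gt0.
  by rewrite lw mv (detE _ _ wP lw vQ mv) !mul1r mulr1; ring.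
have [u' u'J uE] : exists2 u', u' \in suppl J & u = wadd (1%N, 1%N) u'.
  have : u \in suppl (Xm _ (1%N, 1%N) * J) by rewrite JE mem_suppl coef2Cmul mulf_neq0.
  by move=> /suppl_mul[v [u' [+ u'J ->]]]; rewrite suppl_Xm inE => /eqP->; exists u'.
have J0 : J != 0 by apply: contraTneq u'J => ->; rewrite mem_suppl coef20 eqxx.
have LJ : lo F (fun z => nC (peval (logjac P Q) z)) (mn w0).
  have : ulim F (fun z => \sum_(w <- suppl P) \sum_(v <- suppl Q)
      (if (w \in suppl P) && (v \in suppl Q) then (detw w v)%:~R * coef2 P w * coef2 Q v * (mon w z * (mon v z / mon w0 z)) else 0))
     (\sum_(w <- suppl P) \sum_(v <- suppl Q)
      (if (w \in suppl P) && (v \in suppl Q) then (detw w v)%:~R * coef2 P w * coef2 Q v * (lam w * mu v) else 0)).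
    apply: ulim_sum => w; apply: ulim_sum => v; case: ifP => [/andP[wP vQ]|_]; last exact: ulim_cst.
    apply: ulimM; first exact: ulim_cst.
    by apply: ulimM (hmu v vQ); exact: hlam.
  have -> : \sum_(w <- suppl P) \sum_(v <- suppl Q)
      (if (w \in suppl P) && (v \in suppl Q) then (detw w v)%:~R * coef2 P w * coef2 Q v * (lam w * mu v) else 0) = 0.
    rewrite big_seq big1// => w wP.
    rewrite (_ : \sum_(v <- _) _ = ((detw w w0)%:~R * coef2 P w * lam w) * \sum_(v <- suppl Q) coef2 Q v * mu v).
      by rewrite smu mulr0.
    rewrite mulr_sumr big_seq [RHS]big_seq; apply: eq_bigr => v vQ; rewrite wP vQ /=.
    have [lw|lw] := eqVneq (lam w) 0; first by rewrite lw !(mul0r, mulr0).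
    have [mv|mv] := eqVneq (mu v) 0; first by rewrite mv !(mul0r, mulr0).
    by rewrite (detE _ _ wP lw vQ mv); ring.
  move=> /ulim0P h k k0; apply: filterS2 (h k k0) Ft => z {}h tz.
  rewrite -ler_pdivrMr ?nC_mon_gt0//; move: h; rewrite mulr1 /mn -nCV -nCM; apply: le_trans.
  rewrite /logjac peval_sum mulr_suml le_eqVlt; apply/orP; left; apply/eqP; congr nC.
  rewrite big_seq [RHS]big_seq; apply: eq_bigr => w wP.
  rewrite peval_sum mulr_suml big_seq [RHS]big_seq; apply: eq_bigr => v vQ.
  by rewrite wP vQ /= pevalM pevalC peval_Xm monD !mulrA.
split => //.
  have [w2 [w2Q w20 mw2]] : exists v, [/\ v \in suppl Q, v != w0 & mu v != 0].
    apply: contrapT => nh; move: smu; rewrite (bigD1_seq _ w0Q (suppl_uniq _)) /= big_seq_cond big1.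
      by rewrite addr0 => /eqP; rewrite mulf_eq0 (negbTE mw0) orbF -[_ == 0]negbK -mem_suppl w0Q.
    move=> v /andP[vQ vw0]; have [->|mv] := eqVneq (mu v) 0; first by rewrite mulr0.
    by case: nh; exists v.
  exists w0, (0%N, 0%N), w2, (0%N, 0%N); split; [by left|by left|].
  have e1 := detE _ _ w1P lw1 w2Q mw2; apply/eqP => e2.
  move/eqP: w20; apply; apply: (detw_cramer det1 e1); move: e2; rewrite /detw /= !subr0 => ->.
  by rewrite subrr.
move=> k k0; have [K K0 hK] := uw0.
have k1 : 0 < k / (K * nC eps) by rewrite divr_gt0// mulr_gt0// nC_gt0.
apply: filterS3 (LJ _ k1) hK Ft => z h1 h2 tz.
have p11 : 0 < nC (mon (1%N, 1%N) z) by exact: nC_mon_gt0.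
rewrite -(ler_pM2l p11) -nCM -peval_Xm -pevalM JE pevalM pevalC nCM.
apply: le_trans (ler_wpM2l (nC_ge0 _) h1) _.
have h3 : mn w0 z <= K * (nC (mon (1%N, 1%N) z) * Mx J z).
  apply: le_trans h2 _; rewrite ler_wpM2l ?(ltW K0)// uE /mn monD nCM ler_wpM2l ?nC_ge0//.
  exact: Mx_ge.
apply: le_trans (_ : nC eps * (k / (K * nC eps) * (K * (nC (mon (1%N, 1%N) z) * Mx J z))) <= _).
  by rewrite ler_wpM2l ?nC_ge0// ler_wpM2l// ltW.
have e0 : nC eps != 0 by rewrite nC_eq0.
rewrite le_eqVlt; apply/orP; left; apply/eqP; rewrite peval_Xm; field.
by rewrite e0 lt0r_neq0.
Qed.
End Face.
End LogJacobian.

(** * Finitely many asymptotic values along a curve *)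

Section RootLimits.
Variables (R : realType) (T : Type) (F : set_system T).
Context {FU : UltraFilter F}.
Local Notation C := (R[i]).

Lemma lo_prod_factor (I : eqType) (s : seq I) (u : I -> T -> R) : (forall i x, 0 <= u i x) ->
  lo F (fun x => \prod_(i <- s) u i x) (fun=> 1) -> exists2 i, i \in s & lo F (u i) (fun=> 1).
Proof.
move=> u0; elim: s => [|a s IH] h.
  exfalso; apply: (@lo_irr _ _ F FU (fun=> 1) (fun=> 1)); last by apply: ufT.
    by move=> k k0; apply: filterS (h k k0) => x; rewrite big_nil.
  exact: lO_refl.
have [ha|[K K0 hK]] := @lo_or _ _ F FU (u a) (fun=> 1); first by exists a; rewrite ?mem_head.
have [|i is_ hi] := IH; last by exists i => //; rewrite inE is_ orbT.
move=> k k0; have k1 : 0 < k / K by rewrite divr_gt0.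
apply: filterS2 (h _ k1) hK => x; rewrite big_cons !mulr1 => h1 h2.
have p0 : 0 <= \prod_(j <- s) u j x by apply: prodr_ge0.
rewrite -[leLHS]mul1r; apply: le_trans (ler_wpM2r p0 h2) _.
by rewrite -mulrA mulrC -ler_pdivlMr.
Qed.

Lemma ulim_root (q : {poly C}) (u : T -> C) : q != 0 -> ulim F (fun x => q.[u x]) 0 ->
  exists2 r, q.[r] = 0 & ulim F u r.
Proof.
move=> q0 /ulim0P h.
have [r rq hr] : exists2 r, r \in rootsC q & lo F (fun x => nC (u x - r)) (fun=> 1).
  apply: (@lo_prod_factor _ _ (fun r x => nC (u x - r))) => [i x|k k0]; first exact: nC_ge0.
  have l0 : 0 < nC (lead_coef q) by rewrite nC_gt0 lead_coef_eq0.
  have k1 : 0 < nC (lead_coef q) * k by rewrite mulr_gt0.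
  apply: filterS (h _ k1) => x; rewrite !mulr1 horner_rootsC nCM ler_pM2l//.
  by rewrite nC_prod.
by exists r => //; apply/eqP; rewrite -mem_rootsC.
Qed.
End RootLimits.

Section Star.
Variable R : realType.
Local Notation C := (R[i]).

Lemma fcoef_neq0 (f : pmap2 R) : torus (Defs.fmap f (0, 0)) ->
  coef2 f.1 (0%N, 0%N) != 0 /\ coef2 f.2 (0%N, 0%N) != 0.
Proof. by rewrite /torus /Defs.fmap /= !coef2_00. Qed.

Lemma ray_exponent (s : seq (nat * nat)) : (forall w v, w \in s -> v \in s -> detw w v = 0) ->
  exists v0 : nat * nat, forall w, w \in s -> exists k, w = ((k * v0.1)%N, (k * v0.2)%N).
Proof.
move=> h; case: (pselect (exists2 w0, w0 \in s & w0 != (0%N, 0%N))) => [[w0 w0s w00]|nw]; last first.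
  exists (0%N, 0%N) => w ws; exists 0%N; apply: contrapT => /eqP w0; apply: nw.
  by exists w.
pose g := gcdn w0.1 w0.2.
have g0 : (0 < g)%N.
  by rewrite gcdn_gt0 !lt0n -negb_and; apply: contra w00 => /andP[/eqP a /eqP b]; apply/eqP; case: (w0) a b => x y /= -> ->.
pose a := (w0.1 %/ g)%N; pose b := (w0.2 %/ g)%N.
have aE : w0.1 = (a * g)%N by rewrite divnK// dvdn_gcdl.
have bE : w0.2 = (b * g)%N by rewrite divnK// dvdn_gcdr.
have cop : coprime a b.
  rewrite /coprime -(eqn_pmul2r g0) muln_gcdl -aE -bE mul1n; exact/eqP.
exists (a, b) => w ws /=.
have e : (a * w.2 = b * w.1)%N.
  apply/eqP; rewrite -(eqn_pmul2l g0) !mulnA ![(g * _)%N]mulnC -aE -bE.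
  by have /eqP := h w0 w w0s ws; rewrite /detw subr_eq0 -!PoszM eqz_nat.
have [a0|a0] := posnP a.
  have b1 : b = 1%N by apply/eqP; move: cop; rewrite a0 /coprime gcd0n.
  exists w.2; rewrite a0 b1 muln0 muln1; move: e; rewrite a0 b1 mul0n mul1n.
  by case: (w) => x y /= ->.
have d1 : (a %| w.1)%N by rewrite -(Gauss_dvdr _ cop) -e dvdn_mulr.
exists (w.1 %/ a)%N; rewrite divnK//; case: w {ws} e d1 => x y /= e d1; congr (_, _).
apply/eqP; rewrite -(eqn_pmul2l a0) e mulnA [(a * _)%N]mulnC divnK// mulnC; exact/eqP.
Qed.

Lemma dominant_limit (f : pmap2 R) y : dominant f -> exists F : set_system (C * C),
  [/\ UltraFilter F, ulim F (peval f.1) y.1 & ulim F (peval f.2) y.2].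
Proof.
move=> df; pose S n (x : C * C) : Prop := cdist (Defs.fmap f x) y < (n.+1%:R)^-1.
have [n|n x|F [FU FS]] := @uf_exists _ S.
- by apply: df; rewrite invr_gt0 ltr0n.
- by move/lt_trans; apply; rewrite ltf_pV2 ?posrE ?ltr_nat ?ltr0n.
exists F; split => // e e0; have [n hn] := natSinv_small e0; apply: filterS (FS n) => x h; rewrite mulr1.
  exact: le_trans (nC1_le_cnorm2 (_, _)) (le_trans (ltW h) hn).
exact: le_trans (nC2_le_cnorm2 (_, _)) (le_trans (ltW h) hn).
Qed.

(** Otherwise [f] factors through one monomial: f1 = p1(t) and f2 = p2(t). Near the value p1(0) + 1
    of f1, t is near one of finitely many roots, and a [y2] that avoids their images under p2 is not
    approached. *)
Lemma dominant_nonparallel (f : pmap2 R) : dominant f -> torus (Defs.fmap f (0, 0)) ->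
  nonparallel f.1 f.2.
Proof.
move=> df /fcoef_neq0[c1 c2]; apply: contrapT => np.
have z1 : (0%N, 0%N) \in suppl f.1 by rewrite mem_suppl.
have z2 : (0%N, 0%N) \in suppl f.2 by rewrite mem_suppl.
have dz w v : w \in suppl f.1 ++ suppl f.2 -> v \in suppl f.1 ++ suppl f.2 -> detw w v = 0.
  rewrite !mem_cat => hw hv; apply: contrapT => /eqP ne; apply: np.
  exists w, (0%N, 0%N), v, (0%N, 0%N); split; last by rewrite /= !subr0; rewrite /detw subr_eq0 in ne.
    by case/orP: hw; [left|right].
  by case/orP: hv; [left|right].
have [v0 hv0] := ray_exponent dz.
have pE (P : {poly {poly C}}) : {subset suppl P <= suppl f.1 ++ suppl f.2} ->
    exists p : {poly C}, forall z, peval P z = p.[mon v0 z].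
  move=> sP; have hk w : exists k, w \in suppl P -> w = ((k * v0.1)%N, (k * v0.2)%N).
    have [wP|] := boolP (w \in suppl P); last by exists 0%N.
    by have [k hk] := hv0 w (sP _ wP); exists k.
  exists (\sum_(w <- suppl P) coef2 P w *: 'X^(sval (cid (hk w)))) => z.
  rewrite peval_suppl horner_sum big_seq [RHS]big_seq; apply: eq_bigr => w wP.
  rewrite hornerZ hornerXn; congr (_ * _); case: cid => k /= /(_ wP) ->.
  by rewrite /mon /= exprMn -!exprM ![(_ * k)%N]mulnC.
have [p1 p1E] := pE f.1 (fun w h => ltac:(by rewrite mem_cat h)).
have [p2 p2E] := pE f.2 (fun w h => ltac:(by rewrite mem_cat h orbT)).
pose q := p1 - (p1.[0] + 1)%:P.
have q0 : q != 0.
  apply/eqP => /(congr1 (fun p : {poly C} => p.[0])); rewrite /q !hornerE opprD addNKr.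
  by move/eqP; rewrite oppr_eq0 oner_eq0.
have [y2 [_ hy2]] := exists_nonroot [seq p2.[r] | r <- rootsC q] (oner_neq0 {poly C}).
have [F [FU F1 F2]] := dominant_limit (p1.[0] + 1, y2) df.
have [|r qr hr] := @ulim_root R _ F FU q (mon v0) q0.
  have := @ulimB _ _ F FU _ _ _ _ F1 (@ulim_cst _ _ F FU (p1.[0] + 1)); rewrite subrr; apply: ulim_ext.
  by apply: ufT => z; rewrite p1E /q !hornerE.
move/negP: hy2; apply; apply/mapP; exists r; first by rewrite mem_rootsC// qr.
apply: (@ulim_uniq R _ F FU (peval f.2)); first exact: F2.
by apply: ulim_ext (ulim_poly p2 hr); apply: ufT => z; rewrite p2E.
Qed.

Lemma Mx_unbounded_leaves (F : set_system (C * C)) : UltraFilter F -> F (fun z => torus z) ->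
  forall P : {poly {poly C}}, P != 0 -> lo F (fun=> 1) (Mx P) -> leaves F.
Proof.
move=> FU Ft P /suppl_neq0[w0 w0P] h.
have [w wP hw] := @mon_argmax R F FU (suppl P) _ w0P.
apply: (@unbounded_leaves R F FU Ft w); apply: lo_lO_trans h _.
by apply: lO_sum => [z|v vP]; [exact: nC_ge0|apply: lO_lev; exact: hw].
Qed.

(** If the monomials of f1 and f2 are both unbounded, the convergent values are negligible and (f1,
    f2) degenerates. If only those of one f_i are, [face_degenerate] shows that f_i with the
    Jacobian does. *)
Theorem monomials_bounded (f : pmap2 R) (F : set_system (C * C)) y : UltraFilter F ->
  generically_non_proper f -> F (fun z => torus z) ->
  ulim F (peval f.1) y.1 -> ulim F (peval f.2) y.2 ->
  y.1 != coef2 f.1 (0%N, 0%N) -> y.2 != coef2 f.2 (0%N, 0%N) ->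
  lO F (Mx f.1) (fun=> 1) /\ lO F (Mx f.2) (fun=> 1).
Proof.
move=> FU [[df _ ft] [n12 n1J n2J]] Ft F1 F2 y1 y2.
have [c1 c2] := fcoef_neq0 ft.
have ne (P : {poly {poly C}}) : coef2 P (0%N, 0%N) != 0 -> P != 0 by apply: contraNneq => ->; rewrite coef20.
have jE e : e = 1 -> Xm _ (1%N, 1%N) * jacdet f = e%:P%:P * logjac f.1 f.2.
  by move=> ->; rewrite logjac_jacdet !polyC1 mul1r.
have jE' : Xm _ (1%N, 1%N) * jacdet f = (-1)%:P%:P * logjac f.2 f.1.
  by rewrite logjac_jacdet (logjacC f.1) !polyCN !polyC1 mulN1r opprK.
have [h1|h1] := @lo_or R _ F FU (fun=> 1) (Mx f.1); have [h2|h2] := @lo_or R _ F FU (fun=> 1) (Mx f.2) => //; exfalso.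
- apply: (@nondegenerate R f.1 f.2 F FU (ne _ c1) (ne _ c2) c1 (dominant_nonparallel df ft) n12 Ft).
  + exact: Mx_unbounded_leaves (ne _ c1) h1.
  + exact: lO_lo_trans (ulim_lO F1) h1.
  + exact: lO_lo_trans (ulim_lO F2) h2.
- have n10 : -1 != 0 :> C by rewrite oppr_eq0 oner_eq0.
  have [Fl npar J0 lJ] := @face_degenerate R F FU Ft f.2 f.1 (jacdet f) (-1) y.2 c2 c1 n10 jE' F2 y2
    (ulim_lO F1) h2 h1.
  apply: (@nondegenerate R f.1 (jacdet f) F FU (ne _ c1) J0 c1 npar n1J Ft Fl _ lJ).
  exact: lO_lo_trans (ulim_lO F1) h1.
- have [Fl npar J0 lJ] := @face_degenerate R F FU Ft f.1 f.2 (jacdet f) 1 y.1 c1 c2 (oner_neq0 _) (jE _ erefl) F1 y1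
    (ulim_lO F2) h1 h2.
  apply: (@nondegenerate R f.2 (jacdet f) F FU (ne _ c2) J0 c2 npar n2J Ft Fl _ lJ).
  exact: lO_lo_trans (ulim_lO F2) h2.
Qed.
End Star.

(** * Resultants as determinants *)

Section Elimination.
Implicit Types (A B : comNzRingType).

Definition comp A n (p : {poly A}) : 'M[A]_n.+1 :=
  \matrix_(i, j) if i == n :> nat then - p`_j else (i.+1 == j :> nat)%:R.

(** The norm of [q] modulo a monic [p] of degree n + 1. The matrix size depends on [n] only, so
    specialising the coefficients commutes with the determinant ([elim_map]). *)
Definition elim A n (p q : {poly A}) : A := \det (horner_mx (comp n p) q).

Lemma elim_map A B (f : {rmorphism A -> B}) n (p q : {poly A}) :
  f (elim n p q) = elim n (map_poly f p) (map_poly f q).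
Proof.
rewrite /elim -det_map_mx map_horner_mx; congr (\det (horner_mx _ _)).
apply/matrixP => i j; rewrite !mxE coef_map; case: ifP => _; first by rewrite rmorphN.
by rewrite rmorph_nat.
Qed.

Lemma char_poly_cast A m n (e : m = n) (M : 'M[A]_m) : char_poly (castmx (e, e) M) = char_poly M.
Proof. by subst n; rewrite castmx_id. Qed.

Lemma char_poly_comp A n (p : {poly A}) : p \is monic -> size p = n.+2 -> char_poly (comp n p) = p.
Proof.
move=> pm sp; have e : (size p).-1 = n.+1 by rewrite sp.
rewrite -[RHS]companionmxK// -(char_poly_cast e); congr char_poly.
by apply/matrixP => i j; rewrite castmxE !mxE /= sp.
Qed.

Lemma horner_char_poly A n (M : 'M[A]_n) (a : A) : (char_poly M).[a] = \det (a%:M - M).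
Proof.
rewrite -[LHS]/(horner_eval a _) /char_poly -det_map_mx; congr (\det _); rewrite /char_poly_mx.
apply/matrixP => i j; rewrite !mxE /= /horner_eval hornerD hornerN hornerC; congr (_ - _).
by rewrite hornerMn hornerX.
Qed.

(** Both sides are multiplicative in [q]; for linear [q] the determinant is, up to sign, a value of
    the characteristic polynomial of the companion matrix, which is the product itself. *)
Lemma elim_prod_seq (R : realType) n (s : seq R[i]) (q : {poly R[i]}) : size s = n.+1 ->
  elim n (\prod_(a <- s) ('X - a%:P)) q = \prod_(a <- s) q.[a].
Proof.
move=> sr; set p := \prod_(a <- s) ('X - a%:P).
have pm : p \is monic by exact: monic_prod_XsubC.
have sp : size p = n.+2 by rewrite size_prod_XsubC sr.
have key b : elim n p ('X - b%:P) = \prod_(a <- s) (a - b).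
  rewrite /elim rmorphB /= horner_mx_X horner_mx_C.
  transitivity ((-1) ^+ n.+1 * (char_poly (comp n p)).[b]).
    rewrite horner_char_poly -[LHS]/(\det _) -detZ; congr (\det _).
    by rewrite scaleN1r opprB.
  rewrite char_poly_comp// horner_prod -sr.
  elim: (s) => [|a r IH]; first by rewrite !big_nil mulr1.
  by rewrite !big_cons /= exprS mulrACA IH hornerXsubC mulN1r opprB.
have elimM u v : elim n p (u * v) = elim n p u * elim n p v.
  by rewrite /elim rmorphM /= -det_mulmx.
rewrite [in LHS](rootsCE q) -mul_polyC elimM.
have -> : elim n p (lead_coef q)%:P = \prod_(a <- s) lead_coef q.
  by rewrite /elim horner_mx_C det_scalar big_const_seq count_predT sr iter_mulr_1.
rewrite [RHS](eq_bigr (fun a => lead_coef q * \prod_(b <- rootsC q) (a - b))); last first.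
  by move=> a _; exact: horner_rootsC.
rewrite big_split /=; congr (_ * _); rewrite exchange_big /=.
elim: (rootsC q) => [|b r IH]; last by rewrite !big_cons elimM key IH.
by rewrite !big_nil /elim rmorph1 det1.
Qed.

Lemma elim_prod (R : realType) n (p q : {poly R[i]}) : p \is monic -> size p = n.+2 ->
  elim n p q = \prod_(a <- rootsC p) q.[a].
Proof.
move=> pm sp; have p0 : p != 0 by rewrite monic_neq0.
have sr : size (rootsC p) = n.+1 by have := size_rootsC p0; rewrite sp => -[].
have pE : p = \prod_(a <- rootsC p) ('X - a%:P).
  by rewrite {1}(rootsCE p) (monicP pm) scale1r.
by rewrite {1}pE elim_prod_seq.
Qed.
End Elimination.

Section FiniteValues.
Variable R : realType.
Local Notation C := (R[i]).

(* x1 = xi + lam * x2, as polynomials in x2 over C[xi] *)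
Definition shear (lam : C) (g : {poly {poly C}}) : {poly {poly C}} :=
  \sum_(w <- suppl g) (coef2 g w)%:P%:P * (('X%:P + lam%:P *: 'X) ^+ w.1 * 'X^(w.2)).

Lemma peval_shear lam g xi z : peval (shear lam g) (z, xi) = peval g (xi + lam * z, z).
Proof.
rewrite /shear peval_sum [RHS]peval_suppl; apply: eq_bigr => w _.
rewrite pevalM pevalC pevalM !pevalX pevalD; congr (_ * (_ ^+ _ * _ ^+ _)).
  by rewrite !pevalE !hornerE.
by rewrite pevalE !hornerE.
Qed.

(** [lam] is chosen so that the form of top degree of [g] does not vanish at (lam, 1); this value is
    the leading coefficient in x2. *)
Lemma exists_shear (g : {poly {poly C}}) : g != 0 -> exists lam,
  size (shear lam g) = (tdeg g).+1 /\ exists2 c, c != 0 & lead_coef (shear lam g) = c%:P.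
Proof.
move=> g0.
have [w0 w0g w0d] : exists2 w, w \in suppl g & (w.1 + w.2)%N = tdeg g.
  have [v vg] := suppl_neq0 g0.
  have [w wg hw] := seq_argmax (fun w => (w.1 + w.2)%N%:Z) vg; exists w => //.
  apply/eqP; rewrite eqn_leq tdegP//= /tdeg; apply/bigmax_leqP => i _; apply/bigmax_leqP => j cj.
  by have := hw (i : nat, j : nat); rewrite mem_suppl cj lez_nat; apply.
pose d := tdeg g; pose l : {poly C} := \sum_(w <- suppl g) (if (w.1 + w.2 == d)%N then coef2 g w else 0) *: 'X^(w.1).
have l0 : l != 0.
  apply/eqP => /(congr1 (fun p : {poly C} => p`_(w0.1))); rewrite coef_sum coef0.
  rewrite (bigD1_seq _ w0g (suppl_uniq _)) /= w0d eqxx coefZ coefXn eqxx mulr1 big1 ?addr0 => [/eqP|w ww0].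
    by rewrite -[_ == 0]negbK -mem_suppl w0g.
  case: eqP => [e|_]; last by rewrite scale0r coef0.
  rewrite coefZ coefXn; case: eqP => [e2|_]; last by rewrite mulr0.
  case/eqP: ww0; move: e e2 w0d; rewrite -/d; case: (w) (w0) => a b [a' b'] /= ? ? ?.
  by congr (_, _); lia.
have [lam [llam lam0]] := exists_nonroot [:: 0] l0; rewrite inE in lam0.
have lamP0 : lam%:P != 0 by rewrite polyC_eq0.
pose y : {poly {poly C}} := 'X%:P + lam%:P *: 'X.
have sX : size (lam%:P *: 'X : {poly {poly C}}) = 2 by rewrite size_scale ?size_polyX.
have szC : (size (('X : {poly C})%:P) < size (lam%:P *: 'X : {poly {poly C}}))%N.
  by rewrite sX (leq_ltn_trans (size_polyC_leq1 _)).
have sy : size y = 2 by rewrite /y addrC size_polyDl.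
have ly : lead_coef y = lam%:P by rewrite /y addrC lead_coefDl// lead_coefZ lead_coefX mulr1.
have y0 : y != 0 by rewrite -size_poly_eq0 sy.
have st (w : nat * nat) : size (y ^+ w.1 * 'X^(w.2)) = (w.1 + w.2).+1.
  have sz k : size (y ^+ k) = k.+1.
    by rewrite -[LHS]prednK ?size_exp ?sy ?mul1n// size_poly_gt0 expf_neq0.
  by rewrite size_mul ?expf_neq0 ?polyX_eq0// sz size_polyXn addSn addnS.
have lt (w : nat * nat) : lead_coef (y ^+ w.1 * 'X^(w.2)) = (lam ^+ w.1)%:P.
  by rewrite lead_coefM lead_coefXn mulr1 lead_coef_exp ly rmorphXn.
have cd : (shear lam g)`_d = (l.[lam])%:P.
  rewrite /shear /l coef_sum horner_sum rmorph_sum /= big_seq [RHS]big_seq; apply: eq_bigr => w wg.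
  rewrite coefCM hornerZ hornerXn polyCM; case: eqP => [e|e].
    by rewrite -(lt w) lead_coefE st /= e.
  rewrite polyC0 mul0r nth_default ?mulr0// st; have := tdegP wg; rewrite -/d; lia.
have ss : (size (shear lam g) <= d.+1)%N.
  apply/leq_sizeP => j dj; rewrite /shear coef_sum big_seq big1// => w wg.
  rewrite coefCM nth_default ?mulr0// st; have := tdegP wg; rewrite -/d; lia.
have sE : size (shear lam g) = d.+1.
  apply/eqP; rewrite eqn_leq ss /= ltnNge; apply/negP => h.
  by move: cd; rewrite nth_default// => /esym/eqP; rewrite polyC_eq0 (negbTE llam).
exists lam; split => //; exists l.[lam] => //; by rewrite lead_coefE sE /= cd.
Qed.

Lemma lo_exp_inv (T : Type) (F : set_system T) {FU : UltraFilter F} (u : T -> R) n :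
  (forall x, 0 <= u x) -> lo F (fun=> 1) u -> (0 < n)%N -> lo F (fun=> 1) (fun x => u x ^+ n).
Proof.
move=> u0 h n0; have := @lo_exp _ _ F FU (fun=> 1) u n n0 (fun=> ler01) h.
by move=> h1 k k0; apply: filterS (h1 k k0) => x; rewrite expr1n.
Qed.

Lemma root_bounded (T : Type) (F : set_system T) {FU : UltraFilter F} n (a : nat -> T -> C) (z : T -> C) :
  (forall i, (i < n)%N -> lO F (fun x => nC (a i x)) (fun=> 1)) -> lO F (fun=> 1) (fun x => nC (a n x)) ->
  F (fun x => \sum_(i < n.+1) a i x * z x ^+ i = 0) -> lO F (fun x => nC (z x)) (fun=> 1).
Proof.
move=> ha hn h0; have [hz|//] := @lo_or _ _ F FU (fun=> 1) (fun x => nC (z x)); exfalso.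
have zn (i : 'I_n) : lo F (fun x => nC (a i x * z x ^+ i)) (fun x => nC (z x) ^+ n).
  apply: (@lo_lO_trans _ _ F FU (fun x => 1 * nC (z x) ^+ n)); last by apply: lO_le => x; rewrite mul1r.
  apply: (@lO_lo_trans _ _ F FU (fun x => nC (a i x) * nC (z x) ^+ i)).
    by apply: lO_le => x; rewrite nCM nCX.
  apply: lo_mull => [x|x||]; rewrite ?exprn_ge0 ?nC_ge0//; first exact: ha.
  have e : (n = i + (n - i))%N by rewrite subnKC// ltnW.
  have ni : (0 < n - i)%N by rewrite subn_gt0.
  move=> k k0; apply: filterS (lo_exp_inv (fun x => nC_ge0 (z x)) hz ni k0) => x h.
  have -> : nC (z x) ^+ n = nC (z x) ^+ i * nC (z x) ^+ (n - i) by rewrite -exprD -e.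
  by rewrite mulrCA -[leLHS]mulr1 ler_wpM2l// exprn_ge0// nC_ge0.
have s1 : lo F (fun x => nC (\sum_(i < n) a i x * z x ^+ i)) (fun x => nC (z x) ^+ n).
  apply: (@lO_lo_trans _ _ F FU (fun x => \sum_(i <- index_enum 'I_n) nC (a i x * z x ^+ i))).
    by apply: lO_le => x; exact: nC_sum.
  by apply: lo_sum => [x|i _]; rewrite ?exprn_ge0 ?nC_ge0//; exact: zn.
have zpos : F (fun x => 0 < nC (z x)).
  apply: filterS (hz 1 ltr01) => x; rewrite mul1r; exact: lt_le_trans.
apply: (lo_irr s1); last first.
  move: hn => [K K0 hn]; apply: filterS3 hn h0 zpos => x h1 h2 zp.
  rewrite big_ord_recr /= in h2; have -> : \sum_(i < n) a i x * z x ^+ i = - (a n x * z x ^+ n).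
    by apply/eqP; rewrite -addr_eq0 h2.
  rewrite nCN nCM nCX mulr_gt0 ?exprn_gt0// -(ltr_pM2l K0) mulr0; exact: lt_le_trans h1.
move: hn => [K K0 hn]; exists K => //; apply: filterS2 hn h0 => x h1 h2.
rewrite big_ord_recr /= in h2; have -> : \sum_(i < n) a i x * z x ^+ i = - (a n x * z x ^+ n).
  by apply/eqP; rewrite -addr_eq0 h2.
by rewrite nCN nCM nCX mulrA -[leLHS]mul1r ler_wpM2r ?exprn_ge0 ?nC_ge0.
Qed.

(** Otherwise [xi] would be a root of polynomials with bounded coefficients and leading coefficient
    away from 0, hence bounded. *)
Lemma lead_coef_limit (T : Type) (F : set_system T) {FU : UltraFilter F} (P : {poly {poly C}}) (xi v : T -> C) y :
  lo F (fun=> 1) (fun x => nC (xi x)) -> ulim F v y -> F (fun x => peval P (xi x, v x) = 0) ->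
  (lead_coef P).[y] = 0.
Proof.
move=> hx hv h0; apply/eqP/negPn/negP => ly.
have bd : lO F (fun x => nC (xi x)) (fun=> 1).
  apply: (@root_bounded T F FU (size P).-1 (fun i x => (P`_i).[v x])).
  - by move=> i _; exact: ulim_lO (ulim_poly _ hv).
  - exact: ulim_neq0 (ulim_poly (lead_coef P) hv) ly.
  - apply: filterS h0 => x; rewrite pevalE /= => e; rewrite -[RHS]e.
    have [->|P0] := eqVneq P 0; first by rewrite !horner0 big1// => i _; rewrite coef0 horner0 mul0r.
    rewrite (horner_coef P) horner_sum; have -> : (size P).-1.+1 = size P by rewrite prednK// size_poly_gt0.
    by apply: eq_bigr => i _; rewrite hornerM -rmorphXn /= hornerC.
by apply: (lo_irr hx bd); apply: ufT.
Qed.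

(** After a shear the curve is finite over the xi-line, and [chi] is the characteristic polynomial
    of multiplication by [phi]. At an asymptotic value xi tends to infinity, so the coefficient of
    the highest power of xi vanishes there; its degree in the value is at most [tdeg g]. *)
Theorem finite_asymptotic_values (g phi : {poly {poly C}}) (s : seq C) : g != 0 -> uniq s ->
  (forall y, y \in s -> exists F : set_system (C * C), [/\ UltraFilter F, F (fun z => peval g z = 0),
     lo F (fun=> 1) (fun z => nC z.1 + nC z.2) & ulim F (peval phi) y]) ->
  (size s <= tdeg g)%N.
Proof.
move=> g0 us hs; have [lam [sg [c c0 lc]]] := exists_shear g0.
case dE : (tdeg g) sg => [|n] sg.
  case: s us hs => // y s _ /(_ y (mem_head _ _))[F [FU Fg _ _]]; exfalso.
  have h w : w \in suppl g -> w = (0%N, 0%N).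
    by move=> /tdegP; rewrite dE; case: w => -[|a] [|b].
  apply: (@uf_absurd _ F FU); apply: filterS Fg => z; rewrite (poly2_constant h) pevalC => /eqP.
  by apply/negP; apply: contra g0 => /eqP e; rewrite (poly2_constant h) e.
pose p := c^-1%:P *: shear lam g.
have cP : c^-1%:P != 0 by rewrite polyC_eq0 invr_eq0.
have pm : p \is monic by rewrite monicE lead_coefZ lc -polyCM mulVf.
have sp : size p = n.+2 by rewrite size_scale.
pose chi := char_poly (horner_mx (comp n p) (shear lam phi)).
have chiE xi z : peval g (xi + lam * z, z) = 0 -> peval chi (peval phi (xi + lam * z, z), xi) = 0.
  move=> gz; set t := peval phi _.
  pose p' := map_poly (horner_eval xi) p; pose q' := map_poly (horner_eval xi) (shear lam phi).
  have pm' : p' \is monic by exact: monic_map.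
  have sp' : size p' = n.+2 by rewrite size_map_poly_id0// (monicP pm) /= /horner_eval hornerC oner_neq0.
  have -> : peval chi (t, xi) = elim n p' (t%:P - q').
    rewrite /elim rmorphB /= horner_mx_C -[LHS]/((map_poly (horner_eval xi) chi).[t]) /chi.
    rewrite map_char_poly horner_char_poly.
    rewrite map_horner_mx; congr (\det (_ - horner_mx _ _)).
    apply/matrixP => i j; rewrite !mxE coef_map; case: ifP => _; first by rewrite rmorphN.
    by rewrite rmorph_nat.
  rewrite elim_prod//; apply/eqP; rewrite prodf_seq_eq0; apply/hasP; exists z.
    rewrite mem_rootsC ?monic_neq0// -[p'.[z]]/(peval p (z, xi)) /p -mul_polyC pevalM peval_shear.
    by rewrite gz mulr0.
  by rewrite hornerD hornerN hornerC -[q'.[z]]/(peval (shear lam phi) (z, xi)) peval_shear subrr eqxx.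
have chi0 : swapXY chi != 0 by rewrite swapXY_eq0 monic_neq0// char_poly_monic.
have L0 : lead_coef (swapXY chi) != 0 by rewrite lead_coef_eq0.
have sL : (size (lead_coef (swapXY chi)) <= n.+2)%N.
  apply/leq_sizeP => j nj; rewrite lead_coefE coef_swapXY [chi`_j]nth_default ?coef0//.
  by rewrite size_char_poly.
suff rt y : y \in s -> (lead_coef (swapXY chi)).[y] = 0.
  apply: leq_trans (size_undup_roots L0 us rt) _; by case: (size _) sL.
move=> /hs[F [FU Fg Fb Fphi]].
apply: (@lead_coef_limit _ F FU _ (fun z => z.1 - lam * z.2) (peval phi)) => //; last first.
  apply: filterS Fg => z gz; have := chiE (z.1 - lam * z.2) z.2; rewrite subrK -surjective_pairing => /(_ gz) <-.
  by rewrite peval_swapXY.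
(* A bounded xi would bound x2, a root of the monic [p], and then x1. *)
have [//|hxi] := @lo_or _ _ F FU (fun=> 1) (fun z : C * C => nC (z.1 - lam * z.2)); exfalso.
have [xi0 hx0] := @ulim_ex R _ F FU (fun z => z.1 - lam * z.2) hxi.
have hz : lO F (fun z : C * C => nC z.2) (fun=> 1).
  apply: (@root_bounded _ F FU n.+1 (fun i z => (p`_i).[z.1 - lam * z.2])).
  - by move=> i _; exact: ulim_lO (ulim_poly _ hx0).
  - have -> : p`_n.+1 = 1 by rewrite -(monicP pm) lead_coefE sp.
    by apply: lO_le => z; rewrite hornerC nC1.
  - apply: filterS Fg => z gz; have := peval_shear lam g (z.1 - lam * z.2) z.2.
    rewrite subrK -surjective_pairing gz => e.
    have : peval p (z.2, z.1 - lam * z.2) = 0 by rewrite /p -mul_polyC pevalM e mulr0.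
    rewrite /peval (@horner_coef_wide _ n.+2); last by apply: leq_trans (size_poly _ _) _; rewrite sp.
    by move=> h; rewrite -[RHS]h; apply: eq_bigr => i _; rewrite coef_map_id0// horner0.
apply: (@lo_irr _ _ F FU (fun=> 1) (fun z : C * C => nC z.1 + nC z.2)) => //; last by apply: ufT.
apply: lO_add => //; apply: (@lO_trans _ _ F FU (fun z : C * C => nC (z.1 - lam * z.2) + nC lam * nC z.2)).
  by apply: lO_le => z; rewrite -nCM -[X in nC X <= _](subrK (lam * z.2)); exact: nCD.
apply: lO_add => //; have [K K0 h] := hz; exists (nC lam * K + 1); first by rewrite ltr_pwDr// mulr_ge0 ?nC_ge0 ?ltW.
apply: filterS h => z; rewrite !mulr1 => h; apply: le_trans (ler_wpM2l (nC_ge0 lam) h) _; lra.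
Qed.
End FiniteValues.

(** * The Jacobian does not vanish identically *)

Section JacobianNonzero.
Variable R : realType.
Local Notation C := (R[i]).

Lemma conv_triangle (s : seq (nat * nat)) w v (la mu : R) : (0%N, 0%N) \in s -> w \in s -> v \in s ->
  0 <= la -> 0 <= mu -> la + mu <= 1 ->
  @Defs.conv R [set w | w \in s] (la * (w.1)%:R + mu * (v.1)%:R, la * (w.2)%:R + mu * (v.2)%:R).
Proof.
move=> s0 sw sv l0 m0 lm.
exists 3%N, (fun i : 'I_3 => nth (0%N, 0%N) [:: (0%N, 0%N); w; v] i),
  (fun i : 'I_3 => nth 0 [:: 1 - (la + mu); la; mu] i); split.
- by case=> -[|[|[|]]].
- by case=> -[|[|[|]]] //= _; rewrite subr_ge0.
- by rewrite !big_ord_recl big_ord0 /= addr0; ring.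
- by rewrite !big_ord_recl !big_ord0 /= !mulr0 !add0r !addr0.
Qed.

Lemma barycentric (a b c d y1 y2 : R) (e1 := y1 - (a + c) / 3) (e2 := y2 - (b + d) / 3)
    (D := a * d - b * c) : D != 0 ->
  (y1 = (1 / 3 + (e1 * d - e2 * c) / D) * a + (1 / 3 - (e1 * b - e2 * a) / D) * c) *
  (y2 = (1 / 3 + (e1 * d - e2 * c) / D) * b + (1 / 3 - (e1 * b - e2 * a) / D) * d).
Proof. by rewrite /D /e1 /e2 => D0; split; field. Qed.

(** The triangle with vertices 0, w, v contains a small square with a corner at its centroid. *)
Lemma vol_conv_gt0 (s : seq (nat * nat)) h w v : supfun s h ->
  (0%N, 0%N) \in s -> w \in s -> v \in s -> detw w v != 0 ->
  (0 < @vol2 R (@Defs.conv R [set w | w \in s]))%E.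
Proof.
move=> hs s0 sw sv dn.
pose k := (w.1 + w.2 + (v.1 + v.2))%N.
have k0 : (0 < k)%N.
  rewrite lt0n; apply: contra dn; rewrite /k /detw; case: (w) (v) => a b [c d] /=.
  by rewrite !addn_eq0 => /andP[/andP[/eqP-> /eqP->] _]; rewrite !mul0r subrr.
(* q / (3k) is the centroid (w + v) / 3. As the determinant is a nonzero integer, moving inside a
   square of side 1 / (3k) changes the two barycentric coordinates by at most 1/3 in total. *)
pose q := ((k * (w.1 + v.1))%N, (k * (w.2 + v.2))%N).
have n0 : (0 < 3 * k)%N by rewrite muln_gt0.
have [mq vq] := @vol_squares R (3 * k) 0 [:: q] n0 isT.
have p0 : (0 < (1%:R / (3 * k)%:R ^+ 2 : R)%:E)%E.
  by rewrite lte_fin divr_gt0// exprn_gt0// ltr0n.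
apply: (lt_le_trans p0); rewrite -[X in (X <= _)%E]vq; apply: vol2_le => //; first exact: conv_measurable hs.
move=> y [_ /[!inE] /eqP-> []]; rewrite /q /= !subr0 => /andP[a1 a2] /andP[b1 b2].
pose D : R := (w.1)%:R * (v.2)%:R - (w.2)%:R * (v.1)%:R.
have DE : D = (detw w v)%:~R by rewrite /D /detw rmorphB !rmorphM.
have DnZ : 1 <= `|D|.
  by rewrite DE -intr_norm -[1]/(1%:~R) ler_int -gtz0_ge1 normr_gt0.
have D0 : D != 0 by rewrite -normr_gt0; apply: lt_le_trans DnZ.
have kR : 0 < k%:R :> R by rewrite ltr0n.
pose e1 := y.1 - ((w.1)%:R + (v.1)%:R) / 3; pose e2 := y.2 - ((w.2)%:R + (v.2)%:R) / 3.
have he1 : 0 <= e1 <= (3 * k%:R)^-1.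
  apply/andP; rewrite /e1; move: a1 a2; rewrite !natrM natrD => a1 a2; split.
    by rewrite -(pmulr_rge0 _ kR); nra.
  by rewrite -(ler_pM2l (mulr_gt0 (ltr0n R 3) kR)) divff ?lt0r_neq0 ?mulr_gt0//; nra.
have he2 : 0 <= e2 <= (3 * k%:R)^-1.
  apply/andP; rewrite /e2; move: b1 b2; rewrite !natrM natrD => b1 b2; split.
    by rewrite -(pmulr_rge0 _ kR); nra.
  by rewrite -(ler_pM2l (mulr_gt0 (ltr0n R 3) kR)) divff ?lt0r_neq0 ?mulr_gt0//; nra.
have dev (a b : nat) : `|(e1 * a%:R - e2 * b%:R) / D| <= (a + b)%:R / (3 * k%:R).
  rewrite normrM normfV ler_pdivrMr ?normr_gt0//.
  apply: le_trans (_ : (a + b)%:R / (3 * k%:R) * 1 <= _); last first.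
    by rewrite ler_wpM2l// divr_ge0// mulr_ge0// ltW.
  rewrite mulr1 natrD [X in _ <= X]mulrDl; apply: le_trans (ler_normB _ _) _.
  move: he1 he2 => /andP[? ?] /andP[? ?].
  by rewrite !normrM (ger0_norm (_ : 0 <= e1))// (ger0_norm (_ : 0 <= e2))// !normr_nat lerD// mulrC ler_wpM2l.
pose la := 1 / 3 + (e1 * (v.2)%:R - e2 * (v.1)%:R) / D.
pose mu := 1 / 3 - (e1 * (w.2)%:R - e2 * (w.1)%:R) / D.
have yE : y = (la * (w.1)%:R + mu * (v.1)%:R, la * (w.2)%:R + mu * (v.2)%:R).
  rewrite [LHS]surjective_pairing.
  by have [f1 f2] := barycentric y.1 y.2 D0; congr (_, _); [exact: f1|exact: f2].
rewrite yE; have d1 := dev v.2 v.1; have d2 := dev w.2 w.1.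
have kk : (v.2 + v.1)%:R / (3 * k%:R) + (w.2 + w.1)%:R / (3 * k%:R) = 1 / 3 :> R.
  rewrite -mulrDl -natrD (_ : (v.2 + v.1 + (w.2 + w.1))%N = k); last by rewrite /k addnC (addnC w.2) (addnC v.2).
  by field; rewrite lt0r_neq0.
have p1 : 0 <= (v.2 + v.1)%:R / (3 * k%:R) :> R by rewrite divr_ge0// mulr_ge0// ltW.
have p2 : 0 <= (w.2 + w.1)%:R / (3 * k%:R) :> R by rewrite divr_ge0// mulr_ge0// ltW.
move: d1 d2; rewrite !ler_norml => /andP[d1 d1'] /andP[d2 d2'].
by apply: conv_triangle => //; rewrite /la /mu; lra.
Qed.

(** When the supports lie on two different lines through 0, a sum of exponents determines its
    summands, so no term of the log-Jacobian cancels. *)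
Lemma logjac_neq0 (P Q : {poly {poly C}}) w v :
  (forall w v, w \in suppl P -> v \in suppl P -> detw w v = 0) ->
  (forall w v, w \in suppl Q -> v \in suppl Q -> detw w v = 0) ->
  w \in suppl P -> v \in suppl Q -> detw w v != 0 -> logjac P Q != 0.
Proof.
move=> hP hQ wP vQ d0; apply/eqP => /(congr1 (fun p => coef2 p (wadd w v))).
rewrite coef20 coef2_sum (bigD1_seq _ wP (suppl_uniq _)) /= coef2_sum (bigD1_seq _ vQ (suppl_uniq _)) /=.
have key w' v' : w' \in suppl P -> v' \in suppl Q -> wadd w v = wadd w' v' -> w' = w /\ v' = v.
  move=> w'P v'Q; have := hP _ _ w'P wP; have := hQ _ _ v'Q vQ; move: d0; rewrite /detw /wadd.
  case: (w) (v) (w') (v') => [a b] [c d] [a' b'] [c' d'] /= D e2 e1 [f1 f2].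
  have g1 : a'%:Z = a%:Z + c%:Z - c'%:Z by lia.
  have g2 : b'%:Z = b%:Z + d%:Z - d'%:Z by lia.
  rewrite g1 g2 in e1.
  have h1 : (a%:Z * d%:Z - b%:Z * c%:Z) * (c%:Z - c'%:Z) = 0.
    transitivity (a%:Z * (- (c'%:Z * d%:Z - d'%:Z * c%:Z)) - c%:Z * ((a%:Z + c%:Z - c'%:Z) * b%:Z - (b%:Z + d%:Z - d'%:Z) * a%:Z)); first by ring.
    by rewrite e1 e2 oppr0 !mulr0 subr0.
  have h2 : (a%:Z * d%:Z - b%:Z * c%:Z) * (d%:Z - d'%:Z) = 0.
    transitivity (b%:Z * (- (c'%:Z * d%:Z - d'%:Z * c%:Z)) - d%:Z * ((a%:Z + c%:Z - c'%:Z) * b%:Z - (b%:Z + d%:Z - d'%:Z) * a%:Z)); first by ring.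
    by rewrite e1 e2 oppr0 !mulr0 subr0.
  move/eqP: h1; move/eqP: h2; rewrite !mulf_eq0 (negbTE D) /= !subr_eq0 !eqz_nat => /eqP h2 /eqP h1.
  by split; congr (_, _); lia.
rewrite coef2Cmul coef2_Xm eqxx mulr1 big_seq_cond big1 => [|v' /andP[v'Q v'v]]; last first.
  rewrite coef2Cmul coef2_Xm; case: eqP => [e|_]; rewrite ?mulr0//.
  by have [_ e'] := key _ _ wP v'Q e; rewrite e' eqxx in v'v.
rewrite big_seq_cond big1 => [|w' /andP[w'P w'w]]; last first.
  rewrite coef2_sum big_seq big1// => v' v'Q.
  rewrite coef2Cmul coef2_Xm; case: eqP => [e|_]; rewrite ?mulr0//.
  by have [e' _] := key _ _ w'P v'Q e; rewrite e' eqxx in w'w.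
rewrite !addr0 => /eqP; rewrite !mulf_eq0 intr_eq0 (negbTE d0) /=.
by rewrite -[_ == 0]negbK -mem_suppl wP -[_ == 0]negbK -mem_suppl vQ.
Qed.

Lemma conv0 : @Defs.conv R set0 = set0.
Proof.
apply/seteqP; split=> // y [n [a [w [ha w0 w1 _]]]].
case: n a w ha w0 w1 => [|n] a w ha w0 w1; last exact: (ha ord0).
by move: w1; rewrite big_ord0 => /eqP; rewrite eq_sym oner_eq0.
Qed.

(** The hull of the empty support is empty, so the mixed volume is minus the area of the hull of
    supp P. As a number of solutions it is nonnegative; so the area is 0. *)
Lemma isolated_count_zero (P : {poly {poly C}}) : P != 0 -> coef2 P (0%N, 0%N) != 0 ->
  isolated_count P 0 (mixed_volume R (supp P) (supp (0 : {poly {poly C}}))) ->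
  forall w v, w \in suppl P -> v \in suppl P -> detw w v = 0.
Proof.
move=> P0 P00 [s [m [_ _ _ MV]]] w v wP vP; apply: contrapT => /eqP dn.
have [h hs] := supfun_ex P0.
have z0 : (0%N, 0%N) \in suppl P by rewrite mem_suppl.
have := vol_conv_gt0 hs z0 wP vP dn.
have -> : [set w | w \in suppl P] = supp P by apply/seteqP; split=> u; rewrite /= suppP.
have s0 : supp (0 : {poly {poly C}}) = set0.
  by apply/seteqP; split=> // u; rewrite /supp /= coef20 eqxx.
move: MV; rewrite /mixed_volume s0 conv0.
have -> : @Defs.msum R (@Defs.conv R (supp P)) set0 = set0.
  by apply/seteqP; split=> // y [a [b []]].
have -> : @vol2 R set0 = 0%E by exact: measure0.
rewrite sub0e sube0 => MV; apply/negP; rewrite -leNgt -leeN2 oppe0 -MV lee_fin ler0n.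
by [].
Qed.

(** For a zero Jacobian the last two systems put each support on a line through 0
    ([isolated_count_zero]), and [logjac_neq0] makes the lines agree, against dominance. *)
Theorem jacdet_neq0 (f : pmap2 R) : generically_non_proper f -> jacdet f != 0.
Proof.
move=> [[df _ ft] [_ n1J n2J]]; apply/eqP => J0.
have [c1 c2] := fcoef_neq0 ft.
have ne (P : {poly {poly C}}) : coef2 P (0%N, 0%N) != 0 -> P != 0 by apply: contraNneq => ->; rewrite coef20.
rewrite J0 in n1J n2J.
have h1 := isolated_count_zero (ne _ c1) c1 n1J; have h2 := isolated_count_zero (ne _ c2) c2 n2J.
have L0 : logjac f.1 f.2 = 0 by rewrite -logjac_jacdet J0 mulr0.
have h12 w v : w \in suppl f.1 -> v \in suppl f.2 -> detw w v = 0.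
  move=> wP vQ; apply: contrapT => /eqP d0; have := logjac_neq0 h1 h2 wP vQ d0.
  by rewrite L0 eqxx.
have h21 w v : w \in suppl f.2 -> v \in suppl f.1 -> detw w v = 0.
  by move=> wP vQ; have := h12 _ _ vQ wP; rewrite /detw; lia.
have [w1 [w2 [v1 [v2 [hw hv /eqP]]]]] := dominant_nonparallel df ft; apply.
have D4 w v : w \in suppl f.1 ++ suppl f.2 -> v \in suppl f.1 ++ suppl f.2 -> detw w v = 0.
  by rewrite !mem_cat => /orP[] ? /orP[] ?; [exact: h1|exact: h12|exact: h21|exact: h2].
have mw : w1 \in suppl f.1 ++ suppl f.2 /\ w2 \in suppl f.1 ++ suppl f.2.
  by rewrite !mem_cat; case: hw => -[-> ->]; rewrite ?orbT.
have mv : v1 \in suppl f.1 ++ suppl f.2 /\ v2 \in suppl f.1 ++ suppl f.2.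
  by rewrite !mem_cat; case: hv => -[-> ->]; rewrite ?orbT.
apply/eqP; rewrite -subr_eq0; apply/eqP.
transitivity (detw w1 v1 - detw w1 v2 - detw w2 v1 + detw w2 v2); first by rewrite /detw; ring.
by rewrite (D4 _ _ mw.1 mv.1) (D4 _ _ mw.1 mv.2) (D4 _ _ mw.2 mv.1) (D4 _ _ mw.2 mv.2).
Qed.
End JacobianNonzero.

(** * Local multiplicities and the growth of the resultant *)

Section Substitution.
Variable R : realType.
Local Notation C := (R[i]).
Implicit Types (P Q : {poly {poly C}}).

Section Sub2.
Variables (A : comNzRingType) (iota : {rmorphism C -> A}) (al be : A).

(** One morphism with arbitrary target covers evaluation at points, restriction to parametrised
    curves and composition; the chain rule is proved once, for any derivation [del]. *)
Definition sub2 : {poly {poly C}} -> A :=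
  horner_eval al \o map_poly (horner_eval be \o map_poly iota).
HB.instance Definition _ := GRing.RMorphism.on sub2.

Lemma sub2X : sub2 'X = al.
Proof. by rewrite /sub2 /= map_polyX /horner_eval hornerX. Qed.
Lemma sub2Y : sub2 ('X%:P) = be.
Proof. by rewrite /sub2 /= map_polyC /= map_polyX /horner_eval hornerX hornerC. Qed.
Lemma sub2C (q : {poly C}) : sub2 q%:P = (map_poly iota q).[be].
Proof. by rewrite /sub2 /= map_polyC /= /horner_eval hornerC. Qed.
Lemma sub2CC (c : C) : sub2 c%:P%:P = iota c.
Proof. by rewrite sub2C map_polyC hornerC. Qed.

Variable del : {additive A -> A}.
Hypothesis delM : forall x y, del (x * y) = del x * y + x * del y.
Hypothesis delC : forall c, del (iota c) = 0.

Lemma sub2_chain P : del (sub2 P) = sub2 (pd1 P) * del al + sub2 (pd2 P) * del be.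
Proof.
have inner (q : {poly C}) : del (sub2 q%:P) = sub2 (deriv q)%:P * del be.
  elim/poly_ind: q => [|q c IH]; first by rewrite deriv0 !rmorph0 raddf0 mul0r.
  rewrite derivD derivC addr0 derivM derivX mulr1 !rmorphD !rmorphM /= sub2Y sub2CC.
  by rewrite raddfD delC addr0 delM IH; ring.
elim/poly_ind: P => [|P q IH].
  by rewrite /pd1 /pd2 deriv0 map_poly0 !rmorph0 raddf0 !mul0r addr0.
rewrite /pd1 /pd2 derivD derivC addr0 derivM derivX mulr1.
have -> : map_poly deriv (P * 'X + q%:P) = map_poly deriv P * 'X + (deriv q)%:P.
  apply/polyP => i; rewrite coef_map_id0 ?raddf0// !coefD !coefMX !coefC.
  by case: i => [|i] /=; rewrite ?add0r ?addr0 // coef_map_id0 ?raddf0.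
rewrite !rmorphD !rmorphM /= sub2X raddfD delM IH inner /pd1 /pd2; ring.
Qed.
End Sub2.

Lemma sub2_map (A B : comNzRingType) (iota : {rmorphism C -> A}) (th : {rmorphism A -> B}) al be P :
  th (sub2 iota al be P) = sub2 (th \o iota) (th al) (th be) P.
Proof.
elim/poly_ind: P => [|P q IH]; first by rewrite !rmorph0.
rewrite !rmorphD !rmorphM /= IH !sub2X; congr (_ + _).
elim/poly_ind: q => [|q c IHq]; first by rewrite !rmorph0.
by rewrite !rmorphD !rmorphM /= IHq !sub2Y !sub2CC.
Qed.

Lemma eq_sub2 (A : comNzRingType) (io io' : {rmorphism C -> A}) al be P :
  io =1 io' -> sub2 io al be P = sub2 io' al be P.
Proof.
move=> e; elim/poly_ind: P => [|P q IH]; first by rewrite !rmorph0.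
rewrite !rmorphD !rmorphM /= IH !sub2X; congr (_ + _).
elim/poly_ind: q => [|q c IHq]; first by rewrite !rmorph0.
by rewrite !rmorphD !rmorphM /= IHq !sub2Y !sub2CC e.
Qed.

Lemma peval_sub2 P z : peval P z = sub2 (idfun : {rmorphism C -> C}) z.1 z.2 P.
Proof.
rewrite pevalE; elim/poly_ind: P => [|P q IH]; first by rewrite !horner0 rmorph0.
rewrite hornerMXaddC hornerD hornerM hornerC IH rmorphD rmorphM /= sub2X sub2C.
by rewrite map_poly_id.
Qed.

Definition sub1 (al be : {poly C}) P : {poly C} := sub2 polyC al be P.
Definition subG (g1 g2 : {poly {poly C}}) P : {poly {poly C}} :=
  sub2 (polyC \o polyC : {rmorphism C -> {poly {poly C}}}) g1 g2 P.

Lemma horner_sub1 al be P x : (sub1 al be P).[x] = peval P (al.[x], be.[x]).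
Proof.
rewrite -[LHS]/(horner_eval x _) /sub1 sub2_map peval_sub2; apply: eq_sub2 => c.
by rewrite /= /horner_eval hornerC.
Qed.

Lemma peval_subG g1 g2 P z : peval (subG g1 g2 P) z = peval P (peval g1 z, peval g2 z).
Proof.
rewrite (peval_sub2 (subG _ _ _)) /subG sub2_map peval_sub2 /= -!peval_sub2; apply: eq_sub2 => c.
by rewrite /= -peval_sub2 pevalC.
Qed.

Lemma deriv_sub1 al be P :
  deriv (sub1 al be P) = sub1 al be (pd1 P) * deriv al + sub1 al be (pd2 P) * deriv be.
Proof. by apply: sub2_chain => [x y|c]; [exact: derivM|exact: derivC]. Qed.

Lemma pd1_subG g1 g2 P :
  pd1 (subG g1 g2 P) = subG g1 g2 (pd1 P) * pd1 g1 + subG g1 g2 (pd2 P) * pd1 g2.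
Proof. by apply: sub2_chain => [x y|c]; [exact: derivM|exact: derivC]. Qed.

Lemma pd2M P Q : pd2 (P * Q) = pd2 P * Q + P * pd2 Q.
Proof.
apply/polyP => i; rewrite /pd2 coef_map_id0 ?raddf0// coefD !coefM raddf_sum -big_split /=.
by apply: eq_bigr => j _; rewrite derivM !coef_map_id0 ?raddf0.
Qed.

Lemma pd2B P Q : pd2 (P - Q) = pd2 P - pd2 Q.
Proof. by apply/polyP => i; rewrite /pd2 coefB !coef_map_id0 ?raddf0// coefB derivB. Qed.
HB.instance Definition _ := GRing.isZmodMorphism.Build _ _ (@pd2 R) pd2B.

Lemma pd2_subG g1 g2 P :
  pd2 (subG g1 g2 P) = subG g1 g2 (pd1 P) * pd2 g1 + subG g1 g2 (pd2 P) * pd2 g2.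
Proof.
apply: sub2_chain => [x y|c]; first exact: pd2M.
by rewrite -[LHS]/(pd2 c%:P%:P) /pd2 map_polyC /= derivC.
Qed.

Lemma jacdet_subG g1 g2 K :
  jacdet (g1, subG g1 g2 K) = subG g1 g2 (pd2 K) * jacdet (g1, g2).
Proof. rewrite /jacdet /= pd1_subG pd2_subG; ring. Qed.
End Substitution.

(** * Newton steps and lower bounds for the distance to a value *)

Section Graves.
Variable R : realType.
Local Notation C := (R[i]).
Implicit Types (P Q : {poly {poly C}}).

Lemma taylor1 (q : {poly C}) : exists2 K : R, 0 < K & forall t : R, 0 <= t <= 1 ->
  nC (q.[t%:C%C] - (q.[0] + t%:C%C * q^`().[0])) <= K * t ^+ 2.
Proof.
pose r : {poly C} := drop_poly 2 q.
have qE : q = r * 'X^2 + q`_1 *: 'X + (q`_0)%:P.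
  rewrite -[LHS](poly_take_drop 2) addrC -addrA; congr (_ + _).
  apply/polyP => i; rewrite coef_take_poly coefD coefZ coefX coefC.
  by case: i => [|[|i]] /=; rewrite ?mulr0 ?mulr1 ?add0r ?addr0.
pose K := 1 + \sum_(i < size r) nC r`_i.
have K0 : 0 < K by rewrite ltr_pwDl// sumr_ge0// => i _; exact: nC_ge0.
exists K => // t /andP[t0 t1].
have -> : q.[t%:C%C] - (q.[0] + t%:C%C * q^`().[0]) = r.[t%:C%C] * t%:C%C ^+ 2.
  rewrite !horner_coef0 coef_deriv mulr1n {1}qE !hornerE; ring.
rewrite nCM nCX nC_real ger0_norm// ler_wpM2r ?exprn_ge0//.
rewrite horner_coef; apply: le_trans (nC_sum _ _ _) _.
apply: le_trans (_ : \sum_(i < size r) nC r`_i <= _); last by rewrite lerDr.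
apply: ler_sum => i _; rewrite nCM nCX nC_real ger0_norm// ler_piMr ?nC_ge0// exprn_ile1//.
Qed.

Definition gap (G1 G2 : {poly {poly C}}) (y z : C * C) : R :=
  nC (peval G1 z - y.1) + nC (peval G2 z - y.2).

Lemma gap_ge0 G1 G2 y z : 0 <= gap G1 G2 y z.
Proof. by rewrite addr_ge0// nC_ge0. Qed.

Lemma gap_eq0 G1 G2 y z : gap G1 G2 y z = 0 -> peval G1 z = y.1 /\ peval G2 z = y.2.
Proof.
move/eqP; rewrite paddr_eq0 ?nC_ge0// !nC_eq0 !subr_eq0 => /andP[/eqP-> /eqP->].
by [].
Qed.

(** Compactness: an ultrafilter on a minimising sequence converges in the closed ball, and gap and
    distance are continuous along it. *)
Lemma bounded_min (G1 G2 : {poly {poly C}}) (y a : C * C) (r sg : R) : 0 <= r -> exists z : C * C,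
  nC (z.1 - a.1) + nC (z.2 - a.2) <= r /\
  forall z', nC (z'.1 - a.1) + nC (z'.2 - a.2) <= r ->
    gap G1 G2 y z + sg * (nC (z.1 - a.1) + nC (z.2 - a.2)) <=
    gap G1 G2 y z' + sg * (nC (z'.1 - a.1) + nC (z'.2 - a.2)).
Proof.
move=> r0; pose dist (z : C * C) := nC (z.1 - a.1) + nC (z.2 - a.2).
pose Phi z := gap G1 G2 y z + sg * dist z.
have dist_ge0 z : 0 <= dist z by rewrite addr_ge0// nC_ge0.
pose B := [set z | dist z <= r].
pose S := [set Phi z | z in B].
have Sa : S (Phi a) by exists a => //=; rewrite /B /dist /= !subrr nC0 addr0.
have Slb : has_lbound S.
  exists (- (`|sg| * r)) => _ [z zB <-]; rewrite /Phi.
  have h : `|sg * dist z| <= `|sg| * r by rewrite normrM ler_wpM2l// ger0_norm.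
  have := gap_ge0 G1 G2 y z; move: h; rewrite ler_norml => /andP[h _]; lra.
have infS : has_inf S by split => //; exists (Phi a).
pose m := inf S.
have [n|n z [zB h]|F [FU FS]] := @uf_exists _ (fun n z => B z /\ Phi z <= m + (n.+1%:R)^-1).
- have n0 : 0 < (n.+1%:R : R)^-1 by rewrite invr_gt0 ltr0n.
  by have [_ [z zB <-] h] := inf_adherent n0 infS; exists z; split => //; exact: ltW.
- split => //; apply: le_trans h _; rewrite lerD2l lef_pV2 ?posrE ?ltr0n// ler_nat.
  by [].
have FB : F B by apply: filterS (FS 0%N) => z [].
have b1 : lO F (fun z => nC z.1) (fun=> 1).
  exists (nC a.1 + r + 1); first by rewrite ltr_pwDr// addr_ge0// nC_ge0.
  apply: filterS FB => z; rewrite mulr1 /B /dist /= => h; have := nCBB z.1 a.1.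
  by have := nC_ge0 (z.2 - a.2); lra.
have b2 : lO F (fun z => nC z.2) (fun=> 1).
  exists (nC a.2 + r + 1); first by rewrite ltr_pwDr// addr_ge0// nC_ge0.
  apply: filterS FB => z; rewrite mulr1 /B /dist /= => h; have := nCBB z.2 a.2.
  by have := nC_ge0 (z.1 - a.1); lra.
have [z1 hz1] := @ulim_ex R _ F FU fst b1; have [z2 hz2] := @ulim_ex R _ F FU snd b2.
have lP P : ulim F (peval P) (peval P (z1, z2)).
  by apply: ulim_ext (ulim_peval P hz1 hz2); apply: ufT => z; rewrite -surjective_pairing.
have dl (f : C * C -> C) l (e : R) : 0 < e -> ulim F f l -> F (fun z => `|nC (f z) - nC l| <= e).
  move=> e0 h; apply: filterS (h e e0) => z; rewrite mulr1; apply: le_trans.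
  rewrite ler_norml; have := nCBB (f z) l; have := nCBB l (f z); rewrite [nC (l - _)]nCBC.
  by move=> ? ?; apply/andP; split; lra.
have cl l (c : C) (f : C * C -> C) : ulim F f l -> ulim F (fun z => f z - c) (l - c).
  by move=> h; apply: ulimB h (ulim_cst _).
have hd (e : R) : 0 < e -> F (fun z => `|dist z - dist (z1, z2)| <= 2 * e).
  move=> e0; apply: filterS2 (dl _ _ e e0 (cl _ a.1 _ hz1)) (dl _ _ e e0 (cl _ a.2 _ hz2)) => z h1 h2.
  by move: h1 h2; rewrite /dist /= !ler_norml => /andP[? ?] /andP[? ?]; apply/andP; split; lra.
have hg (e : R) : 0 < e -> F (fun z => `|gap G1 G2 y z - gap G1 G2 y (z1, z2)| <= 2 * e).
  move=> e0; apply: filterS2 (dl _ _ e e0 (cl _ y.1 _ (lP G1))) (dl _ _ e e0 (cl _ y.2 _ (lP G2))) => z h1 h2.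
  by move: h1 h2; rewrite /gap /= !ler_norml => /andP[? ?] /andP[? ?]; apply/andP; split; lra.
exists (z1, z2); split.
  apply/ler_addgt0Pr => e e0; have e2 : 0 < e / 2 by rewrite divr_gt0.
  have [z [zB]] := filter_ex (filterI FB (hd _ e2)); move: zB; rewrite /B /= ler_norml.
  by rewrite -/(dist (z1, z2)) => ? /andP[? ?]; lra.
move=> z' z'B; apply: le_trans (_ : m <= _); last by apply: ge_inf => //; exists z'.
apply/ler_addgt0Pr => e e0.
pose e1 := e / (4 * (1 + `|sg|)).
have sg1 : 0 < 1 + `|sg| by rewrite ltr_pwDl.
have e10 : 0 < e1 by rewrite divr_gt0// mulr_gt0.
have e2 : 0 < e / 2 by rewrite divr_gt0.
have [n hn] := natSinv_small e2.
have [z [[zB hz] [h1 h2]]] := filter_ex (filterI (FS n) (filterI (hd _ e10) (hg _ e10))).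
rewrite -/(dist (z1, z2)).
have h3 : `|sg * (dist z - dist (z1, z2))| <= `|sg| * (2 * e1) by rewrite normrM ler_wpM2l.
have e1E : (1 + `|sg|) * e1 = e / 4 by rewrite /e1; field; rewrite lt0r_neq0.
move: hz hn h2 h3 e1E; clearbody e1; rewrite /Phi !ler_norml; clear.
move: (gap G1 G2 y z) (gap _ _ _ _) (dist z) (dist _) (n.+1%:R^-1) (`|sg|) => A1 A2 B1 B2 N0 S0.
move=> ? ? /andP[? ?] /andP[? ?] ?; lra.
Qed.

(* a point of small gap with a uniformly invertible differential nearby has a solution nearby:
   otherwise a Newton step decreases the penalised gap at its minimum *)
Lemma graves (G1 G2 : {poly {poly C}}) (y a : C * C) (r sg : R) : 0 < r -> 0 < sg ->
  (forall z, nC (z.1 - a.1) + nC (z.2 - a.2) <= r -> gap G1 G2 y z != 0) ->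
  (forall z, nC (z.1 - a.1) + nC (z.2 - a.2) <= r -> exists v : C * C,
     [/\ peval (pd1 G1) z * v.1 + peval (pd2 G1) z * v.2 = - (peval G1 z - y.1),
         peval (pd1 G2) z * v.1 + peval (pd2 G2) z * v.2 = - (peval G2 z - y.2) &
         sg * (nC v.1 + nC v.2) <= gap G1 G2 y z]) ->
  sg / 2 * r <= gap G1 G2 y a.
Proof.
move=> r0 sg0 nz hv; rewrite leNgt; apply/negP => lt.
have [z [zr zmin]] := bounded_min G1 G2 y a (sg / 2) (ltW r0).
have [v [v1 v2 vs]] := hv z zr.
have ga := zmin a; rewrite !subrr nC0 addr0 mulr0 addr0 in ga; have {}ga := ga (ltW r0).
set d := nC (z.1 - a.1) + nC (z.2 - a.2) in zr ga zmin.
have gz : 0 < gap G1 G2 y z by rewrite lt_def nz// gap_ge0.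
have dr : d < r.
  have : sg / 2 * d < sg / 2 * r by lra.
  by rewrite ltr_pM2l// divr_gt0.
pose q G := sub1 ((z.1)%:P + v.1 *: 'X) ((z.2)%:P + v.2 *: 'X) G.
have q0 G : (q G).[0] = peval G z.
  by rewrite horner_sub1 !hornerE -surjective_pairing.
have q1 G : (q G)^`().[0] = peval (pd1 G) z * v.1 + peval (pd2 G) z * v.2.
  rewrite /q deriv_sub1 !derivD !derivC !derivZ !derivX !add0r hornerD !hornerM !horner_sub1.
  rewrite !hornerD !hornerZ !hornerC !hornerX !mulr0 !addr0 !mulr1.
  by rewrite -surjective_pairing.
have [K1 K10 h1] := taylor1 (q G1); have [K2 K20 h2] := taylor1 (q G2).
pose V := nC v.1 + nC v.2.
have V0 : 0 <= V by rewrite addr_ge0// nC_ge0.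
pose g := gap G1 G2 y z.
(* The three bounds serve the Taylor estimate, the ball, and a quadratic error of at most t g / 4.
   The penalty grows by at most t g / 2, so the gain t g wins. *)
pose t := Num.min (Num.min 1 ((r - d) / (1 + V))) (g / (4 * (K1 + K2))).
have K0 : 0 < K1 + K2 by rewrite addr_gt0.
have V1 : 0 < 1 + V by rewrite ltr_pwDl.
have t0 : 0 < t by rewrite /t !lt_min ltr01 !divr_gt0 ?subr_gt0 ?mulr_gt0.
have t1 : t <= 1 by rewrite /t !ge_min lexx.
have tV : t * V <= r - d.
  have : t <= (r - d) / (1 + V) by rewrite /t !ge_min lexx orbT.
  by rewrite ler_pdivlMr// mulrDr mulr1; lra.
have tK : t * (4 * (K1 + K2)) <= g.
  by rewrite -ler_pdivlMr ?mulr_gt0// /t !ge_min lexx !orbT.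
pose z' : C * C := (z.1 + t%:C%C * v.1, z.2 + t%:C%C * v.2).
have d' : nC (z'.1 - a.1) + nC (z'.2 - a.2) <= d + t * V.
  have e1 : nC (z'.1 - a.1) <= nC (z.1 - a.1) + t * nC v.1.
    have -> : z'.1 - a.1 = (z.1 - a.1) + t%:C%C * v.1 by rewrite /z' /=; ring.
    by apply: le_trans (nCD _ _) _; rewrite nCM nC_real gtr0_norm.
  have e2 : nC (z'.2 - a.2) <= nC (z.2 - a.2) + t * nC v.2.
    have -> : z'.2 - a.2 = (z.2 - a.2) + t%:C%C * v.2 by rewrite /z' /=; ring.
    by apply: le_trans (nCD _ _) _; rewrite nCM nC_real gtr0_norm.
  by rewrite /d /V mulrDr; lra.
have step G (yc : C) K : (forall t : R, 0 <= t <= 1 -> nC ((q G).[t%:C%C] - ((q G).[0] + t%:C%C * (q G)^`().[0])) <= K * t ^+ 2) ->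
    peval (pd1 G) z * v.1 + peval (pd2 G) z * v.2 = - (peval G z - yc) ->
    nC (peval G z' - yc) <= (1 - t) * nC (peval G z - yc) + K * t ^+ 2.
  move=> hK e; have := hK t; rewrite (ltW t0) t1 => /(_ isT); rewrite q0 q1 e horner_sub1.
  have -> : (((z.1)%:P + v.1 *: 'X).[t%:C%C], ((z.2)%:P + v.2 *: 'X).[t%:C%C]) = z'.
    by rewrite !hornerE /z'; congr (_ + _, _ + _); rewrite mulrC.
  set E := peval G z' - (_ + _) => hE.
  have -> : peval G z' - yc = (1 - t%:C%C) * (peval G z - yc) + E by rewrite /E; ring.
  apply: le_trans (nCD _ _) _; apply: lerD => //; rewrite nCM.
  have -> : 1 - t%:C%C = (1 - t)%:C%C :> C by rewrite rmorphB.
  by rewrite nC_real ger0_norm// subr_ge0.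
have s1 := step _ _ _ h1 v1; have s2 := step _ _ _ h2 v2.
have g' : gap G1 G2 y z' <= (1 - t) * g + (K1 + K2) * t ^+ 2.
  by rewrite /gap /g /gap mulrDr mulrDl; lra.
have := zmin z'; rewrite (le_trans d'); last by lra.
move=> /(_ isT); rewrite -/g => h.
have h3 : sg / 2 * (nC (z'.1 - a.1) + nC (z'.2 - a.2)) <= sg / 2 * d + t * g / 2.
  apply: le_trans (_ : sg / 2 * (d + t * V) <= _); first by rewrite ler_wpM2l// divr_ge0// ltW.
  have : t * (sg * V) <= t * g by rewrite ler_wpM2l// ltW.
  by nra.
have h4 : (K1 + K2) * t ^+ 2 <= t * g / 4.
  have : t * (t * (4 * (K1 + K2))) <= t * g by rewrite ler_wpM2l// ltW.
  by rewrite expr2; lra.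
have tg : 0 < t * g by rewrite mulr_gt0.
by rewrite mulrBl mul1r in g'; lra.
Qed.
End Graves.

Section Lojasiewicz.
Variable R : realType.
Local Notation C := (R[i]).
Implicit Types (P Q : {poly {poly C}}).

Lemma ulim_nC (T : Type) (F : set_system T) {FU : UltraFilter F} (f : T -> C) l (e : R) : 0 < e -> ulim F f l ->
  F (fun z => `|nC (f z) - nC l| <= e).
Proof.
move=> e0 h; apply: filterS (h e e0) => z; rewrite mulr1; apply: le_trans.
rewrite ler_norml; have := nCBB (f z) l; have := nCBB l (f z); rewrite [nC (l - _)]nCBC.
by move=> ? ?; apply/andP; split; lra.
Qed.

Lemma peval_away0 P z0 : peval P z0 != 0 -> exists2 c : R, 0 < c & forall z,
  nC (z.1 - z0.1) + nC (z.2 - z0.2) <= c -> c <= nC (peval P z).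
Proof.
move=> P0; apply: contrapT => nh.
have [n|n z [h1 h2]|F [FU FS]] := @uf_exists _ (fun n (z : C * C) =>
    nC (z.1 - z0.1) + nC (z.2 - z0.2) <= (n.+1%:R)^-1 /\ nC (peval P z) <= (n.+1%:R)^-1).
- apply: contrapT => nz; apply: nh; exists (n.+1%:R)^-1; first by rewrite invr_gt0 ltr0n.
  move=> z hz; rewrite leNgt; apply/negP => /ltW h; apply: nz; by exists z.
- have mono : (n.+2%:R : R)^-1 <= n.+1%:R^-1 by rewrite lef_pV2 ?posrE ?ltr0n// ler_nat.
  by split; [exact: le_trans h1 mono|exact: le_trans h2 mono].
have lim1 : ulim F fst z0.1.
  move=> e e0; have [n hn] := natSinv_small e0; apply: filterS (FS n) => z [h1 _]; rewrite mulr1.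
  by apply: le_trans hn; apply: le_trans h1; rewrite lerDl nC_ge0.
have lim2 : ulim F snd z0.2.
  move=> e e0; have [n hn] := natSinv_small e0; apply: filterS (FS n) => z [h1 _]; rewrite mulr1.
  by apply: le_trans hn; apply: le_trans h1; rewrite lerDr nC_ge0.
have l1 : ulim F (peval P) (peval P z0).
  rewrite [z0 in peval P z0]surjective_pairing.
  by apply: ulim_ext (ulim_peval P lim1 lim2); apply: ufT => z; rewrite -surjective_pairing.
have l0 : ulim F (peval P) 0.
  apply/ulim0P => e e0; have [n hn] := natSinv_small e0; apply: filterS (FS n) => z [_ h2].
  by rewrite mulr1; exact: le_trans h2 hn.
by move/eqP: P0; apply; exact: ulim_uniq l1 l0.
Qed.

Lemma peval_bounded P (r : R) : exists2 B : R, 0 < B & forall z, nC z.1 <= r -> nC z.2 <= r -> nC (peval P z) <= B.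
Proof.
have [K K0 hK] := nC_peval_le P.
exists (K * (1 + \sum_(w <- suppl P) `|r| ^+ (w.1 + w.2))).
  by rewrite mulr_gt0// ltr_pwDl// sumr_ge0// => w _; rewrite exprn_ge0.
move=> z z1 z2; apply: le_trans (hK z) _; rewrite ler_wpM2l ?(ltW K0)//.
apply: le_trans (_ : \sum_(w <- suppl P) `|r| ^+ (w.1 + w.2) <= _); last by rewrite lerDr.
apply: ler_sum => w _; rewrite /mon nCM !nCX exprD.
by apply: ler_pM; rewrite ?exprn_ge0 ?nC_ge0// lerXn2r ?nnegrE ?nC_ge0// (le_trans _ (ler_norm r)).
Qed.

(* Cramer's rule, with the size of the solution *)
Lemma newton_step (G1 G2 : {poly {poly C}}) (y z : C * C) (B sg : R) : 0 < B ->
  nC (peval (pd1 G1) z) <= B -> nC (peval (pd2 G1) z) <= B ->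
  nC (peval (pd1 G2) z) <= B -> nC (peval (pd2 G2) z) <= B ->
  0 < sg -> 2 * B * sg <= nC (peval (jacdet (G1, G2)) z) ->
  exists v : C * C,
     [/\ peval (pd1 G1) z * v.1 + peval (pd2 G1) z * v.2 = - (peval G1 z - y.1),
         peval (pd1 G2) z * v.1 + peval (pd2 G2) z * v.2 = - (peval G2 z - y.2) &
         sg * (nC v.1 + nC v.2) <= gap G1 G2 y z].
Proof.
rewrite /jacdet /= pevalB !pevalM /gap.
set a := peval (pd1 G1) z; set b := peval (pd2 G1) z; set c := peval (pd1 G2) z; set d := peval (pd2 G2) z.
set g1 := _ - y.1; set g2 := _ - y.2 => B0 ha hb hc hd sg0 hJ; set J := a * d - b * c in hJ.
have J0 : 0 < nC J by apply: lt_le_trans hJ; rewrite !mulr_gt0.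
have Jn0 : J != 0 by rewrite -nC_gt0.
exists (- (d * g1 - b * g2) / J, - (a * g2 - c * g1) / J); split => /=.
- by rewrite /J in Jn0 *; field.
- by rewrite /J in Jn0 *; field.
have [p1 p2] := (nC_ge0 g1, nC_ge0 g2).
have e1 : nC (- (d * g1 - b * g2)) <= B * (nC g1 + nC g2).
  rewrite nCN [X in _ <= X]mulrDr; apply: le_trans (nCB _ _) _; rewrite !nCM.
  by apply: lerD; rewrite ler_wpM2r.
have e2 : nC (- (a * g2 - c * g1)) <= B * (nC g1 + nC g2).
  rewrite nCN [nC g1 + _]addrC [X in _ <= X]mulrDr; apply: le_trans (nCB _ _) _; rewrite !nCM.
  by apply: lerD; rewrite ler_wpM2r.
rewrite !nCM nCV -mulrDl mulrA ler_pdivrMr//.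
apply: le_trans (_ : (nC g1 + nC g2) * (2 * B * sg) <= _); last by rewrite ler_wpM2l// addr_ge0.
have : sg * (nC (- (d * g1 - b * g2)) + nC (- (a * g2 - c * g1))) <= sg * (2 * (B * (nC g1 + nC g2))).
  by rewrite ler_wpM2l ?(ltW sg0)//; lra.
by move/le_trans; apply; rewrite le_eqVlt; apply/orP; left; apply/eqP; ring.
Qed.

(* Near a point (s0, 0) with s0 <> 0 over which the log-Jacobian vanishes to the exact order k along t = 0 *)
Theorem gap_lower_bound (G1 G2 Jh : {poly {poly C}}) (y : C * C) (s0 : C) l k
    (T : Type) (F : set_system T) {FU : UltraFilter F} (a b : T -> C) :
  (forall z, torus z -> z.1 * z.2 * peval (jacdet (G1, G2)) z = z.1 ^+ l * z.2 ^+ k.+1 * peval Jh z) ->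
  s0 != 0 -> peval Jh (s0, 0) != 0 ->
  (forall z, torus z -> gap G1 G2 y z != 0) ->
  ulim F a s0 -> ulim F b 0 -> F (fun x => b x <> 0) ->
  lO F (fun x => nC (b x) ^+ k.+1) (fun x => gap G1 G2 y (a x, b x)).
Proof.
move=> hJ s00 J0 nz la lb b0.
have [c c0 hc] := peval_away0 J0.
pose r : R := nC s0 + 2.
have [B1 B10 hB1] := peval_bounded (pd1 G1) r; have [B2 B20 hB2] := peval_bounded (pd2 G1) r.
have [B3 B30 hB3] := peval_bounded (pd1 G2) r; have [B4 B40 hB4] := peval_bounded (pd2 G2) r.
pose B := B1 + B2 + (B3 + B4).
have B0 : 0 < B by rewrite !addr_gt0.
have s0p : 0 < nC s0 by rewrite nC_gt0.
have [q q0 hq] : exists2 q : R, 0 < q & forall s : C, s != 0 -> nC s0 / 2 <= nC s -> nC s <= r -> q <= nC s ^+ l / nC s.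
  have rp : 0 < r by rewrite /r ltr_pwDr// ltW.
  have s2 : 0 < nC s0 / 2 by rewrite divr_gt0.
  exists ((nC s0 / 2) ^+ l / r); first by rewrite divr_gt0 ?exprn_gt0.
  move=> s sn h1 h2; have sp : 0 < nC s by rewrite nC_gt0.
  apply: ler_pM; rewrite ?exprn_ge0 ?invr_ge0 ?(ltW rp) ?(ltW s2)//; last by rewrite lef_pV2 ?posrE.
  by rewrite lerXn2r ?nnegrE ?(ltW s2) ?(ltW sp).
pose e0 : R := Num.min (Num.min (c / 4) (nC s0 / 4)) (1 / 4).
have e00 : 0 < e0 by rewrite /e0 !lt_min !divr_gt0.
have [e1 e2 e3] : [/\ e0 <= c / 4, e0 <= nC s0 / 4 & e0 <= 1 / 4].
  by rewrite /e0; split; rewrite !ge_min lexx ?orbT.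
(* On the ball of radius |b| / 2 the Jacobian is at least 2 B sgc |b|^k: [q] bounds the power of s,
   (1/2)^k accounts for |t| >= |b| / 2, and [c] bounds [Jh]. *)
pose sgc := q * (1 / 2) ^+ k * c / (2 * B).
have sgc0 : 0 < sgc by rewrite /sgc divr_gt0 ?mulr_gt0// exprn_gt0// divr_gt0.
exists (4 / sgc); first by rewrite divr_gt0.
apply: filterS3 (la e0 e00) (lb e0 e00) b0 => x; rewrite !mulr1 subr0 => ax bx /eqP bn0.
have bp : 0 < nC (b x) by rewrite nC_gt0.
pose sg := sgc * nC (b x) ^+ k.
have sg0 : 0 < sg by rewrite mulr_gt0// exprn_gt0.
have ball z : nC (z.1 - a x) + nC (z.2 - b x) <= nC (b x) / 2 ->
   [/\ torus z, nC s0 / 2 <= nC z.1, nC z.1 <= r, nC z.2 <= r & nC (z.1 - s0) + nC (z.2 - 0) <= c /\ nC (b x) / 2 <= nC z.2].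
  move=> hz.
  have h1 := nC_ge0 (z.1 - a x); have h2 := nC_ge0 (z.2 - b x).
  have h3 : nC (z.1 - s0) <= nC (z.1 - a x) + nC (a x - s0).
    have e : z.1 - s0 = (z.1 - a x) + (a x - s0) by ring.
    by rewrite e nCD.
  have h4 := nCBB z.1 s0; have h5 := nCBB s0 z.1; rewrite [nC (s0 - _)]nCBC in h5.
  have h6 := nCBB z.2 (b x); have h7 := nCBB (b x) z.2; rewrite [nC (b x - _)]nCBC in h7.
  have z1p : nC s0 / 2 <= nC z.1 by lra.
  have z2p : nC (b x) / 2 <= nC z.2 by lra.
  split => //; rewrite /r ?subr0.
  - by split; rewrite -nC_gt0; [apply: lt_le_trans z1p|apply: lt_le_trans z2p]; rewrite divr_gt0.
  - lra.
  - lra.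
  - by split => //; lra.
have := @graves R G1 G2 y (a x, b x) (nC (b x) / 2) sg (divr_gt0 bp (ltr0n R 2)) sg0.
have hnz z : nC (z.1 - a x) + nC (z.2 - b x) <= nC (b x) / 2 -> gap G1 G2 y z != 0.
  by move=> /ball[tz _ _ _ _]; exact: nz.
move=> /(_ hnz) gr; have {}gr : sg / 2 * (nC (b x) / 2) <= gap G1 G2 y (a x, b x).
  apply: gr => z /ball[tz z1 z1r z2r [zc z2]]; have [t1 t2] := tz.
  have [t1p t2p] : 0 < nC z.1 /\ 0 < nC z.2 by rewrite !nC_gt0.
  apply: (@newton_step G1 G2 y z B) => //.
  - by apply: le_trans (hB1 z z1r z2r) _; rewrite /B; lra.
  - by apply: le_trans (hB2 z z1r z2r) _; rewrite /B; lra.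
  - by apply: le_trans (hB3 z z1r z2r) _; rewrite /B; lra.
  - by apply: le_trans (hB4 z z1r z2r) _; rewrite /B; lra.
  have JE : nC (peval (jacdet (G1, G2)) z) = (nC z.1 ^+ l / nC z.1) * nC z.2 ^+ k * nC (peval Jh z).
    have := congr1 (@nC R) (hJ z tz); rewrite !nCM !nCX exprS => e.
    apply: (mulfI (mulf_neq0 (lt0r_neq0 t1p) (lt0r_neq0 t2p))); rewrite e.
    by field; rewrite lt0r_neq0.
  rewrite JE /sg /sgc.
  have -> : 2 * B * (q * (1 / 2) ^+ k * c / (2 * B) * nC (b x) ^+ k) = q * ((1 / 2) ^+ k * nC (b x) ^+ k) * c.
    by field; rewrite lt0r_neq0.
  have hc' := hc z zc.
  have hf : 0 <= (1 / 2 : R) by rewrite divr_ge0.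
  apply: ler_pM => //; rewrite ?(ltW c0)//.
    by rewrite mulr_ge0 ?(ltW q0)// mulr_ge0// exprn_ge0// (ltW bp).
  apply: ler_pM; rewrite ?(ltW q0)//; [|exact: hq|].
    by rewrite mulr_ge0// exprn_ge0// (ltW bp).
  by rewrite -exprMn lerXn2r ?nnegrE ?(mulr_ge0 hf (ltW bp)) ?(ltW t2p)// mulrC mulrA mulr1.
have c4 : 0 <= 4 / sgc by rewrite divr_ge0// ltW.
apply: le_trans (ler_wpM2l c4 gr); rewrite /sg exprS le_eqVlt; apply/orP; left; apply/eqP.
by field; rewrite lt0r_neq0.
Qed.
End Lojasiewicz.

(** * Orders and degrees of polynomials read off along ultrafilters *)

Section Orders.
Variable R : realType.
Local Notation C := (R[i]).
Implicit Types (p q : {poly C}).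

Lemma uf_near (s0 : C) : exists F : set_system C,
  [/\ UltraFilter F, ulim F id s0 & F (fun s => s <> s0)].
Proof.
have [n|n s [h1 h2]|F [FU FS]] := @uf_exists _ (fun n (s : C) => s != s0 /\ nC (s - s0) <= (n.+1%:R)^-1).
- exists (s0 + ((n.+1%:R)^-1 : R)%:C%C).
  have n0 : 0 < (n.+1%:R)^-1 :> R by rewrite invr_gt0 ltr0n.
  rewrite addrC addrK nC_real ger0_norm ?(ltW n0)//; split => //.
  by rewrite -subr_eq0 addrK -nC_eq0 nC_real normr_eq0 lt0r_neq0.
- by split => //; apply: le_trans h2 _; rewrite lef_pV2 ?posrE ?ltr0n// ler_nat.
exists F; split => //; last by apply: filterS (FS 0%N) => s [/eqP].
move=> e e0; have [n hn] := natSinv_small e0; apply: filterS (FS n) => s [_ h].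
by rewrite mulr1; exact: le_trans h hn.
Qed.

Lemma uf_infinity : exists F : set_system C, UltraFilter F /\ lo F (fun=> 1) (fun s => nC s).
Proof.
have [n|n s h|F [FU FS]] := @uf_exists _ (fun n (s : C) => n%:R <= nC s :> R).
- by exists n%:R; rewrite nC_natr.
- by apply: le_trans h; rewrite ler_nat.
exists F; split => // e e0; have [n hn] := natSinv_small e0.
apply: filterS (FS n.+1) => s h; rewrite -(mulVf (lt0r_neq0 e0)) mulrC ler_pM2l//.
by apply: le_trans h; rewrite -(invrK n.+1%:R) lef_pV2 ?posrE ?invr_gt0 ?ltr0n.
Qed.

Section Near.
Variables (T : Type) (F : set_system T).
Context {FU : UltraFilter F}.
Variables (a : T -> C) (s0 : C).
Hypothesis la : ulim F a s0.
Hypothesis na : F (fun x => a x <> s0).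

Let dpos : F (fun x => 0 < nC (a x - s0)).
Proof. by apply: filterS na => x /eqP h; rewrite nC_gt0 subr_eq0. Qed.

Lemma mup_factor p : p != 0 -> exists2 u, u.[s0] != 0 & p = u * ('X - s0%:P) ^+ mup s0 p.
Proof.
move=> p0; have [m [u u0 pE]] := multiplicity_XsubC p s0.
rewrite p0 /= in u0; exists u; first by rewrite -rootE.
suff -> : mup s0 p = m by [].
by rewrite pE mupMr// mup_XsubCX eqxx.
Qed.

Lemma order_lower p : p != 0 -> lO F (fun x => nC (a x - s0) ^+ mup s0 p) (fun x => nC p.[a x]).
Proof.
move=> p0; have [u u0 pE] := mup_factor p0.
have [K K0 h] := ulim_neq0 (ulim_poly u la) u0; exists K => //; apply: filterS h => x h.
rewrite {2}pE hornerM horner_exp hornerXsubC nCM nCX mulrA -[leLHS]mul1r.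
by rewrite ler_wpM2r// exprn_ge0// nC_ge0.
Qed.

Lemma order_upper p : p != 0 -> lO F (fun x => nC p.[a x]) (fun x => nC (a x - s0) ^+ mup s0 p).
Proof.
move=> p0; have [u u0 pE] := mup_factor p0.
have [K K0 h] := ulim_lO (ulim_poly u la); exists K => //; apply: filterS h => x; rewrite mulr1 => h.
by rewrite {1}pE hornerM horner_exp hornerXsubC nCM nCX ler_wpM2r// exprn_ge0// nC_ge0.
Qed.

Lemma lo_dist n m : (n < m)%N -> lo F (fun x => nC (a x - s0) ^+ m) (fun x => nC (a x - s0) ^+ n).
Proof.
move=> nm; have e : m = (n + (m - n))%N by rewrite subnKC// ltnW.
have h : lo F (fun x => nC (a x - s0)) (fun=> 1) by move=> k k0; exact: la.
have mn : (0 < m - n)%N by rewrite subn_gt0.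
have h2 := @lo_exp _ _ F FU _ _ _ mn (fun x => nC_ge0 (a x - s0)) h.
move=> k k0; apply: filterS (h2 k k0) => x; rewrite expr1n mulr1 => hx.
by rewrite e exprD mulrC ler_wpM2r// exprn_ge0// nC_ge0.
Qed.

Lemma order_le p N : p != 0 -> lO F (fun x => nC (a x - s0) ^+ N) (fun x => nC p.[a x]) -> (mup s0 p <= N)%N.
Proof.
move=> p0 h; rewrite leqNgt; apply/negP => lt.
apply: (lo_irr (lo_dist lt) (lO_trans h (order_upper p0))).
by apply: filterS dpos => x hx; rewrite exprn_gt0.
Qed.

Lemma order_ge p N : p != 0 -> lO F (fun x => nC p.[a x]) (fun x => nC (a x - s0) ^+ N) -> (N <= mup s0 p)%N.
Proof.
move=> p0 h; rewrite leqNgt; apply/negP => lt.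
apply: (lo_irr (lo_dist lt) (lO_trans (order_lower p0) h)).
by apply: filterS dpos => x hx; rewrite exprn_gt0.
Qed.

Lemma nonroot_near p : p != 0 -> F (fun x => p.[a x] <> 0).
Proof.
move=> p0; have [K K0 h] := order_lower p0; apply: filterS2 h dpos => x h1 h2 h3.
by move: h1; rewrite h3 nC0 mulr0 leNgt exprn_gt0.
Qed.
End Near.

Section Far.
Variables (T : Type) (F : set_system T).
Context {FU : UltraFilter F}.
Variable a : T -> C.
Hypothesis la : lo F (fun=> 1) (fun x => nC (a x)).

Let apos : F (fun x => 1 <= nC (a x)).
Proof. by apply: filterS (la ltr01) => x; rewrite mul1r. Qed.

Lemma lo_far n m : (n < m)%N -> lo F (fun x => nC (a x) ^+ n) (fun x => nC (a x) ^+ m).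
Proof.
move=> nm; have e : m = (n + (m - n))%N by rewrite subnKC// ltnW.
have mn : (0 < m - n)%N by rewrite subn_gt0.
have h := @lo_exp_inv R T F FU (fun x => nC (a x)) _ (fun x => nC_ge0 (a x)) la mn.
move=> k k0; apply: filterS (h k k0) => x hx.
by rewrite e exprD mulrCA -[leLHS]mulr1 ler_wpM2l// exprn_ge0// nC_ge0.
Qed.

Lemma lO_far n m : (n <= m)%N -> lO F (fun x => nC (a x) ^+ n) (fun x => nC (a x) ^+ m).
Proof. by rewrite leq_eqVlt => /orP[/eqP->|/lo_far/lo_lO]; [exact: lO_refl|]. Qed.

Lemma degree_upper p : lO F (fun x => nC p.[a x]) (fun x => nC (a x) ^+ (size p).-1).
Proof.
apply: (@lO_trans _ _ F FU (fun x => \sum_(i <- index_enum 'I_(size p)) nC (p`_i * a x ^+ i))).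
  by apply: lO_le => x; rewrite horner_coef; exact: nC_sum.
apply: lO_sum => [x|i _]; first by rewrite exprn_ge0// nC_ge0.
have ip : (i <= (size p).-1)%N by rewrite -ltnS; case: (size p) i => [[]|k []].
have [K K0 h] := lO_far ip; exists ((1 + nC p`_i) * K); first by rewrite mulr_gt0// ltr_pwDl// nC_ge0.
apply: filterS h => x h; rewrite nCM nCX -mulrA.
by apply: ler_pM; rewrite ?nC_ge0 ?exprn_ge0 ?nC_ge0// lerDr.
Qed.

Lemma degree_lower p : p != 0 -> lO F (fun x => nC (a x) ^+ (size p).-1) (fun x => nC p.[a x]).
Proof.
move=> p0; pose q : {poly C} := \poly_(i < (size p).-1) p`_i.
have pE : p = q + lead_coef p *: 'X^((size p).-1).
  apply/polyP => i; rewrite coefD coef_poly coefZ coefXn lead_coefE.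
  case: ltngtP => [|h|->]; rewrite ?mulr0 ?addr0 ?add0r ?mulr1//.
  by rewrite nth_default//; move: h; rewrite -size_poly_gt0 in p0; rewrite prednK.
have l0 : 0 < nC (lead_coef p) by rewrite nC_gt0 lead_coef_eq0.
have hq : lo F (fun x => nC q.[a x]) (fun x => nC (a x) ^+ (size p).-1).
  have [q0|q0] := eqVneq q 0.
    move=> k k0; apply: ufT => x; rewrite q0 horner0 nC0 mulr_ge0 ?(ltW k0)//.
    by rewrite exprn_ge0// nC_ge0.
  apply: lO_lo_trans (degree_upper q) _; apply: lo_far.
  have := size_poly (size p).-1 (fun i => p`_i); rewrite -/q -size_poly_gt0 in q0 *.
  by case: (size q) q0.
have k0 : 0 < nC (lead_coef p) / 2 by rewrite divr_gt0.
exists (2 / nC (lead_coef p)); first by rewrite divr_gt0.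
apply: filterS (hq _ k0) => x h.
have e : nC (lead_coef p) * nC (a x) ^+ (size p).-1 <= nC p.[a x] + nC q.[a x].
  rewrite -nCX -nCM; have -> : lead_coef p * a x ^+ (size p).-1 = p.[a x] - q.[a x].
    transitivity ((q + lead_coef p *: 'X^((size p).-1)).[a x] - q.[a x]); last by rewrite -pE.
    by rewrite hornerD hornerZ hornerXn addrC addKr.
  exact: nCB.
rewrite -mulrA mulrCA ler_pdivlMl//; set u := nC (a x) ^+ _ in e h *.
by move: e h; set v := nC (lead_coef p); lra.
Qed.

Lemma degree_ge p N : p != 0 -> lO F (fun x => nC (a x) ^+ N) (fun x => nC p.[a x]) -> (N <= (size p).-1)%N.
Proof.
move=> p0 h; rewrite leqNgt; apply/negP => lt.
apply: (lo_irr (lo_far lt) (lO_trans h (degree_upper p))).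
by apply: filterS apos => x hx; rewrite exprn_gt0// (lt_le_trans ltr01).
Qed.

Lemma degree_le p N : p != 0 -> lO F (fun x => nC p.[a x]) (fun x => nC (a x) ^+ N) -> ((size p).-1 <= N)%N.
Proof.
move=> p0 h; rewrite leqNgt; apply/negP => lt.
apply: (lo_irr (lo_far lt) (lO_trans (degree_lower p0) h)).
by apply: filterS apos => x hx; rewrite exprn_gt0// (lt_le_trans ltr01).
Qed.

Lemma nonroot_far p : p != 0 -> F (fun x => p.[a x] <> 0).
Proof.
move=> p0; have [K K0 h] := degree_lower p0; apply: filterS2 h apos => x h1 h2 h3.
by move: h1; rewrite h3 nC0 mulr0 leNgt exprn_gt0// (lt_le_trans ltr01).
Qed.
End Far.
End Orders.

Section Products.
Variables (R : realType) (T : Type) (F : set_system T).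
Context {FU : UltraFilter F}.
Local Notation C := (R[i]).

Lemma lO_prod (I : eqType) (r : seq I) (u v : I -> T -> R) :
  (forall i x, 0 <= u i x) -> (forall i, i \in r -> lO F (u i) (v i)) ->
  lO F (fun x => \prod_(i <- r) u i x) (fun x => \prod_(i <- r) v i x).
Proof.
move=> u0; elim: r => [|i r IH] h.
  by apply: lO_le => x; rewrite !big_nil.
have h1 : lO F (fun x => \prod_(j <- r) u j x) (fun x => \prod_(j <- r) v j x).
  by apply: IH => j jr; apply: h; rewrite inE jr orbT.
have h2 := h i (mem_head _ _).
have p0 x : 0 <= \prod_(j <- r) u j x by apply: prodr_ge0.
have h3 := @lO_mul _ _ F FU _ _ _ _ (u0 i) p0 h2 h1.
apply: lO_trans (lO_trans (lO_lev _) h3) (lO_lev _); apply: ufT => x; rewrite ?big_cons//.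
Qed.

Lemma ulim_le_scale (f g : T -> C) l m (K : R) : 0 <= K -> ulim F f l -> ulim F g m ->
  F (fun x => nC (f x) <= K * nC (g x)) -> nC l <= K * nC m.
Proof.
move=> K0 hf hg h; apply: (ulim_le hf h) => e e0.
have e1 : 0 < e / (K + 1) by rewrite divr_gt0// ltr_pwDr.
apply: filterS (ulim_nC e1 hg) => x; rewrite ler_norml => /andP[_ h2].
have : K * (nC (g x) - nC m) <= K * (e / (K + 1)) by rewrite ler_wpM2l.
have : K * (e / (K + 1)) <= e.
  by rewrite mulrA ler_pdivrMr ?ltr_pwDr// mulrC ler_wpM2l ?(ltW e0)// lerDl.
rewrite mulrBr; lra.
Qed.

(** [tau] avoids the limits of the convergent [t j]. A polynomial with roots [t j] that is bounded
    at [tau] then has its leading coefficient times any of its unbounded roots under control. *)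
Lemma exists_separated n (t : 'I_n -> T -> C) (bad : seq C) : exists tau : C, tau \notin bad /\
  forall j, lO F (fun=> 1) (fun x => nC (tau - t j x)) /\ lO F (fun x => nC (t j x)) (fun x => nC (tau - t j x)).
Proof.
have [lim hlim] : exists lim : 'I_n -> C, forall j, ulim F (t j) (lim j) \/ lo F (fun=> 1) (fun x => nC (t j x)).
  have h j : exists l, ulim F (t j) l \/ lo F (fun=> 1) (fun x => nC (t j x)).
    have [h1|h1] := @lo_or _ _ F FU (fun=> 1) (fun x => nC (t j x)); first by exists 0; right.
    by have [l hl] := ulim_ex h1; exists l; left.
  by exists (fun j => sval (cid (h j))) => j; case: cid.
have [tau [_ ht]] := exists_nonroot (bad ++ [seq lim j | j <- enum 'I_n]) (oner_neq0 {poly C}).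
rewrite mem_cat negb_or in ht; case/andP: ht => tb tl.
exists tau; split => // j; have [hl|hb] := hlim j.
  have ne : tau - lim j != 0.
    by rewrite subr_eq0; apply: contra tl => /eqP->; apply: map_f; rewrite mem_enum.
  have h1 : lO F (fun=> 1) (fun x => nC (tau - t j x)) by apply: ulim_neq0 (ulimB (ulim_cst tau) hl) ne.
  by split => //; apply: lO_trans (ulim_lO hl) h1.
have t2 : 0 < (2 * (nC tau + 1))^-1.
  by rewrite invr_gt0 mulr_gt0// ltr_pwDr// nC_ge0.
have h2 : lO F (fun x => nC (t j x)) (fun x => nC (tau - t j x)).
  exists 2 => //; apply: filterS (hb _ t2) => x.
  rewrite mulrC ler_pdivlMr ?mul1r; last by rewrite mulr_gt0// ltr_pwDr// nC_ge0.
  have := nCBB (t j x) tau; rewrite [nC (_ - tau)]nCBC.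
  by have := nC_ge0 tau; lra.
by split => //; apply: lO_trans (lo_lO hb) h2.
Qed.
End Products.

Lemma mulr_shuffle (V : comRingType) (a b c d : V) : a * b * (c * d) = b * c * (a * d).
Proof. ring. Qed.

(** * The resultant count over one exceptional value *)

Section Count1.
Variable R : realType.
Local Notation C := (R[i]).
Implicit Types (G : {poly {poly C}}).

Definition proper_at G1 G2 (y : C * C) := forall (T : Type) (F : set_system T) (a b : T -> C),
  UltraFilter F -> F (fun x => torus (a x, b x)) ->
  ulim F (fun x => peval G1 (a x, b x)) y.1 -> ulim F (fun x => peval G2 (a x, b x)) y.2 ->
  lO F (fun x => nC (a x)) (fun=> 1) /\ lO F (fun x => nC (b x)) (fun=> 1).

(* on the branches of G1 = y.1 along which s = a x tends to infinity, |G2 - y.2| grows at least as |s|^L *)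
Definition steep G1 G2 (y : C * C) (L : nat) := forall (T : Type) (F : set_system T) (a b : T -> C),
  UltraFilter F -> F (fun x => torus (a x, b x)) -> lo F (fun=> 1) (fun x => nC (a x)) ->
  F (fun x => peval G1 (a x, b x) = y.1) ->
  lO F (fun x => nC (a x) ^+ L) (fun x => nC (peval G2 (a x, b x) - y.2)).

Definition axX G : {poly C} := map_poly (horner_eval 0) G.
Definition axZ G : {poly C} := axX (swapXY G).

Lemma axXE G s : (axX G).[s] = peval G (s, 0). Proof. by []. Qed.
Lemma axZE G t : (axZ G).[t] = peval G (0, t). Proof. by rewrite /axZ axXE peval_swapXY. Qed.

Lemma gap_swap G1 G2 y z : gap (swapXY G1) (swapXY G2) y z = gap G1 G2 y (z.2, z.1).
Proof. by rewrite /gap !peval_swapXY. Qed.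

Lemma pd1_swapXY G : pd1 (swapXY G) = swapXY (pd2 G).
Proof.
apply: eq_coef2 => w; rewrite coef2_swapXY /coef2 /pd1 /pd2 coef_deriv coefMn /= coef_swapXY.
by rewrite coef_map_id0 ?raddf0// coef_deriv.
Qed.

Lemma pd2_swapXY G : pd2 (swapXY G) = swapXY (pd1 G).
Proof. by rewrite -{2}(swapXYK G) pd1_swapXY swapXYK. Qed.

Lemma jacdet_swapXY G1 G2 : jacdet (swapXY G1, swapXY G2) = - swapXY (jacdet (G1, G2)).
Proof.
have h (a b c d : {poly {poly C}}) : swapXY (a * b - c * d) = swapXY a * swapXY b - swapXY c * swapXY d.
  by rewrite rmorphB !rmorphM.
by rewrite /jacdet h !pd1_swapXY !pd2_swapXY opprB.
Qed.

Variables (G1 G2 Jh : {poly {poly C}}) (y : C * C) (k l L : nat) (SX SZ : seq C).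
Hypothesis hJ : forall z, torus z ->
  z.1 * z.2 * peval (jacdet (G1, G2)) z = z.1 ^+ l.+1 * z.2 ^+ k.+1 * peval Jh z.
Hypothesis hnz : forall z, torus z -> gap G1 G2 y z != 0.
Hypothesis h0 : gap G1 G2 y (0, 0) != 0.
Hypothesis hprop : proper_at G1 G2 y.
Hypothesis hsteep : steep G1 G2 y L.
Hypothesis hP : axX G1 - (y.1)%:P != 0.
Hypothesis hZ : axZ G1 - (y.1)%:P != 0.
Hypothesis goodX : forall s, gap G1 G2 y (s, 0) = 0 -> peval Jh (s, 0) != 0.
Hypothesis goodZ : forall t, gap G1 G2 y (0, t) = 0 -> peval Jh (0, t) != 0.
Hypothesis SXu : uniq SX.
Hypothesis SZu : uniq SZ.
Hypothesis SXP : forall s, gap G1 G2 y (s, 0) = 0 -> s \in SX.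
Hypothesis SZP : forall t, gap G1 G2 y (0, t) = 0 -> t \in SZ.

Let g : {poly {poly C}} := swapXY G1 - (y.1)%:P%:P.
Let q : {poly {poly C}} := swapXY G2 - (y.2)%:P%:P.
Let lc := lead_coef g.
Let gs (s : C) : {poly C} := map_poly (horner_eval s) g.
Let qs (s : C) : {poly C} := map_poly (horner_eval s) q.
(** The roots are listed in an arbitrary order for each [s]: limits along an ultrafilter require no
    continuous branches. *)
Let t (j : nat) (s : C) : C := nth 0 (rootsC (gs s)) j.

Let gsE s tau : (gs s).[tau] = peval G1 (s, tau) - y.1.
Proof. by rewrite -[LHS]/(peval g (tau, s)) /g pevalB peval_swapXY pevalC. Qed.
Let qsE s tau : (qs s).[tau] = peval G2 (s, tau) - y.2.
Proof. by rewrite -[LHS]/(peval q (tau, s)) /q pevalB peval_swapXY pevalC. Qed.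

Variable n : nat.
Hypothesis sg : size g = n.+2.

Let lc0 : lc != 0. Proof. by rewrite lead_coef_eq0 -size_poly_eq0 sg. Qed.

Let size_gs s : lc.[s] != 0 -> size (gs s) = n.+2.
Proof. by move=> h; rewrite size_map_poly_id0. Qed.

Let lead_gs s : lc.[s] != 0 -> lead_coef (gs s) = lc.[s].
Proof. by move=> h; rewrite lead_coef_map_id0// /horner_eval horner0. Qed.

Let size_roots s : lc.[s] != 0 -> size (rootsC (gs s)) = n.+1.
Proof.
move=> h; have g0 : gs s != 0 by rewrite -size_poly_eq0 size_gs.
by have := size_rootsC g0; rewrite size_gs// => -[].
Qed.

Let gs_prod s tau : lc.[s] != 0 -> (gs s).[tau] = lc.[s] * \prod_(j < n.+1) (tau - t j s).
Proof.
move=> h; rewrite horner_rootsC lead_gs//; congr (_ * _).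
by rewrite (big_nth 0) size_roots// big_mkord.
Qed.

Let t_root s (j : 'I_n.+1) : lc.[s] != 0 -> peval G1 (s, t j s) = y.1.
Proof.
move=> h; apply/eqP; rewrite -subr_eq0 -gsE gs_prod// (bigD1 j)//= subrr mul0r mulr0.
exact: eqxx.
Qed.

Let e := (size q).-1.
(** Rescaling makes the polynomial monic: the roots of [phat] are the lc t_j, and [qhat] at lc t is
    lc^e times [q]. The power lc^(e (n + 1)) thus introduced into [Rs] enters its degree and its
    orders alike and cancels in the end. *)
Let phat : {poly {poly C}} := \poly_(i < n.+2) (if i == n.+1 then 1 else g`_i * lc ^+ (n - i)).
Let qhat : {poly {poly C}} := \poly_(i < size q) (q`_i * lc ^+ (e - i)).
Let Rs : {poly C} := elim n phat qhat.

Let phat_prod s : lc.[s] != 0 ->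
  map_poly (horner_eval s) phat = \prod_(a <- [seq lc.[s] * t j s | j <- iota 0 n.+1]) ('X - a%:P).
Proof.
move=> h; apply/eqP; rewrite -subr_eq0; apply/eqP; apply: poly_infinite0 => x.
have xE : x = lc.[s] * (x / lc.[s]) by rewrite mulrC divfK.
set u := x / lc.[s] in xE; rewrite xE hornerD hornerN horner_prod big_map.
have -> : \prod_(j <- iota 0 n.+1) ('X - (lc.[s] * t j s)%:P).[lc.[s] * u] = lc.[s] ^+ n * (gs s).[u].
  rewrite gs_prod// mulrA -exprSr.
  rewrite -[iota 0 n.+1]/(index_iota 0 n.+1) big_mkord.
  have -> : lc.[s] ^+ n.+1 = \prod_(j < n.+1) lc.[s] by rewrite prodr_const card_ord.
  rewrite -big_split /=.
  by apply: eq_bigr => j _; rewrite hornerXsubC mulrBr.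
rewrite (@horner_coef_wide _ n.+2); last first.
  by apply: leq_trans (size_poly _ _) _; exact: size_poly.
rewrite (@horner_coef_wide _ n.+2 (gs s)) ?size_gs// mulr_sumr -sumrB big1// => i _.
rewrite !coef_map coef_poly ltn_ord /= /horner_eval exprMn.
case: eqP => [->|ne].
  have -> : g`_n.+1 = lc by rewrite /lc lead_coefE sg.
  by rewrite hornerC mul1r exprSr; apply/eqP; rewrite subr_eq0; apply/eqP; ring.
have i_n : (i <= n)%N by have := ltn_ord i; rewrite ltnS leq_eqVlt => /orP[/eqP/ne|].
rewrite hornerM horner_exp; have -> : lc.[s] ^+ n = lc.[s] ^+ (n - i) * lc.[s] ^+ i by rewrite -exprD subnK.
by apply/eqP; rewrite subr_eq0; apply/eqP; ring.
Qed.

Let qhat_eval s tau : (map_poly (horner_eval s) qhat).[lc.[s] * tau] = lc.[s] ^+ e * (qs s).[tau].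
Proof.
rewrite (@horner_coef_wide _ (size q)); last first.
  by apply: leq_trans (size_poly _ _) _; exact: size_poly.
rewrite (@horner_coef_wide _ (size q) (qs s)); last exact: size_poly.
rewrite mulr_sumr; apply: eq_bigr => i _.
rewrite /qs !coef_map /qhat coef_poly ltn_ord /= /horner_eval hornerM horner_exp exprMn.
have ie : (i <= e)%N by rewrite -ltnS /e prednK//; case: (size q) i => [[]|].
have -> : lc.[s] ^+ e = lc.[s] ^+ (e - i) * lc.[s] ^+ i by rewrite -exprD subnK.
exact: mulr_shuffle.
Qed.

Let Rs_eval s : lc.[s] != 0 ->
  Rs.[s] = lc.[s] ^+ (e * n.+1) * \prod_(j < n.+1) (peval G2 (s, t j s) - y.2).
Proof.
move=> h; rewrite -[LHS]/(horner_eval s Rs) /Rs elim_map phat_prod// elim_prod_seq; last first.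
  by rewrite size_map size_iota.
rewrite big_map -[iota 0 n.+1]/(index_iota 0 n.+1) big_mkord exprM.
have -> : (lc.[s] ^+ e) ^+ n.+1 = \prod_(j < n.+1) lc.[s] ^+ e by rewrite prodr_const card_ord.
rewrite -big_split /=.
by apply: eq_bigr => j _; rewrite qhat_eval qsE.
Qed.

Section Limit.
Variable F : set_system C.
Context {FU : UltraFilter F}.
Hypothesis Fs0 : F (fun s => s <> 0).
Hypothesis Flc : F (fun s => lc.[s] <> 0).
Hypothesis FP : F (fun s => (axX G1 - (y.1)%:P).[s] <> 0).

Let Qj (j : 'I_n.+1) s := nC (peval G2 (s, t j s) - y.2).
Let Qj_ge0 j s : 0 <= Qj j s. Proof. exact: nC_ge0. Qed.

Let Ft (j : 'I_n.+1) : F (fun s => torus (s, t j s) /\ peval G1 (s, t j s) = y.1).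
Proof.
apply: filterS3 Fs0 Flc FP => s /eqP s0 /eqP ls Ps; rewrite (t_root j ls); split => //; split => //=.
apply: contra_notN Ps => /eqP tj; rewrite hornerD hornerN hornerC axXE -tj (t_root j ls).
by rewrite subrr.
Qed.

Let Ft1 (j : 'I_n.+1) : F (fun s => torus (s, t j s)).
Proof. by apply: filterS (Ft j) => s []. Qed.

Let gapE (j : 'I_n.+1) : F (fun s => gap G1 G2 y (s, t j s) = Qj j s).
Proof. by apply: filterS (Ft j) => s [_ h]; rewrite /gap h subrr nC0 add0r. Qed.

Let near_y (j : 'I_n.+1) (s0 : C) : lo F (Qj j) (fun=> 1) -> ulim F id s0 ->
  exists2 tau, ulim F (t j) tau & gap G1 G2 y (s0, tau) = 0.
Proof.
move=> hQ hs.
have l1 : ulim F (fun s => peval G1 (s, t j s)) y.1.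
  by apply: ulim_ext (ulim_cst _); apply: filterS (Ft j) => s [_ ->].
have l2 : ulim F (fun s => peval G2 (s, t j s)) y.2 by move=> k' k0; exact: hQ.
have [_ /ulim_ex[tau ht]] := hprop FU (Ft1 j) l1 l2.
exists tau => //; have e1 := ulim_uniq l1 (ulim_peval G1 hs ht).
have e2 := ulim_uniq l2 (ulim_peval G2 hs ht).
by rewrite /gap -e1 -e2 !subrr nC0 addr0.
Qed.

Let small (j : 'I_n.+1) : bool := `[< lo F (Qj j) (fun=> 1) >].

Let big_lO (j : 'I_n.+1) : ~~ small j -> lO F (fun=> 1) (Qj j).
Proof. by move=> /asboolPn h; have [/h|] := @lo_or _ _ F FU (Qj j) (fun=> 1). Qed.

Let G1_bounded s0 tau : ulim F id s0 -> lO F (fun s => nC (peval G1 (s, tau) - y.1)) (fun=> 1).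
Proof.
move=> hs; have h : ulim F (fun s => peval G1 (s, tau) - y.1) (peval G1 (s0, tau) - y.1); first by apply: ulimB (ulim_peval G1 hs (ulim_cst tau)) (ulim_cst y.1).
exact: ulim_lO h.
Qed.

Let eqord (T : Type) (F' : set_system T) (FU' : UltraFilter F') (u v : T -> R) :
  F' (fun x => u x = v x) -> lO F' u v.
Proof. by move=> h; apply: lO_lev; apply: filterS h => x ->. Qed.

(** Branches along which G2 tends to y.2 converge to a fibre point, which lies on t = 0, and there
    Q_j is at least of size |t_j|^(k+1). The product of lc and all t_j is, up to sign, G1 - y.1 on
    the axis, and lc times the other t_j is bounded by comparison with a separated [tau]; so the
    product of the small t_j is at least of size |s - s0| to the order of G1 - y.1. *)
Lemma order_generic s0 : s0 != 0 -> ulim F id s0 ->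
  lO F (fun s => nC (s - s0) ^+ (k.+1 * (if s0 \in SX then mup s0 (axX G1 - (y.1)%:P) else 0)))
       (fun s => \prod_(j < n.+1) Qj j s).
Proof.
move=> s00 hs.
have sm j : small j -> [/\ ulim F (t j) 0, s0 \in SX & lO F (fun s => nC (t j s) ^+ k.+1) (Qj j)].
  move=> /asboolP h; have [tau ht g0] := near_y h hs.
  have tau0 : tau = 0.
    apply: contrapT => /eqP tau0; have : torus (s0, tau) by [].
    by move=> /hnz; rewrite g0 eqxx.
  rewrite tau0 in ht g0; split => //; first exact: SXP.
  have tn0 : F (fun s => t j s <> 0) by apply: filterS (Ft1 j) => s [_ /eqP].
  apply: lO_trans (gap_lower_bound hJ s00 (goodX g0) hnz hs ht tn0) _.
  exact: eqord (gapE j).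
pose A s := \prod_(j <- index_enum 'I_n.+1) (if small j then nC (t j s) else 1).
pose B s := \prod_(j <- index_enum 'I_n.+1) (if small j then 1 else nC (t j s)).
have A0 s : 0 <= A s by apply: prodr_ge0 => j _; case: ifP => // _; exact: nC_ge0.
have B0 s : 0 <= B s by apply: prodr_ge0 => j _; case: ifP => // _; exact: nC_ge0.
have hA : lO F (fun s => A s ^+ k.+1) (fun s => \prod_(j < n.+1) Qj j s).
  apply: (@lO_trans _ _ F FU (fun s => \prod_(j <- index_enum 'I_n.+1) (if small j then nC (t j s) ^+ k.+1 else 1))).
    apply: eqord; apply: ufT => s; rewrite /A -prodrXl; apply: eq_bigr => j _.
    by case: ifP => _; rewrite ?expr1n.
  apply: lO_prod => [j s|j _]; first by case: ifP => // _; rewrite exprn_ge0// nC_ge0.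
  by case: (boolP (small j)) => [/sm[]|/big_lO].
have [inS|notS] := boolP (s0 \in SX); last first.
  apply: lO_trans hA; apply: eqord; apply: ufT => s; rewrite muln0 expr0 /A big1 ?expr1n// => j _.
  by case: (boolP (small j)) => // /sm[_ h]; rewrite h in notS.
rewrite mulnC; apply: (@lO_trans _ _ F FU (fun s => A s ^+ k.+1)) hA.
apply: (@lO_trans _ _ F FU (fun s => (nC (s - s0) ^+ mup s0 (axX G1 - (y.1)%:P)) ^+ k.+1)).
  by apply: eqord; apply: ufT => s; rewrite exprM.
apply: lO_exp => [s|]; first by rewrite exprn_ge0// nC_ge0.
apply: lO_trans (order_lower hs hP) _.
have [tau [_ htau]] := exists_separated (fun j : 'I_n.+1 => t j) [::].
have hB : lO F (fun s => nC lc.[s] * B s) (fun=> 1).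
  apply: lO_trans (G1_bounded tau hs).
  apply: (@lO_trans _ _ F FU (fun s => nC lc.[s] * \prod_(j <- index_enum 'I_n.+1) nC (tau - t j s))).
    apply: lO_mul => [s|s||]; rewrite ?nC_ge0//; first exact: lO_refl.
    apply: lO_prod => [j s|j _]; first by case: ifP => // _; exact: nC_ge0.
    by have [u1 u2] := htau j; case: (small j).
  by apply: eqord; apply: filterS Flc => s /eqP ls; rewrite -gsE gs_prod// nCM nC_prod.
apply: (@lO_trans _ _ F FU (fun s => A s * (nC lc.[s] * B s))).
  apply: eqord; apply: filterS Flc => s /eqP ls; rewrite hornerD hornerN hornerC axXE -gsE gs_prod//.
  rewrite nCM nC_prod mulrCA /A /B -big_split /=; congr (_ * _); apply: eq_bigr => j _.
  by rewrite sub0r nCN; case: ifP; rewrite ?mulr1 ?mul1r.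
apply: (@lO_trans _ _ F FU (fun s => A s * 1)); last by apply: lO_le => s; rewrite mulr1.
apply: lO_mul => [s|s||]; rewrite ?mulr_ge0 ?nC_ge0//; exact: lO_refl.
Qed.

(** Semicontinuity of roots, valid also if [lc] vanishes at 0: comparison with a separated [tau0]
    bounds |G1(0, tau) - y.1| near [tstar] by a constant times |tau - tstar|^#|J|. *)
Let count_limit tstar : ulim F id 0 ->
  (#|[pred j : 'I_n.+1 | `[< ulim F (t j) tstar >]]| <= mup tstar (axZ G1 - (y.1)%:P))%N.
Proof.
move=> hs; set J := [pred j | _]; have [tau0 [_ htau]] := exists_separated (fun j : 'I_n.+1 => t j) [::].
have [B B0 hB] := G1_bounded tau0 hs.
have [K hK] : exists K : 'I_n.+1 -> R, forall j, 0 < K j /\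
    F (fun s => forall tau, nC (tau - tstar) <= 1 -> nC (tau - t j s) <= K j * nC (tau0 - t j s) /\ 1 <= K j * nC (tau0 - t j s)).
  have h (j : 'I_n.+1) : exists K : R, 0 < K /\
    F (fun s => forall tau, nC (tau - tstar) <= 1 -> nC (tau - t j s) <= K * nC (tau0 - t j s) /\ 1 <= K * nC (tau0 - t j s)).
    have [[K1 K10 h1] [K2 K20 h2]] := htau j.
    have T0 : 0 <= nC tstar + 1 by rewrite addr_ge0// nC_ge0.
    exists (K1 + (nC tstar + 1) * K1 + K2); split.
      by rewrite ltr_pwDr// addr_ge0 ?(ltW K10)// mulr_ge0// ltW.
    apply: filterS2 h1 h2 => s; set d := nC (tau0 - _) => h1 h2 tau htau'.
    have d0 : 0 <= d by exact: nC_ge0.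
    have e1 : 0 <= (nC tstar + 1) * (K1 * d) by rewrite mulr_ge0// mulr_ge0// ltW.
    have e2 : 0 <= K2 * d by rewrite mulr_ge0// ltW.
    have e3 : (nC tstar + 1) * 1 <= (nC tstar + 1) * (K1 * d) by rewrite ler_wpM2l.
    have e4 := nCB tau (t j s); have e5 := nCBB tau tstar.
    have e6 : 0 <= K1 * d by rewrite mulr_ge0// ltW.
    by rewrite !mulrDl -mulrA; split; lra.
  by exists (fun j => sval (cid (h j))) => j; case: cid.
pose KK := B * \prod_(j <- index_enum 'I_n.+1) K j.
have KK0 : 0 <= KK by rewrite mulr_ge0 ?(ltW B0)// prodr_ge0// => j _; case: (hK j) => /ltW.
have key tau : nC (tau - tstar) <= 1 -> nC (axZ G1 - (y.1)%:P).[tau] <= KK * nC (tau - tstar) ^+ #|J|.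
  move=> ht; rewrite hornerD hornerN hornerC axZE -nCX.
  apply: (@ulim_le_scale R _ F FU (fun s => peval G1 (s, tau) - y.1)
    (fun s => \prod_(j <- enum J) (tau - t j s)) _ _ KK KK0).
  - exact: ulimB (ulim_peval G1 hs (ulim_cst tau)) (ulim_cst _).
  - have -> : (tau - tstar) ^+ #|J| = \prod_(j <- enum J) (tau - tstar).
      by rewrite big_enum prodr_const.
    apply: ulim_prod => j; rewrite mem_enum => /asboolP hj; exact: ulimB (ulim_cst _) hj.
  - have hall := @uf_all _ F FU _ (index_enum 'I_n.+1) _ (fun j _ => (hK j).2).
    apply: filterS3 hall hB Flc => s ha hb /eqP ls; rewrite mulr1 in hb.
    have e1 tau' : nC (peval G1 (s, tau') - y.1) = nC lc.[s] * \prod_(j < n.+1) nC (tau' - t j s).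
      by rewrite -gsE gs_prod// nCM nC_prod.
    rewrite [leLHS]e1 nC_prod; rewrite e1 in hb.
    apply: le_trans (_ : nC lc.[s] * \prod_(j < n.+1) (K j * nC (tau0 - t j s) * (if j \in J then nC (tau - t j s) else 1)) <= _).
      rewrite ler_wpM2l ?nC_ge0//; apply: ler_prod => j _; rewrite nC_ge0 /=.
      have [u1 u2] := ha j (mem_index_enum _) tau ht.
      by case: ifP => _; rewrite ?mulr1// -[leLHS]mul1r ler_wpM2r// nC_ge0.
    rewrite !big_split /= -big_mkcond /= /KK big_enum /=.
    rewrite mulrA [_ * (\prod_(i < n.+1) K i * _)]mulrCA [B * _]mulrC -!mulrA [X in _ * X <= _]mulrA.
    apply: ler_wpM2l; last apply: ler_wpM2r => //.
      by rewrite prodr_ge0// => j _; case: (hK j) => /ltW.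
    by rewrite prodr_ge0// => j _; exact: nC_ge0.
have [F' [FU' h1 h2]] := uf_near tstar.
apply: (order_ge h1 h2 hZ); exists (KK + 1); first by rewrite ltr_pwDr.
apply: filterS (h1 1 ltr01) => tau; rewrite mul1r => ht; apply: le_trans (key _ ht) _.
by rewrite ler_wpM2r ?exprn_ge0 ?nC_ge0// lerDl.
Qed.

(** At s = 0 the small branches converge to fibre points on the other axis. With coordinates
    exchanged, [gap_lower_bound] gives Q_j at least of size |s|^(l+1), and [count_limit] bounds the
    number of such branches. *)
Lemma order_zero : ulim F id 0 ->
  lO F (fun s => nC (s - 0) ^+ (l.+1 * \sum_(tau <- SZ) mup tau (axZ G1 - (y.1)%:P)))
       (fun s => \prod_(j < n.+1) Qj j s).
Proof.
move=> hs.
have hJ' z : torus z -> z.1 * z.2 * peval (jacdet (swapXY G1, swapXY G2)) z =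
    z.1 ^+ k.+1 * z.2 ^+ l.+1 * peval (- swapXY Jh) z.
  move=> [z1 z2]; have := hJ (conj z2 z1 : torus (z.2, z.1)).
  rewrite jacdet_swapXY !pevalN !peval_swapXY /= => E.
  by rewrite !mulrN [z.1 * z.2]mulrC E; congr (- _); rewrite [_ ^+ _ * _]mulrC.
have sm j : small j -> (exists2 tau, tau \in SZ & ulim F (t j) tau) /\ lO F (fun s => nC s ^+ l.+1) (Qj j).
  move=> /asboolP h; have [tau ht g0] := near_y h hs.
  have tau0 : tau != 0 by apply/eqP => e'; move: h0; rewrite e' in g0; rewrite g0 eqxx.
  split; first by exists tau => //; exact: SZP.
  have nz' z : torus z -> gap (swapXY G1) (swapXY G2) y z != 0.
    by move=> [z1 z2]; rewrite gap_swap; apply: hnz.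
  have Jz : peval (- swapXY Jh) (tau, 0) != 0 by rewrite pevalN peval_swapXY oppr_eq0 goodZ.
  apply: lO_trans (gap_lower_bound hJ' tau0 Jz nz' ht hs Fs0) _.
  by apply: eqord; apply: filterS (gapE j) => s <-; rewrite gap_swap.
have c1 : (#|[pred j | small j]| <= \sum_(tau <- SZ) mup tau (axZ G1 - (y.1)%:P))%N.
  apply: leq_trans (_ : \sum_(tau <- SZ) #|[pred j : 'I_n.+1 | `[< ulim F (t j) tau >]]| <= _)%N; last first.
    by apply: leq_sum => tau _; exact: count_limit.
  rewrite -sum1_card; under [X in (_ <= X)%N]eq_bigr do rewrite -sum1_card big_mkcond /=.
  rewrite exchange_big /= [X in (_ <= X)%N](bigID (fun j => small j)) /=.
  apply: leq_trans (leq_addr _ _); apply: leq_sum => j hj.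
  have [[tau ts ht] _] := sm j hj; rewrite (bigD1_seq tau)//= inE.
  by rewrite (asboolT ht).
apply: (@lO_trans _ _ F FU (fun s => nC s ^+ (l.+1 * #|[pred j | small j]|))).
  apply: lO_lev; apply: filterS (hs 1 ltr01) => s; rewrite !subr0 mulr1 => s1.
  by rewrite ler_wiXn2l ?nC_ge0// leq_mul2l c1 orbT.
apply: (@lO_trans _ _ F FU (fun s => \prod_(j <- index_enum 'I_n.+1) (if small j then nC s ^+ l.+1 else 1))).
  apply: eqord; apply: ufT => s; rewrite -big_mkcond /= prodr_const -exprM.
  by congr (_ ^+ (_ * _)); apply: eq_card => j; rewrite !inE.
apply: lO_prod => [j s|j _]; first by case: ifP => // _; rewrite exprn_ge0// nC_ge0.
by case: (boolP (small j)) => [/sm[]|/big_lO].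
Qed.

Lemma order_infinity : lo F (fun=> 1) (fun s => nC s) ->
  lO F (fun s => nC s ^+ (L * n.+1)) (fun s => \prod_(j < n.+1) Qj j s).
Proof.
move=> hs; apply: (@lO_trans _ _ F FU (fun s => \prod_(j <- index_enum 'I_n.+1) nC s ^+ L)).
  by apply: eqord; apply: ufT => s; rewrite prodr_const card_ord exprM.
apply: lO_prod => [j s|j _]; first by rewrite exprn_ge0// nC_ge0.
by apply: hsteep => //; apply: filterS (Ft j) => s [].
Qed.
End Limit.

(* The resultant in t of G1 - y.1 and G2 - y.2 is a polynomial in s; its order at each zero s0 and at 0 is
   bounded below by gap_lower_bound, and its degree above by its growth at infinity. *)
Theorem count_asymptotic :
  (L * n.+1 <= k.+1 * (\sum_(s <- SX) mup s (axX G1 - (y.1)%:P)) +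
     l.+1 * (\sum_(tau <- SZ) mup tau (axZ G1 - (y.1)%:P)))%N.
Proof.
have RsO (F : set_system C) (FU : UltraFilter F) : F (fun s => lc.[s] <> 0) ->
    lO F (fun s => nC lc.[s] ^+ (e * n.+1) * \prod_(j < n.+1) nC (peval G2 (s, t j s) - y.2)) (fun s => nC Rs.[s]).
  move=> h; apply: lO_lev; apply: filterS h => s /eqP ls.
  by rewrite Rs_eval// nCM nCX nC_prod.
have inf : Rs != 0 /\ ((size lc).-1 * (e * n.+1) + L * n.+1 <= (size Rs).-1)%N.
  have [F [FU hs]] := uf_infinity R.
  have Fs0 : F (fun s => s <> 0).
    apply: filterS (hs 1 ltr01) => s /[swap] ->; rewrite nC0 mulr0 => h.
    by have := ltr01 (R := R); rewrite ltNge h.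
  have Flc : F (fun s => lc.[s] <> 0) by exact: nonroot_far.
  have FP : F (fun s => (axX G1 - (y.1)%:P).[s] <> 0) by exact: nonroot_far.
  have h : lO F (fun s => nC s ^+ ((size lc).-1 * (e * n.+1) + L * n.+1)) (fun s => nC Rs.[s]).
    apply: lO_trans (RsO F FU Flc).
    apply: (@lO_trans _ _ F FU (fun s => (nC s ^+ (size lc).-1) ^+ (e * n.+1) * nC s ^+ (L * n.+1))).
      by apply: lO_le => s; rewrite exprD exprM.
    apply: lO_mul => [s|s||]; rewrite ?exprn_ge0 ?exprn_ge0 ?nC_ge0//.
      by apply: lO_exp => [s|]; [rewrite exprn_ge0 ?nC_ge0|exact: degree_lower].
    exact: order_infinity.
  have R0 : Rs != 0.
    apply/eqP => R0; move: h => [K K0 h]; apply: (@uf_absurd _ F FU).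
    apply: filterS2 h Fs0 => s + /eqP s0; rewrite R0 horner0 nC0 mulr0 leNgt exprn_gt0//.
    by rewrite nC_gt0.
  by split => //; apply: (degree_ge hs R0 h).
have [R0 degR] := inf.
have ord (s0 : C) : (mup s0 Rs <= mup s0 lc * (e * n.+1) +
    (if s0 == 0%R then l.+1 * \sum_(tau <- SZ) mup tau (axZ G1 - (y.1)%:P)
     else k.+1 * (if s0 \in SX then mup s0 (axX G1 - (y.1)%:P) else 0)))%N.
  have [F [FU hs hn]] := uf_near s0.
  have Flc : F (fun s => lc.[s] <> 0) by apply: (nonroot_near hs hn).
  have FP : F (fun s => (axX G1 - (y.1)%:P).[s] <> 0) by apply: (nonroot_near hs hn).
  have Fs0 : F (fun s => s <> 0).
    have [s00|s00] := eqVneq s0 0; first by rewrite -s00.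
    by apply: ulim_ev_neq hs _.
  apply: (order_le hs hn R0); apply: lO_trans (RsO F FU Flc).
  apply: (@lO_trans _ _ F FU (fun s => (nC (s - s0) ^+ mup s0 lc) ^+ (e * n.+1) *
      nC (s - s0) ^+ (if s0 == 0%R then l.+1 * \sum_(tau <- SZ) mup tau (axZ G1 - (y.1)%:P)
     else k.+1 * (if s0 \in SX then mup s0 (axX G1 - (y.1)%:P) else 0)))).
    by apply: lO_le => s; rewrite exprD exprM.
  apply: lO_mul => [s|s||]; rewrite ?exprn_ge0 ?exprn_ge0 ?nC_ge0//.
    by apply: lO_exp => [s|]; [rewrite exprn_ge0 ?nC_ge0|exact: order_lower].
  have [s00|s00] := eqVneq s0 0; last exact: order_generic.
  by rewrite s00 in hs hn *; exact: order_zero.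
pose D := undup (rootsC Rs ++ rootsC lc ++ SX ++ [:: 0]).
have Du : uniq D by exact: undup_uniq.
have sR : (\sum_(s0 <- D) mup s0 Rs)%N = (size Rs).-1.
  by apply: sum_mup_all => // x; rewrite mem_undup !mem_cat => ->.
have sL : (\sum_(s0 <- D) mup s0 lc)%N = (size lc).-1.
  by apply: sum_mup_all => // x; rewrite mem_undup !mem_cat => ->; rewrite orbT.
have D0 : 0 \in D by rewrite mem_undup !mem_cat !inE eqxx !orbT.
have : (\sum_(s0 <- D) mup s0 Rs <= \sum_(s0 <- D) (mup s0 lc * (e * n.+1) +
    (if s0 == 0%R then l.+1 * \sum_(tau <- SZ) mup tau (axZ G1 - (y.1)%:P)
     else k.+1 * (if s0 \in SX then mup s0 (axX G1 - (y.1)%:P) else 0))))%N.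
  by apply: leq_sum => s0 _.
rewrite sR big_split /= -big_distrl /= sL (bigD1_seq 0)//= eqxx.
have h : (\sum_(s0 <- D | s0 != 0%R) (if s0 == 0%R then l.+1 * \sum_(tau <- SZ) mup tau (axZ G1 - (y.1)%:P)
     else k.+1 * (if s0 \in SX then mup s0 (axX G1 - (y.1)%:P) else 0)) <=
     k.+1 * (\sum_(s <- SX) mup s (axX G1 - (y.1)%:P)))%N.
  apply: leq_trans (_ : \sum_(s0 <- D | s0 \in SX) k.+1 * mup s0 (axX G1 - (y.1)%:P) <= _)%N.
    rewrite big_mkcond [X in (_ <= X)%N]big_mkcond /=; apply: leq_sum => s0 _.
    by case: eqP => //= _; case: ifP => //; rewrite muln0.
  rewrite -big_distrr /= leq_mul2l -big_filter; apply/orP; right.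
  rewrite (perm_big SX)//; apply: uniq_perm => //; first exact: filter_uniq.
  move=> x; rewrite mem_filter; apply/andP/idP => [[]//|xS]; split => //.
  by rewrite mem_undup !mem_cat xS !orbT.
move=> H; rewrite -(leq_add2l ((size lc).-1 * (e * n.+1))); apply: leq_trans degR (leq_trans H _).
by rewrite leq_add2l addnC leq_add2r.
Qed.
End Count1.

Lemma size_product_gt (a b q : nat) : (0 < a)%N -> (0 < b)%N -> (1 < q)%N -> b = (a + (b + q).-1).-1 -> False.
Proof. lia. Qed.

(** * The equation of the image of the axes *)

Section Curves.
Variable R : realType.
Local Notation C := (R[i]).
Local Notation curve := ({poly C} * {poly C})%type.
Implicit Types (K Q M : {poly {poly C}}) (c : curve) (cs : seq curve).

(* K has outer variable y2, inner variable y1 *)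
Definition on_curve c K : {poly C} := sub1 c.2 c.1 K.

Lemma on_curveE c K u : (on_curve c K).[u] = peval K (c.2.[u], c.1.[u]).
Proof. exact: horner_sub1. Qed.

Lemma on_curveM c K Q : on_curve c (K * Q) = on_curve c K * on_curve c Q.
Proof. by rewrite /on_curve /sub1 rmorphM. Qed.
Lemma on_curveD c K Q : on_curve c (K + Q) = on_curve c K + on_curve c Q.
Proof. by rewrite /on_curve /sub1 rmorphD. Qed.

Lemma on_curveC c e : (1 < size c.1)%N -> e != 0 -> on_curve c e%:P != 0.
Proof.
move=> s1 e0; apply/eqP => h; have [u [u0 _]] := exists_nonroot [::] (e0 : e != 0).
have /closed_rootP[v /rootP pv] : size (c.1 - u%:P) != 1%N.
  by rewrite size_polyDl ?size_polyN ?(leq_ltn_trans (size_polyC_leq1 _)) ?neq_ltn ?s1 ?orbT.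
have e1 := congr1 (horner^~ v) h; rewrite /= on_curveE horner0 pevalE hornerC in e1.
move/eqP: pv; rewrite hornerD hornerN hornerC subr_eq0 => /eqP pv.
by move: u0; rewrite -pv; rewrite e1 eqxx.
Qed.

Definition vanishes cs K := forall c, c \in cs -> on_curve c K = 0.

Lemma deriv_eq0_size K : deriv K = 0 -> (size K <= 1)%N.
Proof.
move=> h; apply/leq_sizeP => j j0; have := congr1 (fun p : {poly {poly C}} => p`_j.-1) h.
rewrite coef_deriv coef0 prednK// -scaler_nat => /eqP; rewrite scaler_eq0.
by rewrite pnatr_eq0 (gtn_eqF j0) /= => /eqP.
Qed.

(** A primitive equation of least degree in y2: pseudo-division leaves remainder 0 by minimality,
    and Gauss's lemma cancels the power of the leading coefficient. *)
Lemma minimal_equation cs : (forall c, c \in cs -> (1 < size c.1)%N) ->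
  (exists2 K, K != 0 & vanishes cs K) ->
  exists K, [/\ K != 0, vanishes cs K & forall Q, vanishes cs Q -> exists M, Q = M * K].
Proof.
move=> hcs [K0 K00 vK0].
pose Pn n := `[< exists K, [/\ K != 0, vanishes cs K & size K = n] >].
have exP : exists n, Pn n by exists (size K0); apply/asboolP; exists K0.
have [n /asboolP[K1 [K10 vK1 sK1]] mn] := ex_minnP exP.
have [e [g [e0 pg K1E]]] := primitive_part K10.
have g0 : g != 0 by apply: contraNneq K10 => h; rewrite K1E h mulr0.
have vg : vanishes cs g.
  move=> c cc; have := vK1 c cc; rewrite K1E on_curveM => /eqP; rewrite mulf_eq0.
  by rewrite (negbTE (on_curveC (hcs c cc) e0)) => /eqP.
have sg : (size g <= n)%N by rewrite -sK1 K1E mul_polyC size_scale.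
exists g; split => // Q vQ.
have E := Pdiv.Idomain.divp_eq Q g; have lt : (size (Q %% g)%R < size g)%N by rewrite Pdiv.Idomain.ltn_modp.
have r0 : Q %% g = 0.
  apply/eqP; apply: contrapT => /negP r0.
  have : (n <= size (Q %% g)%R)%N.
    apply: mn; apply/asboolP; exists (Q %% g); split => // c cc.
    have := congr1 (on_curve c) E; rewrite -mul_polyC on_curveD !on_curveM (vQ c cc) (vg c cc) !mulr0 add0r.
    by move=> <-.
  by move=> h; have := leq_ltn_trans (leq_trans sg h) lt; rewrite ltnn.
rewrite r0 addr0 -mul_polyC mulrC in E.
have lc0 : lead_coef g ^+ scalp Q g != 0 by rewrite expf_neq0// lead_coef_eq0.
have E' : (lead_coef g ^+ scalp Q g)%:P * Q = g * (Q %/ g) by rewrite mulrC E mulrC.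
have [q' q'E] := gauss_cancel lc0 (fun x _ => pg x) E'.
exists q'; apply: (@mulfI _ (lead_coef g ^+ scalp Q g)%:P); first by rewrite polyC_eq0.
by rewrite E' q'E mulrCA [g * q']mulrC.
Qed.

(** Otherwise the minimal equation [Q] of [c] alone would divide [K] twice, and K / Q would still
    vanish on all the curves. *)
Lemma minimal_separable cs K c : (forall c, c \in cs -> (1 < size c.1)%N) -> c \in cs ->
  K != 0 -> vanishes cs K -> (forall Q, vanishes cs Q -> exists M, Q = M * K) ->
  on_curve c (pd1 K) != 0.
Proof.
move=> hcs cc K0 vK minK; apply/eqP => h.
have [||Q [Q0 vQ minQ]] := @minimal_equation [:: c].
- by move=> c'; rewrite inE => /eqP->; exact: hcs.
- by exists K => // c'; rewrite inE => /eqP->; exact: vK.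
have Qc : on_curve c Q = 0 by apply: vQ; rewrite inE.
have in1 M : on_curve c M = 0 -> vanishes [:: c] M by move=> h' c'; rewrite inE => /eqP->.
have [M KE] := minQ K (in1 K (vK c cc)).
have M0 : M != 0 by apply: contraNneq K0 => h'; rewrite KE h' mul0r.
have sQ : (1 < size Q)%N.
  rewrite ltnNge; apply/negP => s1; move: Qc; rewrite (size1_polyC s1); apply/eqP.
  by apply: on_curveC (hcs c cc) _; rewrite -polyC_eq0 -size1_polyC.
have Q'0 : on_curve c (pd1 Q) != 0.
  apply/eqP => h'; have [M' E'] := minQ _ (in1 _ h').
  have d0 : pd1 Q != 0 by apply/eqP => /deriv_eq0_size; rewrite leqNgt sQ.
  have M'0 : M' != 0 by apply: contraNneq d0 => h''; rewrite E' h'' mul0r.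
  have := lt_size_deriv Q0; rewrite -/(pd1 Q) E' size_mul//.
  have M'1 : (0 < size M')%N by rewrite size_poly_gt0.
  by move: M'1; case: (size M') => // i _; rewrite addSn /= ltnNge leq_addl.
have Mc : on_curve c M = 0.
  move: h; rewrite /pd1 KE derivM on_curveD !on_curveM Qc mulr0 add0r => /eqP.
  by rewrite mulf_eq0 (negbTE Q'0) orbF => /eqP.
have [M1 ME] := minQ M (in1 M Mc).
have vM : vanishes cs M.
  move=> c' cc'; have := vK c' cc'; rewrite KE on_curveM => /eqP; rewrite mulf_eq0 => /orP[/eqP//|/eqP q'].
  by rewrite ME on_curveM q' mulr0.
have [M2 M2E] := minK M vM.
have M20 : M2 != 0 by apply: contraNneq M0 => h'; rewrite M2E h' mul0r.
have : size M = size (M2 * (M * Q)) by rewrite -KE -M2E.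
rewrite !size_mul ?mulf_neq0//; apply: size_product_gt => //; by rewrite size_poly_gt0.
Qed.

Lemma size_shiftC (p : {poly C}) y : (1 < size p)%N -> size (p - y%:P) = size p /\ lead_coef (p - y%:P) = lead_coef p.
Proof.
move=> s1; have h : (size (- y%:P : {poly C}) < size p)%N.
  by rewrite size_polyN (leq_ltn_trans (size_polyC_leq1 _)).
by rewrite size_polyDl ?lead_coefDl.
Qed.

(** The characteristic polynomial of multiplication by c.2 on C[v], seen as a module over C[y1]
    through y1 = c.1(v). *)
Lemma curve_char c : (1 < size c.1)%N -> exists2 K, K \is monic &
  forall y, map_poly (horner_eval y) K = \prod_(v <- rootsC (c.1 - y%:P)) ('X - (c.2.[v])%:P).
Proof.
case: c => p q /= s1; have [n sp] : exists n, size p = n.+2 by case: (size p) s1 => [|[|n]]// _; exists n.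
pose i0 : {poly C} -> {poly {poly C}} := map_poly polyC.
pose l := (lead_coef p)^-1; pose ph := i0 (l *: p) - (l *: 'X)%:P.
pose K := char_poly (horner_mx (comp n ph) (i0 q)).
exists K; first exact: char_poly_monic.
have i0E y (r : {poly C}) : map_poly (horner_eval y) (i0 r) = r.
  by apply/polyP => j; rewrite !coef_map /= /horner_eval hornerC.
move=> y; have [sy ly] := size_shiftC y s1.
have phE : map_poly (horner_eval y) ph = \prod_(v <- rootsC (p - y%:P)) ('X - v%:P).
  rewrite /ph rmorphB /= i0E map_polyC /= /horner_eval hornerZ hornerX.
  have -> : l *: p - (l * y)%:P = l *: (p - y%:P) by rewrite scalerBr -!mul_polyC -polyCM.
  rewrite {1}(rootsCE (p - y%:P)) scalerA ly mulVf ?scale1r//.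
  by rewrite lead_coef_eq0 -size_poly_eq0 sp.
apply/eqP; rewrite -subr_eq0; apply/eqP; apply: poly_infinite0 => x.
rewrite hornerD hornerN horner_prod /K map_char_poly horner_char_poly map_horner_mx i0E.
have sr : size (rootsC (p - y%:P)) = n.+1.
  have h0 : p - y%:P != 0 by rewrite -size_poly_eq0 sy sp.
  by have := size_rootsC h0; rewrite sy sp => -[].
have := elim_prod_seq (x%:P - q) sr.
rewrite -phE /elim rmorphB /= horner_mx_C.
have -> : comp n (map_poly (horner_eval y) ph) = map_mx (horner_eval y) (comp n ph).
  by apply/matrixP => i j; rewrite !mxE; case: ifP => _; rewrite ?rmorphN ?coef_map ?rmorph_nat.
by move=> ->; apply/eqP; rewrite subr_eq0; apply/eqP; apply: eq_bigr => v _; rewrite hornerD hornerN hornerC hornerXsubC.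
Qed.

(** The bound is uniform in the mask because the roots of the minimal equation form an unknown part
    of those of the product equation. *)
Lemma deriv_prod_bound (s : seq C) (m : bitseq) t :
  nC ((\prod_(x <- mask m s) ('X - x%:P))^`()).[t] <= (size s)%:R * \prod_(x <- s) (1 + nC (t - x)) /\
  nC (\prod_(x <- mask m s) ('X - x%:P)).[t] <= \prod_(x <- s) (1 + nC (t - x)).
Proof.
have B1 x : 1 <= 1 + nC (t - x) by rewrite lerDl nC_ge0.
have P1 s' : 1 <= \prod_(x <- s') (1 + nC (t - x)).
  elim: s' => [|x s' IH]; first by rewrite big_nil.
  by rewrite big_cons -[leLHS]mulr1 ler_pM.
elim: s m => [|x s IH] m.
  by rewrite mask0 !big_nil -polyC1 derivC horner0 nC0 mulr1 hornerC nC1.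
have pos := le_trans ler01 (P1 s).
case: m => [|[] m]; rewrite ?mask0s /=.
- rewrite !big_nil -polyC1 derivC horner0 nC0 hornerC nC1; split; last exact: P1.
  by rewrite mulr_ge0 ?ler0n// (le_trans ler01 (P1 _)).
- have [h1 h2] := IH m; rewrite !big_cons derivM derivXsubC mul1r hornerD !hornerM hornerXsubC; split.
    apply: le_trans (nCD _ _) _; rewrite nCM.
    have a0 := nC_ge0 (t - x); set a := nC (t - x) in a0 *; set Pi := \prod_(_ <- s) _ in pos h1 h2 *.
    have : a * nC (\prod_(y <- mask m s) ('X - y%:P))^`().[t] <= a * ((size s)%:R * Pi) by rewrite ler_wpM2l.
    have s0 : 0 <= (size s)%:R * Pi by rewrite mulr_ge0.
    have aP : 0 <= a * Pi by rewrite mulr_ge0.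
    rewrite -natr1; nra.
  by rewrite nCM ler_pM ?nC_ge0// lerDr.
- have [h1 h2] := IH m; rewrite !big_cons; set Pi := \prod_(_ <- s) _ in pos h1 h2 *; split.
    apply: le_trans h1 _; apply: ler_pM => //; first by rewrite ler_nat.
    by rewrite -[leLHS]mul1r ler_wpM2r.
  by apply: le_trans h2 _; rewrite -[leLHS]mul1r ler_wpM2r.
Qed.

Definition adeg (p : {poly C}) := (size p).-1.
(** Bounds the growth exponent in u of the product of c.2(u) - c'.2(v) over the v with c'.1(v) =
    c.1(u), each v growing like u^(deg c.1 / deg c'.1). *)
Definition growth c c' := maxn (adeg c.2 * adeg c'.1) (adeg c.1 * adeg c'.2).

Section Growth.
Variables (F : set_system C) (c : curve) (N : nat).
Context {FU : UltraFilter F}.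
Hypothesis hF : lo F (fun=> 1) (fun w => nC w).
Hypothesis N0 : (0 < N)%N.
Let u (w : C) := w ^+ N.

Let hu : lo F (fun=> 1) (fun w => nC (u w)).
Proof.
have h := @lo_exp_inv R _ F FU (fun w => nC w) N (fun w => nC_ge0 w) hF N0.
by move=> e e0; apply: filterS (h e e0) => w; rewrite /u nCX.
Qed.

(** Putting u = w^N makes the fractional exponent of the branch an integer: v is at most of size
    |w|^(M deg c.1). *)
Lemma branch_growth c' (k M : nat) : (1 < size c'.1)%N -> N = (M * adeg c'.1)%N -> (k < adeg c'.1)%N ->
  lO F (fun w => 1 + nC (c.2.[u w] - c'.2.[nth 0 (rootsC (c'.1 - (c.1.[u w])%:P)) k]))
       (fun w => nC w ^+ (M * growth c c')).
Proof.
case: c' => p' q' /= s1 NE ka; set v := fun w => nth 0 (rootsC (p' - (c.1.[u w])%:P)) k.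
have pv w : p'.[v w] = c.1.[u w].
  have [sy _] := size_shiftC (c.1.[u w]) s1.
  have h0 : p' - (c.1.[u w])%:P != 0 by rewrite -size_poly_gt0 sy ltnW.
  have : v w \in rootsC (p' - (c.1.[u w])%:P).
    by apply: mem_nth; move: ka; rewrite /adeg -sy (size_rootsC h0).
  by rewrite mem_rootsC// hornerD hornerN hornerC subr_eq0 => /eqP.
have a0 : (0 < adeg p')%N by rewrite /adeg -ltnS prednK// ltnW.
have M0 : (0 < M)%N by move: N0; rewrite NE muln_gt0 => /andP[].
have p'0 : p' != 0 by rewrite -size_poly_gt0 ltnW.
have vb : lO F (fun w => nC (v w)) (fun w => nC w ^+ (M * adeg c.1)).
  apply: (lO_root a0) => [w|w|]; rewrite ?exprn_ge0 ?nC_ge0//.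
  have [h|h] := @lo_or _ _ F FU (fun=> 1) (fun w => nC (v w)).
    apply: lO_trans (degree_lower h p'0) _.
    apply: (@lO_trans _ _ F FU (fun w => nC c.1.[u w])); first by apply: lO_le => w; rewrite pv.
    apply: lO_trans (degree_upper hu c.1) _; apply: lO_le => w.
    by rewrite /u nCX -!exprM NE mulnAC.
  apply: (@lO_trans _ _ F FU (fun=> 1)).
    have h2 := @lO_exp _ _ F FU _ _ (adeg p') (fun w => nC_ge0 (v w)) h.
    by apply: lO_trans h2 _; apply: lO_le => w; rewrite expr1n.
  apply: lO_trans (lO_far hF (leq0n (M * adeg c.1 * adeg p'))) _.
  by apply: lO_le => w; rewrite exprM.
have qb : lO F (fun w => nC q'.[v w]) (fun w => nC w ^+ (M * growth c (p', q'))).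
  apply: (@lO_trans _ _ F FU (fun w => \sum_(i <- index_enum 'I_(size q')) nC (q'`_i * v w ^+ i))).
    by apply: lO_le => w; rewrite horner_coef; exact: nC_sum.
  apply: lO_sum => [w|i _]; first by rewrite exprn_ge0 ?nC_ge0.
  apply: (@lO_trans _ _ F FU (fun w => (nC q'`_i + 1) * (nC w ^+ (M * adeg c.1)) ^+ i)).
    apply: (@lO_trans _ _ F FU (fun w => (nC q'`_i + 1) * nC (v w) ^+ i)).
      by apply: lO_le => w; rewrite nCM nCX ler_wpM2r ?exprn_ge0 ?nC_ge0// lerDl.
    apply: lO_mul => [w|w||]; rewrite ?exprn_ge0 ?addr_ge0 ?nC_ge0//; first exact: lO_refl.
    by apply: lO_exp vb => w; exact: nC_ge0.
  exists (nC q'`_i + 1); first by rewrite ltr_pwDr ?nC_ge0.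
  have i_le : (M * adeg c.1 * i <= M * growth c (p', q'))%N.
    rewrite -mulnA leq_mul2l /growth /=; apply/orP; right; apply: leq_trans (leq_maxr _ _).
    rewrite leq_mul2l; apply/orP; right; rewrite /adeg -ltnS prednK//; apply: leq_ltn_trans (ltn_ord i) => //.
  have h1 : F (fun w => 1 <= 1 * nC w) by exact: hF.
  apply: filterS h1 => w; rewrite mul1r => w1.
  rewrite ler_wpM2l ?addr_ge0 ?nC_ge0// -exprM.
  exact: ler_weXn2l.
have ub : lO F (fun w => nC c.2.[u w]) (fun w => nC w ^+ (M * growth c (p', q'))).
  apply: lO_trans (degree_upper hu c.2) _.
  apply: (@lO_trans _ _ F FU (fun w => nC w ^+ (N * adeg c.2))); first by apply: lO_le => w; rewrite /u nCX -exprM.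
  apply: lO_far => //; rewrite NE -mulnA leq_mul2l mulnC; apply/orP; right.
  by rewrite /growth /= mulnC leq_maxl.
apply: lO_add; first by apply: lO_trans (lO_far hF (leq0n _)); apply: lO_le => w; rewrite expr0.
apply: lO_trans (lO_add ub qb); apply: lO_le => w; exact: nCB.
Qed.
End Growth.

(** [K] divides the product [Kt] of the monic equations, so its roots over each y1 are among the
    branches of all the curves. Its derivative at a point of [c] is then bounded by the product of 1
    plus the distances to these branches. *)
Theorem separating_equation cs : (forall c, c \in cs -> (1 < size c.1)%N) ->
  exists K : {poly {poly C}}, forall c, c \in cs ->
    [/\ on_curve c K = 0, on_curve c (pd1 K) != 0 &
        (adeg (on_curve c (pd1 K)) <= \sum_(c' <- cs) growth c c')%N].
Proof.
move=> hcs.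
have [Kc hKc] : exists Kc : curve -> {poly {poly C}}, forall c, c \in cs -> Kc c \is monic /\
    forall y, map_poly (horner_eval y) (Kc c) = \prod_(v <- rootsC (c.1 - y%:P)) ('X - (c.2.[v])%:P).
  have h c : exists K : {poly {poly C}}, c \in cs -> K \is monic /\
      forall y, map_poly (horner_eval y) K = \prod_(v <- rootsC (c.1 - y%:P)) ('X - (c.2.[v])%:P).
    case: (boolP (c \in cs)) => [cc|_]; last by exists 0.
    by have [K K1 K2] := curve_char (hcs c cc); exists K.
  by exists (fun c => sval (cid (h c))) => c; case: cid.
pose Kt := \prod_(c <- cs) Kc c.
have Ktm : Kt \is monic by rewrite /Kt big_seq; apply: monic_prod => c /hKc[].
pose L y := flatten [seq [seq c.2.[v] | v <- rootsC (c.1 - y%:P)] | c <- cs].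
have KtE y : map_poly (horner_eval y) Kt = \prod_(x <- L y) ('X - x%:P).
  rewrite /Kt rmorph_prod /= big_flatten /= big_map big_seq [RHS]big_seq.
  by apply: eq_bigr => c cc; rewrite (hKc c cc).2 big_map.
have vKt : vanishes cs Kt.
  move=> c cc; apply: poly_infinite0 => x; rewrite on_curveE -[LHS]/((map_poly (horner_eval c.1.[x]) Kt).[c.2.[x]]).
  rewrite KtE; apply/eqP; rewrite -/(root _ _) root_prod_XsubC; apply/flatten_mapP; exists c => //.
  have [sy _] := size_shiftC (c.1.[x]) (hcs c cc); apply: map_f.
  rewrite mem_rootsC; first by rewrite hornerD hornerN hornerC subrr.
  by rewrite -size_poly_gt0 sy (ltnW (hcs c cc)).
have [K [K0 vK minK]] := minimal_equation hcs (ex_intro2 _ _ Kt (monic_neq0 Ktm) vKt).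
exists K => c cc; split; [exact: vK|exact: minimal_separable minK|].
have [M KtM] := minK Kt vKt.
have [e0 e00 lcK] : exists2 e0, e0 != 0 & lead_coef K = e0%:P.
  have h : lead_coef M * lead_coef K = 1 by rewrite -lead_coefM -KtM (monicP Ktm).
  have : lead_coef K \is a GRing.unit by apply/unitrP; exists (lead_coef M); rewrite h mulrC h.
  rewrite poly_unitE => /andP[/eqP s1 u0]; exists (lead_coef K)`_0; first by rewrite unitfE in u0.
  by rewrite -size1_polyC ?s1.
have [F [FU hF]] := uf_infinity R.
(* A common multiple of the degrees, so that every branch has an integer growth exponent in w. *)
pose N := (\prod_(c' <- cs) adeg c'.1)%N.
have ad0 c' : c' \in cs -> (0 < adeg c'.1)%N.
  by move=> cc'; rewrite /adeg -ltnS prednK; [exact: hcs|exact: ltnW (hcs _ cc')].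
have N0 : (0 < N)%N by rewrite /N big_seq; apply: prodn_cond_gt0 => c' /ad0.
pose u (w : C) := w ^+ N.
have hu : lo F (fun=> 1) (fun w => nC (u w)).
  have h := @lo_exp_inv R _ F FU (fun w => nC w) N (fun w => nC_ge0 w) hF N0.
  by move=> e e_0; apply: filterS (h e e_0) => w; rewrite /u nCX.
have nz : on_curve c (pd1 K) != 0 by exact: minimal_separable minK.
rewrite /adeg; apply: (degree_le hu nz).
pose S := (\sum_(c' <- cs) adeg c'.1)%N.
have sL y : size (L y) = S.
  rewrite size_flatten /shape -map_comp sumnE big_map; apply: eq_big_seq => c' cc' /=.
  have [sy _] := size_shiftC y (hcs c' cc'); rewrite size_map /adeg -sy.
  by rewrite size_rootsC//= -size_poly_gt0 sy (ltnW (hcs c' cc')).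
have bound w : nC (on_curve c (pd1 K)).[u w] <=
    (nC e0 * S%:R) * \prod_(x <- L (c.1.[u w])) (1 + nC (c.2.[u w] - x)).
  rewrite on_curveE -[peval _ _]/((map_poly (horner_eval c.1.[u w]) (deriv K)).[c.2.[u w]]) -deriv_map.
  set y := c.1.[u w].
  have : map_poly (horner_eval y) K %| \prod_(x <- L y) ('X - x%:P).
    by rewrite -KtE KtM rmorphM /= dvdp_mulIr.
  move=> /dvdp_prod_XsubC[m /eqp_eq].
  have lK : lead_coef (map_poly (horner_eval y) K) = e0.
    by rewrite lead_coef_map_id0 ?lcK /horner_eval ?horner0 ?hornerC.
  have -> : lead_coef (\prod_(i <- mask m (L y)) ('X - i%:P)) = 1 by apply/eqP; rewrite -monicE; apply: monic_prod_XsubC.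
  rewrite lK scale1r => E; rewrite E.
  rewrite derivZ hornerZ nCM -mulrA ler_wpM2l ?nC_ge0// -(sL y).
  exact: (deriv_prod_bound _ _ _).1.
apply: (@lO_trans _ _ F FU (fun w => (nC e0 * S%:R) * \prod_(x <- L (c.1.[u w])) (1 + nC (c.2.[u w] - x)))).
  by apply: lO_le.
have h : lO F (fun w => \prod_(x <- L (c.1.[u w])) (1 + nC (c.2.[u w] - x)))
              (fun w => \prod_(c' <- cs) nC w ^+ (N * growth c c')).
  apply: (@lO_trans _ _ F FU (fun w => \prod_(c' <- cs) \prod_(k <- index_iota 0 (adeg c'.1))
     (1 + nC (c.2.[u w] - c'.2.[nth 0 (rootsC (c'.1 - (c.1.[u w])%:P)) k])))).
    apply: lO_le => w; rewrite big_flatten /= big_map big_seq [leRHS]big_seq.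
    rewrite le_eqVlt; apply/orP; left; apply/eqP; apply: eq_bigr => c' cc'.
    have [sy _] := size_shiftC (c.1.[u w]) (hcs c' cc').
    rewrite big_map (big_nth 0); congr (\big[_/_]_(_ <- index_iota _ _) _).
    by rewrite /adeg -sy size_rootsC//= -size_poly_gt0 sy (ltnW (hcs c' cc')).
  apply: lO_prod => [c' w|c' cc'].
    by apply: prodr_ge0 => k _; rewrite addr_ge0 ?nC_ge0.
  have NE : N = (N %/ adeg c'.1 * adeg c'.1)%N.
    by rewrite divnK// /N (big_rem c')//= dvdn_mulr.
  apply: (@lO_trans _ _ F FU (fun w => \prod_(k <- index_iota 0 (adeg c'.1)) nC w ^+ (N %/ adeg c'.1 * growth c c'))).
    apply: lO_prod => [k w|k]; first by rewrite addr_ge0 ?nC_ge0.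
    by rewrite mem_index_iota => /andP[_ ka]; apply: branch_growth => //; exact: hcs.
  apply: lO_le => w; rewrite prodr_const_nat subn0 -exprM mulnAC -NE.
  by [].
apply: lO_trans (_ : lO F _ (fun w => (nC e0 * S%:R + 1) * \prod_(c' <- cs) nC w ^+ (N * growth c c'))) _.
  apply: lO_mul => [w|w||]; rewrite ?mulr_ge0 ?nC_ge0//.
  - by apply: prodr_ge0 => x _; rewrite addr_ge0 ?nC_ge0.
  - by apply: lO_le => w; rewrite lerDl.
exists (nC e0 * S%:R + 1); first by rewrite ltr_pwDr ?mulr_ge0 ?nC_ge0.
apply: ufT => w; rewrite /u nCX -exprM big_distrr /= expr_sum.
exact: lexx.
Qed.
End Curves.

Lemma poly_lowX (A : idomainType) (p : {poly A}) : p != 0 -> exists j (q : {poly A}), q`_0 != 0 /\ p = 'X^j * q.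
Proof.
move=> p0; have [m [q q0 pE]] := multiplicity_XsubC p 0.
rewrite p0 /= rootE horner_coef0 in q0; exists m, q; split => //.
by rewrite pE subr0 mulrC.
Qed.

Lemma eq_lowX (A : idomainType) (U V : {poly A}) j m : 'X^j * U = 'X^m * V ->
  U`_0 != 0 -> V`_0 != 0 -> j = m /\ U = V.
Proof.
move=> e u0 v0; have jm : j = m.
  have := congr1 (fun p : {poly A} => p`_j) e; have := congr1 (fun p : {poly A} => p`_m) e.
  rewrite !coefXnM !ltnn !subnn; case: (ltngtP j m) => //= [h|h] E1 E2.
    by move: u0; rewrite E2 eqxx.
  by move: v0; rewrite -E1 eqxx.
split => //; apply: (@mulfI _ 'X^j); first by rewrite -size_poly_gt0 size_polyXn.
by rewrite e jm.
Qed.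

Lemma neg_shuffle (V : comRingType) (m c x j : V) : - (m * (c * x * j)) = x * - (m * (c * j)).
Proof. ring. Qed.

Lemma power_deriv_shuffle (V : comRingType) (x xj q q' : V) n :
  x * (n%:R * xj * q + x * xj * q') = x * xj * (n%:R * q + x * q').
Proof. ring. Qed.

Lemma root_deriv_shuffle (V : comRingType) (x xm u u' : V) n :
  u' * (x * xm) + u * (n%:R * xm) = (n%:R * u + x * u') * xm.
Proof. ring. Qed.

Lemma jacdet_shuffle (V : comRingType) (x xj a a2 b b1 q w : V) : b = xj * q -> x * b1 = xj * w ->
  xj * (x * (a * q) - a2 * w) = x * (a * b - a2 * b1).
Proof. by move=> -> e; rewrite [RHS]mulrBr [x * (a2 * _)]mulrCA e; ring. Qed.

Lemma mupN (F : fieldType) (p : {poly F}) x : mup x (- p) = mup x p.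
Proof.
rewrite -[- p]mulN1r mupMr// rootE -polyC1 -polyCN hornerC oppr_eq0.
exact: oner_neq0.
Qed.

(** * Singularity of the image of the axes at an exceptional value *)

Section Local.
Variable R : realType.
Local Notation C := (R[i]).
Implicit Types (K G Om M Jh P : {poly {poly C}}).

Lemma coef0_swapXY P : (swapXY P)`_0 = axX P.
Proof. by apply/polyP => i; rewrite -[LHS]/(coef2 _ (0%N, i)) coef2_swapXY coef_map /= /horner_eval horner_coef0. Qed.

Lemma swapXY_Xm l k : swapXY (Xm R (l, k)) = Xm R (k, l).
Proof. by apply: eq_coef2 => -[i j]; rewrite coef2_swapXY !coef2_Xm /= !xpair_eqE andbC. Qed.

(** Write Om = t^j Q with Q not identically 0 on t = 0; here j >= 1. Comparing lowest powers of t in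
    the Jacobian relation gives j G'(s) Q(s, 0) = M s^l Jh on the axis. So [Q] does not vanish at
    (s0, 0), and [Om] has no zero near this point off the axis. *)
Lemma branch_avoid G Om M Jh l k (s0 : C) (T : Type) (F : set_system T) {FU : UltraFilter F} (a b : T -> C) :
  jacdet (G, Om) = M * (Xm R (l, k) * Jh) -> axX Om = 0 -> deriv (axX G) != 0 ->
  s0 != 0 -> peval M (s0, 0) != 0 -> peval Jh (s0, 0) != 0 ->
  ulim F a s0 -> ulim F b 0 -> F (fun x => b x <> 0) -> F (fun x => peval Om (a x, b x) <> 0).
Proof.
move=> hJ Om0 G'0 s00 Ms Js la lb nb.
pose A := swapXY G; pose B := swapXY Om.
have hJ' : jacdet (A, B) = 'X^k * (- (swapXY M * (('X^l)%:P * swapXY Jh))).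
  have h (u v w : {poly {poly C}}) : swapXY (u * (v * w)) = swapXY u * (swapXY v * swapXY w).
    by rewrite !rmorphM.
  rewrite jacdet_swapXY hJ h swapXY_Xm; exact: neg_shuffle.
set V := - _ in hJ'.
have VE : (V`_0).[s0] = - (peval M (s0, 0) * (s0 ^+ l * peval Jh (s0, 0))).
  rewrite /V -horner_coef0 hornerN !hornerM hornerC !horner_coef0 !coef0_swapXY.
  by rewrite hornerN !hornerM hornerXn !axXE.
have Vs : (V`_0).[s0] != 0 by rewrite VE oppr_eq0 !mulf_neq0// expf_neq0.
have V0 : V`_0 != 0 by apply: contraNneq Vs => ->; rewrite horner0.
have B0 : B != 0.
  apply: contraNneq V0 => B0; have := hJ'; rewrite /jacdet B0 [(_, _).1]/= [(_, _).2]/= /pd1 deriv0 raddf0 !mulr0 subr0.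
  move/esym/eqP; rewrite mulf_eq0 expf_eq0 polyX_eq0 andbF /= => /eqP->.
  by rewrite coef0.
have [j [Q [Q0 BE]]] := poly_lowX B0.
have j0 : (0 < j)%N.
  rewrite lt0n; apply: contraNneq Q0 => j0.
  have E : B`_0 = 0 by rewrite /B coef0_swapXY.
  by rewrite BE j0 expr0 mul1r in E; apply/eqP.
pose U := 'X * (pd1 A * pd2 Q) - pd2 A * (j%:R * Q + 'X * pd1 Q).
have UE : 'X^j * U = 'X^(k.+1) * V.
  transitivity ('X * jacdet (A, B)); last by rewrite hJ' exprS mulrA.
  have d2 : pd2 B = 'X^j * pd2 Q.
    rewrite BE pd2M; have -> : pd2 ('X^j : {poly {poly C}}) = 0.
      apply/polyP => i; rewrite /pd2 coef_map_id0 ?raddf0// coefXn coef0.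
      by case: eqP; rewrite ?derivC// raddf0.
    by rewrite mul0r add0r.
  have d1 : 'X * pd1 B = 'X^j * (j%:R * Q + 'X * pd1 Q).
    have e : 'X^j = 'X * 'X^(j.-1) :> {poly {poly C}} by rewrite -exprS prednK.
    by rewrite BE /pd1 derivM derivXn -mulr_natl e; exact: power_deriv_shuffle.
  exact: jacdet_shuffle d2 d1.
have U0 : U`_0 = - (deriv (axX G) * (j%:R * Q`_0)).
  rewrite /U -horner_coef0 hornerD hornerN !hornerM hornerX !mul0r add0r hornerD !hornerM hornerX mul0r addr0.
  rewrite !horner_coef0 /pd2 coef_map_id0 ?raddf0// /A coef0_swapXY.
  by rewrite -horner_coef0 -[X in X.[0]]polyC_natr hornerC.
have Un0 : U`_0 != 0.
  rewrite U0 oppr_eq0 !mulf_neq0// -polyC_natr polyC_eq0 pnatr_eq0 -lt0n.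
  exact: j0.
have [_ UV] := eq_lowX UE Un0 V0.
have Qs : (Q`_0).[s0] != 0.
  move: Vs; rewrite -UV U0 hornerN oppr_eq0 !hornerM !mulf_eq0 !negb_or => /andP[_ /andP[]] //.
have lQ : ulim F (fun x => peval Q (b x, a x)) (Q`_0).[s0].
  have -> : (Q`_0).[s0] = peval Q (0, s0) by rewrite pevalE -horner_coef0.
  exact: ulim_peval.
have nQ : F (fun x => peval Q (b x, a x) <> 0) by apply: ulim_ev_neq lQ Qs.
apply: filterS2 nb nQ => x /eqP bx /eqP qx; apply/eqP.
have -> : peval Om (a x, b x) = peval B (b x, a x) by rewrite /B peval_swapXY.
by rewrite BE pevalM pevalX; rewrite mulf_neq0// expf_neq0// pevalE hornerX hornerC.
Qed.

Lemma jacdet_subG1 G1 G2 K : jacdet (G1, subG G2 G1 K) = subG G2 G1 (pd1 K) * jacdet (G1, G2).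
Proof. by rewrite /jacdet [(_, _).1]/= [(_, _).2]/= pd1_subG pd2_subG; ring. Qed.

Lemma jacdet_swap G1 G2 : jacdet (G2, G1) = - jacdet (G1, G2).
Proof. by rewrite /jacdet [(_, _).1]/= [(_, _).2]/= opprB [pd1 G1 * _]mulrC [pd1 G2 * _]mulrC. Qed.

Lemma axX_subG G1 G2 K : axX (subG G2 G1 K) = on_curve (axX G1, axX G2) K.
Proof.
apply/eqP; rewrite -subr_eq0; apply/eqP; apply: poly_infinite0 => s.
by rewrite hornerD hornerN on_curveE axXE peval_subG subrr.
Qed.

(** [branch_avoid] for the composite K(G2, G1): it vanishes on the axis, and its Jacobian with G1 or
    G2 is, up to sign, a partial derivative of [K] times that of (G1, G2). *)
Lemma curve_avoid G1 G2 Jh K l k (y : C * C) (s0 : C) (T : Type) (F : set_system T) {FU : UltraFilter F} (a b : T -> C) :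
  jacdet (G1, G2) = Xm R (l, k) * Jh -> on_curve (axX G1, axX G2) K = 0 ->
  deriv (axX G1) != 0 -> deriv (axX G2) != 0 ->
  s0 != 0 -> peval G1 (s0, 0) = y.1 -> peval G2 (s0, 0) = y.2 -> peval Jh (s0, 0) != 0 ->
  peval (pd1 K) (y.2, y.1) != 0 \/ peval (pd2 K) (y.2, y.1) != 0 ->
  ulim F a s0 -> ulim F b 0 -> F (fun x => b x <> 0) ->
  F (fun x => peval K (peval G2 (a x, b x), peval G1 (a x, b x)) <> 0).
Proof.
move=> hJ K0 g1 g2 s00 e1 e2 Js nK la lb nb.
have h : F (fun x => peval (subG G2 G1 K) (a x, b x) <> 0); last first.
  by apply: filterS h => x; rewrite peval_subG.
case: nK => nK.
  have hj : jacdet (G1, subG G2 G1 K) = subG G2 G1 (pd1 K) * (Xm R (l, k) * Jh) by rewrite jacdet_subG1 hJ.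
  by apply: (branch_avoid hj) la lb nb; rewrite ?axX_subG ?peval_subG ?e1 ?e2.
have hj : jacdet (G2, subG G2 G1 K) = subG G2 G1 (pd2 K) * (Xm R (l, k) * - Jh).
  by rewrite jacdet_subG jacdet_swap hJ !mulrN.
by apply: (branch_avoid hj) la lb nb; rewrite ?axX_subG ?peval_subG ?e1 ?e2 ?pevalN ?oppr_eq0.
Qed.

Section Vanish.
Variables (G1 G2 Jh K : {poly {poly C}}) (l k : nat) (y : C * C).
Hypothesis hJ : jacdet (G1, G2) = Xm R (l, k) * Jh.
Hypothesis hnz : forall z, torus z -> gap G1 G2 y z != 0.
Hypothesis h0 : gap G1 G2 y (0, 0) != 0.
Hypothesis hprop : proper_at G1 G2 y.
Hypothesis hlift : forall (T : Type) (F : set_system T) (v : T -> C * C), UltraFilter F ->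
  ulim F (fun x => (v x).1) y.1 -> ulim F (fun x => (v x).2) y.2 -> F (fun x => v x <> y) ->
  exists a b : T -> C, F (fun x => torus (a x, b x)) /\
    F (fun x => peval G1 (a x, b x) = (v x).1 /\ peval G2 (a x, b x) = (v x).2).
Hypothesis hX : forall s, gap G1 G2 y (s, 0) = 0 -> [/\ on_curve (axX G1, axX G2) K = 0,
  deriv (axX G1) != 0, deriv (axX G2) != 0 & peval Jh (s, 0) != 0].
Hypothesis hZ : forall t, gap G1 G2 y (0, t) = 0 -> [/\ on_curve (axZ G1, axZ G2) K = 0,
  deriv (axZ G1) != 0, deriv (axZ G2) != 0 & peval Jh (0, t) != 0].

(* If K had a nonzero differential at y, the points of its zero set near y would lift to the torus and
   specialise to an axis, which branch_avoid rules out. *)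
Lemma curve_singular s0 : gap G1 G2 y (s0, 0) = 0 ->
  peval (pd1 K) (y.2, y.1) = 0 /\ peval (pd2 K) (y.2, y.1) = 0.
Proof.
move=> g0; have [K0 d1 d2 _] := hX g0; have [e1 e2] := gap_eq0 g0.
suff h : ~ (peval (pd1 K) (y.2, y.1) != 0 \/ peval (pd2 K) (y.2, y.1) != 0).
  by split; apply/eqP; apply: contrapT => /negP n; apply: h; [left|right].
move=> nK; have [F [FU hs hn]] := uf_near s0.
pose v (s : C) := ((axX G1).[s], (axX G2).[s]).
have v1 : ulim F (fun s => (v s).1) y.1 by rewrite -e1 -axXE; apply: ulim_poly hs.
have v2 : ulim F (fun s => (v s).2) y.2 by rewrite -e2 -axXE; apply: ulim_poly hs.
have vy : F (fun s => v s <> y).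
  have p0 : axX G1 - (y.1)%:P != 0.
    by apply: contraNneq d1 => /eqP; rewrite subr_eq0 => /eqP->; rewrite derivC.
  have h : F (fun s => (axX G1 - (y.1)%:P).[s] <> 0) by apply: (nonroot_near hs hn).
  by apply: filterS h => s + E; rewrite hornerD hornerN hornerC -E subrr.
have [a [b [tab Gab]]] := hlift FU v1 v2 vy.
have l1 : ulim F (fun s => peval G1 (a s, b s)) y.1 by apply: ulim_ext v1; apply: filterS Gab => s [].
have l2 : ulim F (fun s => peval G2 (a s, b s)) y.2 by apply: ulim_ext v2; apply: filterS Gab => s [].
have [/ulim_ex[a0 la] /ulim_ex[b0 lb]] := hprop FU tab l1 l2.
have E1 := ulim_uniq l1 (ulim_peval G1 la lb); have E2 := ulim_uniq l2 (ulim_peval G2 la lb).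
have gab : gap G1 G2 y (a0, b0) = 0 by rewrite /gap -E1 -E2 !subrr nC0 addr0.
have Kv : F (fun s => peval K (peval G2 (a s, b s), peval G1 (a s, b s)) = 0).
  apply: filterS Gab => s [-> ->]; rewrite /v /=.
  by rewrite -[LHS](on_curveE (axX G1, axX G2)) K0 horner0.
have contra : ~ F (fun s => peval K (peval G2 (a s, b s), peval G1 (a s, b s)) <> 0).
  by move=> h; apply: (@uf_absurd _ F FU); apply: filterS2 h Kv.
have nb : F (fun s => b s <> 0) by apply: filterS tab => s [_ /eqP].
have na : F (fun s => a s <> 0) by apply: filterS tab => s [/eqP].
have [b00|b00] := eqVneq b0 0.
  rewrite b00 in gab lb; have a00 : a0 != 0 by apply: contraNneq h0 => E; rewrite -{1}E gab.
  have [f1 f2] := gap_eq0 gab; have [_ _ _ Js] := hX gab.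
  by apply: contra; apply: (curve_avoid hJ K0 d1 d2 a00 f1 f2 Js nK la lb nb).
have [a00|a00] := eqVneq a0 0; last by have := hnz (conj a00 b00 : torus (a0, b0)); rewrite gab eqxx.
rewrite a00 in gab la; have [f1 f2] := gap_eq0 gab; have [K0' d1' d2' Js] := hZ gab.
have hJ' : jacdet (swapXY G1, swapXY G2) = Xm R (k, l) * - swapXY Jh.
  by rewrite jacdet_swapXY hJ rmorphM /= swapXY_Xm mulrN.
apply: contra.
have h : F (fun s => peval K (peval (swapXY G2) (b s, a s), peval (swapXY G1) (b s, a s)) <> 0).
  by apply: (curve_avoid hJ' K0' d1' d2' b00 _ _ _ nK lb la na); rewrite ?pevalN ?oppr_eq0 peval_swapXY.
by apply: filterS h => s; rewrite !peval_swapXY.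
Qed.
End Vanish.

Lemma sub1_suppl (al be : {poly C}) P : sub1 al be P = \sum_(w <- suppl P) (coef2 P w)%:P * (al ^+ w.1 * be ^+ w.2).
Proof.
apply/eqP; rewrite -subr_eq0; apply/eqP; apply: poly_infinite0 => x.
rewrite hornerD hornerN horner_sub1 peval_suppl horner_sum; apply/eqP; rewrite subr_eq0; apply/eqP.
by apply: eq_bigr => w _; rewrite !hornerM hornerC !horner_exp.
Qed.

Lemma sub1_congr (d al be : {poly C}) (c e : C) P : d %| al - c%:P -> d %| be - e%:P ->
  peval P (c, e) = 0 -> d %| sub1 al be P.
Proof.
move=> h1 h2 P0; have -> : sub1 al be P = sub1 al be P - (peval P (c, e))%:P by rewrite P0 subr0.
rewrite sub1_suppl peval_suppl rmorph_sum /= -sumrB; elim/big_ind: _ => [|u v|w _]; rewrite ?dvdp0//.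
  exact: dvdp_add.
rewrite /mon /= rmorphM -mulrBr; apply: dvdp_mull; rewrite rmorphM !rmorphXn /=.
have -> : al ^+ w.1 * be ^+ w.2 - c%:P ^+ w.1 * e%:P ^+ w.2 =
    (al ^+ w.1 - c%:P ^+ w.1) * be ^+ w.2 + c%:P ^+ w.1 * (be ^+ w.2 - e%:P ^+ w.2) by ring.
by rewrite !subrXX; apply: dvdp_add; [apply: dvdp_mulr; apply: dvdp_mulr|apply: dvdp_mull; apply: dvdp_mulr].
Qed.

Lemma mup_deriv (p : {poly C}) s : p != 0 -> root p s -> mup s (deriv p) = (mup s p).-1 /\ deriv p != 0.
Proof.
move=> p0 ps; have [u us pE] := mup_factor s p0.
have m0 : (0 < mup s p)%N by rewrite -XsubC_dvd// dvdp_XsubCl.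
set m := mup s p in pE m0 *.
pose v := m%:R * u + ('X - s%:P) * deriv u.
have E : deriv p = v * ('X - s%:P) ^+ m.-1.
  have e : ('X - s%:P) ^+ m = ('X - s%:P) * ('X - s%:P) ^+ m.-1 by rewrite -exprS prednK.
  rewrite pE derivM deriv_exp derivXsubC mul1r /v -mulr_natl e.
  exact: root_deriv_shuffle.
have vs : v.[s] != 0.
  rewrite /v hornerD !hornerM hornerXsubC subrr mul0r addr0 -polyC_natr hornerC mulf_neq0//.
  by rewrite pnatr_eq0 -lt0n.
have v0 : v != 0 by apply: contraNneq vs => ->; rewrite horner0.
split; last by rewrite E mulf_neq0// expf_neq0// polyXsubC_eq0.
by rewrite E mupMr ?mup_XsubCX ?eqxx// rootE.
Qed.

(** Let m and n be the orders of p - y.1 and q - y.2. Both partial derivatives of [K] vanish on the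
    curve to order at least min(m, n). Differentiating K(q, p) = 0 gives ord(K_y2) + n - 1 =
    ord(K_y1) + m - 1, which yields ord(K_y2) >= m also when n < m. *)
Lemma order_gradient (p q : {poly C}) K (y : C * C) s : on_curve (p, q) K = 0 ->
  p - (y.1)%:P != 0 -> q - (y.2)%:P != 0 -> p.[s] = y.1 -> q.[s] = y.2 ->
  peval (pd1 K) (y.2, y.1) = 0 -> peval (pd2 K) (y.2, y.1) = 0 ->
  on_curve (p, q) (pd1 K) != 0 ->
  (mup s (p - (y.1)%:P) <= mup s (on_curve (p, q) (pd1 K)))%N.
Proof.
move=> K0 p0 q0 ps qs k1 k2 H0; set H := on_curve _ _ in H0 *; pose H2 := on_curve (p, q) (pd2 K).
have D : H * deriv (q - (y.2)%:P) + H2 * deriv (p - (y.1)%:P) = 0.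
  have := deriv_sub1 q p K; rewrite -[sub1 q p K]/(on_curve (p, q) K) K0 deriv0 => ->.
  by rewrite !derivB !derivC !subr0.
have rp : root (p - (y.1)%:P) s by rewrite rootE hornerD hornerN hornerC ps subrr.
have rq : root (q - (y.2)%:P) s by rewrite rootE hornerD hornerN hornerC qs subrr.
have [mp p'0] := mup_deriv p0 rp; have [mq q'0] := mup_deriv q0 rq.
have m1 : (0 < mup s (p - (y.1)%:P))%N by rewrite -XsubC_dvd// dvdp_XsubCl.
have m2 : (0 < mup s (q - (y.2)%:P))%N by rewrite -XsubC_dvd// dvdp_XsubCl.
have D' : H * deriv (q - (y.2)%:P) = - H2 * deriv (p - (y.1)%:P) by move/eqP: D; rewrite addr_eq0 mulNr => /eqP.
have H20 : - H2 != 0.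
  by apply: contraNneq (mulf_neq0 H0 q'0) => h; rewrite D' h mul0r.
have low P : peval P (y.2, y.1) = 0 -> on_curve (p, q) P != 0 ->
    (minn (mup s (p - (y.1)%:P)) (mup s (q - (y.2)%:P)) <= mup s (on_curve (p, q) P))%N.
  move=> P0 cP; rewrite mup_geq//; apply: sub1_congr P0; rewrite /= -mup_geq//.
    exact: geq_minr.
  exact: geq_minl.
have a1 := low _ k1 H0; have a2 : (minn (mup s (p - (y.1)%:P)) (mup s (q - (y.2)%:P)) <= mup s (- H2))%N.
  by rewrite mupN; apply: low k2 _; rewrite -oppr_eq0.
have := congr1 (mup s) D'; rewrite !mupM// mp mq -/H in a1 *.
move: a1 a2 m1 m2; move: (mup s (p - _)) (mup s (q - _)) (mup s H) (mup s (- H2)).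
by clear; lia.
Qed.
End Local.

(** * Summation over the exceptional values *)

Section System.
Variable R : realType.
Local Notation C := (R[i]).
Local Notation poly2 := {poly {poly C}}.

Definition flip (y : C * C) := (y.2, y.1).

Definition liftable (G1 G2 : poly2) (y : C * C) := forall (T : Type) (F : set_system T) (v : T -> C * C),
  UltraFilter F -> ulim F (fun x => (v x).1) y.1 -> ulim F (fun x => (v x).2) y.2 -> F (fun x => v x <> y) ->
  exists a b : T -> C, F (fun x => torus (a x, b x)) /\
    F (fun x => peval G1 (a x, b x) = (v x).1 /\ peval G2 (a x, b x) = (v x).2).

(* the value y is taken by (G1, G2) only on the axes, at points where the nonmonomial part Jh of the
   Jacobian does not vanish; aX and aZ tell on which axes this may happen *)
Record system (G1 G2 Jh : poly2) (l k D : nat) (p1 p2 z1 z2 : {poly C}) (aX aZ : bool) (y : C * C) : Prop := System {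
  sysJ : jacdet (G1, G2) = Xm R (l, k) * Jh;
  sysD : (0 < D)%N;
  sysp1 : axX G1 = p1 \Po 'X^D;  sysp2 : axX G2 = p2 \Po 'X^D;
  sysz1 : axZ G1 = z1 \Po 'X^D;  sysz2 : axZ G2 = z2 \Po 'X^D;
  sysX : aX -> (1 < size p1)%N /\ (1 < size p2)%N;
  sysZ : aZ -> (1 < size z1)%N /\ (1 < size z2)%N;
  sysN : forall z, torus z -> gap G1 G2 y z != 0;
  sys0 : gap G1 G2 y (0, 0) != 0;
  sys_proper : proper_at G1 G2 y;
  sys_lift : liftable G1 G2 y;
  sysNX : ~~ aX -> forall s, gap G1 G2 y (s, 0) != 0;
  sysNZ : ~~ aZ -> forall t, gap G1 G2 y (0, t) != 0;
  sysP1 : axX G1 - (y.1)%:P != 0;  sysP2 : axX G2 - (y.2)%:P != 0;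
  sysZ1 : axZ G1 - (y.1)%:P != 0;  sysZ2 : axZ G2 - (y.2)%:P != 0;
  sys_steepX : aX -> steep G1 G2 y (D * adeg p2) /\ steep G2 G1 (flip y) (D * adeg p1);
  sys_steepZ : aZ -> steep (swapXY G1) (swapXY G2) y (D * adeg z2) /\
    steep (swapXY G2) (swapXY G1) (flip y) (D * adeg z1);
  sys_goodX : forall s, gap G1 G2 y (s, 0) = 0 -> peval Jh (s, 0) != 0;
  sys_goodZ : forall t, gap G1 G2 y (0, t) = 0 -> peval Jh (0, t) != 0 }.

Lemma gap_flip G1 G2 y z : gap G2 G1 (flip y) z = gap G1 G2 y z.
Proof. by rewrite /gap addrC. Qed.

Lemma system_flip G1 G2 Jh l k D p1 p2 z1 z2 aX aZ y : system G1 G2 Jh l k D p1 p2 z1 z2 aX aZ y ->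
  system G2 G1 (- Jh) l k D p2 p1 z2 z1 aX aZ (flip y).
Proof.
case=> hJ hD hp1 hp2 hz1 hz2 hX hZ hN h0 hp hl hNX hNZ hP1 hP2 hZ1 hZ2 hsX hsZ hgX hgZ; split => //.
- by rewrite jacdet_swap hJ mulrN.
- by move=> /hX[].
- by move=> /hZ[].
- by move=> z; rewrite gap_flip; exact: hN.
- by rewrite gap_flip.
- by move=> T F a b FU h1 h2 h3; apply: (hp T F a b FU h1 h3 h2).
- move=> T F v FU h1 h2 h3; have [|a [b [t1 t2]]] := hl T F (fun x => flip (v x)) FU h2 h1.
    by apply: filterS h3 => x h e; apply: h; rewrite -e; case: (v x).
  by exists a, b; split => //; apply: filterS t2 => x [].
- by move=> h s; rewrite gap_flip; apply: hNX.
- by move=> h s; rewrite gap_flip; apply: hNZ.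
- by move=> /hsX[h1 h2]; split => //; case: (y) h1.
- by move=> /hsZ[h1 h2]; split => //; case: (y) h1.
- by move=> s; rewrite gap_flip pevalN oppr_eq0; exact: hgX.
- by move=> s; rewrite gap_flip pevalN oppr_eq0; exact: hgZ.
Qed.

Lemma system_swapXY G1 G2 Jh l k D p1 p2 z1 z2 aX aZ y : system G1 G2 Jh l k D p1 p2 z1 z2 aX aZ y ->
  system (swapXY G1) (swapXY G2) (- swapXY Jh) k l D z1 z2 p1 p2 aZ aX y.
Proof.
have zX G : axZ (swapXY G) = axX G by rewrite /axZ swapXYK.
case=> hJ hD hp1 hp2 hz1 hz2 hX hZ hN h0 hp hl hNX hNZ hP1 hP2 hZ1 hZ2 hsX hsZ hgX hgZ; split; rewrite ?zX ?swapXYK//.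
- by rewrite jacdet_swapXY hJ rmorphM /= swapXY_Xm mulrN.
- by move=> [a b] [/= h1 h2]; rewrite gap_swap; exact: hN.
- by rewrite gap_swap.
- move=> T F a b FU h1; under eq_fun do rewrite peval_swapXY /=.
  move=> h2; under eq_fun do rewrite peval_swapXY /=; move=> h3.
  by have [] // := hp T F b a FU _ h2 h3; apply: filterS h1 => x [].
- move=> T F v FU h1 h2 h3; have [a [b [t1 t2]]] := hl T F v FU h1 h2 h3.
  exists b, a; split; first by apply: filterS t1 => x [].
  by apply: filterS t2 => x; rewrite !peval_swapXY.
- by move=> h t; rewrite gap_swap; apply: hNZ.
- by move=> h t; rewrite gap_swap; apply: hNX.
- by move=> s; rewrite gap_swap pevalN oppr_eq0 peval_swapXY; exact: hgZ.
- by move=> s; rewrite gap_swap pevalN oppr_eq0 peval_swapXY; exact: hgX.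
Qed.

Lemma deriv_neq0 (p : {poly C}) : (1 < size p)%N -> deriv p != 0.
Proof.
case sp : (size p) => [|[|n]]// _; apply/eqP => h.
have := congr1 (fun q : {poly C} => q`_n) h; rewrite coef_deriv coef0 -mulr_natr => /eqP.
rewrite mulf_eq0 pnatr_eq0 orbF; have : lead_coef p != 0 by rewrite lead_coef_eq0 -size_poly_eq0 sp.
by rewrite lead_coefE sp => /negbTE->.
Qed.

Lemma on_curve_comp (p q : {poly C}) D K : on_curve (p \Po 'X^D, q \Po 'X^D) K = on_curve (p, q) K \Po 'X^D.
Proof.
apply/eqP; rewrite -subr_eq0; apply/eqP; apply: poly_infinite0 => s.
by rewrite hornerD hornerN on_curveE !horner_comp on_curveE subrr.
Qed.

Lemma adeg_comp (p : {poly C}) D : adeg (p \Po 'X^D) = (adeg p * D)%N.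
Proof. by rewrite /adeg size_comp_poly size_polyXn. Qed.

Definition fibre (p q : {poly C}) (y : C * C) : seq C :=
  [seq s <- undup (rootsC (p - (y.1)%:P)) | q.[s] == y.2].

Lemma fibre_uniq p q y : uniq (fibre p q y).
Proof. by rewrite filter_uniq// undup_uniq. Qed.

Lemma mem_fibre p q y s : p - (y.1)%:P != 0 -> (s \in fibre p q y) = (p.[s] == y.1) && (q.[s] == y.2).
Proof.
by move=> h; rewrite mem_filter mem_undup mem_rootsC// hornerD hornerN hornerC subr_eq0 andbC.
Qed.

(** Fibres over distinct values are disjoint, so the orders of the single polynomial [H] add up to
    at most its degree. *)
Lemma fibre_sum (p q H : {poly C}) (E : seq (C * C)) : uniq E -> H != 0 ->
  (forall y, y \in E -> p - (y.1)%:P != 0) ->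
  (forall y s, y \in E -> p.[s] = y.1 -> q.[s] = y.2 -> (mup s (p - (y.1)%:P) <= mup s H)%N) ->
  (\sum_(y <- E) \sum_(s <- fibre p q y) mup s (p - (y.1)%:P) <= adeg H)%N.
Proof.
move=> uE H0 hp h.
apply: (@leq_trans (\sum_(y <- E) \sum_(s <- fibre p q y) mup s H)).
  rewrite big_seq [X in (_ <= X)%N]big_seq; apply: leq_sum => y yE.
  rewrite big_seq [X in (_ <= X)%N]big_seq; apply: leq_sum => s.
  by rewrite mem_fibre ?hp// => /andP[/eqP h1 /eqP h2]; exact: h.
rewrite -(big_map (fibre p q) xpredT (fun r => \sum_(s <- r) mup s H)%N) -big_flatten /=.
apply: sum_mup => //; elim: E uE hp {h} => //= y E IH /andP[yE uE] hp.
rewrite cat_uniq fibre_uniq IH//; last by move=> y' y'E; apply: hp; rewrite inE y'E orbT.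
rewrite andbT; apply/hasPn => s /flatten_mapP[y' y'E].
rewrite mem_fibre ?hp ?inE ?y'E ?orbT// => /andP[/eqP h1 /eqP h2].
rewrite mem_fibre ?hp ?inE ?eqxx// h1 h2; apply/negP => /andP[/eqP e1 /eqP e2].
by move: yE; rewrite (surjective_pairing y) -e1 -e2 -surjective_pairing y'E.
Qed.

Lemma gap0P (G1 G2 : poly2) y z : gap G1 G2 y z = 0 <-> peval G1 z = y.1 /\ peval G2 z = y.2.
Proof. by split => [/gap_eq0//|[h1 h2]]; rewrite /gap h1 h2 !subrr nC0 addr0. Qed.

Definition total_growth (a b : bool) (c c' : {poly C} * {poly C}) : nat :=
  if a then (growth c c + (if b then growth c c' else 0))%N else 0.

(** [count_asymptotic] bounds the fibre multiplicities below for each y; their sum over y is bounded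
    above through [order_gradient] and [separating_equation]. The factor [D] from the substitution
    of s^D occurs on both sides and cancels. *)
Lemma system_count G1 G2 Jh l k D p1 p2 z1 z2 aX aZ (E : seq (C * C)) : uniq E ->
  (forall y, y \in E -> system G1 G2 Jh l k D p1 p2 z1 z2 aX aZ y) -> aX ->
  (size E * (adeg p2 * (size (swapXY G1)).-1) <= k.+1 * total_growth aX aZ (p1, p2) (z1, z2) +
     l.+1 * total_growth aZ aX (z1, z2) (p1, p2))%N.
Proof.
move=> uE hE haX; pose h1 := (size (swapXY G1)).-1; rewrite -/h1.
case: E uE hE => [|y0 E'] //; set E := y0 :: E' => uE hE; have s0 := hE _ (mem_head _ _).
have D0 := sysD s0.
(* Only active axes enter the equation: an inactive one carries no point over [E]. *)
pose cs := (if aX then [:: (p1, p2)] else [::]) ++ (if aZ then [:: (z1, z2)] else [::]).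
have hcs c : c \in cs -> (1 < size c.1)%N.
  rewrite mem_cat => /orP[]; case: ifP => // a; rewrite inE => /eqP-> /=.
    by have [] := sysX s0 a.
  by have [] := sysZ s0 a.
have [K hK] := separating_equation hcs.
have cX : aX -> (p1, p2) \in cs by move=> a; rewrite /cs a mem_head.
have cZ : aZ -> (z1, z2) \in cs by move=> a; rewrite /cs a mem_cat mem_head orbT.
have sumc (f : ({poly C} * {poly C}) -> nat) : (\sum_(c <- cs) f c = (if aX then f (p1, p2) else 0) + (if aZ then f (z1, z2) else 0))%N.
  by rewrite /cs big_cat /=; congr (_ + _)%N; case: ifP; rewrite ?big_seq1 ?big_nil.
have big1 y : y \in E -> forall s, gap G1 G2 y (s, 0) = 0 -> [/\ on_curve (axX G1, axX G2) K = 0,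
    deriv (axX G1) != 0, deriv (axX G2) != 0 & peval Jh (s, 0) != 0].
  move=> yE s gs; have sy := hE y yE.
  have a : aX by apply: contraT => /(sysNX sy) /(_ s); rewrite gs eqxx.
  have [q1 q2] := sysX sy a; have [K0 _ _] := hK _ (cX a).
  split; last exact: sys_goodX sy _ gs.
  - by rewrite (sysp1 sy) (sysp2 sy) on_curve_comp K0 comp_poly0.
  - apply: deriv_neq0; rewrite (sysp1 sy) -subn_gt0 subn1 -/(adeg _) adeg_comp muln_gt0 D0.
    by rewrite /adeg -subn1 subn_gt0 q1.
  - apply: deriv_neq0; rewrite (sysp2 sy) -subn_gt0 subn1 -/(adeg _) adeg_comp muln_gt0 D0.
    by rewrite /adeg -subn1 subn_gt0 q2.
have big2 y : y \in E -> forall t, gap G1 G2 y (0, t) = 0 -> [/\ on_curve (axZ G1, axZ G2) K = 0,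
    deriv (axZ G1) != 0, deriv (axZ G2) != 0 & peval Jh (0, t) != 0].
  move=> yE s gs; have sy := hE y yE.
  have a : aZ by apply: contraT => /(sysNZ sy) /(_ s); rewrite gs eqxx.
  have [q1 q2] := sysZ sy a; have [K0 _ _] := hK _ (cZ a).
  split; last exact: sys_goodZ sy _ gs.
  - by rewrite (sysz1 sy) (sysz2 sy) on_curve_comp K0 comp_poly0.
  - apply: deriv_neq0; rewrite (sysz1 sy) -subn_gt0 subn1 -/(adeg _) adeg_comp muln_gt0 D0.
    by rewrite /adeg -subn1 subn_gt0 q1.
  - apply: deriv_neq0; rewrite (sysz2 sy) -subn_gt0 subn1 -/(adeg _) adeg_comp muln_gt0 D0.
    by rewrite /adeg -subn1 subn_gt0 q2.
have sX : (\sum_(y <- E) \sum_(s <- fibre (axX G1) (axX G2) y) mup s (axX G1 - (y.1)%:P) <=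
    D * total_growth aX aZ (p1, p2) (z1, z2))%N.
  rewrite /total_growth haX; have [K0 K1 K2] := hK _ (cX haX).
  rewrite sumc haX in K2; apply: (@leq_trans (adeg (on_curve (axX G1, axX G2) (pd1 K)))); last first.
    by rewrite (sysp1 s0) (sysp2 s0) on_curve_comp adeg_comp mulnC leq_mul2l K2 orbT.
  have H0 : on_curve (axX G1, axX G2) (pd1 K) != 0.
    rewrite (sysp1 s0) (sysp2 s0) on_curve_comp; apply/eqP => h.
    by move/eqP: h; rewrite comp_poly_eq0 ?size_polyXn// (negbTE K1).
  apply: fibre_sum => // [y yE|y s yE e1 e2]; first exact: (sysP1 (hE y yE)).
  have gs : gap G1 G2 y (s, 0) = 0 by apply/gap0P; rewrite -!axXE.
  have sy := hE y yE; have [c0 _ _ _] := big1 y yE s gs.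
  have [k1 k2] := curve_singular (sysJ sy) (sysN sy) (sys0 sy) (sys_proper sy) (sys_lift sy) (big1 y yE) (big2 y yE) gs.
  exact: order_gradient c0 (sysP1 sy) (sysP2 sy) e1 e2 k1 k2 H0.
have sZ : (\sum_(y <- E) \sum_(s <- fibre (axZ G1) (axZ G2) y) mup s (axZ G1 - (y.1)%:P) <=
    D * total_growth aZ aX (z1, z2) (p1, p2))%N.
  case: (boolP aZ) => haZ; last first.
    rewrite big_seq big1_idem ?addn0// => y yE; rewrite big_seq big1_idem ?addn0// => s.
    rewrite mem_fibre ?(sysZ1 (hE y yE))// => /andP[/eqP e1 /eqP e2].
    have := sysNZ (hE y yE) haZ s; suff -> : gap G1 G2 y (0, s) = 0 by rewrite eqxx.
    by apply/gap0P; rewrite -!axZE.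
  rewrite /total_growth; have [K0 K1 K2] := hK _ (cZ haZ).
  rewrite sumc haX haZ addnC in K2; apply: (@leq_trans (adeg (on_curve (axZ G1, axZ G2) (pd1 K)))); last first.
    by rewrite (sysz1 s0) (sysz2 s0) on_curve_comp adeg_comp mulnC leq_mul2l haX K2 orbT.
  have H0 : on_curve (axZ G1, axZ G2) (pd1 K) != 0.
    rewrite (sysz1 s0) (sysz2 s0) on_curve_comp; apply/eqP => h.
    by move/eqP: h; rewrite comp_poly_eq0 ?size_polyXn// (negbTE K1).
  apply: fibre_sum => // [y yE|y s yE e1 e2]; first exact: (sysZ1 (hE y yE)).
  have gs : gap G1 G2 y (0, s) = 0 by apply/gap0P; rewrite -!axZE.
  have sy := system_swapXY (hE y yE); have [c0 _ _ _] := big2 y yE s gs.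
  have gs' : gap (swapXY G1) (swapXY G2) y (s, 0) = 0 by rewrite gap_swap.
  have b1 t : gap (swapXY G1) (swapXY G2) y (t, 0) = 0 -> [/\ on_curve (axX (swapXY G1), axX (swapXY G2)) K = 0,
      deriv (axX (swapXY G1)) != 0, deriv (axX (swapXY G2)) != 0 & peval (- swapXY Jh) (t, 0) != 0].
    by rewrite gap_swap pevalN oppr_eq0 peval_swapXY; exact: big2.
  have b2 t : gap (swapXY G1) (swapXY G2) y (0, t) = 0 -> [/\ on_curve (axZ (swapXY G1), axZ (swapXY G2)) K = 0,
      deriv (axZ (swapXY G1)) != 0, deriv (axZ (swapXY G2)) != 0 & peval (- swapXY Jh) (0, t) != 0].
    by rewrite gap_swap pevalN oppr_eq0 peval_swapXY /axZ !swapXYK; exact: big1.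
  have [k1 k2] := curve_singular (sysJ sy) (sysN sy) (sys0 sy) (sys_proper sy) (sys_lift sy) b1 b2 gs'.
  exact: order_gradient c0 (sysZ1 (hE y yE)) (sysZ2 (hE y yE)) e1 e2 k1 k2 H0.
have each y : y \in E -> (D * (adeg p2 * h1) <= k.+1 * (\sum_(s <- fibre (axX G1) (axX G2) y) mup s (axX G1 - (y.1)%:P)) +
     l.+1 * (\sum_(s <- fibre (axZ G1) (axZ G2) y) mup s (axZ G1 - (y.1)%:P)))%N.
  move=> yE; have sy := hE y yE.
  case e : h1 => [|n]; first by rewrite !muln0.
  have sg : size (swapXY G1 - (y.1)%:P%:P) = n.+2.
    have e' : size (swapXY G1) = n.+2 by move: e; rewrite /h1; case: (size _) => //= m ->.
    by rewrite size_polyDl ?e'// size_polyN size_polyC; case: eqP.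
  have hJ z : torus z -> z.1 * z.2 * peval (jacdet (G1, G2)) z = z.1 ^+ l.+1 * z.2 ^+ k.+1 * peval Jh z.
    by move=> _; rewrite (sysJ sy) pevalM peval_Xm /mon /= !exprS; ring.
  have [st _] := sys_steepX sy haX; rewrite mulnA.
  apply: (count_asymptotic hJ (sysN sy) (sys0 sy) (sys_proper sy) st (sysP1 sy) (sysZ1 sy) (sys_goodX sy) (sys_goodZ sy)
    (fibre_uniq _ _ _) (fibre_uniq _ _ _) _ _ sg) => s /gap_eq0[e1 e2].
    by rewrite mem_fibre ?(sysP1 sy)// !axXE e1 e2 !eqxx.
  by rewrite mem_fibre ?(sysZ1 sy)// !axZE e1 e2 !eqxx.
rewrite -(leq_pmul2l D0) mulnDr [(D * (size E * _))%N]mulnCA ![(D * (_.+1 * _))%N]mulnCA.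
have : (\sum_(y <- E) D * (adeg p2 * h1) <= \sum_(y <- E) (k.+1 * (\sum_(s <- fibre (axX G1) (axX G2) y) mup s (axX G1 - (y.1)%:P)) +
     l.+1 * (\sum_(s <- fibre (axZ G1) (axZ G2) y) mup s (axZ G1 - (y.1)%:P))))%N.
  by rewrite big_seq [X in (_ <= X)%N]big_seq; apply: leq_sum.
rewrite big_const_seq count_predT iter_addn_0 mulnC big_split /= -!big_distrr /= => /leq_trans; apply.
by apply: leq_add; rewrite leq_mul2l ?sX ?sZ orbT.
Qed.

End System.

(** With m the largest of the four products a2 h1, a1 h2, b2 g1, b1 g2 one has D B <= m, kX a1 a2 <=
    (a1 + a2) m and kZ b1 b2 <= (b1 + b2) m; so the inequality for N m can be divided by m. *)
Lemma both_sides_arith N D a1 a2 b1 b2 h1 h2 g1 g2 kX kZ B :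
  (0 < D)%N -> (0 < a1)%N -> (0 < a2)%N -> (0 < b1)%N -> (0 < b2)%N ->
  B = maxn (a2 * b1) (a1 * b2) ->
  (D * b1 <= h1)%N -> (D * b2 <= h2)%N -> (kX <= h1 + h2)%N -> (kZ <= g1 + g2)%N ->
  (N * (a2 * h1) <= kX * (a1 * a2 + B) + kZ * (b1 * b2 + B))%N ->
  (N * (a1 * h2) <= kX * (a1 * a2 + B) + kZ * (b1 * b2 + B))%N ->
  (N * (b2 * g1) <= kX * (a1 * a2 + B) + kZ * (b1 * b2 + B))%N ->
  (N * (b1 * g2) <= kX * (a1 * a2 + B) + kZ * (b1 * b2 + B))%N ->
  (N * D <= D * (a1 + a2 + b1 + b2) + kX + kZ)%N.
Proof.
move=> D0 a10 a20 b10 b20 BE e1 e2 eX eZ n1 n2 n3 n4.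
pose m := maxn (maxn (a2 * h1) (a1 * h2)) (maxn (b2 * g1) (b1 * g2)).
have m1 : (a2 * h1 <= m)%N by rewrite !leq_max leqnn.
have m2 : (a1 * h2 <= m)%N by rewrite !leq_max leqnn orbT.
have m3 : (b2 * g1 <= m)%N by rewrite !leq_max leqnn !orbT.
have m4 : (b1 * g2 <= m)%N by rewrite !leq_max leqnn !orbT.
have nm : (N * m <= kX * (a1 * a2 + B) + kZ * (b1 * b2 + B))%N.
  by rewrite /m !maxnMr !geq_max n1 n2 n3 n4.
have mB : (D * B <= m)%N.
  rewrite BE maxnMr geq_max; apply/andP; split.
    by apply: leq_trans m1; rewrite mulnCA leq_mul2l e1 orbT.
  by apply: leq_trans m2; rewrite mulnCA leq_mul2l e2 orbT.
have m0 : (0 < m)%N.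
  by apply: leq_trans m1; rewrite muln_gt0 a20 (leq_trans _ e1)// muln_gt0 D0.
have x1 : (kX * (a1 * a2) <= (a1 + a2) * m)%N.
  apply: (@leq_trans ((h1 + h2) * (a1 * a2))); first by rewrite leq_mul2r eX orbT.
  rewrite mulnDl mulnDl; apply: leq_add.
    by rewrite mulnCA leq_mul2l mulnC m1 orbT.
  by rewrite [(a1 * a2)%N]mulnC mulnCA leq_mul2l mulnC m2 orbT.
have x2 : (kZ * (b1 * b2) <= (b1 + b2) * m)%N.
  apply: (@leq_trans ((g1 + g2) * (b1 * b2))); first by rewrite leq_mul2r eZ orbT.
  rewrite mulnDl mulnDl; apply: leq_add.
    by rewrite mulnCA leq_mul2l mulnC m3 orbT.
  by rewrite [(b1 * b2)%N]mulnC mulnCA leq_mul2l mulnC m4 orbT.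
rewrite -(leq_pmul2r m0).
apply: (@leq_trans (D * (kX * (a1 * a2 + B) + kZ * (b1 * b2 + B)))).
  by rewrite mulnAC mulnC leq_mul2l nm orbT.
have y1 : (kX * (D * B) <= kX * m)%N by rewrite leq_mul2l mB orbT.
have y2 : (kZ * (D * B) <= kZ * m)%N by rewrite leq_mul2l mB orbT.
have z1 : (D * (kX * (a1 * a2)) <= D * ((a1 + a2) * m))%N by rewrite leq_mul2l x1 orbT.
have z2 : (D * (kZ * (b1 * b2)) <= D * ((b1 + b2) * m))%N by rewrite leq_mul2l x2 orbT.
rewrite (_ : _ * (_ + _) = D * (kX * (a1 * a2)) + kX * (D * B) + (D * (kZ * (b1 * b2)) + kZ * (D * B)))%N; last by ring.
rewrite (_ : _ * m = D * ((a1 + a2) * m) + kX * m + (D * ((b1 + b2) * m) + kZ * m))%N; last by ring.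
by rewrite !leq_add.
Qed.

Lemma one_side_arith N a1 a2 h1 h2 kX :
  (0 < a1)%N -> (0 < a2)%N -> (0 < kX)%N -> (kX <= h1 + h2)%N ->
  (N * (a2 * h1) <= kX * (a1 * a2))%N -> (N * (a1 * h2) <= kX * (a1 * a2))%N -> (N <= a1 + a2)%N.
Proof.
move=> a10 a20 k0 eX n1 n2; pose m := maxn (a2 * h1) (a1 * h2).
have m1 : (a2 * h1 <= m)%N by rewrite !leq_max leqnn.
have m2 : (a1 * h2 <= m)%N by rewrite !leq_max leqnn orbT.
have nm : (N * m <= kX * (a1 * a2))%N by rewrite /m !maxnMr !geq_max n1 n2.
have m0 : (0 < m)%N.
  rewrite /m leq_max !muln_gt0 a10 a20 /=; have := leq_trans k0 eX.
  by rewrite addn_gt0.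
rewrite -(leq_pmul2r m0); apply: leq_trans nm _.
apply: (@leq_trans ((h1 + h2) * (a1 * a2))); first by rewrite leq_mul2r eX orbT.
rewrite mulnDl mulnDl; apply: leq_add.
  by rewrite mulnCA leq_mul2l mulnC m1 orbT.
by rewrite [(a1 * a2)%N]mulnC mulnCA leq_mul2l mulnC m2 orbT.
Qed.

Definition flipn (w : nat * nat) : nat * nat := (w.2, w.1).
(** The determinant of (b, w); the truncated subtraction is exact where it is applied to exponents
    of a [cone]. *)
Definition height (b w : nat * nat) : nat := (w.2 * b.1 - w.1 * b.2)%N.
Definition wsize (w : nat * nat) : nat := (w.1 + w.2)%N.

(* bX and bZ are the primitive generators of the lowest and the highest ray of the cone spanned by A *)
Record cone (A : seq (nat * nat)) (bX bZ : nat * nat) (D : nat) : Prop := Cone {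
  coneX : coprime bX.1 bX.2;
  coneZ : coprime bZ.1 bZ.2;
  coneAX : forall w, w \in A -> (w.1 * bX.2 <= w.2 * bX.1)%N;
  coneAZ : forall w, w \in A -> (w.2 * bZ.1 <= w.1 * bZ.2)%N;
  coneD : (0 < D)%N;
  coneDE : (D + bX.2 * bZ.1 = bX.1 * bZ.2)%N }.

Lemma flipnK : involutive flipn. Proof. by case. Qed.

Lemma cone_flip A bX bZ D : cone A bX bZ D -> cone (map flipn A) (flipn bZ) (flipn bX) D.
Proof.
case=> h1 h2 h3 h4 h5 h6; split => //=; rewrite 1?coprime_sym//.
- by move=> _ /mapP[w wA ->] /=; exact: h4.
- by move=> _ /mapP[w wA ->] /=; exact: h3.
- by rewrite mulnC h6 mulnC.
Qed.

Lemma slope_trans (a b c d e f : nat) : (0 < c + d -> b * c < a * d -> e * d <= f * c -> f * a < e * b -> False)%N.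
Proof.
case: (posnP c) => [->|c0] h1 h2 h3 h4; first by move: h3 h4; rewrite muln0 leqn0 muln_eq0; case: e => // n; lia.
have e1 : (c * (f * a) < c * (e * b))%N by rewrite ltn_pmul2l.
have e2 : (a * (e * d) <= a * (f * c))%N by rewrite leq_mul2l h3 orbT.
have e3 : (e * (b * c) <= e * (a * d))%N by rewrite leq_mul2l (ltnW h2) orbT.
by clear h1 h2 h3 h4; lia.
Qed.

Lemma lowest_vector (A : seq (nat * nat)) : (exists2 w, w \in A & (0 < wsize w)%N) ->
  exists w0, [/\ w0 \in A, (0 < wsize w0)%N & forall w, w \in A -> (w.1 * w0.2 <= w.2 * w0.1)%N].
Proof.
elim: A => [[w]//|u A IH] [w wA w0].
have [[u1 u1A u10]|nA] := pselect (exists2 w, w \in A & (0 < wsize w)%N); last first.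
  move: wA; rewrite inE => /orP[/eqP we|wA]; last by case: nA; exists w.
  exists w; split; rewrite ?we ?mem_head// -?we// => v; rewrite inE => /orP[/eqP->|vA]; first by rewrite we mulnC.
  have : wsize v = 0%N by apply/eqP; rewrite -leqn0 leqNgt; apply/negP => v0; apply: nA; exists v.
  by rewrite /wsize => /eqP; rewrite addn_eq0 => /andP[/eqP-> /eqP->].
have [v0 [v0A v00 hv]] := IH (ex_intro2 _ _ u1 u1A u10).
have [h|h] := leqP (u.1 * v0.2) (u.2 * v0.1).
  by exists v0; split; rewrite ?inE ?v0A ?orbT// => v; rewrite inE => /orP[/eqP->//|/hv].
exists u; split; rewrite ?mem_head//.
  by rewrite lt0n; apply: contraTneq h => /eqP; rewrite /wsize addn_eq0 => /andP[/eqP-> /eqP->].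
move=> v; rewrite inE => /orP[/eqP->|/hv hv']; first by rewrite mulnC.
rewrite leqNgt; apply/negP => lt; move: v00 h hv' lt; rewrite /wsize.
case: u v0 v {wA w0 hv v0A u1A u10 IH w u1} => [a b] [c d] [e f] /= h1 h2 h3 h4.
exact: slope_trans h1 h2 h3 h4.
Qed.

Lemma primitive_ray (A : seq (nat * nat)) : (exists2 w, w \in A & (0 < wsize w)%N) ->
  exists b k, [/\ coprime b.1 b.2, (0 < k)%N, ((k * b.1)%N, (k * b.2)%N) \in A &
    forall w, w \in A -> (w.1 * b.2 <= w.2 * b.1)%N].
Proof.
move=> /lowest_vector[[x z] [wA w0 h]]; pose g := gcdn x z.
have g0 : (0 < g)%N by rewrite gcdn_gt0; move: w0; rewrite /wsize addn_gt0.
exists ((x %/ g)%N, (z %/ g)%N), g; split => //=.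
- rewrite /coprime -(eqn_pmul2l g0) muln1 muln_gcdr.
  by rewrite !(mulnC g) !divnK ?dvdn_gcdl ?dvdn_gcdr.
- by rewrite !(mulnC g) !divnK ?dvdn_gcdl ?dvdn_gcdr.
- move=> w /h /= hw; rewrite -(leq_pmul2r g0) -!mulnA !divnK ?dvdn_gcdl ?dvdn_gcdr//.
Qed.

(** * The toric chart *)

Section Cone.
Variables (A : seq (nat * nat)) (bX bZ : nat * nat) (D : nat).
Hypothesis hc : cone A bX bZ D.

(** The exponent of s in the chart is det(w, bZ) and that of t is det(bX, w), so each vanishes on
    one extremal ray. *)
Definition cZ w := height (flipn bZ) (flipn w).
Definition cX w := height bX w.
Definition chart w : nat * nat := (cZ w, cX w).

Lemma cXE w : w \in A -> (cX w + w.1 * bX.2 = w.2 * bX.1)%N.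
Proof. by move=> wA; rewrite subnK// (coneAX hc). Qed.
Lemma cZE w : w \in A -> (cZ w + w.2 * bZ.1 = w.1 * bZ.2)%N.
Proof. by move=> wA; rewrite /cZ /height /= subnK// (coneAZ hc). Qed.

Lemma cramer_arith (d x z b1 b2 e1 e2 u v : nat) : (d + b2 * e1 = b1 * e2 -> u + x * b2 = z * b1 -> v + z * e1 = x * e2 ->
  d * x = v * b1 + u * e1 /\ d * z = v * b2 + u * e2)%N.
Proof.
move=> h1 h2 h3.
have H1 : d%:Z = b1%:Z * e2%:Z - b2%:Z * e1%:Z by rewrite -!PoszM -h1 PoszD addrK.
have H2 : u%:Z = z%:Z * b1%:Z - x%:Z * b2%:Z by rewrite -!PoszM -h2 PoszD addrK.
have H3 : v%:Z = x%:Z * e2%:Z - z%:Z * e1%:Z by rewrite -!PoszM -h3 PoszD addrK.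
by split; apply/eqP; rewrite -eqz_nat PoszD !PoszM H1 H2 H3; apply/eqP; ring.
Qed.

Lemma cone_cramer w : w \in A ->
  (D * w.1 = cZ w * bX.1 + cX w * bZ.1 /\ D * w.2 = cZ w * bX.2 + cX w * bZ.2)%N.
Proof. by move=> wA; apply: cramer_arith (coneDE hc) (cXE wA) (cZE wA). Qed.

Lemma chart_det w v : w \in A -> v \in A ->
  (cZ w)%:Z * (cX v)%:Z - (cX w)%:Z * (cZ v)%:Z = D%:Z * detw w v.
Proof.
move=> wA vA; have H1 : D%:Z = bX.1%:Z * bZ.2%:Z - bX.2%:Z * bZ.1%:Z by rewrite -!PoszM -(coneDE hc) PoszD addrK.
have Xx u : u \in A -> (cX u)%:Z = u.2%:Z * bX.1%:Z - u.1%:Z * bX.2%:Z.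
  by move=> uA; rewrite -!PoszM -(cXE uA) PoszD addrK.
have Zz u : u \in A -> (cZ u)%:Z = u.1%:Z * bZ.2%:Z - u.2%:Z * bZ.1%:Z.
  by move=> uA; rewrite -!PoszM -(cZE uA) PoszD addrK.
by rewrite H1 !Xx// !Zz// /detw; ring.
Qed.

Lemma dvd_cZ a : (D %| a * bX.1 -> D %| a * bX.2 -> D %| a)%N.
Proof.
move=> h1 h2; have : (D %| gcdn (a * bX.1) (a * bX.2))%N by rewrite dvdn_gcd h1.
by rewrite -muln_gcdr (eqP (coneX hc)) muln1.
Qed.

(** As [bX] is primitive, the exponents sent to the s-axis are its multiples, and they land on
    multiples of [D]. Hence the chart map restricted to this axis is a polynomial in s^D. *)
Lemma chart_ray w i : w \in A ->
  (chart w == (i, 0%N)) = (D %| i)%N && (w == ((i %/ D * bX.1)%N, (i %/ D * bX.2)%N)).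
Proof.
move=> wA; have [c1 c2] := cone_cramer wA; have D0 := coneD hc.
apply/eqP/andP => [[ci cx]|[Di /eqP wE]].
  rewrite cx ci !mul0n !addn0 in c1 c2.
  have Di : (D %| i)%N by apply: dvd_cZ; rewrite -?c1 -?c2 dvdn_mulr.
  split => //; apply/eqP; rewrite (surjective_pairing w); congr (_, _); apply/eqP.
    by rewrite -(eqn_pmul2l D0) c1 mulnA [(D * _)%N]mulnC divnK.
  by rewrite -(eqn_pmul2l D0) c2 mulnA [(D * _)%N]mulnC divnK.
have x0 : cX w = 0%N by rewrite /cX /height wE /= mulnAC subnn.
have z0 : cZ w = i.
  rewrite /cZ /height wE /= -!mulnA -mulnBr -(coneDE hc) addnK.
  by rewrite divnK.
by rewrite /chart x0 z0.
Qed.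

(** The images of exponents span a lattice whose points on the first axis are multiples of [D],
    because [bX] is primitive. Sums of two exponents are what occurs in the Jacobian. *)
Lemma chart_congr w v w' v' : w \in A -> v \in A -> w' \in A -> v' \in A ->
  (cX w + cX v = cX w' + cX v' -> cZ w + cZ v = cZ w' + cZ v' %[mod D])%N.
Proof.
move=> wA vA wA' vA' e.
wlog le : w v w' v' wA vA wA' vA' e / (cZ w' + cZ v' <= cZ w + cZ v)%N.
  move=> H; have [h|h] := leqP (cZ w' + cZ v') (cZ w + cZ v); first exact: H.
  by apply/esym/H => //; exact: ltnW.
apply/eqP; rewrite eqn_mod_dvd//.
have [a1 a2] := cone_cramer wA; have [b1 b2] := cone_cramer vA.
have [c1 c2] := cone_cramer wA'; have [d1 d2] := cone_cramer vA'.
have s1 : (D * (w.1 + v.1) = (cZ w + cZ v) * bX.1 + (cX w + cX v) * bZ.1)%N by rewrite mulnDr a1 b1; ring.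
have s2 : (D * (w.2 + v.2) = (cZ w + cZ v) * bX.2 + (cX w + cX v) * bZ.2)%N by rewrite mulnDr a2 b2; ring.
have s3 : (D * (w'.1 + v'.1) = (cZ w' + cZ v') * bX.1 + (cX w + cX v) * bZ.1)%N by rewrite mulnDr c1 d1 e; ring.
have s4 : (D * (w'.2 + v'.2) = (cZ w' + cZ v') * bX.2 + (cX w + cX v) * bZ.2)%N by rewrite mulnDr c2 d2 e; ring.
apply: dvd_cZ; rewrite mulnBl.
  by rewrite -(subnDr ((cX w + cX v) * bZ.1)) -s1 -s3 -mulnBr dvdn_mulr.
by rewrite -(subnDr ((cX w + cX v) * bZ.2)) -s2 -s4 -mulnBr dvdn_mulr.
Qed.

Lemma cZ_bound w : w \in A -> (cZ w * wsize bX <= D * wsize w)%N.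
Proof.
move=> /cone_cramer[c1 c2]; rewrite /wsize !mulnDr c1 c2.
by apply: leq_add; rewrite leq_addr.
Qed.

Variable R : realType.
Local Notation C := (R[i]).
Local Notation poly2 := {poly {poly C}}.

Definition lifts (st x : C * C) := forall w, w \in A -> mon (chart w) st = mon w x.

(** s and t are monomials in D-th roots of the coordinates of [x]; by [cone_cramer] a monomial of
    the chart has exponent D w in these roots. *)
Lemma lift_exists x : torus x -> exists st, torus st /\ lifts st x.
Proof.
case: x => x z [/= x0 z0]; have D0 := coneD hc.
pose r := D.-root x; pose q := D.-root z.
have rE : r ^+ D = x by rewrite /r rootCK.
have qE : q ^+ D = z by rewrite /q rootCK.
have r0 : r != 0 by apply: contraNneq x0 => h; rewrite -rE h expr0n gtn_eqF.
have q0 : q != 0 by apply: contraNneq z0 => h; rewrite -qE h expr0n gtn_eqF.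
exists (r ^+ bX.1 * q ^+ bX.2, r ^+ bZ.1 * q ^+ bZ.2); split.
  by split => /=; rewrite mulf_neq0// expf_neq0.
move=> w /cone_cramer[c1 c2]; rewrite /mon /= !exprMn -!exprM mulrACA -!exprD.
by rewrite (mulnC bX.1) (mulnC bX.2) (mulnC bZ.1) (mulnC bZ.2) -c1 -c2 !exprM rE qE.
Qed.

Lemma project_exists st : torus st -> exists x, torus x /\ lifts st x.
Proof.
case: st => s t [/= s0 t0]; exists (s ^+ bZ.2 / t ^+ bX.2, t ^+ bX.1 / s ^+ bZ.1); split.
  by split => /=; rewrite mulf_neq0// ?invr_eq0 expf_neq0.
move=> w wA; rewrite /mon /= !expr_div_n mulf_div -!exprM; apply/esym/eqP.
rewrite -[X in _ == X]divr1 eqr_div ?mulf_neq0 ?expf_neq0 ?oner_neq0// mulr1.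
rewrite (mulnC bZ.2) (mulnC bX.1) -cZE// -cXE// !exprD (mulnC bX.2) (mulnC bZ.1).
by apply/eqP; ring.
Qed.

(* P in the chart: Gmap P evaluated at (s, t) is P evaluated at any x lifting (s, t) *)
Definition Gmap (P : poly2) : poly2 := \sum_(w <- suppl P) (coef2 P w)%:P%:P * Xm R (chart w).

Lemma peval_Gmap P st x : {subset suppl P <= A} -> lifts st x -> peval (Gmap P) st = peval P x.
Proof.
move=> PA h; rewrite /Gmap peval_sum [RHS]peval_suppl; apply: eq_big_seq => w wP.
by rewrite pevalM pevalC peval_Xm h// PA.
Qed.

(** The part of [P] on the ray of [b], as a polynomial in x^b; for nonzero [b] the index cannot
    exceed [tdeg P]. *)
Definition ray_poly (b : nat * nat) (P : poly2) : {poly C} :=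
  \poly_(k < (tdeg P).+1) coef2 P ((k * b.1)%N, (k * b.2)%N).

Lemma coef_ray_poly b P k : (0 < wsize b)%N -> (ray_poly b P)`_k = coef2 P ((k * b.1)%N, (k * b.2)%N).
Proof.
move=> b0; rewrite coef_poly; case: ltnP => // lt; apply/esym/eqP; apply: contraTT lt.
rewrite -mem_suppl => /tdegP /=; rewrite -mulnDr -leqNgt; apply: leq_trans.
by rewrite leq_pmulr.
Qed.

Lemma wsizeX : (0 < wsize bX)%N.
Proof.
rewrite lt0n; apply/eqP => /eqP; rewrite /wsize addn_eq0 => /andP[/eqP h1 /eqP h2].
by have := coneX hc; rewrite h1 h2.
Qed.

Lemma axX_Gmap P : {subset suppl P <= A} -> axX (Gmap P) = ray_poly bX P \Po 'X^D.
Proof.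
move=> PA; apply/polyP => i; rewrite coef_comp_poly_Xn ?(coneD hc)//.
have -> : (axX (Gmap P))`_i = coef2 (Gmap P) (i, 0%N) by rewrite coef_map /= /horner_eval horner_coef0.
rewrite /Gmap coef2_sum.
transitivity (\sum_(w <- suppl P) coef2 P w * ((D %| i)%N && (w == ((i %/ D * bX.1)%N, (i %/ D * bX.2)%N)))%:R).
  by apply: eq_big_seq => w wP; rewrite coef2Cmul coef2_Xm eq_sym chart_ray// PA.
case: (D %| i)%N => /=; last by rewrite big1// => w _; rewrite mulr0.
rewrite coef_ray_poly ?wsizeX//; set v := (_, _).
have [vP|vP] := boolP (v \in suppl P).
  rewrite (bigD1_seq v) ?suppl_uniq//= eqxx mulr1 big1 ?addr0// => w /negbTE->.
  by rewrite mulr0.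
rewrite big_seq big1 => [|w wP].
  by apply/esym/eqP; move: vP; rewrite mem_suppl negbK.
case: eqP => [e|_]; last by rewrite mulr0.
  by rewrite -e wP in vP.
Qed.
End Cone.

Lemma poly_residue (K : idomainType) (p : {poly K}) D r : (r < D)%N ->
  (forall i, p`_i != 0 -> (i %% D = r)%N) ->
  p = 'X^r * ((\poly_(j < size p) p`_(r + j * D)) \Po 'X^D).
Proof.
move=> rD h; have D0 : (0 < D)%N by exact: leq_ltn_trans rD.
apply/polyP => i; rewrite coefXnM coef_comp_poly_Xn//.
have [pi0|pi0] := eqVneq p`_i 0; last first.
  have ri : (r <= i)%N by rewrite -(h i pi0) leq_mod.
  have Di : (D %| i - r)%N by rewrite -eqn_mod_dvd// (h i pi0) modn_small.
  rewrite ltnNge ri Di coef_poly divnK// subnKC//; case: ltnP => // le.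
  rewrite nth_default//; apply: leq_trans le (leq_trans (leq_div _ _) (leq_subr _ _)).
rewrite pi0; case: ltnP => // ri; case: (boolP (D %| i - r)%N) => // Di.
by rewrite coef_poly divnK// subnKC// pi0 if_same.
Qed.

(** * The Jacobian in the chart and its zeros on the axes *)

Section ChartJacobian.
Variable R : realType.
Local Notation C := (R[i]).
Local Notation poly2 := {poly {poly C}}.
Implicit Types (P Q : poly2).

Lemma swapXY_term (c : C) i : swapXY (c%:P%:P * Xm R i) = c%:P%:P * Xm R (flipn i).
Proof.
apply: eq_coef2 => -[a b]; rewrite coef2_swapXY !coef2Cmul !coef2_Xm; case: i => i j.
by rewrite /flipn /= !xpair_eqE andbC.
Qed.

Lemma swapXY_Gmap bX bZ P : swapXY (Gmap bX bZ P) = Gmap (flipn bZ) (flipn bX) (swapXY P).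
Proof.
rewrite /Gmap rmorph_sum /= [RHS](perm_big (map flipn (suppl P))) /=.
  rewrite big_map; apply: eq_bigr => w _; rewrite swapXY_term coef2_swapXY /=.
  by rewrite /chart /cX /cZ !flipnK -surjective_pairing.
apply: uniq_perm; first exact: suppl_uniq.
  by rewrite map_inj_uniq ?suppl_uniq//; apply: can_inj flipnK.
move=> w; rewrite mem_suppl coef2_swapXY -/(flipn w) -mem_suppl.
by apply/idP/mapP => [h|[v vP ->]]; [exists (flipn w); rewrite ?flipnK|rewrite flipnK].
Qed.

Lemma pd1_sum (I : eqType) (r : seq I) (c : I -> C) (e : I -> nat * nat) :
  'X * pd1 (\sum_(w <- r) (c w)%:P%:P * Xm R (e w)) = \sum_(w <- r) (((e w).1)%:R * c w)%:P%:P * Xm R (e w).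
Proof.
rewrite /pd1 raddf_sum mulr_sumr; apply: eq_bigr => w _; case: (e w) => i j /=.
apply: eq_coef2 => -[a b]; rewrite coef2Cmul coef2_Xm {1}/coef2 /= coefXM; case: a => [|a] /=.
  by rewrite coef0 xpair_eqE; case: i => [|i]; rewrite ?mul0r// mulr0.
rewrite coef_deriv coefMn -[_`_b]/(coef2 ((c w)%:P%:P * Xm R (i, j)) (a.+1, b)) coef2Cmul coef2_Xm.
rewrite xpair_eqE; case: eqP => [<-|_] /=; last by rewrite !mulr0 mul0rn.
by rewrite -[LHS]mulr_natl mulrA.
Qed.

Lemma pd2_sum (I : eqType) (r : seq I) (c : I -> C) (e : I -> nat * nat) :
  'X%:P * pd2 (\sum_(w <- r) (c w)%:P%:P * Xm R (e w)) = \sum_(w <- r) (((e w).2)%:R * c w)%:P%:P * Xm R (e w).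
Proof.
apply: (can_inj (@swapXYK _)); rewrite rmorphM /= swapXY_polyC map_polyX -pd1_swapXY !rmorph_sum /=.
rewrite (eq_bigr (fun w => (c w)%:P%:P * Xm R (flipn (e w)))) => [|w _]; last exact: swapXY_term.
by rewrite pd1_sum; apply: eq_bigr => w _; rewrite swapXY_term.
Qed.

Lemma term_mul (a b : C) i j : a%:P%:P * Xm R i * (b%:P%:P * Xm R j) = (a * b)%:P%:P * Xm R (wadd i j).
Proof. by rewrite mulrACA -XmD !polyCM. Qed.

Lemma peval_term (c : C) i z : peval (c%:P%:P * Xm R i) z = c * mon i z.
Proof. by rewrite pevalM pevalC peval_Xm. Qed.

Lemma logjac_sum (I : eqType) (r r' : seq I) (c c' : I -> C) (e : I -> nat * nat)
    (G1 := \sum_(w <- r) (c w)%:P%:P * Xm R (e w)) (G2 := \sum_(w <- r') (c' w)%:P%:P * Xm R (e w)) :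
  Xm R (1%N, 1%N) * jacdet (G1, G2) = \sum_(w <- r) \sum_(v <- r')
   ((((e w).1)%:Z * ((e v).2)%:Z - ((e w).2)%:Z * ((e v).1)%:Z)%:~R * (c w * c' v))%:P%:P * Xm R (wadd (e w) (e v)).
Proof.
have -> : Xm R (1%N, 1%N) * jacdet (G1, G2) = ('X * pd1 G1) * ('X%:P * pd2 G2) - ('X%:P * pd2 G1) * ('X * pd1 G2).
  rewrite /jacdet [(_, _).1]/= [(_, _).2]/= /Xm !expr1.
  by move: (pd1 G1) (pd2 G1) (pd1 G2) (pd2 G2) ('X) ('X%:P) => *; ring.
rewrite !pd1_sum !pd2_sum !mulr_suml -sumrB; apply: eq_bigr => w _.
rewrite !mulr_sumr -sumrB; apply: eq_bigr => v _.
rewrite !term_mul -mulrBl -!polyCB; congr (_%:P%:P * _).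
by rewrite rmorphB !rmorphM /= -!pmulrn; ring.
Qed.

Variables (A : seq (nat * nat)) (bX bZ : nat * nat) (D : nat).
Hypothesis hc : cone A bX bZ D.
Variables (P Q : poly2).
Hypothesis PA : {subset suppl P <= A}.
Hypothesis QA : {subset suppl Q <= A}.
Let G1 := Gmap bX bZ P.
Let G2 := Gmap bX bZ Q.

Lemma chart_jacdet_neq0 : jacdet (P, Q) != 0 -> jacdet (G1, G2) != 0.
Proof.
apply: contraNneq => h; have X0 : Xm R (1%N, 1%N) != 0.
  by apply/eqP => e; have := coef2_Xm R (1%N, 1%N) (1%N, 1%N); rewrite e coef20 eqxx => /esym/eqP; rewrite oner_eq0.
suff : Xm R (1%N, 1%N) * jacdet (P, Q) = 0 by move=> /eqP; rewrite mulf_eq0 (negbTE X0).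
apply: peval_torus0 => x tx; have [st [tst lst]] := lift_exists hc tx.
have := congr1 (fun T : poly2 => peval T st) (logjac_sum (suppl P) (suppl Q) (coef2 P) (coef2 Q) (chart bX bZ)).
rewrite -/G1 -/G2 [X in _ * X]h mulr0 peval0.
have -> : peval (\sum_(w <- suppl P) \sum_(v <- suppl Q) ((((chart bX bZ w).1)%:Z * ((chart bX bZ v).2)%:Z - ((chart bX bZ w).2)%:Z * ((chart bX bZ v).1)%:Z)%:~R * (coef2 P w * coef2 Q v))%:P%:P * Xm R (wadd (chart bX bZ w) (chart bX bZ v))) st
   = D%:R * peval (logjac P Q) x.
  rewrite peval_sum /logjac peval_sum mulr_sumr; apply: eq_big_seq => w wP.
  rewrite !peval_sum mulr_sumr; apply: eq_big_seq => v vQ.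
  have E : ((chart bX bZ w).1)%:Z * ((chart bX bZ v).2)%:Z - ((chart bX bZ w).2)%:Z * ((chart bX bZ v).1)%:Z = D%:Z * detw w v.
    exact: (chart_det hc (PA wP) (QA vQ)).
  rewrite E !peval_term !monD (lst w (PA wP)) (lst v (QA vQ)) intrM -pmulrn; ring.
move=> /esym/eqP; rewrite mulf_eq0 pnatr_eq0 (gtn_eqF (coneD hc)) /= => /eqP.
by rewrite -(logjac_jacdet (P, Q)).
Qed.

Lemma chart_jacdet_supp i : coef2 (Xm R (1%N, 1%N) * jacdet (G1, G2)) i != 0 ->
  exists w v, [/\ w \in suppl P, v \in suppl Q & i = wadd (chart bX bZ w) (chart bX bZ v)].
Proof.
rewrite /G1 /G2 logjac_sum coef2_sum => h; apply: contrapT => nh; move/eqP: h; apply.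
rewrite big_seq big1// => w wP; rewrite coef2_sum big_seq big1// => v vQ.
rewrite coef2Cmul coef2_Xm; case: eqP => [e|]; last by rewrite mulr0.
by case: nh; exists w, v.
Qed.

Lemma factor_Xm (J : poly2) : J != 0 -> exists l k Jh, [/\ J = Xm R (l, k) * Jh, axX Jh != 0 & axZ Jh != 0].
Proof.
move=> J0; have [l [T [T0 JE]]] := poly_lowX J0.
have sT0 : swapXY T != 0.
  by apply: contraNneq T0 => h; rewrite -(swapXYK T) h rmorph0 coef0.
have [k [T' [T'0 TE]]] := poly_lowX sT0.
have TE' : T = ('X^k)%:P * swapXY T'.
  by rewrite -(swapXYK T) TE rmorphM rmorphXn /= swapXY_X rmorphXn.
exists l, k, (swapXY T'); split.
- by rewrite JE TE' /Xm /= mulrCA mulrA.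
- by rewrite -coef0_swapXY swapXYK.
- rewrite /axZ -coef0_swapXY !swapXYK; apply: contraNneq T0 => h.
  by rewrite TE' coefCM h mulr0.
Qed.

(** t^k divides the Jacobian, whose degree in t is at most the sum of the degrees of G1 and G2 in t,
    less 1 for the derivation. *)
Lemma jacdet_order l k Jh : jacdet (G1, G2) = Xm R (l, k) * Jh -> Jh != 0 ->
  (k.+1 <= (size (swapXY G1)).-1 + (size (swapXY G2)).-1)%N.
Proof.
move=> hJ J0; set U := swapXY G1; set V := swapXY G2.
have E : jacdet (U, V) = 'X^k * (- (('X^l)%:P * swapXY Jh)).
  by rewrite jacdet_swapXY hJ rmorphM /= swapXY_Xm /Xm /= mulrN [_%:P * _]mulrC mulrA.
have n0 : - (('X^l)%:P * swapXY Jh) != 0.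
  rewrite oppr_eq0 mulf_neq0 ?polyC_eq0 ?expf_neq0 ?polyX_eq0//.
  by apply: contraNneq J0 => h; rewrite -(swapXYK Jh) h rmorph0.
have s1 : (k < size (jacdet (U, V)))%N.
  rewrite E mulrC size_mulXn// -[X in (X < _)%N]addn0 -addnS leq_add2l size_poly_gt0.
  exact: n0.
apply: leq_trans s1 _; rewrite /jacdet [(_, _).1]/= [(_, _).2]/=.
have d1 (W : poly2) : (size (pd1 W) <= (size W).-1)%N by rewrite /pd1; exact: size_poly.
have d2 (W : poly2) : (size (pd2 W) <= size W)%N by rewrite /pd2; exact: size_poly.
have m (a b : poly2) (x y : poly2) : (size a <= (size x).-1)%N -> (size b <= size y)%N ->
    (size (a * b)%R <= (size x).-1 + (size y).-1)%N.
  move=> ha hb; apply: leq_trans (size_polyMleq _ _) _.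
  by clear - ha hb; lia.
apply: leq_trans (size_polyD _ _) _; rewrite size_polyN geq_max; apply/andP; split.
  exact: m.
by rewrite mulrC addnC; apply: m.
Qed.

(* the zeros s of Jh on the axis come in full orbits of the D-th roots of unity *)
Lemma bad_count l k Jh (E : seq (C * C)) d1 d2 : jacdet (G1, G2) = Xm R (l, k) * Jh -> axX Jh != 0 ->
  (tdeg P <= d1)%N -> (tdeg Q <= d2)%N -> uniq E ->
  (forall y, y \in E -> exists s, [/\ s != 0, peval G1 (s, 0) = y.1, peval G2 (s, 0) = y.2 & peval Jh (s, 0) = 0]) ->
  ((size E * D + l.+1) * wsize bX <= D * (d1 + d2))%N.
Proof.
move=> hJ Jp0 hd1 hd2 uE hE; set Jp := axX Jh in Jp0.
have D0 := coneD hc.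
have supp i : Jp`_i != 0 -> exists w v, [/\ w \in A, v \in A, (wsize w <= d1)%N, (wsize v <= d2)%N &
    (i + l.+1 = cZ bZ w + cZ bZ v)%N /\ (k.+1 = cX bX w + cX bX v)%N].
  move=> h; have : coef2 (Xm R (1%N, 1%N) * jacdet (G1, G2)) ((l.+1 + i)%N, k.+1) != 0.
    have -> : Xm R (1%N, 1%N) * jacdet (G1, G2) = Xm R (l.+1, k.+1) * Jh by rewrite hJ mulrA -XmD.
    have := coef2_XmMD (l.+1, k.+1) Jh (i, 0%N); rewrite /wadd /= addn0 => ->.
    by move: h; rewrite /Jp /axX coef_map /= /horner_eval horner_coef0.
  move=> /chart_jacdet_supp[w [v [wP vQ [e1 e2]]]]; exists w, v.
  rewrite PA// QA// addnC e1 e2; split => //.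
    exact: leq_trans (tdegP wP) hd1.
  exact: leq_trans (tdegP vQ) hd2.
have lead : Jp`_(adeg Jp) != 0 by rewrite /adeg -lead_coefE lead_coef_eq0.
have [w [v [wA vA w1 v1 [e1 e2]]]] := supp _ lead.
(* By [chart_congr] all exponents of [Jp] are congruent modulo [D], so Jp = s^r T(s^D); distinct [y]
   give distinct roots s^D of [T]. *)
pose r := (adeg Jp %% D)%N.
pose T : {poly C} := \poly_(j < size Jp) Jp`_(r + j * D).
have congr i : Jp`_i != 0 -> (i %% D = r)%N.
  move=> /supp[w' [v' [wA' vA' _ _ [f1 f2]]]].
  have := chart_congr hc wA' vA' wA vA; rewrite -f2 -e2 -f1 -e1 => /(_ erefl) /eqP.
  by rewrite eqn_modDr => /eqP.
have JpE s : Jp.[s] = s ^+ r * T.[s ^+ D].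
  have rD : (r < D)%N by rewrite ltn_mod.
  by rewrite {1}(poly_residue rD congr) hornerM hornerXn horner_comp hornerXn.
have T0 : T != 0.
  apply: contraNneq Jp0 => h; apply/eqP; apply: poly_infinite0 => s.
  by rewrite JpE h horner0 mulr0.
have degT : (adeg T * D <= adeg Jp)%N.
  have : T`_(adeg T) != 0 by rewrite /adeg -lead_coefE lead_coef_eq0.
  rewrite coef_poly; case: ltnP; last by rewrite eqxx.
  move=> _ h; apply: (@leq_trans (r + adeg T * D)); first exact: leq_addl.
  rewrite /adeg -ltnS prednK ?size_poly_gt0// ltnNge; apply: contra h => h.
  by rewrite nth_default.
have [sy hsy] : exists sy : C * C -> C, forall y, y \in E -> [/\ sy y != 0, peval G1 (sy y, 0) = y.1, peval G2 (sy y, 0) = y.2 & peval Jh (sy y, 0) = 0].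
  have h y : exists s, y \in E -> [/\ s != 0, peval G1 (s, 0) = y.1, peval G2 (s, 0) = y.2 & peval Jh (s, 0) = 0].
    by case: (boolP (y \in E)) => [/hE[s hs]|_]; [exists s|exists 0].
  by exists (fun y => sval (cid (h y))) => y; case: cid.
have sE : (size E <= adeg T)%N.
  rewrite -(size_map (fun y => sy y ^+ D)); apply: size_undup_roots => //.
    rewrite map_inj_in_uniq// => y y' yE y'E e.
    have [_ a1 a2 _] := hsy y yE; have [_ b1 b2 _] := hsy y' y'E.
    rewrite (surjective_pairing y) (surjective_pairing y') -a1 -a2 -b1 -b2 -!axXE.
    by rewrite /G1 /G2 !(axX_Gmap hc) // !horner_comp !hornerXn e.
  move=> _ /mapP[y yE ->]; have [s0 _ _ js] := hsy y yE.
  have := JpE (sy y); rewrite /Jp axXE js => /esym/eqP; rewrite mulf_eq0 expf_eq0 (negbTE s0) andbF /=.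
  by move=> /eqP.
apply: (@leq_trans ((cZ bZ w + cZ bZ v) * wsize bX)).
  rewrite leq_mul2r -e1 leq_add2r; apply/orP; right.
  by apply: leq_trans degT; rewrite leq_mul2r sE orbT.
rewrite mulnDl mulnDr; apply: leq_add.
  by apply: leq_trans (cZ_bound hc wA) _; rewrite leq_mul2l w1 orbT.
by apply: leq_trans (cZ_bound hc vA) _; rewrite leq_mul2l v1 orbT.
Qed.
End ChartJacobian.

Lemma uf_push (T U : Type) (F : set_system T) (x : T -> U) : UltraFilter F ->
  UltraFilter (fun S : set U => F (fun t => S (x t))).
Proof.
move=> FU; have PF : ProperFilter (fun S : set U => F (fun t => S (x t))) by exact: (fmap_proper_filter x).
split => // G PG GF; apply/seteqP; split; last exact: GF.
move=> S GS; rewrite /mkset; apply: contrapT => /uf_not h.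
have GnS : G (~` S) by apply: GF.
have [z [z1 z2]] := filter_ex (filterI GS GnS); exact: z2.
Qed.

(** * Points of E_f as limits of values *)

Section Limits.
Variable R : realType.
Local Notation C := (R[i]).
Local Notation poly2 := {poly {poly C}}.
Implicit Types (f : pmap2 R) (y : C * C).

Lemma tdeg_le (P : poly2) n : (forall w, w \in suppl P -> (w.1 + w.2 <= n)%N) -> (tdeg P <= n)%N.
Proof.
move=> h; rewrite /tdeg; apply/bigmax_leqP => i _; apply/bigmax_leqP => j cj.
by apply: (h ((i : nat), (j : nat))); rewrite mem_suppl.
Qed.

Lemma suppl_swapXY (P : poly2) w : (w \in suppl (swapXY P)) = (flipn w \in suppl P).
Proof. by rewrite !mem_suppl coef2_swapXY. Qed.

Lemma tdeg_swapXY (P : poly2) : (tdeg (swapXY P) <= tdeg P)%N.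
Proof. by apply: tdeg_le => w; rewrite suppl_swapXY => /tdegP; rewrite /= addnC. Qed.

Lemma cdist_lt y y' (e : R) : nC (y.1 - y'.1) + nC (y.2 - y'.2) < e -> cdist y y' < e.
Proof. by apply: le_lt_trans; exact: cnorm2_le. Qed.

Lemma image_near f y (T : Type) (F : set_system T) (v : T -> C * C) : UltraFilter F -> in_Ef f y ->
  ulim F (fun t => (v t).1) y.1 -> ulim F (fun t => (v t).2) y.2 -> F (fun t => v t <> y) ->
  exists x : T -> C * C, F (fun t => Defs.fmap f (x t) = v t).
Proof.
move=> FU [_ [e e0 he]] l1 l2 nv.
have h t : exists x, (exists x', Defs.fmap f x' = v t) -> Defs.fmap f x = v t.
  by have [[x hx]|n] := pselect (exists x', Defs.fmap f x' = v t); [exists x|exists (0, 0)].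
exists (fun t => sval (cid (h t))).
have e3 : 0 < e / 3 by rewrite divr_gt0.
apply: filterS3 (l1 _ e3) (l2 _ e3) nv => t; rewrite !mulr1 => h1 h2 h3; case: cid => x /= hx; apply: hx.
by apply: he => //; apply: cdist_lt; lra.
Qed.

Lemma bounded_limit f y (T : Type) (F : set_system T) (x : T -> C * C) : UltraFilter F ->
  ulim F (fun t => peval f.1 (x t)) y.1 -> ulim F (fun t => peval f.2 (x t)) y.2 ->
  lO F (fun t => nC (x t).1) (fun=> 1) -> lO F (fun t => nC (x t).2) (fun=> 1) ->
  exists x0, Defs.fmap f x0 = y.
Proof.
move=> FU l1 l2 /ulim_ex[a la] /ulim_ex[b lb]; exists (a, b).
have e t : x t = ((x t).1, (x t).2) by case: (x t).
have m1 : ulim F (fun t => peval f.1 (x t)) (peval f.1 (a, b)).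
  by apply: ulim_ext (ulim_peval f.1 la lb); apply: ufT => t; rewrite -e.
have m2 : ulim F (fun t => peval f.2 (x t)) (peval f.2 (a, b)).
  by apply: ulim_ext (ulim_peval f.2 la lb); apply: ufT => t; rewrite -e.
by rewrite /Defs.fmap (ulim_uniq m1 l1) (ulim_uniq m2 l2) -surjective_pairing.
Qed.

(** On x2 = 0, either x1 is bounded and [y] is attained at a limit point, or x1 tends to infinity;
    then f1 and f2, having finite limits, are constant on this line and [y] is the value at 0. *)
Lemma axis_absurd f y (T : Type) (F : set_system T) (x : T -> C * C) : UltraFilter F ->
  (forall x0, Defs.fmap f x0 <> y) ->
  ulim F (fun t => peval f.1 (x t)) y.1 -> ulim F (fun t => peval f.2 (x t)) y.2 ->
  F (fun t => (x t).2 = 0) -> False.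
Proof.
move=> FU ny l1 l2 x0.
have b2 : lO F (fun t => nC (x t).2) (fun=> 1).
  by apply: lO_lev; apply: filterS x0 => t ->; rewrite nC0.
have [hx|hx] := @lo_or _ _ F FU (fun=> 1) (fun t => nC (x t).1); last first.
  by have [z /ny] := bounded_limit FU l1 l2 hx b2.
have const (P : poly2) z : ulim F (fun t => peval P (x t)) z -> peval P (0, 0) = z.
  move=> l; have l' : ulim F (fun t => (axX P).[(x t).1]) z.
    by apply: ulim_ext l; apply: filterS x0 => t e; rewrite axXE -e -surjective_pairing.
  have s1 : (size (axX P) <= 1)%N.
    rewrite leqNgt; apply/negP => s1.
    have P0 : axX P != 0 by rewrite -size_poly_gt0 ltnW.
    have d0 : (0 < (size (axX P)).-1)%N by rewrite -subn1 subn_gt0.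
    have h : lo F (fun t => nC (x t).1 ^+ 0) (fun=> 1).
      exact: lo_lO_trans (lo_far hx d0) (lO_trans (degree_lower hx P0) (ulim_lO l')).
    apply: (lo_irr h); first by apply: lO_le => t; rewrite expr0.
    by apply: ufT => t; rewrite expr0.
  rewrite -axXE; rewrite (size1_polyC s1) in l' *; rewrite hornerC.
  by apply: ulim_uniq l'; apply: ulim_ext (ulim_cst _); apply: ufT => t; rewrite hornerC.
by apply: (ny (0, 0)); rewrite /Defs.fmap (const _ _ l1) (const _ _ l2) -surjective_pairing.
Qed.

Lemma torus_limit f y (T : Type) (F : set_system T) (x : T -> C * C) : UltraFilter F ->
  (forall x0, Defs.fmap f x0 <> y) ->
  ulim F (fun t => peval f.1 (x t)) y.1 -> ulim F (fun t => peval f.2 (x t)) y.2 ->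
  F (fun t => torus (x t)).
Proof.
move=> FU ny l1 l2.
have h2 : F (fun t => (x t).2 <> 0).
  by apply: contrapT => /uf_not h; apply: (axis_absurd FU ny l1 l2); apply: filterS h => t /contrapT.
have h1 : F (fun t => (x t).1 <> 0).
  apply: contrapT => /uf_not h; pose f' : pmap2 R := (swapXY f.1, swapXY f.2).
  apply: (@axis_absurd f' y T F (fun t => flip (x t)) FU).
  - by move=> x0 e; apply: (ny (flip x0)); move: e; rewrite /Defs.fmap /= !peval_swapXY.
  - by apply: ulim_ext l1; apply: ufT => t; rewrite /= peval_swapXY /= -surjective_pairing.
  - by apply: ulim_ext l2; apply: ufT => t; rewrite /= peval_swapXY /= -surjective_pairing.
  - by apply: filterS h => t /contrapT.
by apply: filterS2 h1 h2 => t /eqP a /eqP b.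
Qed.

Lemma cdist_flip y y' : cdist (flip y) (flip y') = cdist y y'.
Proof.
rewrite /cdist /cnorm2 /flip /=; congr (Num.sqrt _).
by rewrite -[LHS]addrA addrC addrA.
Qed.

Lemma in_Ef_flip f y : in_Ef f y -> in_Ef (f.2, f.1) (flip y).
Proof.
move=> [h1 [e e0 he]]; split.
  by move=> x [a b]; apply: (h1 x); rewrite /Defs.fmap a b; case: (y).
exists e => // y' d ne; have [||x hx] := he (flip y').
- by rewrite -cdist_flip; case: (y') (y) d => [? ?] [? ?].
- by move=> E; apply: ne; rewrite -E; case: (y').
by exists x; move: hx; rewrite /Defs.fmap /flip => -[-> ->]; case: (y').
Qed.

(* above the line y1 = c, the points of E_f are asymptotic values of f.2 along the curve f.1 = c *)
Lemma line_count f c (E : seq (C * C)) : uniq E -> (forall y, y \in E -> in_Ef f y /\ y.1 = c) ->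
  (size E <= tdeg f.1)%N.
Proof.
move=> uE hE; case: E uE hE => // y0 E' uE hE; set E := y0 :: E' in uE hE *.
pose g := f.1 - c%:P%:P.
have g0 : g != 0.
  apply/eqP => /eqP; rewrite subr_eq0 => /eqP f1.
  have [[FE y01]] := (hE y0 (mem_head _ _), tt) => _.
  have [F [FU hs hn]] := uf_near (0 : C).
  have [|||x hx] := @image_near f y0 C F (fun s => (y0.1 + s, y0.2)) FU FE.
  - have h : ulim F (fun s => y0.1 + s) (y0.1 + 0) by exact: ulimD (ulim_cst _) hs.
    by rewrite addr0 in h.
  - exact: ulim_cst.
  - by apply: filterS hn => s s0 e; apply: s0; have := congr1 fst e => /= /eqP; rewrite -subr_eq0 addrAC subrr add0r => /eqP.
  apply: (@uf_absurd _ F FU); apply: filterS2 hx hn => s [e _] s0; apply: s0.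
  by move: e; rewrite f1 pevalC y01 => /eqP; rewrite -subr_eq0 opprD addrA subrr sub0r oppr_eq0 => /eqP.
have dg : (tdeg g <= tdeg f.1)%N.
  apply: tdeg_le => w; rewrite mem_suppl /g coef2D coef2N [X in _ - X]coef2E coefC.
  case: w => [[|a] [|b]] //=; rewrite ?coefC ?coef0 subr0 => h.
  - by have := @tdegP R f.1 (0%N, b.+1); rewrite mem_suppl; apply.
  - by have := @tdegP R f.1 (a.+1, 0%N); rewrite mem_suppl; apply.
  - by have := @tdegP R f.1 (a.+1, b.+1); rewrite mem_suppl; apply.
have u2 : uniq (map snd E).
  rewrite map_inj_in_uniq// => y y' /hE[_ a] /hE[_ b] e.
  by rewrite (surjective_pairing y) (surjective_pairing y') a b e.
rewrite -(size_map snd); apply: leq_trans dg; apply: (finite_asymptotic_values (phi := f.2) g0 u2) => _ /mapP[y yE ->].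
have [FE y1] := hE y yE; have [F [FU hs hn]] := uf_near (0 : C).
have l2 : ulim F (fun s => y.2 + s) y.2.
  have h : ulim F (fun s => y.2 + s) (y.2 + 0) by exact: ulimD (ulim_cst _) hs.
  by rewrite addr0 in h.
have [|x hx] := @image_near f y C F (fun s => (y.1, y.2 + s)) FU FE (ulim_cst _) l2.
  by apply: filterS hn => s s0 e; apply: s0; have := congr1 snd e => /= /eqP; rewrite -subr_eq0 addrAC subrr add0r => /eqP.
have FU' := uf_push x FU; exists (fun S => F (fun s => S (x s))); split => //.
- by apply: filterS hx => s [e _]; rewrite /g pevalB pevalC e y1 subrr.
- have [//|h] := @lo_or _ _ _ FU' (fun=> 1) (fun z : C * C => nC z.1 + nC z.2); exfalso.
  have m1 : ulim F (fun s => peval f.1 (x s)) y.1 by apply: ulim_ext (ulim_cst _); apply: filterS hx => s [->].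
  have m2 : ulim F (fun s => peval f.2 (x s)) y.2 by apply: ulim_ext l2; apply: filterS hx => s [_ ->].
  have hl : lO F (fun s => nC (x s).1 + nC (x s).2) (fun=> 1) by exact: h.
  have b1 : lO F (fun s => nC (x s).1) (fun=> 1).
    by apply: lO_trans hl; apply: lO_le => s; rewrite lerDl nC_ge0.
  have b2 : lO F (fun s => nC (x s).2) (fun=> 1).
    by apply: lO_trans hl; apply: lO_le => s; rewrite lerDr nC_ge0.
  by have [z /FE.1] := bounded_limit FU m1 m2 b1 b2.
- by apply: ulim_ext l2; apply: filterS hx => s [_ ->].
Qed.

Lemma cone_exists f : dominant f -> torus (Defs.fmap f (0, 0)) -> exists bX bZ D kX kZ,
  [/\ cone (suppl f.1 ++ suppl f.2) bX bZ D, (0 < kX)%N, (0 < kZ)%N,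
      ((kX * bX.1)%N, (kX * bX.2)%N) \in suppl f.1 ++ suppl f.2 &
      ((kZ * bZ.1)%N, (kZ * bZ.2)%N) \in suppl f.1 ++ suppl f.2].
Proof.
move=> df ft; set A := _ ++ _.
have [w1 [w2 [v1 [v2 [hw hv nd]]]]] := dominant_nonparallel df ft.
have [w1A w2A] : w1 \in A /\ w2 \in A.
  by rewrite !mem_cat; case: hw => -[-> ->]; rewrite ?orbT.
have [v1A v2A] : v1 \in A /\ v2 \in A.
  by rewrite !mem_cat; case: hv => -[-> ->]; rewrite ?orbT.
have A0 : exists2 w, w \in A & (0 < wsize w)%N.
  apply: contrapT => n0; have z w : w \in A -> w = (0%N, 0%N).
    move=> wA; have : wsize w = 0%N by apply/eqP; rewrite -leqn0 leqNgt; apply/negP => w0; apply: n0; exists w.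
    by case: w {wA} => a b /eqP; rewrite addn_eq0 => /andP[/= /eqP-> /eqP->].
  by move: nd; rewrite (z _ w1A) (z _ w2A) (z _ v1A) (z _ v2A) eqxx.
have [bX [kX [cX k0 kA hX]]] := primitive_ray A0.
have [|bZ' [kZ [cZ kZ0 kZA hZ']]] := @primitive_ray (map flipn A).
  by have [w wA w0] := A0; exists (flipn w); [exact: map_f|rewrite /wsize addnC].
have hZ w : w \in A -> (w.2 * bZ'.2 <= w.1 * bZ'.1)%N by move=> wA; have := hZ' _ (map_f flipn wA).
have kZA' : ((kZ * bZ'.2)%N, (kZ * bZ'.1)%N) \in A.
  by move: kZA => /mapP[[a b] wA [-> ->]].
have le : (bX.2 * bZ'.2 <= bX.1 * bZ'.1)%N.
  by have := hZ _ kA; rewrite /= -!mulnA leq_pmul2l.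
(* If the extremal rays coincided, all exponents would be parallel, against
   [dominant_nonparallel]. *)
have lt : (bX.2 * bZ'.2 < bX.1 * bZ'.1)%N.
  rewrite ltn_neqAle le andbT; apply: contra nd => /eqP eD.
  have par w : w \in A -> (w.1 * bX.2 = w.2 * bX.1)%N.
    move=> wA; have := hX w wA; have := hZ w wA; move: eD cX cZ; clear.
    case: bX bZ' w => [a b] [d c] [x z] /= eD cX cZ h2 h1; apply/eqP; rewrite eqn_leq h1 /=.
    case: (posnP c) => [c0|c0].
      rewrite c0 muln0 in eD; case: (posnP a) => [->|a0]; first by rewrite muln0.
      have d0 : d = 0%N by move/eqP: eD; rewrite eq_sym muln_eq0 gtn_eqF//= => /eqP.
      by move: cZ; rewrite c0 d0.
    rewrite -(leq_pmul2r c0); have := leq_mul2r a (z * c) (x * d); rewrite h2 orbT => h.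
    by apply: leq_trans (_ : z * c * a <= _)%N; [rewrite mulnAC|apply: leq_trans h _; rewrite -mulnA [(d * a)%N]mulnC -eD mulnA].
  have par2 w w' : w \in A -> w' \in A -> (w.1%:Z - w'.1%:Z) * bX.2%:Z = (w.2%:Z - w'.2%:Z) * bX.1%:Z.
    by move=> wA w'A; rewrite !mulrBl -!PoszM !par.
  have p1 := par2 _ _ w1A w2A; have p2 := par2 _ _ v1A v2A.
  have : bX.1 != 0%N \/ bX.2 != 0%N.
    by case: (bX.1) cX => [|n]; [rewrite /coprime gcd0n => /eqP->; right|left].
  rewrite -subr_eq0; move: p1 p2; move: (_ - _) (_ - _) (_ - _) (_ - _) => a b c d p1 p2.
  case=> nz; [have nz' : bX.1%:Z != 0 by []|have nz' : bX.2%:Z != 0 by []]; apply/eqP; apply: (mulIf nz'); rewrite mul0r.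
    have -> : (d * a - c * b) * bX.1%:Z = d * (a * bX.1%:Z) - (c * bX.1%:Z) * b by ring.
    by rewrite -p1 -p2; ring.
  have -> : (d * a - c * b) * bX.2%:Z = (d * bX.2%:Z) * a - c * (b * bX.2%:Z) by ring.
  by rewrite p1 p2; ring.
exists bX, (flipn bZ'), (bX.1 * bZ'.1 - bX.2 * bZ'.2)%N, kX, kZ; split => //; split => //=.
- by rewrite coprime_sym.
- by rewrite subn_gt0.
- by rewrite subnK// ltnW.
Qed.
End Limits.

(** The excess kx + kz in the bound for the good points is absorbed by the terms kz and kx in those
    for the bad points. As w, v >= 2, each of the four quantities bx D + kz, bz D + kx, D a and D b
    is at most half of D S. *)
Lemma both_sides_total D S w v e bx bz N a b kx kz : (0 < D)%N -> (1 < w)%N -> (1 < v)%N ->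
  ((bx * D + kz) * w <= D * S)%N -> ((bz * D + kx) * v <= D * S)%N ->
  (a * w <= S)%N -> (b * v <= S)%N -> (N * D <= D * (a + b) + kx + kz)%N ->
  (e <= bx + bz + N)%N -> (e <= 2 * S)%N.
Proof.
move=> D0 w2 v2 h1 h2 h3 h4 h5 h6; rewrite -(leq_pmul2l D0).
have g1 : ((bx * D + kz) * 2 <= D * S)%N by apply: leq_trans h1; rewrite leq_mul2l w2 orbT.
have g2 : ((bz * D + kx) * 2 <= D * S)%N by apply: leq_trans h2; rewrite leq_mul2l v2 orbT.
have g3 : (D * (a * 2) <= D * S)%N by rewrite leq_mul2l (leq_trans _ h3) ?orbT// leq_mul2l w2 orbT.
have g4 : (D * (b * 2) <= D * S)%N by rewrite leq_mul2l (leq_trans _ h4) ?orbT// leq_mul2l v2 orbT.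
have g5 : (D * e <= D * (bx + bz + N))%N by rewrite leq_mul2l h6 orbT.
by move: g1 g2 g3 g4 g5 h5; clear; lia.
Qed.

Lemma one_side_total D S w e bx N a kz : (0 < D)%N -> (1 < w)%N ->
  ((bx * D + kz) * w <= D * S)%N -> (a * w <= S)%N -> (N <= a)%N -> (e <= bx + N)%N -> (e <= S)%N.
Proof.
move=> D0 w2 h1 h3 h5 h6; rewrite -(leq_pmul2l D0).
have g1 : ((bx * D + kz) * 2 <= D * S)%N by apply: leq_trans h1; rewrite leq_mul2l w2 orbT.
have g3 : (D * (a * 2) <= D * S)%N by rewrite leq_mul2l (leq_trans _ h3) ?orbT// leq_mul2l w2 orbT.
have g5 : (D * e <= D * (bx + a))%N by rewrite leq_mul2l (leq_trans h6) ?orbT// leq_add2l.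
by move: g1 g3 g5; clear; lia.
Qed.

Section RayPolynomials.
Variable R : realType.
Local Notation C := (R[i]).
Local Notation poly2 := {poly {poly C}}.
Implicit Types (P : poly2) (b : nat * nat).

Lemma ray_poly0 b P : (0 < wsize b)%N -> (ray_poly b P)`_0 = coef2 P (0%N, 0%N).
Proof. by move=> b0; rewrite coef_ray_poly. Qed.

Lemma ray_lead b P : (0 < wsize b)%N -> (1 < size (ray_poly b P))%N ->
  ((adeg (ray_poly b P) * b.1)%N, (adeg (ray_poly b P) * b.2)%N) \in suppl P.
Proof.
move=> b0 s1; rewrite mem_suppl -coef_ray_poly// /adeg -lead_coefE lead_coef_eq0 -size_poly_gt0.
exact: ltnW.
Qed.

Lemma ray_adeg b P : (0 < wsize b)%N -> (adeg (ray_poly b P) * wsize b <= tdeg P)%N.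
Proof.
move=> b0; case: (ltnP 1 (size (ray_poly b P))) => s1.
  by have := tdegP (ray_lead b0 s1); rewrite /wsize mulnDr.
by rewrite /adeg; case: (size _) s1 => [|[|n]].
Qed.

Lemma ray_poly_axis P : ray_poly (1%N, 0%N) P = axX P.
Proof.
apply/polyP => k; rewrite coef_ray_poly// muln1 muln0 coef_map /= /horner_eval horner_coef0.
by [].
Qed.

Lemma comp_shift_neq0 (p : {poly C}) D (c : C) : (0 < D)%N -> ((size p <= 1)%N -> c != p`_0) ->
  p \Po 'X^D - c%:P != 0.
Proof.
move=> D0 h; apply/eqP => /eqP; rewrite subr_eq0 => /eqP e.
have s1 : (size p <= 1)%N.
  have : adeg (p \Po 'X^D) = 0%N by rewrite e /adeg size_polyC; case: (c != 0).
  by rewrite adeg_comp /adeg => /eqP; rewrite muln_eq0 (gtn_eqF D0) orbF -leqn0; case: (size p) => [|[|n]].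
have := h s1; rewrite (size1_polyC s1) comp_polyC in e *.
by rewrite coefC eqxx /=; have /polyC_inj -> := e; rewrite eqxx.
Qed.
End RayPolynomials.

(** * The count in the chart of a generically non-proper map *)

Section Main.
Variable R : realType.
Local Notation C := (R[i]).
Local Notation poly2 := {poly {poly C}}.
Implicit Types (P Q : poly2).
Variable f : pmap2 R.
Hypothesis gnp : generically_non_proper f.
Let A := suppl f.1 ++ suppl f.2.
Variables (bX bZ : nat * nat) (D kX kZ : nat).
Hypothesis hc : cone A bX bZ D.
Hypothesis kX0 : (0 < kX)%N.
Hypothesis kZ0 : (0 < kZ)%N.
Hypothesis kXA : ((kX * bX.1)%N, (kX * bX.2)%N) \in A.
Hypothesis kZA : ((kZ * bZ.1)%N, (kZ * bZ.2)%N) \in A.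

Let G1 : poly2 := Gmap bX bZ f.1.
Let G2 : poly2 := Gmap bX bZ f.2.
Let p1 := ray_poly bX f.1.
Let p2 := ray_poly bX f.2.
Let z1 := ray_poly (flipn bZ) (swapXY f.1).
Let z2 := ray_poly (flipn bZ) (swapXY f.2).
Let c1 := coef2 f.1 (0%N, 0%N).
Let c2 := coef2 f.2 (0%N, 0%N).
(** Here f1 and f2 both have nonconstant terms on both extremal rays, so bounded monomials of either
    one bound s and t. *)
Let tight := [&& (1 < size p1)%N, (1 < size p2)%N, (1 < size z1)%N & (1 < size z2)%N].
(** The s-axis can lie over points of E_f only in this case: on the coordinate ray it carries values
    of [f], and a constant ray polynomial forces y_i = f_i(0). *)
Let aX := [&& (1 < size p1)%N, (1 < size p2)%N & bX != (1%N, 0%N)].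
Let aZ := [&& (1 < size z1)%N, (1 < size z2)%N & flipn bZ != (1%N, 0%N)].

Let D0 : (0 < D)%N. Proof. exact: coneD hc. Qed.
Let hc' := cone_flip hc.
Let bX0 : (0 < wsize bX)%N. Proof. exact: wsizeX hc. Qed.
Let bZ0 : (0 < wsize (flipn bZ))%N. Proof. exact: wsizeX hc'. Qed.
Let sub1 : {subset suppl f.1 <= A}. Proof. by move=> w h; rewrite mem_cat h. Qed.
Let sub2 : {subset suppl f.2 <= A}. Proof. by move=> w h; rewrite mem_cat h orbT. Qed.

Let sub_flip P : {subset suppl P <= A} -> {subset suppl (swapXY P) <= map flipn A}.
Proof. by move=> h w; rewrite suppl_swapXY => /h wA; apply/mapP; exists (flipn w); rewrite ?flipnK. Qed.

Let axXG P : {subset suppl P <= A} -> axX (Gmap bX bZ P) = ray_poly bX P \Po 'X^D.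
Proof. exact: axX_Gmap. Qed.

Let axZG P : {subset suppl P <= A} -> axZ (Gmap bX bZ P) = ray_poly (flipn bZ) (swapXY P) \Po 'X^D.
Proof. by move=> h; rewrite /axZ swapXY_Gmap (axX_Gmap hc') //; exact: sub_flip. Qed.

Let chartX k : ((k * bX.1)%N, (k * bX.2)%N) \in A -> chart bX bZ ((k * bX.1)%N, (k * bX.2)%N) = ((k * D)%N, 0%N).
Proof. by move=> wA; apply/eqP; rewrite (chart_ray hc _ wA) dvdn_mull//= mulnK. Qed.

Let chartZ k : ((k * bZ.1)%N, (k * bZ.2)%N) \in A -> chart bX bZ ((k * bZ.1)%N, (k * bZ.2)%N) = (0%N, (k * D)%N).
Proof.
move=> wA; have wA' := map_f flipn wA.
have : chart (flipn bZ) (flipn bX) (flipn ((k * bZ.1)%N, (k * bZ.2)%N)) == ((k * D)%N, 0%N).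
  by rewrite (chart_ray hc' _ wA') dvdn_mull//= mulnK.
by rewrite /chart xpair_eqE => /andP[/eqP h1 /eqP h2]; congr (_, _); [exact: h2|exact: h1].
Qed.

Let project (T : Type) (F : set_system T) (st : T -> C * C) : Filter F -> F (fun t => torus (st t)) ->
  exists x : T -> C * C, F (fun t => torus (x t) /\ lifts A bX bZ (st t) (x t)).
Proof.
move=> FF ht; have h t : exists x, torus (st t) -> torus x /\ lifts A bX bZ (st t) x.
  by have [/(project_exists hc)[x hx]|n] := pselect (torus (st t)); [exists x|exists (0, 0)].
by exists (fun t => sval (cid (h t))); apply: filterS ht => t ht; case: cid => x /= /(_ ht).
Qed.

Let tame (P Q : poly2) := forall (T : Type) (F : set_system T) (x : T -> C * C), UltraFilter F ->
  F (fun t => torus (x t)) -> lo F (fun=> 1) (fun t => Mx P (x t)) -> lo F (fun=> 1) (fun t => Mx Q (x t)) ->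
  lo F (fun t => nC (peval P (x t))) (fun t => Mx P (x t)) ->
  lo F (fun t => nC (peval Q (x t))) (fun t => Mx Q (x t)) -> False.

Let not_tame : tame f.1 f.2.
Proof.
move=> T F x FU ht h1 _ h3 h4; have [[df _ ft] [n12 _ _]] := gnp.
have [e1 e2] := fcoef_neq0 ft; have FU' := uf_push x FU.
have ne (P : poly2) : coef2 P (0%N, 0%N) != 0 -> P != 0 by apply: contraNneq => ->; rewrite coef20.
apply: (@nondegenerate R f.1 f.2 _ FU' (ne _ e1) (ne _ e2) e1 (dominant_nonparallel df ft) n12 ht _ h3 h4).
exact: (Mx_unbounded_leaves FU' ht (ne _ e1) h1).
Qed.

Let not_tame' : tame f.2 f.1.
Proof. by move=> T F x FU ht h1 h2 h3 h4; apply: (not_tame FU ht h2 h1 h4 h3). Qed.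

(** The ray monomials make the monomials of [P] and [Q] unbounded with [u]. As [P] keeps the value
    y.1, negligibility of Q - y.2 against the monomials of [Q] would contradict [tame]; so |Q - y.2|
    is at least of their size, in particular of size u^mQ. *)
Let steep_core P Q wP wQ mP mQ (T : Type) (F : set_system T) (st : T -> C * C) (u : T -> R) y :
  tame P Q -> {subset suppl P <= A} -> {subset suppl Q <= A} -> wP \in suppl P -> wQ \in suppl Q ->
  (0 < mP)%N -> (0 < mQ)%N -> UltraFilter F -> F (fun t => torus (st t)) ->
  (forall t, 0 <= u t) -> lo F (fun=> 1) u ->
  (forall t, nC (mon (chart bX bZ wP) (st t)) = u t ^+ mP) -> (forall t, nC (mon (chart bX bZ wQ) (st t)) = u t ^+ mQ) ->
  F (fun t => peval (Gmap bX bZ P) (st t) = y.1) ->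
  lO F (fun t => u t ^+ mQ) (fun t => nC (peval (Gmap bX bZ Q) (st t) - y.2)).
Proof.
move=> tPQ PA QA wPP wQQ mP0 mQ0 FU ht u0 hu eP eQ hG.
have [x hx] := project _ ht; have tx : F (fun t => torus (x t)) by apply: filterS hx => t [].
have uP : lO F (fun t => u t ^+ mP) (fun t => Mx P (x t)).
  by apply: lO_lev; apply: filterS hx => t [_ lx]; rewrite -eP lx ?PA// Mx_ge.
have uQ : lO F (fun t => u t ^+ mQ) (fun t => Mx Q (x t)).
  by apply: lO_lev; apply: filterS hx => t [_ lx]; rewrite -eQ lx ?QA// Mx_ge.
have MP : lo F (fun=> 1) (fun t => Mx P (x t)).
  have h := @lo_exp_inv R _ F FU u mP u0 hu mP0; exact: lo_lO_trans h uP.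
have MQ : lo F (fun=> 1) (fun t => Mx Q (x t)).
  have h := @lo_exp_inv R _ F FU u mQ u0 hu mQ0; exact: lo_lO_trans h uQ.
have [h|h] := @lo_or _ _ F FU (fun t => nC (peval (Gmap bX bZ Q) (st t) - y.2)) (fun t => Mx Q (x t)); last exact: lO_trans uQ h.
exfalso; apply: (tPQ T F x FU tx MP MQ).
  apply: lO_lo_trans MP; exists (nC y.1 + 1); first by rewrite ltr_pwDr ?nC_ge0.
  by apply: filterS2 hx hG => t [_ lx] e; rewrite -(peval_Gmap PA lx) e mulr1 lerDl.
have cst : lo F (fun=> nC y.2) (fun t => Mx Q (x t)).
  apply: lO_lo_trans MQ; exists (nC y.2 + 1); first by rewrite ltr_pwDr ?nC_ge0.
  by apply: ufT => t; rewrite mulr1 lerDl.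
apply: lO_lo_trans (lo_add h cst); apply: lO_lev; apply: filterS hx => t [_ lx].
rewrite -(peval_Gmap QA lx); have := nCD (peval (Gmap bX bZ Q) (st t) - y.2) y.2.
by rewrite subrK.
Qed.

Let adeg_gt0 (p : {poly C}) : (1 < size p)%N -> (0 < adeg p)%N.
Proof. by rewrite /adeg -subn1 subn_gt0. Qed.

Let steepX P Q y : tame P Q -> {subset suppl P <= A} -> {subset suppl Q <= A} ->
  (1 < size (ray_poly bX P))%N -> (1 < size (ray_poly bX Q))%N ->
  steep (Gmap bX bZ P) (Gmap bX bZ Q) y (D * adeg (ray_poly bX Q)).
Proof.
move=> tPQ PA QA sP sQ T F a b FU ht la hG; rewrite mulnC.
have lP := ray_lead bX0 sP; have lQ := ray_lead bX0 sQ.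
apply: (steep_core (st := fun t => (a t, b t)) (u := fun t => nC (a t)) tPQ PA QA lP lQ _ _ FU ht _ la _ _ hG
  (mP := (adeg (ray_poly bX P) * D)%N)).
- by rewrite muln_gt0 adeg_gt0.
- by rewrite muln_gt0 adeg_gt0.
- by move=> t; exact: nC_ge0.
- by move=> t; rewrite chartX ?PA// /mon /= expr0 mulr1 nCX.
- by move=> t; rewrite chartX ?QA// /mon /= expr0 mulr1 nCX.
Qed.

Let leadZ P : (1 < size (ray_poly (flipn bZ) (swapXY P)))%N ->
  ((adeg (ray_poly (flipn bZ) (swapXY P)) * bZ.1)%N, (adeg (ray_poly (flipn bZ) (swapXY P)) * bZ.2)%N) \in suppl P.
Proof. by move=> s1; have := ray_lead bZ0 s1; rewrite suppl_swapXY. Qed.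

Let steepZ P Q y : tame P Q -> {subset suppl P <= A} -> {subset suppl Q <= A} ->
  (1 < size (ray_poly (flipn bZ) (swapXY P)))%N -> (1 < size (ray_poly (flipn bZ) (swapXY Q)))%N ->
  steep (swapXY (Gmap bX bZ P)) (swapXY (Gmap bX bZ Q)) y (D * adeg (ray_poly (flipn bZ) (swapXY Q))).
Proof.
move=> tPQ PA QA sP sQ T F a b FU ht la hG; rewrite mulnC.
have lP := leadZ sP; have lQ := leadZ sQ.
have ht' : F (fun t => torus (b t, a t)) by apply: filterS ht => t [].
have hG' : F (fun t => peval (Gmap bX bZ P) (b t, a t) = y.1) by apply: filterS hG => t; rewrite peval_swapXY.
have h : lO F (fun t => nC (a t) ^+ (adeg (ray_poly (flipn bZ) (swapXY Q)) * D))
    (fun t => nC (peval (Gmap bX bZ Q) (b t, a t) - y.2)).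
  apply: (steep_core (st := fun t => (b t, a t)) (u := fun t => nC (a t)) tPQ PA QA lP lQ _ _ FU ht' _ la _ _ hG'
    (mP := (adeg (ray_poly (flipn bZ) (swapXY P)) * D)%N)).
  - by rewrite muln_gt0 adeg_gt0.
  - by rewrite muln_gt0 adeg_gt0.
  - by move=> t; exact: nC_ge0.
  - by move=> t; rewrite chartZ ?PA// /mon /= expr0 mul1r nCX.
  - by move=> t; rewrite chartZ ?QA// /mon /= expr0 mul1r nCX.
by apply: lO_trans h _; apply: lO_le => t; rewrite peval_swapXY.
Qed.

Let main y := in_Ef f y /\ (tight \/ y.1 != c1 /\ y.2 != c2).

Let main_small y : main y -> ~~ tight -> y.1 != c1 /\ y.2 != c2.
Proof. by move=> [_ [->|]]. Qed.

(** In the tight case only (f1, f2) is used: the monomials of f1 and f2 cannot both be unbounded,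
    and either family, when bounded, contains powers of s and of t. Otherwise [monomials_bounded]
    applies. *)
Let main_proper y : main y -> proper_at G1 G2 y.
Proof.
move=> [Ey my] T F a b FU ht l1 l2.
have [x hx] := project _ ht; have tx : F (fun t => torus (x t)) by apply: filterS hx => t [].
have m1 : ulim F (fun t => peval f.1 (x t)) y.1.
  by apply: ulim_ext l1; apply: filterS hx => t [_ lx]; rewrite (peval_Gmap sub1 lx).
have m2 : ulim F (fun t => peval f.2 (x t)) y.2.
  by apply: ulim_ext l2; apply: filterS hx => t [_ lx]; rewrite (peval_Gmap sub2 lx).
have bnd P w : {subset suppl P <= A} -> w \in suppl P -> lO F (fun t => Mx P (x t)) (fun=> 1) ->
    lO F (fun t => nC (mon (chart bX bZ w) (a t, b t))) (fun=> 1).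
  move=> PA wP; apply: lO_trans; apply: lO_lev; apply: filterS hx => t [_ lx].
  by rewrite lx ?PA// Mx_ge.
have root (u : T -> C) k : (0 < k)%N -> lO F (fun t => nC (u t) ^+ k) (fun=> 1) -> lO F (fun t => nC (u t)) (fun=> 1).
  move=> k0 h; apply: (lO_root k0) => [t|t|]; rewrite ?nC_ge0//.
  by apply: lO_trans h _; apply: lO_le => t; rewrite expr1n.
have aB P k : {subset suppl P <= A} -> (0 < k)%N -> ((k * bX.1)%N, (k * bX.2)%N) \in suppl P ->
    lO F (fun t => Mx P (x t)) (fun=> 1) -> lO F (fun t => nC (a t)) (fun=> 1).
  move=> PA k0 kP hM; apply: (root a (k * D)%N); first by rewrite muln_gt0 k0.
  apply: lO_trans (bnd P _ PA kP hM); apply: lO_le => t.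
  by rewrite chartX ?PA// /mon /= expr0 mulr1 nCX.
have bB P k : {subset suppl P <= A} -> (0 < k)%N -> ((k * bZ.1)%N, (k * bZ.2)%N) \in suppl P ->
    lO F (fun t => Mx P (x t)) (fun=> 1) -> lO F (fun t => nC (b t)) (fun=> 1).
  move=> PA k0 kP hM; apply: (root b (k * D)%N); first by rewrite muln_gt0 k0.
  apply: lO_trans (bnd P _ PA kP hM); apply: lO_le => t.
  by rewrite chartZ ?PA// /mon /= expr0 mul1r nCX.
case: my => [/and4P[s1 s2 s3 s4]|[n1 n2]].
  have [h1|h1] := @lo_or _ _ F FU (fun=> 1) (fun t => Mx f.1 (x t)); last first.
    by split; [apply: aB (ray_lead bX0 s1) h1|apply: bB (leadZ s3) h1]; rewrite ?adeg_gt0.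
  have [h2|h2] := @lo_or _ _ F FU (fun=> 1) (fun t => Mx f.2 (x t)); last first.
    by split; [apply: aB (ray_lead bX0 s2) h2|apply: bB (leadZ s4) h2]; rewrite ?adeg_gt0.
  exfalso; apply: (not_tame FU tx h1 h2).
    exact: lO_lo_trans (ulim_lO m1) h1.
  exact: lO_lo_trans (ulim_lO m2) h2.
have [h1 h2] := @monomials_bounded R f _ y (uf_push x FU) gnp tx m1 m2 n1 n2.
split.
  move: kXA; rewrite mem_cat => /orP[h|h]; first exact: (aB _ _ sub1 kX0 h h1).
  exact: (aB _ _ sub2 kX0 h h2).
move: kZA; rewrite mem_cat => /orP[h|h]; first exact: (bB _ _ sub1 kZ0 h h1).
exact: (bB _ _ sub2 kZ0 h h2).
Qed.

Let main_lift y : main y -> liftable G1 G2 y.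
Proof.
move=> [Ey _] T F v FU l1 l2 nv; have [x hx] := image_near FU Ey l1 l2 nv.
have m1 : ulim F (fun t => peval f.1 (x t)) y.1 by apply: ulim_ext l1; apply: filterS hx => t <-.
have m2 : ulim F (fun t => peval f.2 (x t)) y.2 by apply: ulim_ext l2; apply: filterS hx => t <-.
have tx := torus_limit FU Ey.1 m1 m2.
have h t : exists st, torus (x t) -> torus st /\ lifts A bX bZ st (x t).
  by have [/(lift_exists hc)[st hst]|n] := pselect (torus (x t)); [exists st|exists (0, 0)].
pose st t := sval (cid (h t)).
have hst t : torus (x t) -> torus (st t) /\ lifts A bX bZ (st t) (x t) by rewrite /st; case: cid.
exists (fun t => (st t).1), (fun t => (st t).2); split.
  by apply: filterS tx => t /hst[]; case: (st t).
apply: filterS2 tx hx => t /hst[_ ls] <-; rewrite -surjective_pairing.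
by rewrite (peval_Gmap sub1 ls) (peval_Gmap sub2 ls).
Qed.

Let main_torus y : main y -> forall z, torus z -> gap G1 G2 y z != 0.
Proof.
move=> [Ey _] z tz; apply/eqP => /gap_eq0[e1 e2]; have [x [_ lx]] := project_exists hc tz.
apply: (Ey.1 x); rewrite /Defs.fmap -(peval_Gmap sub1 lx) -(peval_Gmap sub2 lx).
by rewrite [peval _ _]e1 [X in (_, X)]e2 -surjective_pairing.
Qed.

Let main_origin y : main y -> gap G1 G2 y (0, 0) != 0.
Proof.
move=> [Ey _]; apply/eqP => /gap_eq0[]; rewrite -!axXE (axXG sub1) (axXG sub2) !horner_comp !hornerXn expr0n (gtn_eqF D0).
rewrite !horner_coef0 !ray_poly0// !coef2_00 => e1 e2.
by apply: (Ey.1 (0, 0)); rewrite /Defs.fmap e1 e2 -surjective_pairing.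
Qed.

Let c1z : z1`_0 = c1. Proof. by rewrite /z1 ray_poly0// coef2_swapXY. Qed.
Let c2z : z2`_0 = c2. Proof. by rewrite /z2 ray_poly0// coef2_swapXY. Qed.

(** Either a ray polynomial is constant, which gives an equality y_i = f_i(0) excluded by [n1] or
    [n2], or the ray is the coordinate ray and [y] is a value of [f']. *)
Let main_inactive (f' : pmap2 R) (b : nat * nat) y s : (0 < wsize b)%N ->
  (forall x, Defs.fmap f' x <> y) ->
  ((size (ray_poly b f'.1) <= 1)%N -> y.1 != coef2 f'.1 (0%N, 0%N)) ->
  ((size (ray_poly b f'.2) <= 1)%N -> y.2 != coef2 f'.2 (0%N, 0%N)) ->
  ~~ [&& (1 < size (ray_poly b f'.1))%N, (1 < size (ray_poly b f'.2))%N & b != (1%N, 0%N)] ->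
  (ray_poly b f'.1).[s] = y.1 -> (ray_poly b f'.2).[s] = y.2 -> False.
Proof.
move=> b0 ny n1 n2 na e1 e2; have [s1|s1] := leqP (size (ray_poly b f'.1)) 1.
  by have := n1 s1; rewrite -e1 (size1_polyC s1) hornerC ray_poly0// eqxx.
have [s2|s2] := leqP (size (ray_poly b f'.2)) 1.
  by have := n2 s2; rewrite -e2 (size1_polyC s2) hornerC ray_poly0// eqxx.
move: na; rewrite s1 s2 /= negbK => /eqP be; move: e1 e2; rewrite be !ray_poly_axis !axXE => e1 e2.
by apply: (ny (s, 0)); rewrite /Defs.fmap e1 e2 -surjective_pairing.
Qed.

Let main_NX y : main y -> ~~ aX -> forall s, gap G1 G2 y (s, 0) != 0.
Proof.
move=> my na s; apply/eqP => /gap_eq0[]; rewrite -!axXE (axXG sub1) (axXG sub2) !horner_comp !hornerXn.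
apply: (main_inactive bX0 my.1.1) na => s1.
  by apply: (main_small my _).1; rewrite /tight ltnNge s1.
by apply: (main_small my _).2; rewrite /tight [(1 < size p2)%N]ltnNge s1 andbF.
Qed.

Let main_NZ y : main y -> ~~ aZ -> forall t, gap G1 G2 y (0, t) != 0.
Proof.
move=> my na t; apply/eqP => /gap_eq0[]; rewrite -!axZE (axZG sub1) (axZG sub2) !horner_comp !hornerXn.
apply: (@main_inactive (swapXY f.1, swapXY f.2) _ y _ bZ0 _ _ _ na) => [x|s1|s1].
- by rewrite /Defs.fmap !peval_swapXY => e; apply: (my.1.1 (x.2, x.1)).
- by rewrite coef2_swapXY; apply: (main_small my _).1; rewrite /tight [(1 < size z1)%N]ltnNge s1 !andbF.
- by rewrite coef2_swapXY; apply: (main_small my _).2; rewrite /tight [(1 < size z2)%N]ltnNge s1 !andbF.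
Qed.

Variables (Jh : poly2) (l k : nat).
Hypothesis hJ : jacdet (G1, G2) = Xm R (l, k) * Jh.
Hypothesis JX : axX Jh != 0.
Hypothesis JZ : axZ Jh != 0.

Let badX y := `[< exists s, gap G1 G2 y (s, 0) = 0 /\ peval Jh (s, 0) = 0 >].
Let badZ y := `[< exists t, gap G1 G2 y (0, t) = 0 /\ peval Jh (0, t) = 0 >].

Let good_system y : main y -> ~~ badX y -> ~~ badZ y -> system G1 G2 Jh l k D p1 p2 z1 z2 aX aZ y.
Proof.
move=> my /asboolPn nX /asboolPn nZ; split => //.
- exact: axXG.
- exact: axXG.
- exact: axZG.
- exact: axZG.
- by move=> /and3P[].
- by move=> /and3P[].
- exact: main_torus.
- exact: main_origin.
- exact: main_proper.
- exact: main_lift.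
- exact: main_NX.
- exact: main_NZ.
- rewrite (axXG sub1); apply: comp_shift_neq0 => // s1; rewrite ray_poly0//.
  by apply: (main_small my _).1; rewrite /tight ltnNge s1.
- rewrite (axXG sub2); apply: comp_shift_neq0 => // s1; rewrite ray_poly0//.
  by apply: (main_small my _).2; rewrite /tight [(1 < size p2)%N]ltnNge s1 andbF.
- rewrite (axZG sub1); apply: comp_shift_neq0 => // s1; rewrite -/z1 c1z.
  by apply: (main_small my _).1; rewrite /tight [(1 < size z1)%N]ltnNge s1 !andbF.
- rewrite (axZG sub2); apply: comp_shift_neq0 => // s1; rewrite -/z2 c2z.
  by apply: (main_small my _).2; rewrite /tight [(1 < size z2)%N]ltnNge s1 !andbF.
- by move=> /and3P[s1 s2 _]; split; apply: steepX.
- by move=> /and3P[s1 s2 _]; split; apply: steepZ.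
- by move=> s gs; apply/eqP => j0; apply: nX; exists s.
- by move=> t gt; apply/eqP => j0; apply: nZ; exists t.
Qed.

(** Values near [y] lift to the torus and, by properness, the lifts converge to a point over [y]; it
    cannot be in the torus, so it is on an axis, which must be active. *)
Let main_zero y : main y -> aX \/ aZ.
Proof.
move=> my; apply: contrapT => na.
have naX : ~~ aX by apply/negP => h; apply: na; left.
have naZ : ~~ aZ by apply/negP => h; apply: na; right.
have [F [FU hs hn]] := uf_near (0 : C).
have l1 : ulim F (fun s => y.1 + s) y.1.
  have h : ulim F (fun s => y.1 + s) (y.1 + 0) by exact: ulimD (ulim_cst _) hs.
  by rewrite addr0 in h.
have [||a [b [ht hG]]] := @main_lift y my C F (fun s => (y.1 + s, y.2)) FU l1.
- exact: ulim_cst.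
- by apply: filterS hn => s s0 e; apply: s0; have := congr1 fst e => /= /eqP; rewrite -subr_eq0 addrAC subrr add0r => /eqP.
have m1 : ulim F (fun s => peval G1 (a s, b s)) y.1 by apply: ulim_ext l1; apply: filterS hG => s [->].
have m2 : ulim F (fun s => peval G2 (a s, b s)) y.2 by apply: ulim_ext (ulim_cst _); apply: filterS hG => s [_ ->].
have [/ulim_ex[a0 la] /ulim_ex[b0 lb]] := main_proper my FU ht m1 m2.
have g0 : gap G1 G2 y (a0, b0) = 0.
  by apply/gap0P; rewrite (ulim_uniq m1 (ulim_peval G1 la lb)) (ulim_uniq m2 (ulim_peval G2 la lb)).
have [b00|b00] := eqVneq b0 0; first by have := main_NX my naX a0; rewrite -b00 g0 eqxx.
have [a00|a00] := eqVneq a0 0; first by have := main_NZ my naZ b0; rewrite -{1}a00 g0 eqxx.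
by have := main_torus my (conj a00 b00 : torus (a0, b0)); rewrite g0 eqxx.
Qed.

Let S := (tdeg f.1 + tdeg f.2)%N.

Let bad_countX (E : seq (C * C)) : uniq E -> (forall y, y \in E -> main y /\ badX y) ->
  ((size E * D + l.+1) * wsize bX <= D * S)%N.
Proof.
move=> uE hE; apply: (bad_count hc sub1 sub2 hJ JX) => // y /hE[my /asboolP[s [gs js]]].
have [e1 e2] := gap_eq0 gs; exists s; split => //.
by apply: contraNneq (main_origin my) => s0; rewrite -{1}s0 gs.
Qed.

Let hJ' : jacdet (Gmap (flipn bZ) (flipn bX) (swapXY f.1), Gmap (flipn bZ) (flipn bX) (swapXY f.2)) =
  Xm R (k, l) * - swapXY Jh.
Proof. by rewrite -!swapXY_Gmap jacdet_swapXY hJ rmorphM /= swapXY_Xm mulrN. Qed.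

Let bad_countZ (E : seq (C * C)) : uniq E -> (forall y, y \in E -> main y /\ badZ y) ->
  ((size E * D + k.+1) * wsize (flipn bZ) <= D * S)%N.
Proof.
move=> uE hE; apply: (bad_count hc' (sub_flip sub1) (sub_flip sub2) hJ'); rewrite ?tdeg_swapXY//.
  apply: contraNneq JZ => h; rewrite /axZ -[swapXY Jh]opprK; apply/eqP; apply: poly_infinite0 => s.
  by rewrite axXE pevalN -axXE h horner0 oppr0.
move=> y /hE[my /asboolP[s [gs js]]]; have [e1 e2] := gap_eq0 gs; exists s.
rewrite -!swapXY_Gmap pevalN !peval_swapXY js oppr0; split => //.
by apply: contraNneq (main_origin my) => s0; rewrite -{2}s0 gs.
Qed.

Let sizeZ P : {subset suppl P <= A} ->
  (D * adeg (ray_poly (flipn bZ) (swapXY P)) <= (size (swapXY (Gmap bX bZ P))).-1)%N.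
Proof.
move=> PA; rewrite mulnC -adeg_comp -(axZG PA) /adeg /axZ /axX.
by rewrite -!subn1 leq_sub2r// size_poly.
Qed.

Let Jh0 : Jh != 0.
Proof. by apply: contraNneq JX => ->; rewrite /axX rmorph0. Qed.

Let kX_le : (k.+1 <= (size (swapXY G1)).-1 + (size (swapXY G2)).-1)%N.
Proof. exact: jacdet_order hJ Jh0. Qed.

Let kZ_le : (l.+1 <= (size G1).-1 + (size G2).-1)%N.
Proof.
have h : - swapXY Jh != 0 by rewrite oppr_eq0; apply: contraNneq Jh0 => h; rewrite -(swapXYK Jh) h rmorph0.
by have := jacdet_order hJ' h; rewrite -!swapXY_Gmap !swapXYK.
Qed.

Let growth_self (c : {poly C} * {poly C}) : growth c c = (adeg c.1 * adeg c.2)%N.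
Proof. by rewrite /growth mulnC maxnn. Qed.

Let degX : ((adeg p1 + adeg p2) * wsize bX <= S)%N.
Proof. by rewrite mulnDl leq_add// ray_adeg. Qed.

Let degZ : ((adeg z1 + adeg z2) * wsize (flipn bZ) <= S)%N.
Proof. by rewrite mulnDl leq_add// (leq_trans (ray_adeg _ bZ0))// tdeg_swapXY. Qed.

Let flips (E : seq (C * C)) : uniq E -> uniq (map (@flip R) E).
Proof. by move=> uE; rewrite map_inj_uniq//; apply: (can_inj (g := @flip R)); case. Qed.

(** [system_count] is applied four times, after exchanging G1 with G2 and the two axes, which gives
    the inequalities combined by the arithmetic lemmas. *)
Let good_count (E : seq (C * C)) : uniq E -> (forall y, y \in E -> system G1 G2 Jh l k D p1 p2 z1 z2 aX aZ y) ->
  [/\ aX -> ~~ aZ -> (size E <= adeg p1 + adeg p2)%N,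
      aZ -> ~~ aX -> (size E <= adeg z1 + adeg z2)%N &
      aX -> aZ -> (size E * D <= D * (adeg p1 + adeg p2 + adeg z1 + adeg z2) + k.+1 + l.+1)%N].
Proof.
move=> uE hE.
have hE2 y : y \in map (@flip R) E -> system G2 G1 (- Jh) l k D p2 p1 z2 z1 aX aZ y.
  by move=> /mapP[y' y'E ->]; apply: system_flip; exact: hE.
have hE3 y : y \in E -> system (swapXY G1) (swapXY G2) (- swapXY Jh) k l D z1 z2 p1 p2 aZ aX y.
  by move=> yE; apply: system_swapXY; exact: hE.
have hE4 y : y \in map (@flip R) E -> system (swapXY G2) (swapXY G1) (- swapXY (- Jh)) k l D z2 z1 p2 p1 aZ aX y.
  by move=> yE; apply: system_swapXY; exact: hE2.
have n1 := system_count uE hE; have n2 := system_count (flips uE) hE2.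
have n3 := system_count uE hE3; have n4 := system_count (flips uE) hE4.
rewrite !size_map ?swapXYK in n1 n2 n3 n4.
rewrite /total_growth !growth_self in n1 n2 n3 n4.
split=> [hX hZ|hZ hX|hX hZ].
- rewrite hX (negbTE hZ) /= !addn0 !muln0 !addn0 in n1 n2; have /and3P[s1 s2 _] := hX.
  apply: (one_side_arith (adeg_gt0 s1) (adeg_gt0 s2) _ kX_le (n1 isT)) => //.
  by rewrite mulnC [(adeg p1 * adeg p2)%N]mulnC -[X in (X <= _)%N]mulnC; apply: n2.
- rewrite hZ (negbTE hX) /= !addn0 !muln0 !addn0 in n3 n4; have /and3P[s1 s2 _] := hZ.
  apply: (one_side_arith (adeg_gt0 s1) (adeg_gt0 s2) _ kZ_le (n3 isT)) => //.
  by rewrite mulnC [(adeg z1 * adeg z2)%N]mulnC -[X in (X <= _)%N]mulnC; apply: n4.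
rewrite hX hZ /= in n1 n2 n3 n4; have /and3P[s1 s2 _] := hX; have /and3P[s3 s4 _] := hZ.
pose B := maxn (adeg p2 * adeg z1) (adeg p1 * adeg z2).
have g1 : growth (p1, p2) (z1, z2) = B by [].
have g2 : growth (z1, z2) (p1, p2) = B by rewrite /growth /B /= maxnC mulnC [(adeg z2 * _)%N]mulnC.
have g3 : growth (p2, p1) (z2, z1) = B by rewrite /growth /B /= maxnC.
have g4 : growth (z2, z1) (p2, p1) = B by rewrite /growth /B /= mulnC [(adeg z2 * _)%N]mulnC.
rewrite g1 g2 ?g3 ?g4 /= in n1 n2 n3 n4.
apply: (both_sides_arith (D := D) (B := B) D0 (adeg_gt0 s1) (adeg_gt0 s2) (adeg_gt0 s3) (adeg_gt0 s4) erefl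
  (sizeZ sub1) (sizeZ sub2) kX_le kZ_le).
- exact: n1.
- by have := n2 isT; rewrite [(adeg p2 * adeg p1)%N]mulnC [(adeg z2 * adeg z1)%N]mulnC.
- by rewrite addnC; exact: n3.
- by rewrite addnC; have := n4 isT; rewrite [(adeg p2 * adeg p1)%N]mulnC [(adeg z2 * adeg z1)%N]mulnC.
Qed.

(** A primitive vector of coordinate sum 1 is (1, 0), excluded by activity, or (0, 1), excluded for
    the lower ray by D > 0. *)
Let wX : aX -> (1 < wsize bX)%N.
Proof.
move=> /and3P[_ _]; have := coneX hc; have := coneDE hc; have := D0; clear.
case: bX bZ => [a b] [c d]; rewrite /wsize /= => D0 e cop ne; rewrite ltnNge; apply/negP => s1.
case: a b e cop ne s1 => [|[|a]] [|[|b]] //= e _ _ _.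
by move: e; rewrite mul0n => /eqP; rewrite addn_eq0 (gtn_eqF D0).
Qed.

Let wZ : aZ -> (1 < wsize (flipn bZ))%N.
Proof.
move=> /and3P[_ _]; have := coneX hc'; have := coneDE hc'; have := D0; clear.
case: bX bZ => [a b] [c d]; rewrite /wsize /flipn /= => D0 e cop ne; rewrite ltnNge; apply/negP => s1.
case: d c e cop ne s1 => [|[|d]] [|[|c]] //= e _ _ _.
by move: e; rewrite mul0n => /eqP; rewrite addn_eq0 (gtn_eqF D0).
Qed.

Let main_count (E : seq (C * C)) : uniq E -> (forall y, y \in E -> main y) ->
  (size E <= (if aX && aZ then 2 * S else S))%N.
Proof.
move=> uE hE; pose EX := [seq y <- E | badX y]; pose EZ := [seq y <- E | badZ y].
pose EG := [seq y <- E | ~~ badX y & ~~ badZ y].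
have le : (size E <= size EX + size EZ + size EG)%N.
  rewrite !size_filter -(count_predC badX E) -addnA leq_add2l.
  rewrite -!size_filter -(count_predC badZ [seq y <- E | predC badX y]) !count_filter !size_filter.
  by apply: leq_add; apply: sub_count => y /=; [move=> /andP[]|rewrite andbC].
have uX : uniq EX by exact: filter_uniq.
have uZ : uniq EZ by exact: filter_uniq.
have uG : uniq EG by exact: filter_uniq.
have hX y : y \in EX -> main y /\ badX y by rewrite mem_filter => /andP[b /hE].
have hZ y : y \in EZ -> main y /\ badZ y by rewrite mem_filter => /andP[b /hE].
have hG y : y \in EG -> system G1 G2 Jh l k D p1 p2 z1 z2 aX aZ y.
  by rewrite mem_filter => /andP[/andP[b1 b2] /hE m]; exact: good_system.
have [n1 n2 n3] := good_count uG hG.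
have eX : ~~ aX -> size EX = 0%N.
  move=> na; apply/eqP; rewrite size_eq0; case eE : EX => [//|y E'].
  have [my /asboolP[s [gs _]]] : main y /\ badX y by apply: hX; rewrite eE mem_head.
  by have := main_NX my na s; rewrite gs eqxx.
have eZ : ~~ aZ -> size EZ = 0%N.
  move=> na; apply/eqP; rewrite size_eq0; case eE : EZ => [//|y E'].
  have [my /asboolP[s [gs _]]] : main y /\ badZ y by apply: hZ; rewrite eE mem_head.
  by have := main_NZ my na s; rewrite gs eqxx.
have bcX := bad_countX uX hX; have bcZ := bad_countZ uZ hZ.
case: (boolP aX) => haX; case: (boolP aZ) => haZ /=.
- apply: (both_sides_total D0 (wX haX) (wZ haZ) bcX bcZ degX degZ _ le).
  by rewrite addnA; exact: n3.
- by apply: (one_side_total D0 (wX haX) bcX degX (n1 haX haZ)); rewrite (eZ haZ) addn0 in le.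
- by apply: (one_side_total D0 (wZ haZ) bcZ degZ (n2 haZ haX)); rewrite (eX haX) add0n in le.
- case eE : E hE => [//|y E'] /(_ y); rewrite mem_head => /(_ isT) my.
  by case: (main_zero my) => h; [rewrite h in haX|rewrite h in haZ].
Qed.

Lemma exceptional_count_chart (E : seq (C * C)) : uniq E -> (forall y, y \in E -> in_Ef f y) -> (size E <= 2 * S)%N.
Proof.
move=> uE hE; case: (boolP tight) => ht.
  have := main_count uE (fun y yE => conj (hE y yE) (or_introl ht)); case: ifP => // _ /leq_trans; apply.
  by rewrite mul2n -addnn leq_addr.
(* Two active axes would make all four ray polynomials nonconstant. So [main_count] costs only [S]
   here, and the lines y_i = f_i(0) take the other [S]. *)
have na : aX && aZ = false.
  apply: contraNF ht => /andP[/and3P[s1 s2 _] /and3P[s3 s4 _]].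
  by rewrite /tight s1 s2 s3 s4.
pose E1 := [seq y <- E | y.1 == c1]; pose E2 := [seq y <- E | y.2 == c2].
pose EM := [seq y <- E | (y.1 != c1) && (y.2 != c2)].
have le : (size E <= size E1 + size E2 + size EM)%N.
  rewrite !size_filter -(count_predC (fun y => y.1 == c1) E) -addnA leq_add2l.
  rewrite -!size_filter -(count_predC (fun y => y.2 == c2) [seq y <- E | predC (fun y => y.1 == c1) y]) !count_filter !size_filter.
  by apply: leq_add; apply: sub_count => y /=; [move=> /andP[]|rewrite andbC].
have h1 : (size E1 <= tdeg f.1)%N.
  apply: (@line_count R f c1); first exact: filter_uniq.
  by move=> y; rewrite mem_filter => /andP[/eqP ? /hE].
have h2 : (size E2 <= tdeg f.2)%N.
  rewrite -(size_map (@flip R)); apply: (@line_count R (f.2, f.1) c2).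
    by apply: flips; exact: filter_uniq.
  by move=> _ /mapP[y + ->]; rewrite mem_filter => /andP[/eqP e /hE /in_Ef_flip].
have h3 : (size EM <= S)%N.
  have := @main_count EM (filter_uniq _ uE); rewrite na; apply.
  by move=> y; rewrite mem_filter => /andP[/andP[? ?] /hE ?]; split => //; right.
by apply: leq_trans le _; rewrite mul2n -addnn leq_add// leq_add.
Qed.
End Main.

Theorem exceptional_count (R : realType) (f : pmap2 R) (E : seq (R[i] * R[i])) : generically_non_proper f ->
  uniq E -> (forall y, y \in E -> in_Ef f y) -> (size E <= 2 * (tdeg f.1 + tdeg f.2))%N.
Proof.
move=> gnp uE hE; have [[df _ ft] _] := gnp.
have [bX [bZ [D [kX [kZ [hc k1 k2 k3 k4]]]]]] := cone_exists df ft.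
have J0 : jacdet (Gmap bX bZ f.1, Gmap bX bZ f.2) != 0.
  apply: (chart_jacdet_neq0 hc) => [w h|w h|]; rewrite ?mem_cat ?h ?orbT//.
  by have := jacdet_neq0 gnp; case: (f).
have [l [k [Jh [hJ JX JZ]]]] := factor_Xm J0.
exact: (exceptional_count_chart gnp hc k1 k2 k3 k4 hJ JX JZ uE hE).
Qed.

Theorem theorem1p1 (R : realType) (f : pmap2 R) (mu : nat) :
  generically_non_proper f -> generic_preimages f mu ->
  forall s : seq (R[i] * R[i]), uniq s -> (forall y, y \in s -> in_Ef f y) ->
    (size s <= 6 * pdeg f)%N /\
    ((1 < mu)%N ->
       (size s)%:R <= ((tdeg f.1 * tdeg f.2)%N)%:R / ((mu * (mu - 1))%N)%:R
                      + ((2 * (tdeg f.1 + tdeg f.2))%N)%:R :> R).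
Proof.
move=> gnp _ s us hs; have h := exceptional_count gnp us hs; split => [|_].
  apply: leq_trans h (@leq_trans (2 * (pdeg f + pdeg f)) _ _ _ _).
    by rewrite leq_mul2l leq_add ?orbT ?leq_maxl ?leq_maxr.
  by rewrite addnn -mul2n mulnA leq_mul2r orbT.
by rewrite -[leLHS]add0r lerD ?ler_nat// divr_ge0.
Qed.
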